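(* Given a graph $G$ with $n$ nodes and $m$ edges, a consistent 2-join decomposition tree of $G$ can be computed in time $O(n^3m)$.
   Context: Almost 2-join: a partition $(X_1,X_2)$ of $V(G)$ such that for $i=1,2$, $X_i$ contains disjoint nonempty sets $A_i,B_i$, every node of $A_1$ is adjacent to every node of $A_2$, every node of $B_1$ is adjacent to every node of $B_2$, there are no other edges between $X_1$ and $X_2$, and $|X_i|\ge3$. It is a 2-join if moreover for $i=1,2$, $G[X_i]$ contains a path from $A_i$ to $B_i$, and if $|A_i|=|B_i|=1$ then $G[X_i]$ is not a chordless path. $(X_1,X_2,A_1,A_2,B_1,B_2)$ is called a split. An almost 2-join with split $(X_1,X_2,A_1,A_2,B_1,B_2)$ is consistent if for $i=1,2$: (1) every component of $G[X_i]$ meets both $A_i$ and $B_i$; (2) every node of $A_i$ has a non-neighbor in $B_i$; (3) every node of $B_i$ has a non-neighbor in $A_i$; (4) either $A_1,A_2$ are both cliques, or one of them is a single node and the other is a disjoint union of cliques; (5) the same for $B_1,B_2$; (6) $G[X_i]$ is connected; (7) every node $v\in X_i$ has a path in $G[X_i]$ to some node of $B_i$ with no internal node in $A_i$; (8) every node $v\in X_i$ has a path in $G[X_i]$ to some node of $A_i$ with no internal node in $B_i$. The blocks of decomposition $G_1,G_2$ of $G$ w.r.t. a 2-join: $G_1$ is obtained from $G$ by replacing $X_2$ by a marker path $a_2c_2b_2$ (edges $a_2c_2$, $c_2b_2$ only), where $a_2$ is complete to $A_1$, $b_2$ is complete to $B_1$, and $c_2$ has no neighbor in $X_1$ (and $a_2,b_2$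 have no other neighbors in $X_1$); $G_2$ is defined symmetrically by replacing $X_1$ by a marker path $a_1c_1b_1$. A consistent 2-join decomposition tree of $G$ is a rooted tree whose root is $G$, each non-leaf node is a graph $G'$ having a consistent 2-join with split $(X_1,X_2,A_1,A_2,B_1,B_2)$ whose children are the blocks of decomposition $G'_1,G'_2$ with respect to it, each leaf is a graph with no 2-join or a graph with a non-consistent 2-join (identified as such), and the tree has $O(n)$ nodes. *)

(* Defs.v *)
From mathcomp Require Import all_boot.
Set Implicit Arguments.
Unset Strict Implicit.
Unset Printing Implicit Defensive.

Record sgraph := SGraph {
  vertex :> finType;
  adj : rel vertex;
  adj_sym : symmetric adj;
  adj_irr : irreflexive adj }.

Definition edges (G : sgraph) : {set {set G}} :=
  [set [set e.1; e.2] | e : G * G & adj e.1 e.2].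

Definition induced (G : sgraph) (X : {set G}) : rel G :=
  [rel x y | [&& x \in X, y \in X & adj x y]].

Definition components (G : sgraph) (X : {set G}) : {set {set G}} :=
  equivalence_partition (connect (induced X)) X.

Definition connected (G : sgraph) (X : {set G}) : Prop :=
  {in X &, forall x y, connect (induced X) x y}.

(* x :: p is a path of G[X] *)
Definition path_in (G : sgraph) (X : {set G}) (x : G) (p : seq G) : bool :=
  [&& all (mem X) (x :: p), path (@adj G) x p & uniq (x :: p)].

Definition internal (T : Type) (x : T) (p : seq T) : seq T :=
  behead (belast x p).

Definition chordless_path (G : sgraph) (X : {set G}) : Prop :=
  exists x p, [/\ uniq (x :: p), x :: p =i X &
    forall i j, i <= size p -> j <= size p ->
      adj (nth x (x :: p) i) (nth x (x :: p) j) = (i.+1 == j) || (j.+1 == i)].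

Definition clique (G : sgraph) (A : {set G}) : Prop :=
  {in A &, forall u v, u != v -> adj u v}.

Definition disjoint_union_of_cliques (G : sgraph) (A : {set G}) : Prop :=
  exists P : {set {set G}}, [/\ partition P A,
    {in P, forall C : {set G}, clique C} &
    {in P &, forall C D : {set G}, C != D ->
      {in C & D, forall u v, ~~ adj u v}}].

(* Sides 1 and 2 are indexed by true and false, so that ~~ i is the side    *)
(* opposite to i.                                                           *)
Record split (G : sgraph) := Split {
  sX : bool -> {set G};
  sA : bool -> {set G};
  sB : bool -> {set G} }.

Definition almost_2join (G : sgraph) (S : split G) : Prop :=
  [/\ sX S true :|: sX S false = [set: G],
      [disjoint sX S true & sX S false],
      forall i, [/\ sA S i \subset sX S i, sB S i \subset sX S i,
                    [disjoint sA S i & sB S i],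
                    sA S i != set0 & sB S i != set0],
      {in sX S true & sX S false, forall u v,
        adj u v = (u \in sA S true) && (v \in sA S false)
               || (u \in sB S true) && (v \in sB S false)} &
      forall i, 3 <= #|sX S i|].

Definition two_join (G : sgraph) (S : split G) : Prop :=
  almost_2join S /\ forall i,
    (exists a p, [/\ a \in sA S i, path_in (sX S i) a p &
                     last a p \in sB S i])
    /\ (#|sA S i| = 1 -> #|sB S i| = 1 -> ~ chordless_path (sX S i)).

Definition clique_condition (G : sgraph) (A : bool -> {set G}) : Prop :=
  (forall i, clique (A i)) \/
  (exists i, #|A i| = 1 /\ disjoint_union_of_cliques (A (~~ i))).

Definition consistent_side (G : sgraph) (X A B : {set G}) : Prop :=
  [/\ {in components X, forall C : {set G}, C :&: A != set0 /\ C :&: B != set0},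
      {in A, forall a, exists2 b, b \in B & ~~ adj a b},
      {in B, forall b, exists2 a, a \in A & ~~ adj b a} &
    [/\ connected X,
      {in X, forall v, exists p : seq G,
         [/\ path_in X v p, last v p \in B &
             {in internal v p, forall u, u \notin A}]} &
      {in X, forall v, exists p : seq G,
         [/\ path_in X v p, last v p \in A &
             {in internal v p, forall u, u \notin B}]}]].

Definition consistent (G : sgraph) (S : split G) : Prop :=
  [/\ forall i, consistent_side (sX S i) (sA S i) (sB S i),
      clique_condition (sA S) & clique_condition (sB S)].

(* Block i keeps X_i; its marker path a - c - b is 0 - 1 - 2 in 'I_3.       *)
Definition block_vertex (G : sgraph) (S : split G) (i : bool) : finType :=
  ({x : G | x \in sX S i} + 'I_3)%type.

Definition block_adj (G : sgraph) (S : split G) (i : bool) :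
    rel (block_vertex S i) := fun x y =>
  let attached (u : G) (k : 'I_3) :=
    (k == 0 :> nat) && (u \in sA S i) || (k == 2 :> nat) && (u \in sB S i) in
  match x, y with
  | inl u, inl v => adj (val u) (val v)
  | inl u, inr k => attached (val u) k
  | inr k, inl u => attached (val u) k
  | inr k, inr l => (k.+1 == l) || (l.+1 == k)
  end.

Fact block_adj_sym (G : sgraph) (S : split G) (i : bool) :
  symmetric (@block_adj G S i).
Proof. by move=> [u|k] [v|l] //=; [apply: adj_sym | rewrite orbC]. Qed.

Fact block_adj_irr (G : sgraph) (S : split G) (i : bool) :
  irreflexive (@block_adj G S i).
Proof.
by move=> [u|k] /=; [apply: adj_irr | rewrite orbb; apply/eqP/nesym/n_Sn].
Qed.

Definition block (G : sgraph) (S : split G) (i : bool) : sgraph :=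
  SGraph (@block_adj_sym G S i) (@block_adj_irr G S i).

(* dtree G: consistent 2-join decomposition trees of G, without the bound   *)
(* on the number of nodes, for which see dtree_nodes. The two constructors  *)
(* for leaves tell which kind of leaf it is.                                *)
Inductive dtree (G : sgraph) : Type :=
| LeafNo2Join of (forall S : split G, ~ two_join S)
| LeafNonConsistent of
    (exists S : split G, two_join S /\ ~ consistent S)
| Node (S : split G) of two_join S & consistent S &
    (forall i : bool, dtree (block S i)).

Fixpoint dtree_nodes (G : sgraph) (t : dtree G) : nat :=
  match t with
  | LeafNo2Join _ | LeafNonConsistent _ => 1
  | Node _ _ _ ch => (dtree_nodes (ch true) + dtree_nodes (ch false)).+1
  end.

Inductive expr :=
| Lit of nat
| Reg of nat
| Fetch of expr
| Add of expr & expr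
| Sub of expr & expr
| Mul of expr & expr
| Eq of expr & expr
| Lt of expr & expr.

Inductive cmd :=
| Skip
| Assign of nat & expr
| Store of expr & expr
| Seq of cmd & cmd
| If of expr & cmd & cmd
| While of expr & cmd.

Record state := State { regs : nat -> nat; memory : nat -> nat }.

Fixpoint eval (s : state) (e : expr) : nat :=
  match e with
  | Lit n => n
  | Reg x => regs s x
  | Fetch a => memory s (eval s a)
  | Add e1 e2 => eval s e1 + eval s e2
  | Sub e1 e2 => eval s e1 - eval s e2
  | Mul e1 e2 => eval s e1 * eval s e2
  | Eq e1 e2 => eval s e1 == eval s e2
  | Lt e1 e2 => eval s e1 < eval s e2
  end.

Fixpoint ecost (e : expr) : nat :=
  match e with
  | Lit _ | Reg _ => 1
  | Fetch a => (ecost a).+1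
  | Add e1 e2 | Sub e1 e2 | Mul e1 e2 | Eq e1 e2 | Lt e1 e2 =>
    (ecost e1 + ecost e2).+1
  end.

Definition upd (f : nat -> nat) (x v : nat) : nat -> nat :=
  fun y => if y == x then v else f y.

(* exec W c s t s': from s, c terminates in s' after t steps, and only      *)
(* words smaller than W are ever written to a register or to memory (or     *)
(* used as an address in memory to write to). Intermediate values inside an *)
(* expression may exceed W, but only by a power fixed by the program. The   *)
(* relation is deterministic.                                               *)
Inductive exec (W : nat) : cmd -> state -> nat -> state -> Prop :=
| exec_skip s : exec W Skip s 1 s
| exec_assign x e s :
    eval s e < W ->
    exec W (Assign x e) s (ecost e).+1
      (State (upd (regs s) x (eval s e)) (memory s))
| exec_store a e s :
    eval s a < W -> eval s e < W ->
    exec W (Store a e) s (ecost a + ecost e).+1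
      (State (regs s) (upd (memory s) (eval s a) (eval s e)))
| exec_seq c1 c2 s1 s2 s3 t1 t2 :
    exec W c1 s1 t1 s2 -> exec W c2 s2 t2 s3 ->
    exec W (Seq c1 c2) s1 (t1 + t2) s3
| exec_if e c1 c2 s s' t :
    exec W (if eval s e != 0 then c1 else c2) s t s' ->
    exec W (If e c1 c2) s ((ecost e).+1 + t) s'
| exec_while_stop e c s :
    eval s e = 0 ->
    exec W (While e c) s (ecost e).+1 s
| exec_while_loop e c s1 s2 s3 t1 t2 :
    eval s1 e != 0 ->
    exec W c s1 t1 s2 -> exec W (While e c) s2 t2 s3 ->
    exec W (While e c) s1 ((ecost e).+1 + t1 + t2) s3.

(* vs lists the vertices of G, and es its edges, each edge once and in only *)
(* one of its two orientations (hence the exclusive or).                    *)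
Definition graph_listing (G : sgraph) (vs : seq G) (es : seq (G * G)) : Prop :=
  [/\ uniq vs, vs =i G, uniq es &
      forall u v : G, adj u v = ((u, v) \in es) (+) ((v, u) \in es)].

(* name u is the integer by which vertex u is known to the program. *)
Definition graph_code (G : sgraph) (name : G -> nat)
    (vs : seq G) (es : seq (G * G)) : seq nat :=
  [:: size vs, size es & [seq name u | u <- vs] ++
                         flatten [seq [:: name e.1; name e.2] | e <- es]].

Definition init (input : seq nat) : state :=
  State (fun=> 0) (nth 0 input).

Definition stored (M : nat -> nat) (p : nat) (s : seq nat) : Prop :=
  forall i, i < size s -> M (p + i) = nth 0 s i.

Definition graph_at (M : nat -> nat) (p : nat) (G : sgraph)
    (name : G -> nat) : Prop :=
  injective name /\
  exists vs es, graph_listing vs es /\ stored M p (graph_code name vs es).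

Definition set_at (M : nat -> nat) (p : nat) (G : sgraph)
    (name : G -> nat) (X : {set G}) : Prop :=
  exists s : seq G, [/\ uniq s, s =i X &
    stored M p (size s :: [seq name u | u <- s])].

(* Vertices of X_i keep their names in block i. *)
Definition block_name (G : sgraph) (S : split G) (i : bool) (name : G -> nat)
    (marker : 'I_3 -> nat) (x : block S i) : nat :=
  match x with
  | inl u => name (val u)
  | inr k => marker k
  end.

(* A node of the tree is a record starting with the kind of the node and a  *)
(* pointer to its graph. If it is not a leaf, then 7 words follow for each  *)
(* side i: pointers to X_i, A_i and B_i, the names of the vertices a, c, b  *)
(* of the marker path of block i, and a pointer to the child for block i.   *)
Fixpoint dtree_at (M : nat -> nat) (p : nat) (G : sgraph) (name : G -> nat)
    (t : dtree G) {struct t} : Prop :=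
  graph_at M (M (p + 1)) name /\
  match t with
  | LeafNo2Join _ => M p = 0
  | LeafNonConsistent _ => M p = 1
  | Node J _ _ ch => M p = 2 /\ forall i : bool,
      let q := p + (if i then 2 else 9) in
      [/\ set_at M (M q) name (sX J i),
          set_at M (M (q + 1)) name (sA J i),
          set_at M (M (q + 2)) name (sB J i) &
          dtree_at M (M (q + 6))
            (@block_name G J i name (fun k => M (q + 3 + k))) (ch i)]
  end.

(* Main.v *)
Require Import Defs.
From mathcomp Require Import all_boot.
From mathcomp Require Import zify.
From Stdlib Require Import FunctionalExtensionality.
Import Defs.
(* A graph H of the tree comes with a set M of edges and a labelling of its     *)
(* vertices such that every 2-join of H separates the ends of an edge of M or   *)
(* splits no class of labels. An edge a1a2 of M, or else one with distinct      *)
(* labels, is tested against all edges b1b2 for a 2-join with a1 in A1, a2 in   *)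
(* A2, b1 in B1, b2 in B2: its sides are closed under a relation on the         *)
(* vertices, so that a bounded number of binary guesses leads to it, in time    *)
(* O(n^2). If there is none, the edge leaves M, or the two labels are merged.   *)
(* If there is one and it is consistent, H is split; in each block the edges of *)
(* the marker path are added to M, and the labels found on both sides become a  *)
(* single new one. Consistency makes every 2-join of a block which keeps the    *)
(* marker path on one side lift to H, so the invariant is inherited. All edges  *)
(* of M have an end of degree at most 2, so |M| grows by at most 6 in total,    *)
(* and 2|M| + (number of labels) + 16(n - 7) + 1, summed over the graphs to be  *)
(* treated, decreases with each test: O(n) tests of O(n^2 m) steps each.        *)
(*   The program is written in a language of bounded loops over unbounded       *)
(* arrays, for which bounds on time and word size are read off the text.        *)

Set Implicit Arguments.
Unset Strict Implicit.
Unset Printing Implicit Defensive.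

(** Testing every edge of every graph of the tree for separation by a 2-join would cost too much, so
    what the tests have shown is kept, in a relation [M] and labels [lab] satisfying [hitting]: a
    2-join that separates no pair of [M] splits no class of labels. Every 2-join separates the ends
    of some edge. Hence a graph has no 2-join once [M] is empty and adjacent vertices have equal
    labels ([hitting_leaf]). Until then some edge of [M], or some edge with two labels, is tested,
    and a failed test shrinks [M] ([hitting_drop]) or the set of labels ([hitting_merge]).

    For given edges a1a2 and b1b2 the candidate sides are the sets closed under [forced]. Let L and
    R be the least closed sets around a1, b1 and around a2, b2. The path conditions of a 2-join are
    monotone under closed enlargement ([good_mono]). So if a solution exists and L is good, then L
    is itself a solution, and likewise for R. If neither is good, a vertex outside both is chosen
    and its side is guessed. While a side is not linked, this vertex is a pivot, which links
    whichever side receives it ([pivot_linked], [pivot_linked']). A side that is linked but not good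
    is a path, and an enlargement either makes it good or raises the degree of one of its two ends
    [a1], [b1], never beyond 2 ([progress_lt]). Thus 11 binary guesses lead to a solution
    ([search_complete]).

    When a consistent 2-join is found, the graph is replaced by its blocks. A 2-join of a block that
    separates adjacent markers is hit, because the marker edges join [M]. Any other 2-join lifts to
    the graph when the marker path is expanded to the side it replaced ([lift_two_join]), which uses
    that consistent sides are connected. So the invariant passes to the blocks ([block_hitting]).
    Consistent sides have at least 4 vertices ([consistent_card]), hence blocks are smaller than the
    graph. Since [M] and the labels grow by bounded amounts only ([nrel_blocks], [nlab_block]), the
    sum of the values of [potential] falls with every turn of the main loop. It begins at no more
    than 17n + 1, so O(n) turns suffice. In a turn, a1a2 is tested against all edges b1b2, at most m
    of them ([edges_block]), in time O(n^2) each.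

    The program treats the nodes in the order of their creation; [turn_inv] is the invariant of its
    loop, and the tree is assembled from the final memory ([finished_tree]). Time and word size come
    from the simulation [comp_exec] and from the nesting of the loops ([cst_le]): depth 3 for loops
    of length about n, depth 1 for those of length m. *)

Ltac vmt := solve [vm_compute; reflexivity].

(** * Searching for the sides of a 2-join *)

Lemma connect_exit (T : finType) (e : rel T) (S : {set T}) x y :
  connect e x y -> x \in S -> y \notin S ->
  exists u v, [/\ u \in S, v \notin S & e u v].
Proof.
case/connectP=> p; elim: p x => [|z p IH] x /=; first by move=> _ -> ->.
case/andP=> exz ezp ey xS yS; case: (boolP (z \in S)) => zS.
  exact: IH ezp ey zS yS.
by exists x, z.
Qed.

Lemma connect_ind_r (T : finType) (e : rel T) (P : T -> Prop) x y :
  P x -> (forall u v, P u -> e u v -> P v) -> connect e x y -> P y.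
Proof.
move=> Px step /connectP[p]; elim: p x Px => [|z p IH] x Px /=; first by move=> _ ->.
by case/andP=> /(step _ _ Px) Pz; apply: IH.
Qed.

Section Closure.
Variables (T : finType) (r : rel T).
Implicit Types X Y : {set T}.

Definition cl X : {set T} := [set v | [exists u in X, connect r u v]].
Definition closed_under X := forall u v, u \in X -> r u v -> v \in X.

Lemma clP X v : reflect (exists2 u, u \in X & connect r u v) (v \in cl X).
Proof. by rewrite inE; apply: exists_inP. Qed.

Lemma cl_sub X : X \subset cl X.
Proof. by apply/subsetP=> x xX; apply/clP; exists x. Qed.

Lemma cl_closed X : closed_under (cl X).
Proof.
move=> u v /clP[x xX xu] uv; apply/clP; exists x => //.
exact: connect_trans xu (connect1 uv).
Qed.

Lemma cl_min X Y : X \subset Y -> closed_under Y -> cl X \subset Y.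
Proof.
move=> XY cY; apply/subsetP=> v /clP[u uX uv].
by apply: (connect_ind_r (P := fun v => v \in Y)) uv; [apply: (subsetP XY)|].
Qed.
End Closure.

(** * Induced subgraphs and chordless paths *)

Section Induced.
Variable G : sgraph.
Implicit Types X Y : {set G}.

Lemma induced_sym X : symmetric (induced X).
Proof. by move=> x y; rewrite /induced /= adj_sym andbCA. Qed.

Lemma connect_induced_sym X : connect_sym (induced X).
Proof.
exact/sym_connect_sym/induced_sym.
Qed.

Lemma connect_adj X x y : x \in X -> y \in X -> adj x y -> connect (induced X) x y.
Proof. by move=> xX yX xy; apply: connect1; apply/and3P. Qed.

Lemma induced_sub X Y x y : X \subset Y -> induced X x y -> induced Y x y.
Proof. by move=> /subsetP XY /and3P[/XY xY /XY yY xy]; apply/and3P. Qed.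

Lemma connect_induced_sub X Y x y :
  X \subset Y -> connect (induced X) x y -> connect (induced Y) x y.
Proof.
by move=> XY; apply: connect_sub => u v /(induced_sub XY) /connect1.
Qed.

Definition deg X v := #|[set u in X | adj v u]|.

Lemma deg_sub X Y v : X \subset Y -> deg X v <= deg Y v.
Proof.
move=> /subsetP XY; apply/subset_leq_card/subsetP=> u.
by rewrite !inE => /andP[/XY -> ->].
Qed.

Definition conn X := [forall x in X, forall y in X, connect (induced X) x y].

Lemma connP X : reflect (connected X) (conn X).
Proof.
apply: (iffP forall_inP) => [h x y xX yX|h x xX].
  by have /forall_inP := h x xX; apply.
by apply/forall_inP=> y yX; apply: h.
Qed.

(** Chordless paths in terms of counts that a program can compute; see [pathbP]. *)
Definition pathb X :=
  [&& conn X, [forall v in X, deg X v <= 2] & [exists v in X, deg X v <= 1]].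

Lemma chordless_pathb X : chordless_path X -> pathb X.
Proof.
move=> [x [p [Up Xp Hp]]].
have inX i : i <= size p -> nth x (x :: p) i \in X by move=> hi; rewrite -Xp mem_nth.
have Xnth v : v \in X -> exists2 i, i <= size p & v = nth x (x :: p) i.
  by rewrite -Xp => /(nthP x) [i hi <-]; exists i.
apply/and3P; split.
- have C i j : i <= j -> j <= size p ->
      connect (induced X) (nth x (x :: p) i) (nth x (x :: p) j).
    elim: j => [|j IH]; first by case: i.
    rewrite leq_eqVlt => /orP[/eqP-> //|ij] js.
    apply: connect_trans (IH ij (ltnW js)) (connect1 _).
    by apply/and3P; split; rewrite ?inX ?Hp ?eqxx // ltnW.
  apply/connP=> u v /Xnth[i hi ->] /Xnth[j hj ->].
  case/orP: (leq_total i j) => ij; first exact: C.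
  by rewrite connect_induced_sym; apply: C.
- apply/forall_inP=> v /Xnth[i hi ->].
  apply: (@leq_trans #|[set nth x (x :: p) i.-1; nth x (x :: p) i.+1]|); last first.
    by rewrite cards2; case: (_ != _).
  apply/subset_leq_card/subsetP=> u; rewrite !inE => /andP[/Xnth[j hj ->]].
  by rewrite Hp // => /orP[/eqP<-|/eqP<-]; rewrite eqxx ?orbT.
- apply/exists_inP; exists x; first by have := inX 0; apply.
  apply: (@leq_trans #|[set nth x (x :: p) 1]|); last by rewrite cards1.
  apply/subset_leq_card/subsetP=> u; rewrite !inE => /andP[/Xnth[j hj ->]].
  have := Hp 0 j isT hj; rewrite [nth _ _ 0]/= => -> /orP[/eqP<-|/eqP//].
  by rewrite eqxx.
Qed.

(** A path is extended from a vertex of degree at most 1 until it covers X. Connectivity provides an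
    edge that leaves it, and the degree bounds allow this only at its last vertex; they exclude
    chords as well. *)
Lemma pathb_chordless X : pathb X -> chordless_path X.
Proof.
case/and3P=> /connP cX /forall_inP d2 /exists_inP[x xX d1].
(* Before its end, a path starting at x has no neighbours in X but the next and the previous
   vertex. *)
have nbr p i z : uniq (x :: p) -> all (mem X) (x :: p) -> path (@adj G) x p ->
    i < size p -> z \in X -> adj (nth x (x :: p) i) z ->
    z = nth x (x :: p) i.+1 \/ (0 < i /\ z = nth x (x :: p) i.-1).
  move=> Up Xp Pp ip zX iz.
  have inX k : k <= size p -> nth x (x :: p) k \in X.
    by move=> hk; apply: (allP Xp); rewrite mem_nth.
  have A k : k < size p -> adj (nth x (x :: p) k) (nth x (x :: p) k.+1).
    by move/(pathP x): Pp => /[apply].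
  case: (eqVneq z (nth x (x :: p) i.+1)) => [|z1]; [by left | right].
  case: (posnP i) => [i0|i0].
    move: d1; rewrite leqNgt => /negP[]; subst i.
    apply: (@leq_trans #|[set nth x (x :: p) 1; z]|); first by rewrite cards2 eq_sym z1.
    apply/subset_leq_card/subsetP=> u; rewrite !inE => /orP[]/eqP->.
      by rewrite (inX 1) //; apply: (A 0).
    by rewrite zX.
  split=> //; apply/eqP; apply: contraT => z2.
  have := d2 _ (inX i (ltnW ip)); rewrite leqNgt => /negP[].
  apply: (@leq_trans #|[set nth x (x :: p) i.-1; nth x (x :: p) i.+1; z]|); last first.
    apply/subset_leq_card/subsetP=> u; rewrite !inE => /orP[/orP[]|]/eqP->.
    - rewrite inX; last exact: leq_trans (leq_pred _) (ltnW ip).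
      have := A i.-1; rewrite (prednK i0) adj_sym => -> //; exact: ltnW.
    - by rewrite inX // A.
    - by rewrite zX.
  rewrite setUC cardsU1 cards2 !inE negb_or z1 z2 /=.
  have -> : nth x (x :: p) i.-1 != nth x p i => //.
  rewrite -[nth x p i]/(nth x (x :: p) i.+1) nth_uniq //.
    by rewrite neq_ltn (leq_ltn_trans (leq_pred i)).
  exact: leq_ltn_trans (leq_pred _) (ltnW _).
suff [p [Up Xp Pp]] : exists p, [/\ uniq (x :: p), x :: p =i X & path (@adj G) x p].
  exists x, p; split=> // i j hi hj.
  have allX : all (mem X) (x :: p) by apply/allP=> u; rewrite Xp.
  have inX k : k <= size p -> nth x (x :: p) k \in X.
    by move=> hk; rewrite -Xp mem_nth.
  have A k : k < size p -> adj (nth x (x :: p) k) (nth x (x :: p) k.+1).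
    by move/(pathP x): Pp => /[apply].
  have key k l : k < l -> l <= size p ->
      adj (nth x (x :: p) k) (nth x (x :: p) l) = (k.+1 == l).
    move=> kl hl; apply/idP/eqP => [kl'|<-]; last first.
      by apply: A; apply: leq_trans hl.
    have kp := leq_trans kl hl.
    have [|[k0]] := nbr p k _ Up allX Pp kp (inX _ hl) kl' => /eqP;
      rewrite nth_uniq // ?ltnS //.
    - by move=> /eqP.
    - by move=> /eqP lk; move: kl; rewrite lk ltnNge leq_pred.
    - exact: leq_trans (leq_pred _) (ltnW kp).
  case: (ltngtP i j) => ij.
  - by rewrite key // [j.+1 == i]gtn_eqF ?orbF // ltnW.
  - by rewrite adj_sym key // [i.+1 == j]gtn_eqF // ltnW.
  - by rewrite ij adj_irr !gtn_eqF.
(* After k extensions the path has k edges unless X is covered; for k = #|X| it would have too many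
   vertices. *)
have ext k : exists p, [/\ uniq (x :: p), all (mem X) (x :: p), path (@adj G) x p &
    size p = k \/ x :: p =i X].
  elim: k => [|k [p [Up Xp Pp]]]; first by exists [::]; split=> //=; [rewrite andbT | left].
  case=> [sp|]; last by exists p; split=> //; right.
  case: (boolP (X \subset x :: p)) => [Xs|].
    exists p; split=> //; right=> u; apply/idP/idP; last exact: (subsetP Xs).
    exact: (allP Xp).
  case/subsetPn=> y yX yp.
  have [||u [v [up vp /and3P[uX vX uv]]]] := connect_exit (S := [set z in x :: p]) (cX x y xX yX).
  - by rewrite inE mem_head.
  - by rewrite inE.
  rewrite !inE in up vp.
  have {up} ul : u = last x p.
    have /(nthP x) [i hi ui] : u \in x :: p by rewrite inE.
    rewrite -nth_last -ui; move: hi; rewrite ltnS leq_eqVlt => /orP[/eqP->|ip].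
      by case: (p) => //= z q; apply: set_nth_default.
    rewrite -ui in uv.
    have [|[i0]] := nbr p i v Up Xp Pp ip vX uv => ev; case/negP: vp; rewrite ev.
      by have := @mem_nth _ x (x :: p) i.+1 ip; rewrite inE.
    have := @mem_nth _ x (x :: p) i.-1; rewrite inE; apply.
    exact: leq_ltn_trans (leq_pred _) (leqW ip).
  exists (rcons p v); split.
  - by rewrite -rcons_cons rcons_uniq inE vp.
  - by rewrite -rcons_cons all_rcons Xp andbT.
  - by rewrite rcons_path Pp -ul.
  - by left; rewrite size_rcons sp.
have [p [Up Xp Pp [sp|?]]] := ext #|X|; last by exists p.
have : #|x :: p| <= #|X| by apply/subset_leq_card/subsetP=> u; apply: (allP Xp).
by rewrite (card_uniqP Up) /= sp ltnn.
Qed.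

Lemma pathbP X : reflect (chordless_path X) (pathb X).
Proof. by apply: (iffP idP); [apply: pathb_chordless | apply: chordless_pathb]. Qed.

(* [linked a b X]: X contains a path from a neighbour of a to a neighbour of b; *)
(* in [good a b X] moreover X is not a mere path attached to a and b.          *)
Definition linked (a b : G) X := [exists x in X, exists y in X,
  [&& adj a x, adj b y & connect (induced X) x y]].

Definition pathlike (a b : G) X := [&& #|[set x in X | adj a x]| == 1,
  #|[set x in X | adj b x]| == 1 & pathb X].

Definition good (a b : G) X := linked a b X && ~~ pathlike a b X.

Lemma linkedP a b X : reflect (exists x y, [/\ x \in X, y \in X, adj a x, adj b y &
  connect (induced X) x y]) (linked a b X).
Proof.
apply: (iffP exists_inP) => [[x xX /exists_inP[y yX /and3P[]]]|[x [y [xX yX ax b_y c]]]].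
  by exists x, y.
by exists x => //; apply/exists_inP; exists y => //; apply/and3P.
Qed.

Lemma linked_mono a b X Y : X \subset Y -> linked a b X -> linked a b Y.
Proof.
move=> XY /linkedP[x [y [xX yX ax b_y c]]]; apply/linkedP; exists x, y.
by split=> //; [apply: (subsetP XY)..|apply: connect_induced_sub c].
Qed.
End Induced.

(* The vertices a1, b1 are to lie in the side X1, a2, b2 in the side X2, with   *)
(* a1a2 joining A1 to A2 and b1b2 joining B1 to B2. Then A1 is the set of the   *)
(* neighbours of a2 in X1, and so on; so the sides of the almost 2-joins are    *)
(* the sets which contain a1, b1, avoid a2, b2, and are closed under [forced].  *)
Definition forced (G : sgraph) (a1 a2 b1 b2 : G) : rel G := fun u v =>
  [|| adj u v != (adj a2 u && adj a1 v || adj b2 u && adj b1 v),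
      [&& u == a1, adj a1 v & adj b1 v] | [&& v == a2, adj a2 u & adj b2 u]].

Lemma forced_swap (G : sgraph) (a1 a2 b1 b2 : G) u v :
  forced a2 a1 b2 b1 v u = forced a1 a2 b1 b2 u v.
Proof.
rewrite /forced adj_sym [adj a1 v && _]andbC [adj b1 v && _]andbC.
by congr orb; rewrite orbC.
Qed.

(** * Closed sides and the search for a good one *)

Section Search.
Variables (G : sgraph).
Implicit Types (a b : G) (L R S X Y : {set G}).

Definition valid a1 a2 b1 b2 S := [/\ a1 \in S, b1 \in S, a2 \notin S, b2 \notin S &
  closed_under (forced a1 a2 b1 b2) S].

Lemma valid_swap a1 a2 b1 b2 S :
  valid a1 a2 b1 b2 S -> valid a2 a1 b2 b1 (~: S).
Proof.
move=> [a1S b1S a2S b2S cS]; split; rewrite ?inE ?negbK // => u v.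
rewrite !inE forced_swap => uS vu; apply: contra uS => vS; exact: cS vu.
Qed.

(** The neighbours of [a2] and [b2] in S are A1 and B1, so [good a2 b2 S] is the path condition of a
    2-join for the side S; on the complement [a1] and [b1] play this role. *)
Definition target a1 a2 b1 b2 S :=
  [/\ valid a1 a2 b1 b2 S, good a2 b2 S & good a1 b1 (~: S)].

Lemma target_swap a1 a2 b1 b2 S :
  target a1 a2 b1 b2 S -> target a2 a1 b2 b1 (~: S).
Proof. by case=> v g1 g2; split; rewrite ?setCK //; apply: valid_swap. Qed.

Section Closed.
Variables (a1 a2 b1 b2 : G) (L : {set G}).
Hypotheses (a12 : adj a1 a2) (b12 : adj b1 b2).
Hypotheses (a1L : a1 \in L) (b1L : b1 \in L) (cL : closed_under (forced a1 a2 b1 b2) L).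

Lemma closed_edge u v : u \in L -> v \notin L ->
  adj u v = (adj a2 u && adj a1 v || adj b2 u && adj b1 v).
Proof.
by move=> uL; apply: contraNeq => h; apply: (cL uL); rewrite /forced h.
Qed.

(** The purpose of the second clause of [forced]: it keeps A2 and B2 disjoint. *)
Lemma closed_both v : v \notin L -> adj a1 v -> ~~ adj b1 v.
Proof.
by move=> vL av; apply: contra vL => bv; apply: (cL a1L); rewrite /forced eqxx av bv !orbT.
Qed.

Lemma pathlike_single X : pathlike a2 b2 X -> a1 \in X -> b1 \in X ->
  (forall u, u \in X -> adj a2 u -> u = a1) /\ (forall u, u \in X -> adj b2 u -> u = b1).
Proof.
case/and3P=> /cards1P[x ex] /cards1P[y ey] _ a1X b1X.
have {x ex} A : [set x0 in X | adj a2 x0] = [set a1].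
  by rewrite ex; congr [set _]; apply/esym/set1P; rewrite -ex inE a1X adj_sym.
have {y ey} B : [set x0 in X | adj b2 x0] = [set b1].
  by rewrite ey; congr [set _]; apply/esym/set1P; rewrite -ey inE b1X adj_sym.
split=> u uX; first by move=> h; apply/set1P; rewrite -A inE uX.
by move=> h; apply/set1P; rewrite -B inE uX.
Qed.

(** An edge that leaves L starts at a neighbour of [a2] or [b2], and in a pathlike X these are [a1]
    and [b1] only. *)
Lemma pathlike_exit X u v : pathlike a2 b2 X -> L \subset X ->
  u \in L -> v \notin L -> adj u v -> u = a1 \/ u = b1.
Proof.
move=> pX LX uL vL; rewrite closed_edge //.
have [A B] := pathlike_single pX (subsetP LX _ a1L) (subsetP LX _ b1L).
by case/orP=> /andP[h _]; [left; apply: A | right; apply: B] => //; apply: (subsetP LX).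
Qed.

(** A walk of X can leave L only at [a1] or [b1], which are joined inside L because L is linked.
    Hence L is connected. If L is not all of X, a vertex where an edge of X leaves L has degree at
    most 1 in L. *)
Lemma pathlike_mono X : L \subset X -> linked a2 b2 L -> pathlike a2 b2 X -> pathlike a2 b2 L.
Proof.
move=> LX /linkedP[x [y [xL yL ax b_y xy]]] pX.
have a1X := subsetP LX _ a1L; have b1X := subsetP LX _ b1L.
have [A B] := pathlike_single pX a1X b1X.
have ab : connect (induced L) b1 a1.
  have <- : x = a1 by apply: A => //; apply: (subsetP LX).
  have <- : y = b1 by apply: B => //; apply: (subsetP LX).
  by rewrite connect_induced_sym.
have [_ _ /and3P[/connP cX /forall_inP d2 /exists_inP[z zX dz]]] := and3P pX.
have toa u : u \in L -> connect (induced L) u a1.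
  move=> uL; have /connectP[p pp ep] := cX u a1 (subsetP LX _ uL) a1X.
  elim: p u uL pp ep => [|v p IH] u uL /=; first by move=> _ ->.
  case/andP=> /and3P[_ vX uv] pp ep; case: (boolP (v \in L)) => vL.
    by apply: connect_trans (IH v vL pp ep); apply: connect_adj.
  by case: (pathlike_exit pX LX uL vL uv) => ->.
apply/and3P; split.
- apply/cards1P; exists a1; apply/setP=> u; rewrite !inE.
  apply/andP/eqP => [[uL au]|->]; last by rewrite a1L adj_sym.
  by apply: A => //; apply: (subsetP LX).
- apply/cards1P; exists b1; apply/setP=> u; rewrite !inE.
  apply/andP/eqP => [[uL au]|->]; last by rewrite b1L adj_sym.
  by apply: B => //; apply: (subsetP LX).
apply/and3P; split.
- apply/connP=> u v uL vL; apply: connect_trans (toa u uL) _.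
  by rewrite connect_induced_sym; apply: toa.
- apply/forall_inP=> u uL; apply: leq_trans (deg_sub u LX) _.
  by apply: d2; apply: (subsetP LX).
- apply/exists_inP; case: (boolP (X \subset L)) => [XL|/subsetPn[v vX vL]].
    by exists z; [apply: (subsetP XL) | apply: leq_trans (deg_sub _ LX) dz].
  have [u [w [uL wL /and3P[uX wX uw]]]] := connect_exit (cX a1 v a1X vX) a1L vL.
  exists u => //; rewrite -ltnS; apply: leq_trans (d2 u uX).
  apply/proper_card/properP; split.
    by apply/subsetP=> t; rewrite !inE => /andP[/(subsetP LX)-> ->].
  by exists w; rewrite !inE ?wX ?uw // (negPf wL).
Qed.

(** The fact on which the search rests: once good, a closed side stays good in every larger set. *)
Lemma good_mono X : L \subset X -> good a2 b2 L -> good a2 b2 X.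
Proof.
move=> LX /andP[l p]; rewrite /good (linked_mono LX) //=.
by apply: contra p; apply: pathlike_mono.
Qed.

(* Each enlargement of a side raises its progress, up to 6, which is why 11     *)
(* guesses are enough.                                                          *)
Definition progress (a1 a2 b1 b2 : G) X :=
  if linked a2 b2 X then (if pathlike a2 b2 X then deg X a1 + deg X b1 else 5).+1 else 0.

Lemma progress_good X : progress a1 a2 b1 b2 X = 6 -> a1 \in X -> b1 \in X -> good a2 b2 X.
Proof.
rewrite /progress /good; case: ifP => //= _; case: ifP => //= pX [dab] aX bX.
have /and3P[_ _ /and3P[_ /forall_inP d2 _]] := pX.
by have := leq_add (d2 _ aX) (d2 _ bX); rewrite dab.
Qed.

Lemma progress_le X : a1 \in X -> b1 \in X -> progress a1 a2 b1 b2 X <= 6.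
Proof.
rewrite /progress; case: ifP => // _; case: ifP => // pX aX bX.
have /and3P[_ _ /and3P[_ /forall_inP d2 _]] := pX.
exact: leq_trans (leq_add (d2 _ aX) (d2 _ bX)) _.
Qed.

(** If X is pathlike too, it is connected, so one of its edges leaves L; by [pathlike_exit] it does
    so at [a1] or [b1], whose degree grows. Otherwise X has progress 6, the maximum. *)
Lemma progress_lt X : L \proper X -> linked a2 b2 L -> ~~ good a2 b2 L ->
  progress a1 a2 b1 b2 L < progress a1 a2 b1 b2 X.
Proof.
move=> /properP[LX [v vX vL]] lL; rewrite /progress /good lL (linked_mono LX lL) /= negbK => pL.
have /and3P[_ _ /and3P[_ /forall_inP d2 _]] := pL.
rewrite pL ltnS; case: ifP => pX; last exact: leq_ltn_trans (leq_add (d2 _ a1L) (d2 _ b1L)) _.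
have /and3P[_ _ /and3P[/connP cX _ _]] := pX.
have [u [w [uL wL /and3P[uX wX uw]]]] := connect_exit (cX a1 v (subsetP LX _ a1L) vX) a1L vL.
have dlt : deg L u < deg X u.
  apply/proper_card/properP; split.
    by apply/subsetP=> t; rewrite !inE => /andP[/(subsetP LX)-> ->].
  by exists w; rewrite !inE ?wX ?uw // (negPf wL).
case: (pathlike_exit pX LX uL wL uw) => eu; rewrite -eu.
  by rewrite -addSn leq_add // deg_sub.
by rewrite -addnS leq_add // deg_sub.
Qed.

(* Vertices outside L on a path of G - L from a neighbour of a1 to a neighbour  *)
(* of b1. Adding such a vertex to either side links that side.                  *)
Definition from_a (a1 b1 : G) (X : {set G}) : {set G} :=
  cl (fun u v => [&& adj u v, v \notin X, ~~ adj a1 v & ~~ adj b1 v])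
     [set v in ~: X | adj a1 v].

Definition pivots (a1 a2 b1 b2 : G) (X : {set G}) : {set G} :=
  [set w | (w \notin X) && (adj b1 w && adj a2 w ||
     (w \in from_a a1 b1 X) && [exists q, [&& q \notin X, adj b1 q, adj w q &
        ~~ adj a1 w || ~~ adj a2 q]])].

(** On a path of X from a neighbour of [a1], let q be the first neighbour of [b1]. All vertices
    before q are in [from_a]. If q is adjacent to [a2] it is a pivot itself, otherwise the vertex
    before it is one. *)
Lemma pivots_exist X : [disjoint X & L] -> linked a1 b1 X ->
  exists w, w \in pivots a1 a2 b1 b2 L.
Proof.
move=> dXL /linkedP[x [y [xX yX ax b_y xy]]].
have out v : v \in X -> v \notin L by move=> vX; rewrite (disjointFr dXL vX).
suff : (exists w, w \in pivots a1 a2 b1 b2 L) \/ (y \in from_a a1 b1 L) && ~~ adj b1 y.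
  by case=> //; rewrite b_y andbF.
apply: (connect_ind_r (P := fun y => (exists w, w \in pivots a1 a2 b1 b2 L) \/
   (y \in from_a a1 b1 L) && ~~ adj b1 y)) xy; last first.
  move=> u v [|/andP[uF bu]]; first by left.
  case/and3P=> uX vX uv.
  case: (boolP (adj b1 v)) => bv.
    left; case: (boolP (adj a2 v)) => av.
      by exists v; rewrite inE out // bv av.
    exists u; rewrite inE out // uF /=; apply/orP; right; apply/existsP; exists v.
    by rewrite out // bv uv av orbT.
  right; rewrite andbT; case: (boolP (adj a1 v)) => av.
    by apply: (subsetP (cl_sub _ _)); rewrite !inE out.
  by apply: cl_closed uF _; rewrite uv out // av bv.
right; rewrite (closed_both (out _ xX)) // andbT.
by apply: (subsetP (cl_sub _ _)); rewrite !inE out.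
Qed.

Lemma pivot_notin w : w \in pivots a1 a2 b1 b2 L -> w \notin L.
Proof. by rewrite inE => /andP[]. Qed.

Lemma from_a_out w : w \in from_a a1 b1 L -> (w \notin L) && ~~ adj b1 w.
Proof.
case/clP=> x; rewrite !inE => /andP[xL ax].
apply: (connect_ind_r (P := fun w => (w \notin L) && ~~ adj b1 w)).
  by rewrite xL closed_both.
by move=> u v _ /and4P[_ -> _ ->].
Qed.

(** From w the walk leads back towards a neighbour of [a1]. If it stays in X, it ends next to [a1],
    which is adjacent to [a2]. If it leaves X, it does so from a neighbour of [a2], as vertices of
    [from_a] are not adjacent to [b1]. In the other direction, either q is in X and next to [b1], or
    the edge wq leaves X, which makes w a neighbour of [b2]. *)
Lemma pivot_linked w X : w \in pivots a1 a2 b1 b2 L -> w \in X -> L \subset X ->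
  closed_under (forced a1 a2 b1 b2) X -> linked a2 b2 X.
Proof.
move=> wp wX LX cX.
have a1X := subsetP LX _ a1L; have b1X := subsetP LX _ b1L.
have edge u v : u \in X -> v \notin X -> adj u v ->
    adj a2 u && adj a1 v || adj b2 u && adj b1 v.
  by move=> uX vX uv; apply: contraR vX => h; apply: (cX u) => //; rewrite /forced uv (negPf h).
move: wp; rewrite inE => /andP[wL /orP[/andP[bw aw]|/andP[wF /existsP[q /and4P[qL bq wq _]]]]].
  apply/linkedP; exists w, b1; split=> //; first by rewrite adj_sym.
  by apply: connect_adj => //; rewrite adj_sym.
have [x [xX ax xw]] : exists x, [/\ x \in X, adj a2 x & connect (induced X) x w].
  case/clP: wF => x; rewrite !inE => /andP[xL ax] /connectP[p pp ep].
  elim/last_ind: p w ep wX pp {wL wq} => [|p z IH] w /=.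
    move=> -> xX _; exists a1; split=> //; first by rewrite adj_sym.
    exact: connect_adj.
  rewrite last_rcons => -> zX; rewrite rcons_path => /andP[pp /and4P[uz zL az bz]].
  case: (boolP (last x p \in X)) => uX.
    have [y [yX ay yu]] := IH _ erefl uX pp; exists y; split=> //.
    by apply: connect_trans yu (connect_adj uX zX uz).
  exists z; split=> //; have := edge _ _ zX uX; rewrite adj_sym => /(_ uz).
  case/orP=> /andP[//] _ bu.
  have /from_a_out/andP[_] : last x p \in from_a a1 b1 L.
    apply/clP; exists x; first by rewrite !inE xL.
    by apply/connectP; exists p.
  by rewrite bu.
case: (boolP (q \in X)) => qX.
  apply/linkedP; exists x, b1; split=> //; first by rewrite adj_sym.
  apply: connect_trans xw _; apply: connect_trans (connect_adj wX qX wq) _.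
  by apply: connect_adj => //; rewrite adj_sym.
apply/linkedP; exists x, w; split=> //.
case/orP: (edge _ _ wX qX wq) => /andP[//] _ aq.
by have := closed_both qL aq; rewrite bq.
Qed.

(** No edge of the walk from a neighbour of [a1] to w, nor the edge wq, can join the two sides, so
    all of it is drawn into X together with w. *)
Lemma pivot_linked' w X : w \in pivots a1 a2 b1 b2 L -> w \in X -> a2 \in X ->
  closed_under (forced a2 a1 b2 b1) X -> linked a1 b1 X.
Proof.
move=> wp wX a2X cX.
have edge u v : v \in X -> adj u v ->
    ~~ (adj a2 u && adj a1 v || adj b2 u && adj b1 v) -> u \in X.
  by move=> vX uv h; apply: (cX v) => //; rewrite forced_swap /forced uv (negPf h).
move: wp; rewrite inE => /andP[wL /orP[/andP[bw aw]|]].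
  apply/linkedP; exists a2, w; split=> //.
  exact: connect_adj.
move=> /andP[wF /existsP[q /and4P[qL bq wq cq]]].
have /andP[_ bw] := from_a_out wF.
have qX : q \in X.
  apply: (edge q w) => //; first by rewrite adj_sym.
  by rewrite (negPf bw) andbF orbF negb_and orbC.
have [x [xX ax xw]] : exists x, [/\ x \in X, adj a1 x & connect (induced X) x w].
  case/clP: wF => x; rewrite !inE => /andP[xL ax] /connectP[p pp ep].
  elim/last_ind: p w ep wX pp {wL wq cq bw} => [|p z IH] w /=.
    by move=> -> xX _; exists x.
  rewrite last_rcons => -> zX; rewrite rcons_path => /andP[pp /and4P[uz zL az bz]].
  have uX : last x p \in X by apply: (edge _ z) => //; rewrite (negPf az) (negPf bz) !andbF.
  have [y [yX ay yu]] := IH _ erefl uX pp; exists y; split=> //.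
  by apply: connect_trans yu (connect_adj uX zX uz).
apply/linkedP; exists x, q; split=> //.
by apply: connect_trans xw (connect_adj wX qX wq).
Qed.
End Closed.

Section Run.
Variable pk : {set G} -> option G.
Hypothesis pkP : forall X, if pk X is Some x then x \in X else X == set0.

Definition addp (X : {set G}) (w : option G) := if w is Some x then x |: X else X.

(** As long as one of the sides is not linked, the vertex to be guessed is taken among those which
    link whichever side receives them; later it may be any vertex not yet placed. *)
Definition pivot a1 a2 b1 b2 L R :=
  pk (if ~~ linked a1 b1 R then pivots a1 a2 b1 b2 L
      else if ~~ linked a2 b2 L then pivots a2 a1 b2 b1 R else ~: (L :|: R)).

Definition growL a1 a2 b1 b2 L R :=
  cl (forced a1 a2 b1 b2) (addp L (pivot a1 a2 b1 b2 L R)).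
Definition growR a1 a2 b1 b2 L R :=
  cl (forced a2 a1 b2 b1) (addp R (pivot a1 a2 b1 b2 L R)).

(** If L is good and a solution S contains it, the complement of L contains that of S and is good by
    monotonicity. So only L and the complement of R need to be considered. *)
Definition check a1 a2 b1 b2 L R : option {set G} :=
  if [disjoint L & R] then
    if good a2 b2 L && good a1 b1 (~: L) then Some L
    else if good a1 b1 R && good a2 b2 (~: R) then Some (~: R) else None
  else None.

Fixpoint srch a1 a2 b1 b2 cs L R : option {set G} :=
  if check a1 a2 b1 b2 L R is Some X then Some X else
  if cs is c :: cs' then
    if c then srch a1 a2 b1 b2 cs' (growL a1 a2 b1 b2 L R) R
    else srch a1 a2 b1 b2 cs' L (growR a1 a2 b1 b2 L R)
  else None.

Definition search a1 a2 b1 b2 cs := srch a1 a2 b1 b2 cs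
  (cl (forced a1 a2 b1 b2) [set a1; b1]) (cl (forced a2 a1 b2 b1) [set a2; b2]).

Lemma srch_sound a1 a2 b1 b2 cs L R S :
  a1 \in L -> b1 \in L -> closed_under (forced a1 a2 b1 b2) L ->
  a2 \in R -> b2 \in R -> closed_under (forced a2 a1 b2 b1) R ->
  srch a1 a2 b1 b2 cs L R = Some S -> target a1 a2 b1 b2 S.
Proof.
elim: cs L R => [|c cs IH] L R a1L b1L cL a2R b2R cR /=;
  case ec: (check _ _ _ _ _ _) => [S'|] //.
- case=> <-; move: ec; rewrite /check; case: ifP => // dLR.
  case: ifP => [/andP[g1 g2] [<-]|_].
    by split=> //; split=> //; rewrite (disjointFl dLR).
  case: ifP => // /andP[g1 g2] [<-]; apply: target_swap; split=> //.
  by split=> //; rewrite (disjointFr dLR).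
- case=> <-; move: ec; rewrite /check; case: ifP => // dLR.
  case: ifP => [/andP[g1 g2] [<-]|_].
    by split=> //; split=> //; rewrite (disjointFl dLR).
  case: ifP => // /andP[g1 g2] [<-]; apply: target_swap; split=> //.
  by split=> //; rewrite (disjointFr dLR).
have sub X w : X \subset addp X w by case: w => //= x; apply: subsetUr.
have sc r X w x : x \in X -> x \in cl r (addp X w).
  by move=> xX; apply: (subsetP (cl_sub _ _)); apply: (subsetP (sub _ _)).
by case: c; apply: IH => //; try (by apply: sc); apply: cl_closed.
Qed.

Lemma search_sound a1 a2 b1 b2 cs S :
  search a1 a2 b1 b2 cs = Some S -> target a1 a2 b1 b2 S.
Proof.
apply: srch_sound; try by apply: (subsetP (cl_sub _ _)); rewrite !inE eqxx ?orbT.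
- exact: cl_closed.
- exact: cl_closed.
Qed.

(** The guesses follow S. Each one raises the progress of the side that is enlarged. Two sides that
    are not good have progress at most 5 each, hence the bound 10: beyond it one side is good and
    [check] succeeds. *)
Lemma srch_complete a1 a2 b1 b2 S k L R :
  adj a1 a2 -> adj b1 b2 -> target a1 a2 b1 b2 S ->
  a1 \in L -> b1 \in L -> closed_under (forced a1 a2 b1 b2) L -> L \subset S ->
  a2 \in R -> b2 \in R -> closed_under (forced a2 a1 b2 b1) R -> R \subset ~: S ->
  10 < progress a1 a2 b1 b2 L + progress a2 a1 b2 b1 R + k ->
  exists2 cs, size cs = k & srch a1 a2 b1 b2 cs L R.
Proof.
move=> a12 b12 tS; have [[a1S b1S a2S b2S cS] g1 g2] := tS.
have a21 : adj a2 a1 by rewrite adj_sym.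
have b21 : adj b2 b1 by rewrite adj_sym.
have [[_ _ _ _ cS'] _ _] := target_swap tS.
have dis X : X \subset ~: S -> [disjoint S & X].
  by rewrite subsets_disjoint setCK disjoint_sym.
elim: k L R => [|k IH] L R a1L b1L cL LS a2R b2R cR RS hk.
- have dLR : [disjoint L & R] by exact: disjointWl LS (dis _ RS).
  have dn : check a1 a2 b1 b2 L R.
    rewrite /check dLR.
    have [gL|gL] := boolP (good a2 b2 L); last have [gR|gR] := boolP (good a1 b1 R).
    + by rewrite (good_mono a21 b21 _ _ cS') // ?inE // setCS.
    + rewrite /= (good_mono a12 b12 _ _ cS) //; last by rewrite -setCS setCK.
    + have PL : progress a1 a2 b1 b2 L != 6.
        by apply: contra gL => /eqP/progress_good ->.
      have PR : progress a2 a1 b2 b1 R != 6.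
        by apply: contra gR => /eqP/progress_good ->.
      have : progress a1 a2 b1 b2 L < 6 by rewrite ltn_neqAle PL progress_le.
      have : progress a2 a1 b2 b1 R < 6 by rewrite ltn_neqAle PR progress_le.
      rewrite !ltnS => h1 h2; have := leq_add h1 h2.
      by rewrite addnC leqNgt -[X in _ < X]addn0 hk.
  by exists [::] => //=; case: (check _ _ _ _ _ _) dn.
case ec: (check a1 a2 b1 b2 L R) => [S'|].
  by exists (nseq k.+1 true); rewrite ?size_nseq //= ec.
have dLR : [disjoint L & R] by exact: disjointWl LS (dis _ RS).
have [gL gR] : ~~ good a2 b2 L /\ ~~ good a1 b1 R.
  move: ec; rewrite /check dLR.
  have [gL|gL] := boolP (good a2 b2 L).
    by rewrite (good_mono a21 b21 _ _ cS') // ?inE // setCS.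
  have [gR|gR] //= := boolP (good a1 b1 R).
  by rewrite (good_mono a12 b12 _ _ cS) //; rewrite -setCS setCK.
have [/andP[lS _] /andP[lS' _]] := (g1, g2).
set w := pivot a1 a2 b1 b2 L R.
(* The last two clauses: the side of S that has to receive x is linked already or becomes linked. *)
have [x ew [xL xR hlL hlR]] : exists2 x, w = Some x & [/\ x \notin L, x \notin R,
    (linked a2 b2 L) || linked a2 b2 (growL a1 a2 b1 b2 L R) || (x \notin S) &
    (linked a1 b1 R) || linked a1 b1 (growR a1 a2 b1 b2 L R) || (x \in S)].
  have inL x : w = Some x -> x \in growL a1 a2 b1 b2 L R.
    by rewrite /growL -/w => -> /=; apply: (subsetP (cl_sub _ _)); rewrite !inE eqxx.
  have inR x : w = Some x -> x \in growR a1 a2 b1 b2 L R.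
    by rewrite /growR -/w => -> /=; apply: (subsetP (cl_sub _ _)); rewrite !inE eqxx.
  have sub X v : X \subset addp X v by case: v => //= y; apply: subsetUr.
  have sL : L \subset growL a1 a2 b1 b2 L R by apply: subset_trans (sub _ _) (cl_sub _ _).
  have sR : R \subset growR a1 a2 b1 b2 L R by apply: subset_trans (sub _ _) (cl_sub _ _).
  have dSR := dis _ RS.
  move: (pkP (if ~~ linked a1 b1 R then pivots a1 a2 b1 b2 L
      else if ~~ linked a2 b2 L then pivots a2 a1 b2 b1 R else ~: (L :|: R))).
  rewrite -/(pivot a1 a2 b1 b2 L R) -/w; case ew: w => [x|]; last first.
    case: ifP => [_|/negbFE lR].
      have dL : [disjoint ~: S & L] by rewrite disjoint_sym -subsets_disjoint.
      have [y yp] := pivots_exist a1L cL dL lS'.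
      by move=> /eqP/setP/(_ y); rewrite yp inE.
    case: ifP => [_|/negbFE lL].
      have [y yp] := pivots_exist a2R cR dSR lS.
      by move=> /eqP/setP/(_ y); rewrite yp inE.
    (* Every vertex has been placed, so L is S, which is good. *)
    move=> /eqP W0; have eS : S = L.
      apply/eqP; rewrite eqEsubset LS andbT; apply/subsetP=> y yS.
      have /setP/(_ y) := W0; rewrite !inE => /negbFE/orP[//|yR].
      by rewrite (disjointFr dSR yS) in yR.
    by move: gL; rewrite -eS g1.
  case: ifP => [lR|/negbFE lR].
    move=> xp; exists x => //; have xL := pivot_notin xp.
    have l1 := pivot_linked a12 b12 a1L b1L cL xp (inL x ew) sL (@cl_closed _ _ _).
    have l2 : linked a1 b1 (growR a1 a2 b1 b2 L R).
      apply: (pivot_linked' a12 a1L cL xp (inR x ew) _ (@cl_closed _ _ _));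
      exact: (subsetP sR).
    split=> //; rewrite ?l1 ?l2 ?orbT //.
    apply: contra lR => xR.
    exact: (pivot_linked' a12 a1L cL xp xR).
  case: ifP => [lL|/negbFE lL].
    move=> xp; exists x => //; have xR := pivot_notin xp.
    have l2 := pivot_linked a21 b21 a2R b2R cR xp (inR x ew) sR (@cl_closed _ _ _).
    have l1 : linked a2 b2 (growL a1 a2 b1 b2 L R).
      apply: (pivot_linked' a21 a2R cR xp (inL x ew) _ (@cl_closed _ _ _));
      exact: (subsetP sL).
    split=> //; rewrite ?l1 ?l2 ?orbT //.
    apply: contra lL => xL.
    exact: (pivot_linked' a21 a2R cR xp xL).
  by rewrite !inE negb_or => /andP[xL xR]; exists x => //; rewrite lL lR.
have LgL : L \subset growL a1 a2 b1 b2 L R.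
  by apply: subset_trans (cl_sub _ _); rewrite -/w ew /=; apply: subsetUr.
have RgR : R \subset growR a1 a2 b1 b2 L R.
  by apply: subset_trans (cl_sub _ _); rewrite -/w ew /=; apply: subsetUr.
case: (boolP (x \in S)) => xS.
  have xg : x \in growL a1 a2 b1 b2 L R.
    by apply: (subsetP (cl_sub _ _)); rewrite -/w ew /= !inE eqxx.
  have [|||||cs sc hc] := IH (growL a1 a2 b1 b2 L R) R _ _ _ _ a2R b2R cR RS.
  - exact: (subsetP LgL).
  - exact: (subsetP LgL).
  - exact: cl_closed.
  - apply: cl_min cS; rewrite -/w ew /=; apply/subsetP=> y; rewrite !inE.
    by case/orP=> [/eqP->//|]; apply: (subsetP LS).
  - apply: leq_trans hk _; rewrite addnS -addSn leq_add2r -addSn leq_add2r.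
    move: hlL; rewrite xS orbF => /orP[lL|lL].
      apply: progress_lt => //; rewrite properE LgL; apply/subsetPn; by exists x.
    case: (boolP (linked a2 b2 L)) => lL'.
      apply: progress_lt => //; rewrite properE LgL; apply/subsetPn; by exists x.
    by rewrite /progress (negPf lL') lL.
  by exists (true :: cs) => /=; rewrite ?sc // ec.
have xg : x \in growR a1 a2 b1 b2 L R.
  by apply: (subsetP (cl_sub _ _)); rewrite -/w ew /= !inE eqxx.
have [|||||cs sc hc] := IH L (growR a1 a2 b1 b2 L R) a1L b1L cL LS.
- exact: (subsetP RgR).
- exact: (subsetP RgR).
- exact: cl_closed.
- apply: cl_min cS'; rewrite -/w ew /=; apply/subsetP=> y; rewrite !inE.
  by case/orP=> [/eqP->//|/(subsetP RS)]; rewrite inE.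
- apply: leq_trans hk _; rewrite addnS -addSn leq_add2r -addnS leq_add2l.
  move: hlR; rewrite (negPf xS) orbF => /orP[lL|lL].
    apply: progress_lt => //; rewrite properE RgR; apply/subsetPn; by exists x.
  case: (boolP (linked a1 b1 R)) => lL'.
    apply: progress_lt => //; rewrite properE RgR; apply/subsetPn; by exists x.
  by rewrite /progress (negPf lL') lL.
by exists (false :: cs) => /=; rewrite ?sc // ec.
Qed.

Lemma search_complete a1 a2 b1 b2 S :
  adj a1 a2 -> adj b1 b2 -> target a1 a2 b1 b2 S ->
  exists2 cs, size cs = 11 & search a1 a2 b1 b2 cs.
Proof.
move=> a12 b12 tS; have [[a1S b1S a2S b2S cS] _ _] := tS.
have [[_ _ _ _ cS'] _ _] := target_swap tS.
apply: (srch_complete a12 b12 tS);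
  try (by apply: (subsetP (cl_sub _ _)); rewrite !inE eqxx ?orbT); try exact: cl_closed.
- by apply: cl_min cS; apply/subsetP=> x; rewrite !inE => /orP[]/eqP->.
- by apply: cl_min cS'; apply/subsetP=> x; rewrite !inE => /orP[]/eqP->.
- by rewrite addnC leq_addr.
Qed.
End Run.
End Search.

(** * Targets of the search are 2-joins, and conversely *)

Section TwoJoin.
Variable G : sgraph.
Implicit Types (J : split G) (X S : {set G}).

Lemma path_in_connect (X A B : {set G}) : A \subset X ->
  (exists a p, [/\ a \in A, path_in X a p & last a p \in B]) <->
  (exists x y, [/\ x \in A, y \in B & connect (induced X) x y]).
Proof.
move=> /subsetP AX; split=> [[a [p [aA /and3P[Xp pp _] lB]]]|[x [y [xA yB /connectP[p pp ey]]]]].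
  exists a, (last a p); split=> //; apply/connectP; exists p => //.
  elim: p a {aA lB} Xp pp => //= z p IH a /and3P[aX zX Xp] /andP[az pp].
  by apply/andP; split; [apply/and3P | apply: IH => //=; rewrite zX].
rewrite ey in yB; case/shortenP: pp yB => q pq Uq _ yB.
exists x, q; split=> //; apply/and3P; split=> //.
  apply/andP; split; first exact: AX.
  elim: q x {Uq yB xA ey} pq => //= z q IH x /andP[/and3P[_ zX _] pq].
  by rewrite zX; apply: IH pq.
by apply: sub_path pq => u v /and3P[].
Qed.

Definition mk_split (a1 a2 b1 b2 : G) S : split G :=
  Split (fun i => if i then S else ~: S)
    (fun i => if i then [set u in S | adj a2 u] else [set u in ~: S | adj a1 u])
    (fun i => if i then [set u in S | adj b2 u] else [set u in ~: S | adj b1 u]).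

Lemma good_not_path (a b : G) X : good a b X ->
  #|[set u in X | adj a u]| = 1 -> #|[set u in X | adj b u]| = 1 -> ~ chordless_path X.
Proof. by case/andP=> _ h A B /pathbP p; move: h; rewrite /pathlike A B p. Qed.

(** A linked side with at most two vertices is a single edge xy with A = {x} and B = {y}, which is
    pathlike. So goodness yields the three vertices required of a side. *)
Lemma good_card (a b : G) X : good a b X ->
  [disjoint [set u in X | adj a u] & [set u in X | adj b u]] -> 3 <= #|X|.
Proof.
case/andP=> /linkedP[x [y [xX yX ax b_y xy]]] np dab.
rewrite leqNgt; apply: contra np => X2.
have xA : x \in [set u in X | adj a u] by rewrite inE xX.
have yB : y \in [set u in X | adj b u] by rewrite inE yX.
have nxy : x != y by apply: contraTneq yB => <-; rewrite (disjointFr dab xA).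
have eX : X = [set x; y].
  apply/esym/eqP; rewrite eqEcard cards2 nxy -ltnS X2 andbT.
  by apply/subsetP=> u; rewrite !inE => /orP[]/eqP->.
have deg1 u : u \in X -> deg X u <= 1.
  move=> uX; rewrite -ltnS; apply: (@leq_trans #|X|) => //; apply/proper_card/properP; split.
    by apply/subsetP=> v; rewrite inE => /andP[].
  by exists u => //; rewrite inE adj_irr andbF.
apply/and3P; split.
- apply/cards1P; exists x; apply/eqP; rewrite eqEsubset sub1set xA andbT.
  apply/subsetP=> u uA; have := uA; rewrite !inE eX !inE => /andP[/orP[|]// /eqP eu _].
  by move: uA; rewrite eu (disjointFl dab yB).
- apply/cards1P; exists y; apply/eqP; rewrite eqEsubset sub1set yB andbT.
  apply/subsetP=> u uA; have := uA; rewrite !inE eX !inE => /andP[/orP[|]// /eqP eu _].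
  by move: uA; rewrite eu (disjointFr dab xA).
apply/and3P; split.
- apply/connP=> u v; rewrite eX !inE -eX => /orP[]/eqP-> /orP[]/eqP-> //.
  by rewrite connect_induced_sym.
- by apply/forall_inP=> u uX; apply: leq_trans (deg1 u uX) _.
- by apply/exists_inP; exists x => //; apply: deg1.
Qed.

Lemma target_two_join a1 a2 b1 b2 S : adj a1 a2 -> adj b1 b2 ->
  target a1 a2 b1 b2 S -> two_join (mk_split a1 a2 b1 b2 S).
Proof.
move=> a12 b12 tS; have [[a1S b1S a2S b2S cS] g1 g2] := tS.
have a21 : adj a2 a1 by rewrite adj_sym.
have b21 : adj b2 b1 by rewrite adj_sym.
have [[_ _ _ _ cS'] _ _] := target_swap tS.
have d1 : [disjoint [set u in S | adj a2 u] & [set u in S | adj b2 u]].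
  apply/pred0P=> u /=; apply/negP; rewrite !inE => /andP[/andP[uS au] /andP[_ bu]].
  case/negP: a2S; apply: (cS u) => //; by rewrite /forced eqxx au bu !orbT.
have d2 : [disjoint [set u in ~: S | adj a1 u] & [set u in ~: S | adj b1 u]].
  apply/pred0P=> u /=; apply/negP; rewrite !inE => /andP[/andP[uS au] /andP[_ bu]].
  case/negP: uS; apply: (cS a1) => //; by rewrite /forced eqxx au bu !orbT.
split.
  split.
  - by rewrite /= setUCr.
  - by rewrite /= -subsets_disjoint.
  - have sub (P : pred G) X : [set u in X | P u] \subset X.
      by apply/subsetP=> u; rewrite inE => /andP[].
    by case=> /=; split=> //; apply/set0Pn;
      [exists a1|exists b1|exists a2|exists b2]; rewrite !inE ?a1S ?b1S ?a2S ?b2S.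
  - move=> u v /= uS vS; rewrite [u \in _]inE [v \in _]inE [u \in [set _ in _ | adj b2 _]]inE [v \in [set _ in _ | adj b1 _]]inE uS vS /=.
    by apply: (closed_edge cS) => //; rewrite -in_setC.
  - by case=> /=; [apply: good_card g1 d1 | apply: good_card g2 d2].
case; split=> /=.
- apply/path_in_connect; first by apply/subsetP=> u; rewrite inE => /andP[].
  have /andP[/linkedP[x [y [xX yX ax b_y c]]] _] := g1.
  by exists x, y; rewrite !inE xX yX.
- exact: good_not_path.
- apply/path_in_connect; first by apply/subsetP=> u; rewrite inE => /andP[].
  have /andP[/linkedP[x [y [xX yX ax b_y c]]] _] := g2.
  by exists x, y; split; rewrite ?inE -?in_setC ?xX ?yX.
- exact: good_not_path.
Qed.

Section Facts.
Variables (J : split G) (hJ : almost_2join J).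

Lemma join_XN i x : (x \in sX J (~~ i)) = (x \notin sX J i).
Proof.
have [/setP/(_ x) + /pred0P/(_ x) + _ _ _] := hJ; rewrite !inE /=.
by case: i => /=; case: (x \in sX J true); case: (x \in sX J false).
Qed.

Lemma join_XC i : sX J (~~ i) = ~: sX J i.
Proof. by apply/setP=> x; rewrite join_XN inE. Qed.

Lemma join_AX i x : x \in sA J i -> x \in sX J i.
Proof. by have [_ _ /(_ i)[/subsetP h]] := hJ; move=> *; apply: h. Qed.

Lemma join_BX i x : x \in sB J i -> x \in sX J i.
Proof. by have [_ _ /(_ i)[_ /subsetP h]] := hJ; move=> *; apply: h. Qed.

Lemma join_AB i x : x \in sA J i -> x \notin sB J i.
Proof. by have [_ _ /(_ i)[_ _ d _ _] _ _] := hJ => xA; rewrite (disjointFr d xA). Qed.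

Lemma join_BA i x : x \in sB J i -> x \notin sA J i.
Proof. by apply: contraL; apply: join_AB. Qed.

Lemma join_adj i u v : u \in sX J i -> v \in sX J (~~ i) ->
  adj u v = (u \in sA J i) && (v \in sA J (~~ i)) || (u \in sB J i) && (v \in sB J (~~ i)).
Proof.
have [_ _ _ h _] := hJ; case: i => /= uX vX; first exact: h.
by rewrite adj_sym h // andbC [X in _ || X]andbC.
Qed.

Lemma join_adjA i u v : u \in sX J i -> v \in sA J (~~ i) -> adj u v = (u \in sA J i).
Proof.
move=> uX vA; rewrite (join_adj uX) ?join_AX // vA andbT (negPf (join_AB vA)) andbF.
exact: orbF.
Qed.

Lemma join_adjB i u v : u \in sX J i -> v \in sB J (~~ i) -> adj u v = (u \in sB J i).
Proof.
by move=> uX vB; rewrite (join_adj uX) ?join_BX // vB andbT (negPf (join_BA vB)) andbF.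
Qed.

Lemma join_A0 i : exists x, x \in sA J i.
Proof. by have [_ _ /(_ i)[_ _ _ /set0Pn h _] _ _] := hJ. Qed.

Lemma join_B0 i : exists x, x \in sB J i.
Proof. by have [_ _ /(_ i)[_ _ _ _ /set0Pn h] _ _] := hJ. Qed.

Lemma join_nbrA i v : v \in sA J (~~ i) -> [set u in sX J i | adj v u] = sA J i.
Proof.
move=> vA; apply/setP=> u; rewrite inE adj_sym; apply/andP/idP => [[uX]|uA].
  by rewrite (join_adjA uX vA).
by rewrite join_AX // (join_adjA (join_AX uA) vA).
Qed.

Lemma join_nbrB i v : v \in sB J (~~ i) -> [set u in sX J i | adj v u] = sB J i.
Proof.
move=> vA; apply/setP=> u; rewrite inE adj_sym; apply/andP/idP => [[uX]|uA].
  by rewrite (join_adjB uX vA).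
by rewrite join_BX // (join_adjB (join_BX uA) vA).
Qed.
End Facts.

Definition flip_side J := Split (fun i => sX J (~~ i)) (fun i => sA J (~~ i)) (fun i => sB J (~~ i)).
Definition flip_AB J := Split (sX J) (sB J) (sA J).

Lemma flip_side_two_join J : two_join J -> two_join (flip_side J).
Proof.
move=> [[cov dis sub e c] h]; split=> [|i]; last exact: (h (~~ i)).
split=> //=; first by rewrite setUC.
- by rewrite disjoint_sym.
- by move=> u v uX vX; rewrite adj_sym e // andbC [X in _ || X]andbC.
Qed.

Lemma flip_AB_two_join J : two_join J -> two_join (flip_AB J).
Proof.
move=> [aJ h]; have [cov dis sub e c] := aJ; split=> [|i].
  split=> //=; last by move=> u v uX vX; rewrite e // orbC.
  by move=> i; have [h1 h2 h3 h4 h5] := sub i; split=> //; rewrite disjoint_sym.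
have [sA' sB' _ _ _] := sub i; have [hp hn] := h i; split=> /=; last by move=> x y; apply: hn.
have [x [y [xA yB xy]]] := (path_in_connect (sB J i) sA').1 hp.
by apply/(path_in_connect _ sB'); exists y, x; split=> //; rewrite connect_induced_sym.
Qed.

Lemma two_join_target J a1 a2 b1 b2 : two_join J ->
  a1 \in sA J true -> a2 \in sA J false -> b1 \in sB J true -> b2 \in sB J false ->
  target a1 a2 b1 b2 (sX J true).
Proof.
move=> [aJ hJ] a1A a2A b1B b2B.
have X2 : sX J false = ~: sX J true by rewrite -(join_XC aJ).
have nA1 := join_nbrA (i := true) aJ a2A; have nB1 := join_nbrB (i := true) aJ b2B.
have nA2 := join_nbrA (i := false) aJ a1A; have nB2 := join_nbrB (i := false) aJ b1B.
have AB1 u : u \in sX J true -> adj a2 u -> ~~ adj b2 u.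
  move=> uX au; apply/negP=> bu; have : u \in sA J true by rewrite -nA1 inE uX.
  by move/(join_AB aJ)/negP; apply; rewrite -nB1 inE uX.
have AB2 u : u \in sX J false -> adj a1 u -> ~~ adj b1 u.
  move=> uX au; apply/negP=> bu; have : u \in sA J false by rewrite -nA2 inE uX.
  by move/(join_AB aJ)/negP; apply; rewrite -nB2 inE uX.
have goodP (i : bool) (a b : G) : [set u in sX J i | adj a u] = sA J i ->
    [set u in sX J i | adj b u] = sB J i -> good a b (sX J i).
  have [hp hn] := hJ i; have sub : sA J i \subset sX J i by apply/subsetP=> x /(join_AX aJ).
  have [x [y [xA yB xy]]] := (path_in_connect (sB J i) sub).1 hp.
  move=> eA eB; apply/andP; split.
    move: xA yB; rewrite -eA -eB !inE => /andP[xX ax] /andP[yX b_y].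
    by apply/linkedP; exists x, y.
  apply/negP=> /and3P[]; rewrite eA eB => /eqP A1 /eqP B1 /pathbP; exact: hn.
split; last by rewrite -X2; apply: goodP.
  split; [exact: (join_AX aJ)|exact: (join_BX aJ)|..].
  - by rewrite -in_setC -X2 (join_AX aJ).
  - by rewrite -in_setC -X2 (join_BX aJ).
  move=> u v uX; apply: contraTT => vX.
  have vX2 : v \in sX J false by rewrite X2 inE.
  rewrite /forced !negb_or negbK; apply/and3P; split.
  - rewrite (join_adj (i := true) aJ) //= -nA1 -nB1 -nA2 -nB2 !inE uX vX2 /=.
    by rewrite eqxx.
  - by apply/negP=> /and3P[_ av bv]; case/negP: (AB2 v vX2 av).
  - by apply/negP=> /and3P[_ av bv]; case/negP: (AB1 u uX av).
exact: goodP.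
Qed.

Definition separates J x y := (x \in sX J true) != (y \in sX J true).

(** An edge between the sides joins A1 to A2 or B1 to B2. After an exchange of the sides, or of the
    letters A and B, it plays the role of a1a2, so testing it in this role alone is exhaustive. *)
Lemma separates_target J u v : two_join J -> separates J u v -> adj u v ->
  exists b1 b2 S, adj b1 b2 /\ target u v b1 b2 S.
Proof.
wlog uX : J / u \in sX J true.
  move=> hwlog hJ suv uv; case: (boolP (u \in sX J true)) => uX; first exact: hwlog uX hJ suv uv.
  apply: (hwlog (flip_side J)) => //.
  - by rewrite /= (join_XN hJ.1 true).
  - exact: flip_side_two_join.
  - by rewrite /separates /= !(join_XN hJ.1 true) (inj_eq negb_inj).
move=> hJ; have aJ := hJ.1; rewrite /separates uX /= => vX uv.
have vX2 : v \in sX J false by rewrite (join_XN aJ true); case: (v \in _) vX.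
move: (uv); rewrite (join_adj (i := true) aJ) // => /orP[]/andP[uA vA].
  have [b1 B1] := join_B0 aJ true; have [b2 B2] := join_B0 aJ false.
  exists b1, b2, (sX J true); split; last exact: two_join_target.
  by rewrite (join_adjB (i := true) aJ) ?(join_BX aJ).
have [b1 B1] := join_A0 aJ true; have [b2 B2] := join_A0 aJ false.
exists b1, b2, (sX J true); split.
  by rewrite (join_adjA (i := true) aJ) ?(join_AX aJ).
exact: (two_join_target (flip_AB_two_join hJ)).
Qed.

Lemma separates_edge J : two_join J -> exists u v, adj u v /\ separates J u v.
Proof.
move=> [aJ _]; have [u uA] := join_A0 aJ true; have [v vA] := join_A0 aJ false.
exists u, v; split; first by rewrite (join_adjA (i := true) aJ) ?(join_AX aJ).
by rewrite /separates (join_AX aJ) // -(negbK (v \in _)) -(join_XN aJ true) (join_AX aJ).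
Qed.
End TwoJoin.

(** A connected part of a chordless path is an interval, and two neighbours of a vertex outside it
    would lie on different sides of that vertex. *)
Lemma chordless_gap (G : sgraph) (Z X : {set G}) a s t : chordless_path Z ->
  X \subset Z -> connected X -> a \in Z -> a \notin X -> s \in X -> t \in X ->
  s != t -> adj a s -> ~~ adj a t.
Proof.
move=> [x [p [Up Xp Hp]]] XZ cX aZ aX sX tX st as_; apply/negP=> at_.
have idx v : v \in Z -> index v (x :: p) <= size p.
  by rewrite -Xp -index_mem ltnS.
have nidx v : v \in Z -> nth x (x :: p) (index v (x :: p)) = v.
  by rewrite -Xp; apply: nth_index.
have A u v : u \in Z -> v \in Z ->
    adj u v = ((index u (x :: p)).+1 == index v (x :: p)) ||
              ((index v (x :: p)).+1 == index u (x :: p)).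
  by move=> uZ vZ; rewrite -{1}(nidx u uZ) -{1}(nidx v vZ) Hp ?idx.
have inZ v : v \in X -> v \in Z by apply: (subsetP XZ).
wlog lt_st : s t sX tX st as_ at_ / index s (x :: p) < index t (x :: p).
  move=> hw; case: (ltngtP (index s (x :: p)) (index t (x :: p))) => h.
  - exact: hw h.
  - by apply: hw h; rewrite // eq_sym.
  - by case/eqP: st; rewrite -(nidx s) ?inZ // h nidx ?inZ.
have [es et] : (index s (x :: p)).+1 = index a (x :: p) /\ (index a (x :: p)).+1 = index t (x :: p).
  move: as_ at_ lt_st; rewrite !A ?aZ ?inZ //.
  move: (index a _) (index s _) (index t _) => i j k.
  by case/orP=> /eqP <- /orP[]/eqP; lia.
have [||u [v [us vs /and3P[uX vX uv]]]] :=
    connect_exit (S := [set v | index v (x :: p) < index a (x :: p)]) (cX s t sX tX).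
- by rewrite inE -es.
- by rewrite inE -et -leqNgt leqnSn.
move: us vs; rewrite !inE -leqNgt => us vs.
move: uv; rewrite A ?inZ // => /orP[]/eqP h.
  have ev : index v (x :: p) = index a (x :: p) by apply/eqP; rewrite eqn_leq vs -h us.
  by case/negP: aX; rewrite -(nidx a aZ) -ev nidx ?inZ.
by move: (leq_trans us vs); rewrite -h ltnNge leqnSn.
Qed.

(** * 2-joins of blocks *)

Section Consistent.
Variables (G : sgraph) (J : split G) (hJ : two_join J) (cJ : consistent J).
Let aJ := hJ.1.

Lemma consistent_conn i : connected (sX J i).
Proof. by have [/(_ i)[_ _ _ [h _ _]] _ _] := cJ. Qed.

Lemma consistent_nbr i x : x \in sX J i -> exists2 y, y \in sX J i & adj x y.
Proof.
move=> xX; have [_ _ _ _ /(_ i) c3] := aJ.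
have [y yX nyx] : exists2 y, y \in sX J i & y \notin [set x].
  apply/subsetPn; apply: contraL c3 => /subset_leq_card; rewrite cards1 -ltnNge => h.
  exact: leq_trans h _.
have [u [v [ux vx /and3P[uX vX uv]]]] := connect_exit (consistent_conn xX yX) (set11 x) nyx.
by move: ux uv; rewrite inE => /eqP-> uv; exists v.
Qed.

(** A vertex a of A has a non-neighbour b in B, and both have neighbours on their side. With only
    three vertices the side would be the chordless path a, c, b with A = {a} and B = {b}. The bound
    makes both blocks smaller than G, since a marker path has 3 vertices. *)
Lemma consistent_card i : 4 <= #|sX J i|.
Proof.
have [_ _ _ _ /(_ i) c3] := aJ; rewrite ltnNge; apply/negP=> c3'.
have [/(_ i)[_ hA hB _] _ _] := cJ.
have [a aA] := join_A0 aJ i; have [b bB nab] := hA a aA.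
have aX := join_AX aJ aA; have bX := join_BX aJ bB.
have [c cX ac] := consistent_nbr aX.
have [d dX bd] := consistent_nbr bX.
have ab : a != b by apply: contraTneq aA => ->; apply: (join_BA aJ).
have ca : c != a by apply: contraTneq ac => ->; rewrite adj_irr.
have cb : c != b by apply: contraTneq ac => ->.
have eX : sX J i = [set a; b; c].
  apply/esym/eqP; rewrite eqEcard; apply/andP; split.
    by apply/subsetP=> x; rewrite !inE => /orP[/orP[]|]/eqP->.
  by apply: leq_trans c3' _; rewrite setUC cardsU1 cards2 !inE negb_or ca cb ab.
have bc : adj b c.
  move: dX bd; rewrite eX !inE => /orP[/orP[]|]/eqP-> //; last by rewrite adj_irr.
  by rewrite adj_sym (negPf nab).
have cA : c \notin sA J i.
  apply/negP=> cA; have [e eB nce] := hA c cA.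
  have := join_BX aJ eB; rewrite eX !inE => /orP[/orP[]|]/eqP ee.
  - by move: (join_BA aJ eB); rewrite ee aA.
  - by move: nce; rewrite ee adj_sym bc.
  - by move: (join_BA aJ eB); rewrite ee cA.
have cB : c \notin sB J i.
  apply/negP=> cB; have [e eB nce] := hB c cB.
  have := join_AX aJ eB; rewrite eX !inE => /orP[/orP[]|]/eqP ee.
  - by move: nce; rewrite ee adj_sym ac.
  - by move: (join_AB aJ eB); rewrite ee bB.
  - by move: (join_AB aJ eB); rewrite ee cB.
have [_] := hJ.2 i; apply.
- apply/eqP/cards1P; exists a; apply/setP=> x; rewrite inE; apply/idP/eqP => [xA|->//].
  have := join_AX aJ xA; rewrite eX !inE => /orP[/orP[]|]/eqP // ex.
    by move: (join_AB aJ xA); rewrite ex bB.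
  by move: cA; rewrite -ex xA.
- apply/eqP/cards1P; exists b; apply/setP=> x; rewrite inE; apply/idP/eqP => [xA|->//].
  have := join_BX aJ xA; rewrite eX !inE => /orP[/orP[]|]/eqP // ex.
    by move: (join_BA aJ xA); rewrite ex aA.
  by move: cB; rewrite -ex xA.
apply/pathbP/and3P; split.
- exact/connP/consistent_conn.
- apply/forall_inP=> x xX; rewrite -ltnS; apply: leq_trans c3'; apply/proper_card/properP.
  split; first by apply/subsetP=> y; rewrite inE => /andP[].
  by exists x => //; rewrite inE adj_irr andbF.
- apply/exists_inP; exists a => //; apply: (@leq_trans #|[set c]|); last by rewrite cards1.
  apply/subset_leq_card/subsetP=> x; rewrite !inE eX !inE.
  case/andP=> /orP[/orP[]|]/eqP-> //; first by rewrite adj_irr.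
  by rewrite (negPf nab).
Qed.

Definition mk_a : 'I_3 := Ordinal (isT : 0 < 3).
Definition mk_c : 'I_3 := Ordinal (isT : 1 < 3).
Definition mk_b : 'I_3 := Ordinal (isT : 2 < 3).

Lemma mkP (k : 'I_3) : [\/ k = mk_a, k = mk_c | k = mk_b].
Proof.
by case: k => [[|[|[|k]]] hk] //; [constructor 1 | constructor 2 | constructor 3]; apply: val_inj.
Qed.

(* [collapse i] contracts the side opposite to i to the marker path of block i. *)
Definition collapse i (x : G) : block J i :=
  if insub x is Some u then inl u
  else if x \in sA J (~~ i) then inr mk_a
  else if x \in sB J (~~ i) then inr mk_b else inr mk_c.

Variant collapse_spec i x : block J i -> Type :=
| CollapseIn (u : {x : G | x \in sX J i}) of x = val u : collapse_spec x (inl u)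
| CollapseA of x \in sX J (~~ i) & x \in sA J (~~ i) & x \notin sB J (~~ i) :
    collapse_spec x (inr mk_a)
| CollapseB of x \in sX J (~~ i) & x \notin sA J (~~ i) & x \in sB J (~~ i) :
    collapse_spec x (inr mk_b)
| CollapseC of x \in sX J (~~ i) & x \notin sA J (~~ i) & x \notin sB J (~~ i) :
    collapse_spec x (inr mk_c).

Lemma collapseP i x : collapse_spec x (collapse i x).
Proof.
rewrite /collapse; case: insubP => [u _ <-|]; first exact: CollapseIn.
rewrite -(join_XN aJ) => xX; case: ifP => [xA|/negbT xA].
  by apply: CollapseA => //; apply: (join_AB aJ).
by case: ifP => [xB|/negbT xB]; constructor.
Qed.

Lemma collapse_inl i (u : {x : G | x \in sX J i}) : collapse i (val u) = inl u.
Proof. by rewrite /collapse valK. Qed.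

Lemma collapse_in i x : x \in sX J i -> exists2 u, val u = x & collapse i x = inl u.
Proof. by rewrite /collapse; case: insubP => [u _ <-|/negP//]; exists u. Qed.

Lemma collapse_out i x : x \in sX J (~~ i) -> exists k, collapse i x = inr k.
Proof.
case: collapseP => [u -> uX|||]; try by move=> *; eexists.
by have := valP u; move: uX; rewrite (join_XN aJ) => /negPf ->.
Qed.

Lemma collapse_A i x : x \in sA J (~~ i) -> collapse i x = inr mk_a.
Proof.
move=> xA; have := xA; case: collapseP => // [u eu|_ /negP|_ /negP] // /(join_AX aJ).
by rewrite eu (join_XN aJ) (valP u).
Qed.

Lemma collapse_B i x : x \in sB J (~~ i) -> collapse i x = inr mk_b.
Proof.
move=> xA; have := xA; case: collapseP => // [u eu /(join_BX aJ)|_ _ /negP|_ _ /negP] //.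
by rewrite eu (join_XN aJ) (valP u).
Qed.

Lemma collapse_adj i x y : x \in sX J i -> adj x y = adj (collapse i x) (collapse i y).
Proof.
move=> /[dup] xX /collapse_in[u ex ->]; subst x.
case: collapseP => [w ->|||] //= yX yA yB.
- by rewrite (join_adjA aJ xX yA) orbF.
- by rewrite (join_adjB aJ xX yB).
- by rewrite (join_adj aJ xX yX) (negPf yA) (negPf yB) !andbF.
Qed.

(** * Lifting a 2-join of a block that keeps the markers together *)

Section Lift.
Variables (i : bool) (K : split (block J i)) (hK : two_join K) (b : bool).
Hypothesis markers : forall k : 'I_3, inr k \in sX K b.

Definition lift_split : split G := Split (fun c => collapse i @^-1: sX K c)
  (fun c => collapse i @^-1: sA K c) (fun c => collapse i @^-1: sB K c).

Let mNb k : inr k \in sX K (~~ b) = false.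
Proof. by rewrite (join_XN hK.1) markers. Qed.

Let sub_side : sX J (~~ i) \subset sX lift_split b.
Proof. by apply/subsetP=> x xX; rewrite inE; have [k ->] := collapse_out xX. Qed.

Let inl_side x : x \in sX lift_split (~~ b) -> x \in sX J i.
Proof.
move=> xZ; rewrite -[i]negbK (join_XN aJ); apply: contraL xZ => /(subsetP sub_side).
by rewrite !inE (join_XN hK.1) => ->.
Qed.

(** A vertex of A or B has neighbours across the 2-join, but the middle marker is adjacent to
    markers only, and these are on its own side. *)
Let mid_free : (inr mk_c \notin sA K b) && (inr mk_c \notin sB K b).
Proof.
have no w : w \in sX K (~~ b) -> ~~ adj w (inr mk_c : block J i).
  by case: w => [u|k] //= ; rewrite mNb.
apply/andP; split; apply/negP=> h.
  have [w wA] := join_A0 hK.1 (~~ b); have := no w (join_AX hK.1 wA).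
  by rewrite adj_sym (join_adjA hK.1 (join_AX hK.1 h) wA) h.
have [w wA] := join_B0 hK.1 (~~ b); have := no w (join_BX hK.1 wA).
by rewrite adj_sym (join_adjB hK.1 (join_BX hK.1 h) wA) h.
Qed.

Let collapse_onto c (P : {set block J i}) : P \subset sX K c ->
  inr mk_c \notin P -> (exists h, h \in P) -> exists x, collapse i x \in P.
Proof.
move=> _ mP [[u|k] hP]; first by exists (val u); rewrite collapse_inl.
case: (mkP k) => ek; subst k; last 2 first.
- by rewrite hP in mP.
- by have [y yB] := join_B0 aJ (~~ i); exists y; rewrite collapse_B.
by have [y yA] := join_A0 aJ (~~ i); exists y; rewrite collapse_A.
Qed.

Let mid_free' c : (inr mk_c \notin sA K c) && (inr mk_c \notin sB K c).
Proof.
case: (eqVneq c b) => [->|cb]; first exact: mid_free.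
have -> : c = ~~ b by case: c b cb => [] [].
by rewrite -negb_or; apply/negP=> /orP[/(join_AX hK.1)|/(join_BX hK.1)]; rewrite mNb.
Qed.

Let lift_adj x y : x \in sX lift_split true -> y \in sX lift_split false ->
  adj x y = adj (collapse i x) (collapse i y).
Proof.
move=> xZ yZ; case: (boolP (x \in sX J i)) => xX; first exact: collapse_adj.
have yX : y \in sX J i.
  case eb : b sub_side inl_side; last first.
    move=> /subsetP/(_ x); rewrite (join_XN aJ) => /(_ xX).
    by move: xZ; rewrite !inE (join_XN hK.1 true) => ->.
  by move=> _; apply.
by rewrite adj_sym (collapse_adj _ yX) adj_sym.
Qed.

Let lift_almost : almost_2join lift_split.
Proof.
have [cov _ sub _ c3] := hK.1; split.
- apply/setP=> x; rewrite !inE; move/setP/(_ (collapse i x)): cov; by rewrite !inE.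
- by apply/pred0P=> x /=; rewrite !inE (join_XN hK.1 true) andbN.
- move=> c; have [sA' sB' dis _ _] := sub c; have /andP[mA mB] := mid_free' c; split.
  + exact: preimsetS.
  + exact: preimsetS.
  + by apply/pred0P=> x /=; rewrite !inE; apply/negP=> /andP[xA]; rewrite (disjointFr dis xA).
  + apply/set0Pn; have [|x xA] := collapse_onto sA' mA; first exact: join_A0 hK.1 c.
    by exists x; rewrite inE.
  + apply/set0Pn; have [|x xA] := collapse_onto sB' mB; first exact: join_B0 hK.1 c.
    by exists x; rewrite inE.
- move=> x y xZ yZ; rewrite lift_adj //; move: xZ yZ; rewrite !inE => xZ yZ.
  by have [_ _ _ -> // _] := hK.1.
- move=> c; case: (eqVneq c b) => [->|cb].
    by apply: leq_trans (subset_leq_card sub_side); have [_ _ _ _] := aJ; apply.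
  have -> : c = ~~ b by case: c b cb => [] [].
  have [_ _ _ _ /(_ (~~ b)) h] := hK.1; apply: leq_trans h _.
  apply: leq_trans (leq_imset_card (collapse i) _); apply/subset_leq_card/subsetP.
  move=> [u|k]; last by rewrite mNb.
  by move=> uK; apply/imsetP; exists (val u); rewrite ?inE collapse_inl.
Qed.

(** Every vertex of the contracted side may stand for every marker, because that side is
    connected. *)
Let repr (x : G) (h : block J i) :=
  match h with inl u => x == val u | inr _ => x \in sX J (~~ i) end.

Let repr_collapse x : repr x (collapse i x).
Proof. by case: collapseP => //= u ->. Qed.

Let repr_in x h c : repr x h -> h \in sX K c -> x \in sX lift_split c.
Proof.
case: h => [u /eqP-> |k /= xX]; first by rewrite inE collapse_inl.
move=> kc; have -> : c = b; last exact: (subsetP sub_side).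
apply/eqP; apply: contraTT kc => cb.
have -> : c = ~~ b by case: c b cb => [] [].
by rewrite mNb.
Qed.

(** A walk in the block is lifted edge by edge, its stretches along markers becoming walks inside
    the contracted side. *)
Let lift_connect c h h' x x' : connect (induced (sX K c)) h h' -> h \in sX K c ->
  repr x h -> repr x' h' -> connect (induced (sX lift_split c)) x x'.
Proof.
move=> hh' hc rx; move: x'.
have inner k y y' : (inr k : block J i) \in sX K c -> y \in sX J (~~ i) -> y' \in sX J (~~ i) ->
    connect (induced (sX lift_split c)) y y'.
  move=> kc yX y'X; apply: (@connect_induced_sub _ (sX J (~~ i))).
    by apply/subsetP=> z zX; apply: (repr_in (h := inr k)).
  exact: consistent_conn.
apply: (connect_ind_r (P := fun h' => forall x', repr x' h' ->
  connect (induced (sX lift_split c)) x x')) hh'.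
  case: h hc rx => [u|k] hc /= rx x' rx'; last exact: inner hc rx rx'.
  by move: rx rx' => /eqP-> /eqP->.
have touch (u : {x : G | x \in sX J i}) (k : 'I_3) : adj (inl u : block J i) (inr k) ->
    exists2 y, y \in sX J (~~ i) & adj (val u) y.
  rewrite /= => /orP[]/andP[_ uA].
    have [y yA] := join_A0 aJ (~~ i); exists y; first exact: (join_AX aJ).
    by rewrite (join_adjA aJ (valP u) yA).
  have [y yA] := join_B0 aJ (~~ i); exists y; first exact: (join_BX aJ).
  by rewrite (join_adjB aJ (valP u) yA).
move=> [u|k] [v|l] IH /and3P[uc vc uv] x' rx'.
- move: rx' => /eqP->; apply: connect_trans (IH (val u) (eqxx _)) (@connect_adj _ _ (val u) (val v) _ _ uv).
    exact: (repr_in (h := inl u) (eqxx _) uc).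
  exact: (repr_in (h := inl v) (eqxx _) vc).
- have [y yX uy] := touch u l uv.
  apply: connect_trans (IH (val u) (eqxx _)) _.
  apply: connect_trans (inner l y x' vc yX rx'); apply: connect_adj uy.
    exact: (repr_in (h := inl u) (eqxx _) uc).
  exact: (repr_in (h := inr l)).
- rewrite adj_sym in uv; have [y yX uy] := touch v k uv; rewrite adj_sym in uy.
  move: rx' => /eqP->; apply: connect_trans (IH y yX) (connect_adj _ _ uy).
    exact: (repr_in (h := inr k)).
  exact: (repr_in (h := inl v) (eqxx _) vc).
- exact: IH.
Qed.

Let lift_chordless_in : chordless_path (sX lift_split (~~ b)) -> chordless_path (sX K (~~ b)).
Proof.
move=> [x [p [Up Xp Hp]]].
have inj : {in x :: p &, injective (collapse i)}.
  move=> y z; rewrite !Xp => /inl_side yX /inl_side zX.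
  by rewrite /collapse !insubT => -[].
exists (collapse i x), [seq collapse i z | z <- p]; rewrite -map_cons; split.
- by rewrite map_inj_in_uniq.
- move=> h; apply/mapP/idP => [[y]|].
    by rewrite Xp inE => yK ->.
  case: h => [u|k]; last by rewrite mNb.
  by move=> uK; exists (val u); rewrite ?Xp ?inE collapse_inl.
- move=> k l; rewrite size_map => hk hl; rewrite !(nth_map x) // -Hp //.
  apply/esym/collapse_adj/inl_side; by rewrite -Xp mem_nth.
Qed.

(** The delicate point is that the lifted side b, which contains the contracted side, is not a
    chordless path with single ends. If it were, the contracted side would be a chordless path whose
    sets A and B are single too, contrary to J being a 2-join. *)
Lemma lift_two_join : two_join lift_split.
Proof.
split=> [|c]; first exact: lift_almost.
have [hp hn] := hK.2 c; split.
  have [_ _ /(_ c)[sA' _ _ _ _] _ _] := hK.1.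
  have [_ _ /(_ c)[sA'' _ _ _ _] _ _] := lift_almost.
  have [h [h' [hA hB hh']]] := (path_in_connect (sB K c) sA').1 hp.
  apply/(path_in_connect _ sA'').
  (* the endpoints of the path are not the middle of the marker path *)
  have onto h0 : h0 \in sA K c :|: sB K c -> exists2 x, repr x h0 & collapse i x = h0.
    move=> h0AB; have /andP[mA mB] := mid_free' c.
    have [|||x /set1P xh] := @collapse_onto c [set h0].
    - rewrite sub1set; move: h0AB; rewrite inE => /orP[].
        exact: join_AX hK.1 _ _.
      exact: join_BX hK.1 _ _.
    - by apply/negP=> /set1P e; move: h0AB; rewrite -e inE (negPf mA) (negPf mB).
    - by exists h0; rewrite inE.
    - by exists x => //; rewrite -xh; apply: repr_collapse.
  have [|x rx ex] := onto h; first by rewrite inE hA.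
  have [|y ry ey] := onto h'; first by rewrite inE hB orbT.
  exists x, y; rewrite !inE ex ey hA hB; split=> //.
  exact: lift_connect hh' (join_AX hK.1 hA) rx ry.
have card1 (P : {set block J i}) : P \subset sX K (~~ b) -> (exists h, h \in P) ->
    #|collapse i @^-1: P| = 1 -> #|P| = 1.
  move=> /subsetP PX [h hP] c1; apply/eqP; rewrite eqn_leq; apply/andP; split; last first.
    by rewrite card_gt0; apply/set0Pn; exists h.
  rewrite -[X in _ <= X]c1; apply: leq_trans (leq_imset_card (collapse i) _).
  apply/subset_leq_card/subsetP=> -[u|k] hu; last by have := PX _ hu; rewrite mNb.
  by apply/imsetP; exists (val u); rewrite ?inE collapse_inl.
case: (eqVneq c b) => [ec|cb]; last first.
  have ec : c = ~~ b by case: c b cb {hp hn} => [] [].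
  subst c => A1 B1 /lift_chordless_in; have [_ _ /(_ (~~ b))[sA' sB' _ _ _] _ _] := hK.1.
  apply: hn; apply: card1 => //; [exact: join_A0 hK.1 _ | exact: join_B0 hK.1 _].
subst c => A1 B1 cZ; have /pathbP/and3P[/connP cnZ /forall_inP d2 /exists_inP[z zZ dz]] := cZ.
(* A connected subset of a chordless path is a chordless path. *)
have pX : chordless_path (sX J (~~ i)).
  apply/pathbP/and3P; split.
  - exact/connP/consistent_conn.
  - apply/forall_inP=> x xX; apply: leq_trans (deg_sub _ sub_side) _.
    exact/d2/(subsetP sub_side).
  - apply/exists_inP; case: (boolP (sX lift_split b \subset sX J (~~ i))).
      move/subsetP=> ZX; exists z; first exact: ZX.
      exact: leq_trans (deg_sub _ sub_side) dz.
    case/subsetPn=> v vZ vX; have [a aA] := join_A0 aJ (~~ i); have aX := join_AX aJ aA.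
    have [u [w [uX wX /and3P[uZ wZ uw]]]] := connect_exit (cnZ a v (subsetP sub_side _ aX) vZ) aX vX.
    exists u => //; rewrite -ltnS; apply: leq_trans (d2 u uZ).
    apply/proper_card/properP; split.
      by apply/subsetP=> t; rewrite !inE => /andP[/(subsetP sub_side)]; rewrite inE => -> ->.
    by exists w; rewrite !inE ?uw ?(negPf wX) // andbT; rewrite inE in wZ.
(* Suppose that [Ao] has two vertices; both are adjacent to a. If a is on the path, this contradicts
   [chordless_gap]. Otherwise the edge from marker k to a crosses K, so the lifted A or B contains
   all of [Ao] and is not single. *)
have small (k : 'I_3) (Ai Ao : {set G}) : (exists a, a \in Ai) -> Ai \subset sX J i ->
    Ao \subset sX J (~~ i) -> (forall x, x \in Ao -> collapse i x = inr k) ->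
    {in Ai & Ao, forall u v, adj u v} -> #|Ao| <= 1.
  move=> [a aA] /subsetP AiX /subsetP AoX Ak cc; rewrite leqNgt; apply/negP=> h.
  have [s [t [sA tA st]]] : exists s t, [/\ s \in Ao, t \in Ao & s != t].
    have /card_gt0P[s sA] : 0 < #|Ao| by apply: ltnW.
    have : 0 < #|Ao :\ s| by rewrite (cardsD1 s) sA in h.
    by case/card_gt0P=> t; rewrite !inE => /andP[ts tA]; exists s, t; rewrite eq_sym.
  have aX := AiX a aA.
  case: (boolP (a \in sX lift_split b)) => aZ.
    have nX : a \notin sX J (~~ i) by rewrite (join_XN aJ) aX.
    have := chordless_gap cZ sub_side (consistent_conn (i := ~~ i)) aZ nX (AoX _ sA) (AoX _ tA) st.
    by rewrite !cc // => /(_ isT).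
  have ca : collapse i a \in sX K (~~ b).
    by rewrite (join_XN hK.1); rewrite inE in aZ.
  have ka : adj (inr k : block J i) (collapse i a).
    by rewrite adj_sym -(Ak s sA) -collapse_adj // cc.
  move: ka; rewrite (join_adj hK.1 (markers k) ca) => /orP[]/andP[kA _].
    by have := A1; apply/eqP; rewrite neq_ltn (leq_trans h) ?orbT //;
      apply/subset_leq_card/subsetP=> x xA; rewrite inE Ak.
  by have := B1; apply/eqP; rewrite neq_ltn (leq_trans h) ?orbT //;
      apply/subset_leq_card/subsetP=> x xA; rewrite inE Ak.
have subA c : sA J c \subset sX J c by apply/subsetP=> x; apply: join_AX aJ _ _.
have subB c : sB J c \subset sX J c by apply/subsetP=> x; apply: join_BX aJ _ _.
have [_ hn'] := hJ.2 (~~ i); apply: hn' => //.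
  apply/eqP; rewrite eqn_leq; apply/andP; split; last first.
    by rewrite card_gt0; apply/set0Pn; apply: join_A0.
  apply: (small mk_a (sA J i)) => //; first exact: join_A0.
    exact: collapse_A.
  by move=> u v uA vA; rewrite (join_adjA aJ (join_AX aJ uA)).
apply/eqP; rewrite eqn_leq; apply/andP; split; last first.
  by rewrite card_gt0; apply/set0Pn; apply: join_B0.
apply: (small mk_b (sB J i)) => //; first exact: join_B0.
  exact: collapse_B.
by move=> u v uA vA; rewrite (join_adjB aJ (join_BX aJ uA)).
Qed.

Lemma lift_separates x y : separates lift_split x y = separates K (collapse i x) (collapse i y).
Proof. by rewrite /separates !inE. Qed.
End Lift.
End Consistent.

(** * Edges and labels that detect the 2-joins *)

Section Edges.
Variable G : sgraph.

(** Ordered pairs are counted, so each edge counts twice when M is symmetric and irreflexive. *)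
Definition nrel (M : rel G) := #|[set e : G * G | M e.1 e.2]|.

Lemma listing_edges (es : seq (G * G)) : uniq es -> {in es, forall e, adj e.1 e.2} ->
  (forall u v, adj u v = ((u, v) \in es) (+) ((v, u) \in es)) -> size es = #|edges G|.
Proof.
move=> Ues esA H; have -> : edges G = [set [set e.1; e.2] | e in es].
  apply/setP=> E; apply/imsetP/imsetP => [[[u v] uv ->]|[e ees ->]].
    rewrite inE /= H in uv; move: uv.
    case: (boolP ((u, v) \in es)) => [ees _|_ /= ees]; first by exists (u, v).
    by exists (v, u) => //=; rewrite setUC.
  by exists e => //; rewrite inE esA.
rewrite card_in_imset ?(card_uniqP Ues) // => -[u v] [u' v'] /= ees ees'.
move=> /setP E; have := esA _ ees; rewrite H /= ees => /negPf nvu.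
have := E u'; rewrite !inE eqxx /= => /orP[]/eqP eu'; have := E v'; rewrite !inE eqxx orbT.
  move=> /orP[]/eqP ev'; subst; last by [].
  by have := esA _ ees'; rewrite /= adj_irr.
move=> /orP[]/eqP ev'; subst; first by rewrite ees' in nvu.
by have := esA _ ees'; rewrite /= adj_irr.
Qed.

Lemma card_arcs : nrel (@adj G) = 2 * #|edges G|.
Proof.
pose lt (e : G * G) := enum_rank e.1 < enum_rank e.2.
pose es := [seq e <- enum {: G * G} | adj e.1 e.2 && lt e].
have inP u v : ((u, v) \in es) = adj u v && (enum_rank u < enum_rank v).
  by rewrite mem_filter mem_enum inE andbT.
have Ues : uniq es by rewrite filter_uniq ?enum_uniq.
rewrite -(listing_edges Ues) => [|[u v]|u v].
- rewrite mul2n -addnn -[X in _ = _ + X](size_map (fun e => (e.2, e.1))) -size_cat.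
  have U : uniq (es ++ [seq (e.2, e.1) | e <- es]).
    rewrite cat_uniq Ues /= map_inj_uniq => [|[x y] [x' y'] [-> ->] //]; rewrite Ues andbT.
    apply/hasPn=> -[u v] /mapP[[x y]]; rewrite inP => /andP[_ xy] [-> ->].
    by rewrite inP negb_and orbC -leqNgt ltnW.
  rewrite -(card_uniqP U); apply: eq_card => -[u v]; rewrite mem_cat !inE /= inP.
    have -> : ((u, v) \in [seq (e.2, e.1) | e <- es]) = ((v, u) \in es).
      apply/mapP/idP => [[[x y] xy [-> ->]] //|vu]; by exists (v, u).
    rewrite inP [adj v u]adj_sym; case uv: (adj u v) => //=.
    case: (ltngtP (enum_rank u) (enum_rank v)) => // /val_inj/enum_rank_inj e.
    by rewrite e adj_irr in uv.
- by rewrite inP => /andP[].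
rewrite !inP [adj v u]adj_sym; case uv: (adj u v) => //=.
case: (ltngtP (enum_rank u) (enum_rank v)) => // /val_inj/enum_rank_inj e.
by rewrite e adj_irr in uv.
Qed.

Definition nlab (lab : G -> nat) := size (undup [seq lab x | x <- enum G]).

Lemma nlab_le lab : nlab lab <= #|G|.
Proof. by rewrite cardE -(size_map lab); apply: size_undup. Qed.

Lemma nlab_merge (lab : G -> nat) u v : lab u != lab v ->
  nlab (fun x => if lab x == lab v then lab u else lab x) < nlab lab.
Proof.
move=> uv; set lab' := fun x => _.
have sub : {subset undup [seq lab' x | x <- enum G] <=
    rem (lab v) (undup [seq lab x | x <- enum G])}.
  move=> c; rewrite mem_undup => /mapP[x _ ->]; rewrite mem_rem_uniq ?undup_uniq //.
  rewrite inE /lab' mem_undup; case: ifP => [_|/negbT ->].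
    by rewrite /= uv map_f ?mem_enum.
  by rewrite /= map_f ?mem_enum.
have := uniq_leq_size (undup_uniq _) sub; rewrite size_rem; last first.
  by rewrite mem_undup map_f ?mem_enum.
move/leq_ltn_trans; apply; rewrite ltn_predL.
have : lab v \in undup [seq lab x | x <- enum G] by rewrite mem_undup map_f ?mem_enum.
by case: (undup _).
Qed.

(* The invariant of a node of the decomposition: M is a set of edges, lab a     *)
(* partition of the vertices.                                                   *)
Definition hitting (M : rel G) (lab : G -> nat) := forall J, two_join J ->
  (exists u v, M u v /\ separates J u v) \/
  (forall u v, lab u = lab v -> ~~ separates J u v).

Lemma hitting_drop (M : rel G) lab a b : hitting M lab -> symmetric M ->
  (forall J, two_join J -> ~~ separates J a b) ->
  hitting (fun u v => M u v && ((u, v) != (a, b)) && ((u, v) != (b, a))) lab.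
Proof.
move=> h sM nab J hJ; case: (h J hJ) => [[u [v [Muv suv]]]|]; last by right.
left; exists u, v; split=> //; rewrite Muv /= -negb_or; apply/negP.
have := nab J hJ; rewrite /separates => nab'.
by case/orP=> /eqP[eu ev]; move: suv nab'; rewrite eu ev /separates ?(eq_sym (b \in _)) => ->.
Qed.

(** No 2-join separates a from b, so a 2-join that splits neither of their classes does not split
    the union. *)
Lemma hitting_merge (M : rel G) lab a b : hitting M lab ->
  (forall J, two_join J -> ~~ separates J a b) ->
  hitting M (fun x => if lab x == lab b then lab a else lab x).
Proof.
move=> h nab J hJ; case: (h J hJ) => [|hl]; [by left | right=> u v].
have tr x y z : ~~ separates J x y -> ~~ separates J y z -> ~~ separates J x z.
  by rewrite /separates !negbK => /eqP-> /eqP->.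
have sy x y : separates J x y = separates J y x by rewrite /separates eq_sym.
have ab := nab J hJ; case: eqP => eu; case: eqP => ev e.
- by apply: hl; rewrite eu ev.
- apply: (tr _ b); [exact: hl | apply: (tr _ a); [by rewrite sy | exact: hl]].
- apply: (tr _ a); [exact: hl | apply: (tr _ b); [by [] | by rewrite sy; apply: hl]].
- exact: hl.
Qed.

Lemma hitting_leaf (M : rel G) lab : hitting M lab -> (forall u v, ~~ M u v) ->
  (forall u v, adj u v -> lab u = lab v) -> forall J : split G, ~ two_join J.
Proof.
move=> h M0 hl J hJ; have [u [v [uv suv]]] := separates_edge hJ.
case: (h J hJ) => [[x [y [Mxy _]]]|/(_ u v (hl _ _ uv))]; last by rewrite suv.
by case/negP: (M0 x y).
Qed.

(** This property limits the growth of M in a split: a pair of M between A1 and A2 forces one of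
    these sets to be single, see [thin_cross], and likewise for B1 and B2. *)
Definition thin (M : rel G) := forall u v, M u v -> (deg setT u <= 2) || (deg setT v <= 2).
End Edges.

Section BlockCount.
Variables (G : sgraph) (J : split G) (hJ : two_join J) (cJ : consistent J).
Let aJ := hJ.1.
Implicit Types (M : rel G) (i : bool).

(** The image under [collapse] of a pair of M between the sides: its end outside block i becomes a
    marker. *)
Definition touches i M (u : G) (k : 'I_3) :=
  [&& k == 0 :> nat, u \in sA J i & [exists t in sA J (~~ i), M u t]]
  || [&& k == 2 :> nat, u \in sB J i & [exists t in sB J (~~ i), M u t]].

Definition block_marks i M : rel (block J i) := fun x y =>
  match x, y with
  | inl u, inl v => M (val u) (val v)
  | inl u, inr k => touches i M (val u) k
  | inr k, inl u => touches i M (val u) k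
  | inr k, inr l => (k.+1 == l) || (l.+1 == k)
  end.

Arguments block_marks i M : clear implicits.

Definition block_lab i (lab : G -> nat) (fresh : nat) (x : block J i) :=
  match x with
  | inl u => if [exists t, (t \notin sX J i) && (lab t == lab (val u))] then fresh
             else lab (val u)
  | inr _ => fresh
  end.

Lemma block_marks_adj i M : (forall u v, M u v -> adj u v) ->
  forall x y, block_marks i M x y -> adj x y.
Proof.
move=> MA [u|k] [v|l] //=; first exact: MA.
- by case/orP=> /and3P[-> -> _]; rewrite ?orbT.
- by case/orP=> /and3P[-> -> _]; rewrite ?orbT.
Qed.

Lemma block_marks_sym i M : symmetric M -> symmetric (block_marks i M).
Proof. by move=> sM [u|k] [v|l] //=; rewrite orbC. Qed.

(** The marker edges are marked, so it remains to treat a 2-join K with all markers on one side,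
    which lifts to G. If the lift separates a pair of M, then K separates its image, which is
    marked. Otherwise no class is split by the lift, and those classes that meet the contracted side
    lie on the side of the markers, as does the class of the fresh label. *)
Lemma block_hitting i M lab fresh : hitting M lab -> symmetric M ->
  (forall u v, M u v -> adj u v) -> (forall x, lab x < fresh) ->
  hitting (block_marks i M) (block_lab lab fresh (i := i)).
Proof.
move=> h sM MA lt_fresh K hK.
case: (boolP [exists p : 'I_3 * 'I_3, ((p.1.+1 == p.2) || (p.2.+1 == p.1 :> nat)) &&
    separates K (inr p.1) (inr p.2)]) => [/existsP[[k l] /= /andP[kl s]]|].
  by left; exists (inr k), (inr l).
move=> /existsPn nsep.
have same k l : ~~ separates K (inr k) (inr l).
  have cc k' : ~~ separates K (inr k') (inr mk_c).
    case: (mkP k') => ->; last 2 [by rewrite /separates eqxx].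
      by have := nsep (mk_a, mk_c).
    by have := nsep (mk_b, mk_c).
  by move: (cc k) (cc l); rewrite /separates !negbK => /eqP-> /eqP->.
pose b := inr mk_c \in sX K true.
have markers k : inr k \in sX K b.
  have : ~~ separates K (inr k) (inr mk_c) by [].
  rewrite /separates negbK -/b => /eqP kb; case eb : b kb => // kb.
  by rewrite (join_XN hK.1 true) kb.
have hL := lift_two_join hJ cJ hK markers.
case: (h _ hL) => [[u [v [Muv suv]]]|hl].
  left; move: suv; rewrite lift_separates.
  have mk x y (u0 : {x : G | x \in sX J i}) : M (val u0) y -> x = val u0 -> y \in sX J (~~ i) ->
      exists2 k, touches i M (val u0) k & collapse J i y = inr k.
    move=> Mxy _ yX; have := MA _ _ Mxy; rewrite (join_adj aJ (valP u0) yX).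
    case/orP=> /andP[uA yA].
      exists mk_a; last exact: collapse_A.
      by rewrite /touches uA /=; apply/orP; left; apply/exists_inP; exists y.
    exists mk_b; last exact: collapse_B.
    by rewrite /touches uA /=; apply/exists_inP; exists y.
  case: (boolP (u \in sX J i)) => uX; case: (boolP (v \in sX J i)) => vX.
  - have [u0 eu ->] := collapse_in uX; have [v0 ev ->] := collapse_in vX.
    by exists (inl u0), (inl v0); split=> //=; rewrite eu ev.
  - have [u0 eu ->] := collapse_in uX; rewrite -(join_XN aJ) in vX.
    rewrite -eu in Muv; have [k tk ->] := mk u v u0 Muv (esym eu) vX.
    by exists (inl u0), (inr k).
  - have [v0 ev ->] := collapse_in vX; rewrite -(join_XN aJ) in uX.
    rewrite -ev sM in Muv; have [k tk ->] := mk v u v0 Muv (esym ev) uX.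
    by exists (inr k), (inl v0).
  - rewrite -!(join_XN aJ) in uX vX.
    have [k ->] := collapse_out hJ uX; have [l ->] := collapse_out hJ vX.
    by rewrite (negPf (same k l)).
right=> x y.
have toc (u : {x : G | x \in sX J i}) : block_lab lab fresh (inl u) = fresh ->
    ~~ separates K (inl u) (inr mk_c).
  rewrite /=; case: ifP => [/existsP[t /andP[tX /eqP tl]] _|_ e]; last first.
    by have := lt_fresh (val u); rewrite e ltnn.
  rewrite -(join_XN aJ) in tX.
  have := hl _ _ (esym tl); rewrite lift_separates collapse_inl.
  have [k ->] := collapse_out hJ tX; have := same k mk_c.
  by rewrite /separates !negbK => /eqP-> /eqP->.
have sy s t : separates K s t = separates K t s by rewrite /separates eq_sym.
have tr s t w : ~~ separates K s w -> ~~ separates K t w -> ~~ separates K s t.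
  by rewrite /separates !negbK => /eqP-> /eqP->.
case: x y => [u|k] [v|l] e.
- case: (eqVneq (block_lab lab fresh (inl u)) fresh) => eu.
    by apply: tr (toc u eu) (toc v _); rewrite -e.
  have ev : block_lab lab fresh (inl v) != fresh by rewrite -e.
  rewrite -!(collapse_inl) -lift_separates; apply: hl.
  by move: e eu ev => /=; do 2 case: ifP; rewrite ?eqxx.
- by apply: tr (toc u e) (same l mk_c).
- by apply: tr (same k mk_c) (toc v (esym e)).
- exact: same.
Qed.

(** A label survives only in the block whose side contains all its vertices; the summand 2 stands
    for the two fresh labels. *)
Lemma nlab_block (lab : G -> nat) f f' :
  nlab (block_lab lab f (i := true)) + nlab (block_lab lab f' (i := false)) <= nlab lab + 2.
Proof.
pose inner i := undup [seq lab x | x <- enum G & (x \in sX J i) &&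
  ~~ [exists t, (t \notin sX J i) && (lab t == lab x)]].
have le i fresh : nlab (block_lab lab fresh (i := i)) <= (size (inner i)).+1.
  apply: (@uniq_leq_size _ _ (fresh :: inner i)); first exact: undup_uniq.
  move=> c; rewrite mem_undup => /mapP[[u|k] _ ->]; last by rewrite inE eqxx.
  rewrite /=; case: ifPn => cu; first by rewrite inE eqxx.
  by rewrite inE mem_undup map_f ?orbT // mem_filter (valP u) cu mem_enum.
suff : size (inner true ++ inner false) <= nlab lab.
  by rewrite size_cat; have := le true f; have := le false f'; lia.
apply: uniq_leq_size.
  rewrite cat_uniq !undup_uniq andbT /=; apply/hasPn=> c; rewrite !mem_undup => /mapP[x].
  rewrite mem_filter => /andP[/andP[xX nx] _] ->; apply/mapP=> -[y].
  rewrite mem_filter => /andP[/andP[yX _] _] e; move/existsPn: nx => /(_ y).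
  by rewrite e eqxx andbT -(join_XN aJ) /= yX.
by move=> c; rewrite mem_cat !mem_undup => /orP[]/mapP[x _ ->]; rewrite map_f ?mem_enum.
Qed.

(** Every neighbour of u in the block is the image under [collapse] of a neighbour in G. *)
Lemma deg_block i u : deg setT (inl u : block J i) <= deg setT (val u).
Proof.
apply: leq_trans (leq_imset_card (collapse J i) _); apply/subset_leq_card/subsetP=> h.
rewrite !inE /= => uh.
have [y [uy ey]] : exists y, adj (val u) y /\ collapse J i y = h.
  case: h uh => [v|k] /=; first by exists (val v); rewrite collapse_inl.
  case/orP=> /andP[/eqP k0 uA].
    have [y yA] := join_A0 aJ (~~ i); exists y; split.
      by rewrite (join_adjA aJ (valP u) yA).
    by rewrite (collapse_A hJ yA); congr inr; apply: val_inj.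
  have [y yB] := join_B0 aJ (~~ i); exists y; split.
    by rewrite (join_adjB aJ (valP u) yB).
  by rewrite (collapse_B hJ yB); congr inr; apply: val_inj.
by apply/imsetP; exists y; rewrite ?inE.
Qed.

(** One of the at most two neighbours of t is on its own side, so at most one remains across. *)
Lemma thin_cross i (A : {set G}) t : A \subset sX J i -> t \in sX J (~~ i) ->
  {in A, forall u, adj t u} -> deg setT t <= 2 -> #|A| <= 1.
Proof.
move=> /subsetP AX tX At d2; have [y yX ty] := consistent_nbr hJ cJ tX.
rewrite -ltnS -[_.+1]add1n; apply: leq_trans d2.
have -> : 1 + #|A| = #|y |: A|.
  rewrite cardsU1; congr (_ + _); apply/esym/eqP; rewrite eqb1.
  by apply/negP=> /AX; move: yX; rewrite (join_XN aJ) => /negPf->.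
apply/subset_leq_card/subsetP=> u; rewrite !inE => /orP[/eqP->//|]; exact: At.
Qed.

Lemma thin_block i M : (forall u v, M u v -> adj u v) -> symmetric M -> thin M ->
  thin (block_marks i M).
Proof.
move=> MA sM th.
have dk (k : 'I_3) (A : {set G}) : #|A| <= 1 ->
    (forall u, adj (inr k : block J i) (inl u) -> val u \in A) ->
    k != mk_c -> deg setT (inr k : block J i) <= 2.
  move=> A1 sub kc; apply: (@leq_trans (#|A| + 1)); last by rewrite addn1.
  rewrite -[X in _ + X](cards1 (inr mk_c : block J i)).
  apply: (@leq_trans #|(collapse J i @: A) :|: [set inr mk_c]|).
    apply/subset_leq_card/subsetP=> -[u|l]; rewrite !inE /= => h.
      apply/orP; left; apply/imsetP; exists (val u); rewrite ?collapse_inl //.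
      exact: sub.
    by case: (mkP k) kc h => ->; case: (mkP l) => ->; rewrite ?eqxx ?orbT.
  by apply: leq_trans (leq_card_setU _ _) _; rewrite leq_add2r leq_imset_card.
have dt (u : {x : G | x \in sX J i}) (k : 'I_3) : touches i M (val u) k ->
    (deg setT (inl u : block J i) <= 2) || (deg setT (inr k : block J i) <= 2).
  case/orP=> /and3P[/eqP k0 uA /exists_inP[t tA Mut]]; case/orP: (th _ _ Mut) => d;
    try by rewrite (leq_trans (deg_block u) d).
    apply/orP; right; apply: (dk k (sA J i)).
    - apply: (thin_cross (i := i)) (join_AX aJ tA) _ d; first by apply/subsetP=> x /(join_AX aJ).
      by move=> x xA; rewrite adj_sym (join_adjA aJ (join_AX aJ xA) tA).
    - by move=> v /=; rewrite k0 /= orbF.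
    - by rewrite -val_eqE /= k0.
  apply/orP; right; apply: (dk k (sB J i)).
  - apply: (thin_cross (i := i)) (join_BX aJ tA) _ d; first by apply/subsetP=> x /(join_BX aJ).
    by move=> x xA; rewrite adj_sym (join_adjB aJ (join_BX aJ xA) tA).
  - by move=> v /=; rewrite k0 /=.
  - by rewrite -val_eqE /= k0.
have dc : deg setT (inr mk_c : block J i) <= 2.
  apply: (@leq_trans #|[set (inr mk_a : block J i); inr mk_b]|); last first.
    by rewrite cards2; case: (_ != _).
  apply/subset_leq_card/subsetP=> -[u|l]; rewrite !inE //=.
  by case: (mkP l) => ->.
move=> [u|k] [v|l] /= h.
- by case/orP: (th _ _ h) => d; rewrite (leq_trans (deg_block _) d) ?orbT.
- exact: dt.
- by rewrite orbC; apply: dt.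
- by move: h; case: (mkP k) => ->; case: (mkP l) => -> // _; rewrite dc ?orbT.
Qed.

Let inside i M := #|[set e : G * G | [&& M e.1 e.2, e.1 \in sX J i & e.2 \in sX J i]]|.
Let across (A B : {set G}) M := #|[set e : G * G | [&& M e.1 e.2, e.1 \in A & e.2 \in B]]|.
Let fringe (A B : {set G}) M := #|[set u in A | [exists t in B, M u t]]|.

(** Each vertex of a fringe gives one marked edge to a marker; the summand 4 is the marker path,
    both directions counted. *)
Let nrel_block i M : nrel (block_marks i M) <= inside i M
  + 2 * fringe (sA J i) (sA J (~~ i)) M + 2 * fringe (sB J i) (sB J (~~ i)) M + 4.
Proof.
pose c := collapse J i.
pose PA := [set u in sA J i | [exists t in sA J (~~ i), M u t]].
pose PB := [set u in sB J i | [exists t in sB J (~~ i), M u t]].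
pose I := [set e : G * G | [&& M e.1 e.2, e.1 \in sX J i & e.2 \in sX J i]].
pose m k : block J i := inr k.
pose S1 := [set (c e.1, c e.2) | e in I].
pose S2 := [set (c u, m mk_a) | u in PA].
pose S3 := [set (m mk_a, c u) | u in PA].
pose S4 := [set (c u, m mk_b) | u in PB].
pose S5 := [set (m mk_b, c u) | u in PB].
pose S6 := [set (m mk_a, m mk_c); (m mk_c, m mk_a); (m mk_c, m mk_b); (m mk_b, m mk_c)].
apply: (@leq_trans #|S1 :|: (S2 :|: S3) :|: (S4 :|: S5) :|: S6|).
  apply/subset_leq_card/subsetP=> -[x y] h0; have {h0} : block_marks i M x y by move: h0; rewrite inE.
  rewrite !in_setU.
  case: x y => [u|k] [v|l] /= h.
  - apply/orP; left; apply/orP; left; apply/orP; left; apply/imsetP.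
    by exists (val u, val v); rewrite ?inE /= ?h ?(valP u) ?(valP v) // /c !collapse_inl.
  - case/orP: h => /and3P[/eqP l0 uA ex].
      have -> : l = mk_a by apply: val_inj.
      have : (c (val u), m mk_a) \in S2 by apply: imset_f; rewrite inE uA.
      by rewrite /c collapse_inl => ->; rewrite ?orbT.
    have -> : l = mk_b by apply: val_inj.
    have : (c (val u), m mk_b) \in S4 by apply: imset_f; rewrite inE uA.
    by rewrite /c collapse_inl => ->; rewrite ?orbT.
  - case/orP: h => /and3P[/eqP l0 uA ex].
      have -> : k = mk_a by apply: val_inj.
      have : (m mk_a, c (val v)) \in S3 by apply: imset_f; rewrite inE uA.
      by rewrite /c collapse_inl => ->; rewrite ?orbT.
    have -> : k = mk_b by apply: val_inj.
    have : (m mk_b, c (val v)) \in S5 by apply: imset_f; rewrite inE uA.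
    by rewrite /c collapse_inl => ->; rewrite ?orbT.
  - apply/orP; right; rewrite /S6 !inE; move: h.
    by case: (mkP k) => ->; case: (mkP l) => -> // _; rewrite eqxx ?orbT.
have c6 : #|S6| <= 4.
  apply: leq_trans (leq_card_setU _ _) _; rewrite cards1 (addn1 _) ltnS.
  apply: leq_trans (leq_card_setU _ _) _; rewrite cards1 (addn1 _) ltnS.
  by rewrite cards2; case: (_ != _).
apply: leq_trans (leq_card_setU _ _) _; apply: leq_add c6.
rewrite !mul2n -!addnn.
apply: leq_trans (leq_card_setU _ _) _; apply: leq_add; last first.
  by apply: leq_trans (leq_card_setU _ _) _; apply: leq_add; apply: leq_imset_card.
apply: leq_trans (leq_card_setU _ _) _; apply: leq_add; first exact: leq_imset_card.
by apply: leq_trans (leq_card_setU _ _) _; apply: leq_add; apply: leq_imset_card.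
Qed.

Let nrel_ge M : symmetric M -> inside true M + inside false M
  + 2 * across (sA J true) (sA J false) M + 2 * across (sB J true) (sB J false) M <= nrel M.
Proof.
have swI : injective (fun e : G * G => (e.2, e.1)) by move=> [? ?] [? ?] [-> ->].
move=> sM; have sw A B : across A B M = across B A M.
  rewrite /across -(card_imset _ swI).
  apply: eq_card => -[u v]; rewrite inE; apply/imsetP/idP => [[[x y]]|h].
    by rewrite inE /= sM => /and3P[Mxy xA yB] [-> ->]; apply/and3P.
  by exists (v, u) => //; rewrite inE /=; move: h; rewrite /= sM => /and3P[-> -> ->].
rewrite !mul2n -!addnn {2}(sw (sA J true)) {2}(sw (sB J true)) /inside /across /nrel.
have cE (S : {set G * G}) : #|S| = \sum_e (e \in S : nat).
  by rewrite -sum1_card big_mkcond; apply: eq_bigr => e _; case: (e \in S).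
rewrite !cE -!big_split /=; apply: leq_sum => -[u v] _.
rewrite !inE /=; case: (M u v) => //=.
rewrite !(join_XN aJ true).
have hA i x : (x \in sA J i) ==> (x \in sX J i) && (x \notin sB J i).
  by apply/implyP=> xA; rewrite (join_AX aJ) // (join_AB aJ).
have hB i x : (x \in sB J i) ==> (x \in sX J i) by apply/implyP/(join_BX aJ).
move: (hA true u) (hA true v) (hA false u) (hA false v).
move: (hB true u) (hB true v) (hB false u) (hB false v).
rewrite !(join_XN aJ true).
by case: (u \in sX J true); case: (v \in sX J true); case: (u \in sB J true);
  case: (v \in sB J true); case: (u \in sB J false); case: (v \in sB J false) => //=;
  case: (u \in sA J true); case: (v \in sA J true); case: (u \in sA J false);
  case: (v \in sA J false).
Qed.

(** If a pair of M crosses, one of its ends has degree at most 2, so the set opposite to this end is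
    single and its fringe is at most 1. *)
Let fringe_le M (A1 A2 : {set G}) : (forall u v, M u v -> adj u v) -> symmetric M -> thin M ->
  A1 \subset sX J true -> A2 \subset sX J false -> {in A1 & A2, forall u v, adj u v} ->
  fringe A1 A2 M + fringe A2 A1 M <= across A1 A2 M + 1.
Proof.
move=> MA sM th A1X A2X cc.
have le1 : fringe A1 A2 M <= across A1 A2 M.
  apply: leq_trans (leq_imset_card (fun e : G * G => e.1) _); apply/subset_leq_card/subsetP=> u.
  rewrite inE => /andP[uA /exists_inP[t tA Mut]]; apply/imsetP; exists (u, t) => //.
  by rewrite inE Mut uA.
have le2 : fringe A2 A1 M <= across A1 A2 M.
  apply: leq_trans (leq_imset_card (fun e : G * G => e.2) _); apply/subset_leq_card/subsetP=> u.
  rewrite inE => /andP[uA /exists_inP[t tA Mut]]; apply/imsetP; exists (t, u) => //.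
  by rewrite inE sM Mut uA tA.
have sub A B : fringe A B M <= #|A|.
  by apply/subset_leq_card/subsetP=> u; rewrite inE => /andP[].
case: (set_0Vmem [set e : G * G | [&& M e.1 e.2, e.1 \in A1 & e.2 \in A2]]) => [e0|[[u t]]].
  by move: le1 le2; rewrite /across e0 cards0 !leqn0 => /eqP-> /eqP->.
rewrite inE /= => /and3P[Mut uA tA]; case/orP: (th _ _ Mut) => d.
  rewrite leq_add //; apply: leq_trans (sub _ _) _.
  apply: (thin_cross (i := false) A2X (subsetP A1X _ uA)) d => v vA; exact: cc.
rewrite addnC leq_add //; apply: leq_trans (sub _ _) _.
apply: (thin_cross (i := true) A1X (subsetP A2X _ tA)) d => v vA; rewrite adj_sym; exact: cc.
Qed.

Let subA i : sA J i \subset sX J i. Proof. by apply/subsetP=> x; apply: join_AX aJ _ _. Qed.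
Let subB i : sB J i \subset sX J i. Proof. by apply/subsetP=> x; apply: join_BX aJ _ _. Qed.
Let compA : {in sA J true & sA J false, forall u v, adj u v}.
Proof. by move=> u v uA vA; rewrite (join_adjA (i := true) aJ (join_AX aJ uA)). Qed.
Let compB : {in sB J true & sB J false, forall u v, adj u v}.
Proof. by move=> u v uA vA; rewrite (join_adjB (i := true) aJ (join_BX aJ uA)). Qed.

(** The 12 is made of 4 for each of the two marker paths and of the surplus 1 of [fringe_le], at A
    and at B, in both directions. *)
Lemma nrel_blocks M : (forall u v, M u v -> adj u v) -> symmetric M -> thin M ->
  nrel (block_marks true M) + nrel (block_marks false M) <= nrel M + 12.
Proof.
move=> MA sM th; have := nrel_block true M; have := nrel_block false M.
have := nrel_ge sM; have := fringe_le MA sM th (subA true) (subA false) compA.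
have := fringe_le MA sM th (subB true) (subB false) compB.
rewrite /=; lia.
Qed.

(** The edges from the markers to A and B are outnumbered by the edges across, and the two marker
    edges by those inside the side that is removed. Therefore the number of edges of the root bounds
    all loops over edges. *)
Lemma edges_block i : #|edges (block J i)| <= #|edges G|.
Proof.
rewrite -(leq_pmul2l (m := 2)) // -!card_arcs.
have eqb : nrel (@adj (block J i)) <= nrel (block_marks i (@adj G)).
  apply/subset_leq_card/subsetP=> -[[u|k] [v|l]]; rewrite !inE //=.
    case/orP=> /andP[l0 uA]; rewrite /touches l0 uA /=; apply/orP; [left|right];
      apply/exists_inP.
      by have [t tA] := join_A0 aJ (~~ i); exists t => //; rewrite (join_adjA aJ (valP u) tA).
    by have [t tA] := join_B0 aJ (~~ i); exists t => //; rewrite (join_adjB aJ (valP u) tA).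
  case/orP=> /andP[l0 uA]; rewrite /touches l0 uA /=; apply/orP; [left|right];
    apply/exists_inP.
    by have [t tA] := join_A0 aJ (~~ i); exists t => //; rewrite (join_adjA aJ (valP v) tA).
  by have [t tA] := join_B0 aJ (~~ i); exists t => //; rewrite (join_adjB aJ (valP v) tA).
apply: leq_trans eqb _; apply: leq_trans (nrel_block i _) _.
apply: leq_trans (nrel_ge (@adj_sym G)).
(* Non-adjacent a in A and b in B, each with a neighbour on its side, give two different edges, that
   is, four ordered pairs. *)
have ge4 : 4 <= inside (~~ i) (@adj G).
  have [/(_ (~~ i))[_ hA _ _] _ _] := cJ.
  have [a aA] := join_A0 aJ (~~ i); have [b bB nab] := hA a aA.
  have aX := join_AX aJ aA; have bX := join_BX aJ bB.
  have [c cX ac] := consistent_nbr hJ cJ aX; have [d dX bd] := consistent_nbr hJ cJ bX.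
  have ab : a != b by apply: contraTneq aA => ->; apply: (join_BA aJ).
  have nac : a != c by apply: contraTneq ac => ->; rewrite adj_irr.
  have nbd : b != d by apply: contraTneq bd => ->; rewrite adj_irr.
  have ncb : c != b by apply: contraTneq ac => ->.
  have nad : a != d by apply: contraTneq bd => <-; rewrite adj_sym.
  have U : uniq [:: (a, c); (c, a); (b, d); (d, b)].
    rewrite /= !inE !xpair_eqE !negb_or !negb_and /=.
    by rewrite nac ab nad ncb nbd !orbT.
  rewrite -[4]/(size [:: (a, c); (c, a); (b, d); (d, b)]) -(card_uniqP U).
  apply/subset_leq_card/subsetP=> e; rewrite !inE => /or4P[]/eqP->;
  by rewrite /= ?aX ?bX ?cX ?dX ?andbT // adj_sym.
have le (A B : {set G}) : {in A & B, forall u v, adj u v} -> (exists t, t \in B) ->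
    fringe A B (@adj G) <= across A B (@adj G).
  move=> cc _; apply: leq_trans (leq_imset_card (fun e : G * G => e.1) _); apply/subset_leq_card/subsetP=> u.
  rewrite inE => /andP[uA /exists_inP[t tA Mut]]; apply/imsetP; exists (u, t) => //.
  by rewrite inE Mut uA.
have swI : injective (fun e : G * G => (e.2, e.1)) by move=> [? ?] [? ?] [-> ->].
have sw A B : across A B (@adj G) = across B A (@adj G).
  rewrite /across -(card_imset _ swI).
  apply: eq_card => -[u v]; rewrite inE; apply/imsetP/idP => [[[x y]]|h].
    by rewrite inE /= adj_sym => /and3P[Mxy xA yB] [-> ->]; apply/and3P.
  by exists (v, u) => //; rewrite inE /=; move: h; rewrite /= adj_sym => /and3P[-> -> ->].
have lA := le _ _ compA (join_A0 aJ _); have lB := le _ _ compB (join_B0 aJ _).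
have lA' : fringe (sA J false) (sA J true) (@adj G) <= across (sA J false) (sA J true) (@adj G).
  by apply: le (join_A0 aJ _) => u v uA vA; rewrite adj_sym compA.
have lB' : fringe (sB J false) (sB J true) (@adj G) <= across (sB J false) (sB J true) (@adj G).
  by apply: le (join_B0 aJ _) => u v uA vA; rewrite adj_sym compB.
move: ge4 lA lB lA' lB'; rewrite (sw (sA J false)) (sw (sB J false)).
by case: i => /=; lia.
Qed.

Lemma card_block i : #|block J i| = #|sX J i| + 3.
Proof. by rewrite card_sum card_sig card_ord; congr (_ + _). Qed.

Lemma card_sides : #|sX J true| + #|sX J false| = #|G|.
Proof. by rewrite (join_XC aJ true) cardsC. Qed.
End BlockCount.

(** The sizes minus 6 of the two blocks add up to that of G and are at least 1, so this quantity
    bounds the number of leaves unless the root is itself a leaf. *)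
Lemma dtree_nodes_le (G : sgraph) (T : dtree G) : (dtree_nodes T).+1 <= 2 * maxn 1 (#|G| - 6).
Proof.
elim: T => {G} [G _|G _|G J hJ cJ ch IH] /=; try by lia.
have := IH true; have := IH false; rewrite !card_block.
have := consistent_card hJ cJ true; have := consistent_card hJ cJ false.
rewrite -(card_sides hJ); lia.
Qed.

(** * Programs with bounded loops *)

Inductive ex :=
| Cst of nat
| Var of nat
| Hget of ex
| Aget of nat & ex
| Plus of ex & ex
| Minus of ex & ex
| Times of ex & ex
| Equ of ex & ex
| Less of ex & ex.

(* Loop bounds: a constant, register 1, its successor, or register 2.           *)
Inductive bd := BC of nat | BN | BN1 | BM.

Inductive pg :=
| PSkip
| PSet of nat & ex
| PHeap of ex & ex
| PArr of nat & ex & ex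
| PSeq of pg & pg
| PIf of ex & pg & pg
| PFor of nat & bd & pg.

(* The memory is split at the address in register 3 into a flat heap and a      *)
(* constant number of unbounded arrays.                                         *)
Record mstate := MState {
  rg : nat -> nat;
  hp : nat -> nat;
  ar : nat -> nat -> nat }.

Definition setr s x v := MState (upd (rg s) x v) (hp s) (ar s).
Definition seth s a v := MState (rg s) (upd (hp s) a v) (ar s).
Definition seta s a i v :=
  MState (rg s) (hp s) (fun b => if b == a then upd (ar s a) i v else ar s b).

(** A read beyond the end of the heap, which is register 3, yields word 0; in [den] a write there
    has no effect. Thus heap accesses never reach the arrays. *)
Fixpoint ev (s : mstate) (e : ex) : nat :=
  match e with
  | Cst c => c
  | Var x => rg s x
  | Hget e => hp s (if ev s e < rg s 3 then ev s e else 0)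
  | Aget a e => ar s a (ev s e)
  | Plus e1 e2 => ev s e1 + ev s e2
  | Minus e1 e2 => ev s e1 - ev s e2
  | Times e1 e2 => ev s e1 * ev s e2
  | Equ e1 e2 => ev s e1 == ev s e2
  | Less e1 e2 => ev s e1 < ev s e2
  end.

Definition bval (n m : nat) (b : bd) : nat :=
  match b with BC c => c | BN => n | BN1 => n.+1 | BM => m end.

Fixpoint den (p : pg) (s : mstate) : mstate :=
  match p with
  | PSkip => s
  | PSet x e => setr s x (ev s e)
  | PHeap a e => if ev s a < rg s 3 then seth s (ev s a) (ev s e) else s
  | PArr a i e => seta s a (ev s i) (ev s e)
  | PSeq p1 p2 => den p2 (den p1 s)
  | PIf e p1 p2 => if ev s e != 0 then den p1 s else den p2 s
  | PFor x b p => let k := bval (rg s 1) (rg s 2) b in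
      setr (iteri k (fun i s => den p (setr s x i)) s) x k
  end.

Fixpoint wr (p : pg) : seq nat :=
  match p with
  | PSkip | PHeap _ _ | PArr _ _ _ => [::]
  | PSet x _ => [:: x]
  | PSeq p1 p2 | PIf _ p1 p2 => wr p1 ++ wr p2
  | PFor x _ p => x :: wr p
  end.

Fixpoint wa (p : pg) : seq nat :=
  match p with
  | PSkip | PHeap _ _ | PSet _ _ => [::]
  | PArr a _ _ => [:: a]
  | PSeq p1 p2 | PIf _ p1 p2 => wa p1 ++ wa p2
  | PFor _ _ p => wa p
  end.

Fixpoint wh (p : pg) : bool :=
  match p with
  | PSkip | PSet _ _ | PArr _ _ _ => false
  | PHeap _ _ => true
  | PSeq p1 p2 | PIf _ p1 p2 => wh p1 || wh p2
  | PFor _ _ p => wh p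
  end.

Fixpoint rr (e : ex) : seq nat :=
  match e with
  | Cst _ => [::]
  | Var x => [:: x]
  | Hget e => 3 :: rr e
  | Aget _ e => rr e
  | Plus e1 e2 | Minus e1 e2 | Times e1 e2 | Equ e1 e2 | Less e1 e2 => rr e1 ++ rr e2
  end.

Fixpoint ra (e : ex) : seq nat :=
  match e with
  | Cst _ | Var _ => [::]
  | Hget e => ra e
  | Aget a e => a :: ra e
  | Plus e1 e2 | Minus e1 e2 | Times e1 e2 | Equ e1 e2 | Less e1 e2 => ra e1 ++ ra e2
  end.

Fixpoint rh (e : ex) : bool :=
  match e with
  | Cst _ | Var _ => false
  | Hget e => true
  | Aget _ e => rh e
  | Plus e1 e2 | Minus e1 e2 | Times e1 e2 | Equ e1 e2 | Less e1 e2 => rh e1 || rh e2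
  end.

Lemma ev_ext s s' e :
  {in rr e, rg s =1 rg s'} -> {in ra e, forall a, ar s a =1 ar s' a} ->
  (rh e -> hp s =1 hp s') -> ev s e = ev s' e.
Proof.
have sub (T : eqType) (l1 l2 : seq T) (P : T -> Prop) : {in l1 ++ l2, forall x, P x} ->
    {in l1, forall x, P x} /\ {in l2, forall x, P x}.
  by move=> h; split=> x xl; apply: h; rewrite mem_cat xl ?orbT.
have orsub b1 b2 : (b1 || b2 -> hp s =1 hp s') -> (b1 -> hp s =1 hp s') /\ (b2 -> hp s =1 hp s').
  by move=> h; split=> hb; apply: h; rewrite hb ?orbT.
elim: e => //= [x|e IH|a e IH|||||];
  try by move=> e1 IH1 e2 IH2 /sub[r1 r2] /sub[a1 a2] /orsub[h1 h2]; rewrite IH1 ?IH2.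
- by move=> h _ _; apply: h; rewrite inE.
- move=> h1 h2 h3; have -> : ev s e = ev s' e.
    by apply: IH => // [x xr|_]; [apply: h1; rewrite inE xr orbT | apply: h3].
  by rewrite h3 // h1 // inE.
- move=> h1 h2 h3; rewrite IH // => [|b br]; last by apply: h2; rewrite inE br orbT.
  by apply: h2; rewrite inE eqxx.
Qed.

Lemma den_rg p s x : x \notin wr p -> rg (den p s) x = rg s x.
Proof.
elim: p s => //= [y e|a e|p1 IH1 p2 IH2|e p1 IH1 p2 IH2|y b p IH] s.
- by rewrite inE /upd => /negPf->.
- by case: ifP.
- by rewrite mem_cat negb_or => /andP[h1 h2]; rewrite IH2 // IH1.
- by rewrite mem_cat negb_or => /andP[h1 h2]; case: ifP; rewrite ?IH2 ?IH1.
- rewrite inE negb_or => /andP[/negPf xy xp]; rewrite /upd xy.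
  by elim: (bval _ _ _) => //= k IHk; rewrite IH //= /upd xy.
Qed.

Lemma den_ar p s a : a \notin wa p -> ar (den p s) a = ar s a.
Proof.
elim: p s => //= [a' e|a' i e|p1 IH1 p2 IH2|e p1 IH1 p2 IH2|y b p IH] s.
- by case: ifP.
- by rewrite inE => /negPf->.
- by rewrite mem_cat negb_or => /andP[h1 h2]; rewrite IH2 // IH1.
- by rewrite mem_cat negb_or => /andP[h1 h2]; case: ifP; rewrite ?IH2 ?IH1.
- by move=> xp; elim: (bval _ _ _) => //= k IHk; rewrite IH.
Qed.

Lemma den_hp p s : ~~ wh p -> hp (den p s) = hp s.
Proof.
elim: p s => //= [p1 IH1 p2 IH2|e p1 IH1 p2 IH2|y b p IH] s.
- by rewrite negb_or => /andP[h1 h2]; rewrite IH2 // IH1.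
- by rewrite negb_or => /andP[h1 h2]; case: ifP; rewrite ?IH2 ?IH1.
- by move=> xp; elim: (bval _ _ _) => //= k IHk; rewrite IH.
Qed.

Definition same_off (wrs was : seq nat) (h : bool) (s s' : mstate) :=
  [/\ forall x, x \notin wrs -> rg s' x = rg s x,
      forall a, a \notin was -> ar s' a = ar s a & ~~ h -> hp s' = hp s].

Lemma den_same p s : same_off (wr p) (wa p) (wh p) s (den p s).
Proof. by split=> *; [apply: den_rg | apply: den_ar | apply: den_hp]. Qed.

(** The rule for loops: besides the invariant, everything that the body does not write may be
    assumed unchanged since the entry of the loop. *)
Lemma den_for (P : nat -> mstate -> Prop) x b p s k :
  k = bval (rg s 1) (rg s 2) b -> P 0 s ->
  (forall i s', i < k -> same_off (x :: wr p) (wa p) (wh p) s s' -> P i s' ->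
     P i.+1 (den p (setr s' x i))) ->
  exists2 s', P k s' /\ same_off (x :: wr p) (wa p) (wh p) s s' &
    den (PFor x b p) s = setr s' x k.
Proof.
move=> ek P0 Pi; rewrite /= -ek.
suff H i : i <= k -> P i (iteri i (fun i s => den p (setr s x i)) s) /\
    same_off (x :: wr p) (wa p) (wh p) s (iteri i (fun i s => den p (setr s x i)) s).
  by have [h1 h2] := H k (leqnn k); exists (iteri k (fun i s => den p (setr s x i)) s).
elim: i => [|i IH] /= ik; first by split.
have [h1 h2] := IH (ltnW ik); split; first exact: Pi.
case: h2 => f1 f2 f3; have [g1 g2 g3] := den_same p (setr (iteri i (fun i s => den p (setr s x i)) s) x i).
split.
- move=> y; rewrite inE negb_or => /andP[/negPf yx yp].
  by rewrite g1 //= /upd yx f1 // inE yx.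
- by move=> a ap; rewrite g2 //= f2.
- by move=> h; rewrite g3 //= f3.
Qed.

(** * Compilation, and the cost and word size of compiled programs *)

Section Comp.
Variable NA : nat.

(** The arrays are interleaved above the heap: entry i of array a is at address i * NA + a beyond
    register 3. A heap address is multiplied by the truth value of its bounds test. *)
Fixpoint ce (e : ex) : expr :=
  match e with
  | Cst c => Lit c
  | Var x => Reg x
  | Hget e => Fetch (Mul (ce e) (Lt (ce e) (Reg 3)))
  | Aget a e => Fetch (Add (Reg 3) (Add (Mul (ce e) (Lit NA)) (Lit a)))
  | Plus e1 e2 => Add (ce e1) (ce e2)
  | Minus e1 e2 => Sub (ce e1) (ce e2)
  | Times e1 e2 => Mul (ce e1) (ce e2)
  | Equ e1 e2 => Eq (ce e1) (ce e2)
  | Less e1 e2 => Lt (ce e1) (ce e2)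
  end.

Definition cb (b : bd) : expr :=
  match b with
  | BC c => Lit c | BN => Reg 1 | BN1 => Add (Reg 1) (Lit 1) | BM => Reg 2
  end.

Fixpoint comp (p : pg) : cmd :=
  match p with
  | PSkip => Skip
  | PSet x e => Assign x (ce e)
  | PHeap a e => If (Lt (ce a) (Reg 3)) (Store (ce a) (ce e)) Skip
  | PArr a i e => Store (Add (Reg 3) (Add (Mul (ce i) (Lit NA)) (Lit a))) (ce e)
  | PSeq p1 p2 => Seq (comp p1) (comp p2)
  | PIf e p1 p2 => If (ce e) (comp p1) (comp p2)
  | PFor x b p => Seq (Assign x (Lit 0)) (While (Lt (Reg x) (cb b))
      (Seq (comp p) (Assign x (Add (Reg x) (Lit 1)))))
  end.

Fixpoint wfe (e : ex) : bool :=
  match e with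
  | Cst _ | Var _ => true
  | Hget e => wfe e
  | Aget a e => (a < NA) && wfe e
  | Plus e1 e2 | Minus e1 e2 | Times e1 e2 | Equ e1 e2 | Less e1 e2 => wfe e1 && wfe e2
  end.

(* The values of constant expressions depend only on registers 1, 2 and 3. The  *)
(* value of a slow expression exceeds those in the state by a constant only.    *)
Fixpoint const (e : ex) : bool :=
  match e with
  | Cst _ => true
  | Var x => x \in [:: 1; 2; 3]
  | Plus e1 e2 | Times e1 e2 => const e1 && const e2
  | _ => false
  end.

Fixpoint slow (e : ex) : bool :=
  match e with
  | Plus e1 e2 => slow e1 && const e2
  | Minus e1 _ => slow e1
  | Times _ _ => false
  | _ => true
  end.

Fixpoint wf (p : pg) : bool :=
  match p with
  | PSkip => true
  | PSet x e => [&& x \notin [:: 1; 2; 3], wfe e & slow e]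
  | PHeap a e => [&& wfe a, wfe e & slow e]
  | PArr a i e => [&& a < NA, wfe i, wfe e & slow e]
  | PSeq p1 p2 => wf p1 && wf p2
  | PIf e p1 p2 => [&& wfe e, wf p1 & wf p2]
  | PFor x _ p => [&& x \notin [:: 1; 2; 3], x \notin wr p & wf p]
  end.

Fixpoint cval (n m h : nat) (e : ex) : nat :=
  match e with
  | Cst c => c
  | Var x => if x == 1 then n else if x == 2 then m else h
  | Plus e1 e2 => cval n m h e1 + cval n m h e2
  | Times e1 e2 => cval n m h e1 * cval n m h e2
  | _ => 0
  end.

Fixpoint gx (n m h : nat) (e : ex) : nat :=
  match e with
  | Cst c => c
  | Plus e1 e2 => gx n m h e1 + cval n m h e2
  | Minus e1 _ => gx n m h e1
  | Equ _ _ | Less _ _ => 1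
  | _ => 0
  end.

(** How much the largest stored value can grow. As slow expressions only add constants, a loop
    multiplies the growth of its body by its bound; the last summand accounts for the loop
    register. *)
Fixpoint gr (n m h : nat) (p : pg) : nat :=
  match p with
  | PSkip => 0
  | PSet _ e | PHeap _ e | PArr _ _ e => gx n m h e
  | PSeq p1 p2 | PIf _ p1 p2 => gr n m h p1 + gr n m h p2
  | PFor _ b p => bval n m b * gr n m h p + bval n m b
  end.

(** Indices of arrays may contain products of stored values, hence an exponent: see [esz_ev]. *)
Fixpoint esz (e : ex) : nat :=
  match e with
  | Cst c => c.+1
  | Var _ | Hget _ | Aget _ _ | Equ _ _ | Less _ _ => 1
  | Minus e1 _ => esz e1
  | Plus e1 e2 | Times e1 e2 => esz e1 + esz e2
  end.

Fixpoint asz (p : pg) : nat :=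
  match p with
  | PSkip | PSet _ _ | PHeap _ _ => 0
  | PArr _ i _ => esz i
  | PSeq p1 p2 | PIf _ p1 p2 => asz p1 + asz p2
  | PFor _ _ p => asz p
  end.

Fixpoint cst (n m : nat) (p : pg) : nat :=
  match p with
  | PSkip => 1
  | PSet _ e => (ecost (ce e)).+1
  | PHeap a e => (ecost (ce a)).+3 + (ecost (ce a) + ecost (ce e)).+1
  | PArr _ i e => (ecost (ce i) + ecost (ce e) + 6).+1
  | PSeq p1 p2 => cst n m p1 + cst n m p2
  | PIf e p1 p2 => (ecost (ce e)).+1 + cst n m p1 + cst n m p2
  | PFor _ b p => bval n m b * (cst n m p + 10) + 8
  end.

Definition sim (s : mstate) (t : state) :=
  [/\ regs t =1 rg s, forall a, a < rg s 3 -> memory t a = hp s a &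
      forall a i, a < NA -> memory t (rg s 3 + (i * NA + a)) = ar s a i].

Definition bounded (v : nat) (s : mstate) :=
  [/\ forall x, rg s x <= v, forall a, hp s a <= v & forall a i, ar s a i <= v].

Lemma ce_eval s t e : sim s t -> 0 < rg s 3 -> wfe e -> eval t (ce e) = ev s e.
Proof.
move=> [sr sh sa] h0; elim: e => //= [e IH|a e IH|||||];
  try by move=> e1 IH1 e2 IH2 /andP[/IH1-> /IH2->].
- move=> /IH->; rewrite sr; case: ifP => lt; first by rewrite muln1 sh.
  by rewrite muln0 sh.
- by case/andP=> aN /IH->; rewrite sr sa.
Qed.

Lemma slow_ev s v e : bounded v s -> slow e ->
  ev s e <= v + gx (rg s 1) (rg s 2) (rg s 3) e.
Proof.
move=> [br bh ba]; elim: e => //=.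
- by move=> c _; apply: leq_addl.
- by move=> x _; rewrite addn0.
- by move=> e _ _; rewrite addn0.
- by move=> a e _ _; rewrite addn0.
- move=> e1 IH1 e2 _ /andP[/IH1 h c2]; rewrite addnA; apply: leq_add h _.
  elim: e2 c2 => //= [x|e1' IH1' e2' IH2'|e1' IH1' e2' IH2'].
  + by rewrite !inE => /or3P[]/eqP->.
  + by case/andP=> /IH1' h1 /IH2' h2; apply: leq_add.
  + by case/andP=> /IH1' h1 /IH2' h2; apply: leq_mul.
- by move=> e1 IH1 e2 _ /IH1 h; apply: leq_trans (leq_subr _ _) h.
- by move=> e1 _ e2 _ _; rewrite addn1 (leq_trans (leq_b1 _)).
- by move=> e1 _ e2 _ _; rewrite addn1 (leq_trans (leq_b1 _)).
Qed.

Lemma esz_ev s v e : bounded v s -> ev s e <= v.+2 ^ esz e.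
Proof.
move=> [br bh ba].
have e1 x : x <= v -> x <= v.+2 ^ 1 by rewrite expn1 => h; rewrite (leq_trans h) // !leqW.
have b1 (b : bool) : b <= v.+2 ^ 1 by rewrite expn1; case: b.
have pos f : 1 < v.+2 ^ esz f.
  elim: f => //= [c|g1 IH1 g2 IH2|g1 IH1 g2 IH2]; last 2 first.
  - by rewrite expnD; apply: leq_trans (leq_mul IH1 (ltnW IH2)).
  - by rewrite expnD; apply: leq_trans (leq_mul IH1 (ltnW IH2)).
  - by rewrite (@leq_trans (2 ^ c.+1)) ?leq_exp2r // (@leq_exp2l 2 1).
elim: e => //=.
- by move=> c; apply: (@leq_trans (v.+2 ^ c)); [apply/ltnW/ltn_expl | rewrite leq_exp2l].
- by move=> x; apply: e1.
- by move=> e _; apply: e1.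
- by move=> a e _; apply: e1.
- move=> f1 IH1 f2 IH2; rewrite expnD; apply: leq_trans (leq_add IH1 IH2) _.
  move: (pos f1) (pos f2); move: (_ ^ esz f1) (_ ^ esz f2) => p q; nia.
- by move=> f1 IH1 f2 _; apply: leq_trans (leq_subr _ _) IH1.
- by move=> f1 IH1 f2 IH2; rewrite expnD; apply: leq_mul.
Qed.

Lemma sim_setr s t x v : sim s t -> x \notin [:: 1; 2; 3] ->
  sim (setr s x v) (State (upd (regs t) x v) (memory t)).
Proof.
move=> [sr sh sa] x3; have e3 : upd (rg s) x v 3 = rg s 3.
  by rewrite /upd; case: eqP => // e; rewrite -e in x3.
by split=> [y|a|a i] /=; rewrite ?e3; [rewrite /upd sr | apply: sh | apply: sa].
Qed.

Lemma bounded_le v v' s : v <= v' -> bounded v s -> bounded v' s.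
Proof. by move=> vv [h1 h2 h3]; split=> *; apply: leq_trans vv. Qed.

Lemma bounded_setr v s x u : bounded v s -> u <= v -> bounded v (setr s x u).
Proof. by move=> [h1 h2 h3] uv; split=> //= y; rewrite /upd; case: eqP. Qed.

Lemma wf_const p s x : wf p -> x \in [:: 1; 2; 3] -> rg (den p s) x = rg s x.
Proof.
move=> wp x3; apply: den_rg; elim: p wp => //=.
- by move=> y e /and3P[+ _ _]; apply: contra; rewrite inE => /eqP<-.
- by move=> p1 IH1 p2 IH2 /andP[h1 h2]; rewrite mem_cat negb_or IH1 ?IH2.
- by move=> e p1 IH1 p2 IH2 /and3P[_ h1 h2]; rewrite mem_cat negb_or IH1 ?IH2.
- move=> y b p IH /and3P[y3 _ wp]; rewrite inE negb_or IH // andbT.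
  by apply: contra y3 => /eqP<-.
Qed.

Lemma cb_eval t b : eval t (cb b) = bval (regs t 1) (regs t 2) b.
Proof. by case: b => //=; rewrite addn1. Qed.

Lemma cb_cost b : ecost (cb b) <= 3. Proof. by case: b. Qed.

Section Exec.
Variables (W vf n m h : nat).
Hypothesis (vfW : vf < W).

(** Here v bounds the values at the start and [vf] those ever stored. The hypothesis on [asz] keeps
    the addresses of array entries below the word bound W. *)
Theorem comp_exec p s t v : wf p -> sim s t -> rg s 1 = n -> rg s 2 = m -> rg s 3 = h ->
  0 < h -> bounded v s -> v + gr n m h p <= vf ->
  h + (vf.+2 ^ asz p * NA + NA) < W ->
  exists t' time, [/\ exec W (comp p) t time t', time <= cst n m p, sim (den p s) t' &
    bounded (v + gr n m h p) (den p s)].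
Proof.
move=> + + + + + h0; elim: p s t v => /= [|x e|a e|a i e|p1 IH1 p2 IH2|e p1 IH1 p2 IH2|x b p IH] s t v.
- move=> _ st _ _ _ bs _ _; exists t, 1; split=> //; first exact: exec_skip.
  by rewrite addn0.
- case/and3P=> x3 we se st en em eh bs vle _.
  have ee : eval t (ce e) = ev s e by apply: ce_eval; rewrite ?eh.
  have le := slow_ev bs se; rewrite en em eh in le.
  exists (State (upd (regs t) x (ev s e)) (memory t)), (ecost (ce e)).+1; split=> //.
  + rewrite -ee; apply: exec_assign; rewrite ee; lia.
  + exact: sim_setr.
  + by apply: bounded_setr le; apply: bounded_le bs; apply: leq_addr.
- case/and3P=> wa' we se st en em eh bs vle hW.
  have ee : eval t (ce e) = ev s e by apply: ce_eval; rewrite ?eh.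
  have ea : eval t (ce a) = ev s a by apply: ce_eval; rewrite ?eh.
  have le := slow_ev bs se; rewrite en em eh in le.
  have [sr sh sa] := st.
  have eif : eval t (Lt (ce a) (Reg 3)) = (ev s a < rg s 3) by rewrite /= ea sr.
  case lt: (ev s a < rg s 3) eif => eif.
    exists (State (regs t) (upd (memory t) (ev s a) (ev s e))).
    exists ((ecost (Lt (ce a) (Reg 3))).+1 + (ecost (ce a) + ecost (ce e)).+1); split.
    + apply: exec_if; rewrite eif /= -ea -ee; apply: exec_store; rewrite ?ea ?ee; last by lia.
      by move: hW; rewrite -eh; lia.
    + by rewrite /= addn1.
    + split=> [y|a' la|a' i' la] //=; rewrite /upd.
        by case: eqP => // _; apply: sh.
      case: eqP => [e'|_]; last exact: sa.
      by move: lt; rewrite -e' ltnNge leq_addr.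
    + have [h1 h2 h3] := bounded_le (leq_addr (gx n m h e) v) bs; split=> // a' /=.
      by rewrite /upd; case: eqP.
  exists t, ((ecost (Lt (ce a) (Reg 3))).+1 + 1); split=> //.
  + by apply: exec_if; rewrite eif; apply: exec_skip.
  + by rewrite /= addn1; lia.
  + by apply: bounded_le bs; apply: leq_addr.
- case/and4P=> aN wi we se st en em eh bs vle hW.
  have ee : eval t (ce e) = ev s e by apply: ce_eval; rewrite ?eh.
  have ei : eval t (ce i) = ev s i by apply: ce_eval; rewrite ?eh.
  have le := slow_ev bs se; rewrite en em eh in le.
  have [sr sh sa] := st.
  set ad := Add _ _; have ead : eval t ad = rg s 3 + (ev s i * NA + a) by rewrite /= ei sr.
  exists (State (regs t) (upd (memory t) (eval t ad) (eval t (ce e)))).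
  exists (ecost ad + ecost (ce e)).+1; split=> //.
  + apply: exec_store; last by rewrite ee; lia.
    have lei : ev s i <= vf.+2 ^ esz i by apply: esz_ev (bounded_le _ bs); lia.
    rewrite ead eh; apply: leq_ltn_trans hW; rewrite leq_add2l; apply: leq_add (ltnW aN).
    by rewrite leq_mul2r lei orbT.
  + by rewrite /=; lia.
  + rewrite ead ee; split=> [y|b lb|b j lb] //=; rewrite /upd.
      case: eqP => [e'|_]; last exact: sh.
      by move: lb; rewrite e' ltnNge leq_addr.
    case: eqP => [/addnI e'|ne].
      (* Division by NA recovers the index and the array from the address. *)
      by have := f_equal (edivn^~ NA) e'; rewrite !edivn_eq // => -[-> ->]; rewrite !eqxx.
    rewrite sa //; case: eqP => // eb; case: eqP => [ej|_]; last by rewrite eb.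
    by case: ne; rewrite eb ej.
  + have [h1 h2 h3] := bounded_le (leq_addr (gx n m h e) v) bs; split=> // b j /=.
    by case: (b == a) => //; rewrite /upd; case: eqP.
- case/andP=> w1 w2 st en em eh bs vle hW.
  have mono q1 q2 : h + (vf.+2 ^ (q1 + q2) * NA + NA) < W ->
      h + (vf.+2 ^ q1 * NA + NA) < W /\ h + (vf.+2 ^ q2 * NA + NA) < W.
    by move=> hh; split; apply: leq_ltn_trans hh; rewrite leq_add2l leq_add2r leq_mul2r
      leq_exp2l // ?leq_addr ?leq_addl orbT.
  have [hW1 hW2] := mono _ _ hW.
  have [|t1 [c1 [x1 l1 s1 b1]]] := IH1 s t v w1 st en em eh bs _ hW1; first by lia.
  have [||||t2 [c2 [x2 l2 s2 b2]]] := IH2 _ t1 _ w2 s1 _ _ _ b1 _ hW2; rewrite ?wf_const //;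
    first by lia.
  exists t2, (c1 + c2); split=> //; [exact: exec_seq x1 x2 | exact: leq_add | by rewrite addnA].
- case/and3P=> we w1 w2 st en em eh bs vle hW.
  have mono q1 q2 : h + (vf.+2 ^ (q1 + q2) * NA + NA) < W ->
      h + (vf.+2 ^ q1 * NA + NA) < W /\ h + (vf.+2 ^ q2 * NA + NA) < W.
    by move=> hh; split; apply: leq_ltn_trans hh; rewrite leq_add2l leq_add2r leq_mul2r
      leq_exp2l // ?leq_addr ?leq_addl orbT.
  have [hW1 hW2] := mono _ _ hW.
  have ee : eval t (ce e) = ev s e by apply: ce_eval; rewrite ?eh.
  case ce0: (ev s e != 0).
    have [|t1 [c1 [x1 l1 s1 b1]]] := IH1 s t v w1 st en em eh bs _ hW1; first by lia.
    exists t1, ((ecost (ce e)).+1 + c1); split=> //.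
    + by apply: exec_if; rewrite ee ce0.
    + lia.
    + by apply: bounded_le b1; rewrite addnA leq_addr.
  have [|t1 [c1 [x1 l1 s1 b1]]] := IH2 s t v w2 st en em eh bs _ hW2; first by lia.
  exists t1, ((ecost (ce e)).+1 + c1); split=> //.
  + by apply: exec_if; rewrite ee ce0.
  + lia.
  + by apply: bounded_le b1; lia.
case/and3P=> x3 xp wp st en em eh bs vle hW.
rewrite en em; set k := bval n m b; set g := gr n m h p in vle *.
pose S i := iteri i (fun i s => den p (setr s x i)) s.
(* Induction on the number j of rounds still to come, [S i] being the state after i rounds. *)
have loop j i t' : i + j = k -> sim (setr (S i) x i) t' ->
    rg (S i) 1 = n -> rg (S i) 2 = m -> rg (S i) 3 = h ->
    bounded (v + i * g + k) (S i) ->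
    exists t1 c1, [/\ exec W (While (Lt (Reg x) (cb b))
      (Seq (comp p) (Assign x (Add (Reg x) (Lit 1))))) t' c1 t1,
      c1 <= j * (cst n m p + 10) + 6, sim (setr (S k) x k) t1 &
      bounded (v + k * g + k) (S k)].
  have xne y : y \in [:: 1; 2; 3] -> (y == x) = false.
    by move=> y3; apply: contraNF x3 => /eqP<-.
  elim: j i t' => [|j IHj] i t' eij st' e1 e2 e3 bi.
    rewrite addn0 in eij; subst i.
    exists t', (ecost (Lt (Reg x) (cb b))).+1; split=> //.
    + apply: exec_while_stop; have [sr _ _] := st'.
      by rewrite /= cb_eval !sr /= /upd eqxx !xne // e1 e2 ltnn.
    + by have := cb_cost b => /=; lia.
  have ik : i < k by lia.
  have [|||||t1 [c1 [y1 l1 s1 b1]]] := IH (setr (S i) x i) t' (v + i * g + k) wp st' _ _ _ _ _ hW.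
  + by rewrite /= /upd xne.
  + by rewrite /= /upd xne.
  + by rewrite /= /upd xne.
  + by apply: bounded_setr bi _; lia.
  + rewrite -/g; have := leq_mul2r g i.+1 k; rewrite ik orbT mulSn; lia.
  have s2 := sim_setr i.+1 s1 x3.
  have ex : rg (den p (setr (S i) x i)) x = i by rewrite den_rg //= /upd eqxx.
  have [|||||t2 [c2 [y2 l2 s3 b3]]] := IHj i.+1 _ _ s2.
  + by rewrite addSn -addnS.
  + by rewrite /= wf_const //= /upd xne.
  + by rewrite /= wf_const //= /upd xne.
  + by rewrite /= wf_const //= /upd xne.
  + by apply: bounded_le b1; rewrite -/g; lia.
  exists t2, ((ecost (Lt (Reg x) (cb b))).+1 + (c1 + 4) + c2); split=> //.
  + apply: exec_while_loop y2.
      have [sr _ _] := st'.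
      by rewrite /= cb_eval !sr /= /upd eqxx !xne // e1 e2 -/k ik.
    apply: exec_seq y1 _.
    have ei : eval t1 (Add (Reg x) (Lit 1)) = i.+1.
      by have [sr _ _] := s1; rewrite /= sr ex addn1.
    rewrite -[X in upd _ _ X]ei; apply: exec_assign; rewrite ei; lia.
  + by have := cb_cost b => /=; lia.
have s0 := sim_setr 0 st x3.
have [||||t1 [c1 [y1 l1 s1 b1]]] := loop k 0 _ (add0n k) s0 => //.
  by apply: bounded_le bs; lia.
exists t1, (2 + c1); split=> //.
- apply: exec_seq y1; apply: exec_assign => /=; lia.
- by lia.
- by apply: bounded_setr; [rewrite addnA | lia].
Qed.
End Exec.
End Comp.

Notation eAnd := Times.
(** * Vertices as indices, sets as arrays *)

Definition eOr e1 e2 := Less (Cst 0) (Plus e1 e2).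
Definition eNot e := Equ e (Cst 0).
Definition eIn a e := Less (Cst 0) (Aget a e).
Definition eMat a x y := Aget a (Plus (Times x (Plus (Var 1) (Cst 1))) y).
Definition eAdj := eMat 0.

Lemma den_seq p q s : den (PSeq p q) s = den q (den p s). Proof. by []. Qed.
Lemma den_set x e s : den (PSet x e) s = setr s x (ev s e). Proof. by []. Qed.
Lemma den_if e p q s : den (PIf e p q) s = if ev s e != 0 then den p s else den q s.
Proof. by []. Qed.

Lemma uniq4 (t i : nat) : uniq [:: t; i; 10; 1] ->
  [/\ t != i, t != 10, t != 1, i != 10 & i != 1].
Proof. by rewrite /= !inE !negb_or !andbT => /andP[/and3P[-> -> ->] /andP[-> ->]]. Qed.

Section Eval.
Variable s : mstate.

Lemma ev_and e1 e2 (b1 b2 : bool) : ev s e1 = b1 -> ev s e2 = b2 -> ev s (eAnd e1 e2) = b1 && b2.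
Proof. by move=> /= -> ->; rewrite mulnb. Qed.

Lemma ev_or e1 e2 (b1 b2 : bool) : ev s e1 = b1 -> ev s e2 = b2 -> ev s (eOr e1 e2) = b1 || b2.
Proof. by move=> /= -> ->; case: b1; case: b2. Qed.

Lemma ev_not e (b : bool) : ev s e = b -> ev s (eNot e) = ~~ b.
Proof. by move=> /= ->; case: b. Qed.
End Eval.

Definition seqs (ps : seq pg) := foldr PSeq PSkip ps.
Arguments seqs : simpl never.

(** Loops run up to the size of the root, in register 1; the comparison with register 10 restricts
    their effect to the vertices of the current graph. *)
Definition Fill i a e := PFor i BN (PIf (eAnd (Less (Var i) (Var 10)) e)
  (PArr a (Var i) (Cst 1)) (PArr a (Var i) (Cst 0))).

Lemma fill_nat i a e s j : i != 10 -> i != 1 -> a \notin ra e -> j < rg s 1 ->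
  ar (den (Fill i a e) s) a j = (j < rg s 10) && (ev (setr s i j) e != 0).
Proof.
move=> i10 i1 ae jN; rewrite /Fill; set B := PIf _ _ _.
have [|||s' [h _ ->]] := @den_for (fun k s' => forall j, j < k ->
    ar s' a j = (j < rg s 10) && (ev (setr s i j) e != 0) :> nat) i BN B s (rg s 1).
- by [].
- by [].
- move=> k s' kN [f1 f2 f3] IH l lk.
  have evk : ev (setr s' i k) e = ev (setr s i k) e.
    apply: ev_ext => [x _|b be|_].
    + by rewrite /= /upd; case: eqP => // /eqP xi; rewrite f1 // !inE (negPf xi).
    + by move=> y /=; rewrite f2 // !inE orbb; apply: contraNneq ae => <-.
    + by rewrite /= f3.
  have e10 : rg s' 10 = rg s 10 by rewrite f1 // !inE eq_sym (negPf i10).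
  rewrite /= /upd eqxx /= (eq_sym 10) (negPf i10) e10.
  have -> : ((k < rg s 10) * ev (setr s' i k) e != 0) = (k < rg s 10) && (ev (setr s i k) e != 0).
    by rewrite muln_eq0 negb_or evk; case: (k < _).
  move: lk; rewrite ltnS leq_eqVlt => /orP[/eqP->|lk].
    by case: ifP => _; rewrite /= eqxx /upd eqxx.
  by case: ifP => _; rewrite /= eqxx /upd (ltn_eqF lk) IH.
- exact: h.
Qed.

Definition Count t i e := PSeq (PSet t (Cst 0)) (PFor i BN
  (PIf (eAnd (Less (Var i) (Var 10)) e) (PSet t (Plus (Var t) (Cst 1))) PSkip)).

Lemma count_nat t i e s : uniq [:: t; i; 10; 1] -> t \notin rr e ->
  rg (den (Count t i e) s) t =
  count (fun j => (j < rg s 10) && (ev (setr s i j) e != 0)) (iota 0 (rg s 1)).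
Proof.
move=> /uniq4[ti t10 t1 i10 i1] te.
rewrite /Count den_seq den_set; set s0 := setr s t _; set B := PIf _ _ _.
have e1 : rg s0 1 = rg s 1 by rewrite /= /upd eq_sym (negPf t1).
have [|||s' [h _ ->]] := @den_for (fun k s' => rg s' t =
    count (fun j => (j < rg s 10) && (ev (setr s i j) e != 0)) (iota 0 k)) i BN B s0 (rg s 1).
- exact: esym e1.
- by rewrite /= /upd eqxx.
- move=> k s' kN [f1 f2 f3] IH.
  have evk : ev (setr s' i k) e = ev (setr s i k) e.
    apply: ev_ext => [x xe|b be|_].
    + rewrite /= /upd; case: eqP => // /eqP xi; rewrite f1 /= /upd.
        by case: eqP => // xt; rewrite xt (negPf te) in xe.
      by rewrite !inE (negPf xi) /=; apply: contraNneq te => <-.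
    + by move=> y /=; rewrite f2.
    + by rewrite /= f3.
  have e10 : rg s' 10 = rg s 10.
    rewrite f1 /= /upd ?inE; first by rewrite eq_sym (negPf t10).
    by rewrite /= negb_or !(eq_sym 10) i10 t10.
  have -> : iota 0 k.+1 = iota 0 k ++ [:: k] by rewrite -(addn1 k) iotaD.
  rewrite count_cat /= addn0 -IH /upd eqxx (eq_sym 10) (negPf i10) e10.
  have -> : ((k < rg s 10) * ev (setr s' i k) e != 0) = (k < rg s 10) && (ev (setr s i k) e != 0).
    by rewrite muln_eq0 negb_or evk; case: (k < _).
  by case: ifP => _; rewrite /= /upd ?eqxx (negPf ti) ?addn0.
- by rewrite /= /upd (negPf ti).
Qed.

Section Index.
Variables (T : finType) (vs : seq T).
Hypotheses (Uvs : uniq vs) (vsT : forall x, x \in vs).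

Definition ix x := index x vs.

Lemma size_vs : size vs = #|T|.
Proof. by rewrite -(card_uniqP Uvs); apply: eq_card => x; rewrite vsT. Qed.

Lemma ix_inj : injective ix.
Proof.
by move=> x y e; rewrite -(nth_index x (vsT x)) -/(ix x) e nth_index.
Qed.

Lemma ix_eq x y : (ix x == ix y) = (x == y).
Proof. exact: inj_eq ix_inj _ _. Qed.

Lemma ix_lt x : ix x < #|T|.
Proof. by rewrite -size_vs index_mem. Qed.

Lemma ix_onto i : i < #|T| -> exists x, ix x = i.
Proof.
move=> h; have /card_gt0P[x0 _] : 0 < #|T| by apply: leq_ltn_trans h.
by exists (nth x0 vs i); rewrite /ix index_uniq ?size_vs.
Qed.

Lemma map_ix : map ix vs = iota 0 #|T|.
Proof.
apply: (@eq_from_nth _ 0) => [|i]; rewrite size_map size_vs ?size_iota // => h.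
have /card_gt0P[x0 _] : 0 < #|T| by apply: leq_ltn_trans h.
by rewrite nth_iota // (nth_map x0) ?size_vs // /ix index_uniq ?size_vs.
Qed.

Lemma count_ix (P : pred nat) (Q : pred T) n : #|T| <= n ->
  (forall x, P (ix x) = Q x) -> (forall j, #|T| <= j -> P j = false) ->
  count P (iota 0 n) = #|Q|.
Proof.
move=> le PQ P0; rewrite -(subnKC le) iotaD count_cat add0n.
have -> : count P (iota #|T| (n - #|T|)) = 0.
  apply/eqP; rewrite -leqn0 leqNgt -has_count; apply/hasPn=> j.
  by rewrite mem_iota => /andP[/P0->].
rewrite addn0 -map_ix count_map (eq_count PQ) cardE /enum_mem size_filter.
rewrite -enumT; apply/permP; apply: uniq_perm => //; first exact: enum_uniq.
by move=> x; rewrite vsT mem_enum.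
Qed.

Definition rep (s : mstate) a (X : {set T}) := forall x, (ar s a (ix x) != 0) = (x \in X).

Definition small s := (rg s 10 = #|T|) /\ #|T| <= rg s 1.

Lemma ix_small s x : small s -> ix x < rg s 1.
Proof. by move=> [_]; apply: leq_trans (ix_lt x). Qed.

Lemma fill_rep i a e s (X : {set T}) : small s -> i != 10 -> i != 1 -> a \notin ra e ->
  (forall x, ev (setr s i (ix x)) e = (x \in X)) -> rep (den (Fill i a e) s) a X.
Proof.
move=> sm i10 i1 ae h x; rewrite fill_nat ?ix_small // h; have [-> _] := sm.
by rewrite ix_lt; case: (x \in X).
Qed.

Lemma count_set t i e s (Q : pred T) : small s -> uniq [:: t; i; 10; 1] -> t \notin rr e ->
  (forall x, ev (setr s i (ix x)) e = Q x) -> rg (den (Count t i e) s) t = #|Q|.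
Proof.
move=> [s10 s1] U te h; rewrite count_nat //; apply: count_ix => // [x|j].
  by rewrite h s10 ix_lt; case: (Q x).
by rewrite s10 leqNgt => /negPf->.
Qed.

(* Find i t a: register t holds the last index in the set a, or register 1 if   *)
(* that set is empty.                                                           *)
Definition Find t i a := PSeq (PSet t (Var 1)) (PFor i BN
  (PIf (eAnd (Less (Var i) (Var 10)) (eIn a (Var i))) (PSet t (Var i)) PSkip)).

(** The choice made by [Find]; it instantiates the parameter [pk] of the search. *)
Definition pick_last (X : {set T}) := ohead (rev [seq x <- vs | x \in X]).

Lemma pick_lastP X : if pick_last X is Some x then x \in X else X == set0.
Proof.
rewrite /pick_last; case e: (rev _) => [|x r] /=.
  apply/eqP/setP=> x; rewrite inE; apply/negP=> xX.
  have : x \in rev [seq x <- vs | x \in X] by rewrite mem_rev mem_filter xX vsT.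
  by rewrite e.
have : x \in rev [seq x <- vs | x \in X] by rewrite e inE eqxx.
by rewrite mem_rev mem_filter => /andP[].
Qed.

Lemma find_last t i a s (X : {set T}) : small s -> uniq [:: t; i; 10; 1] -> rep s a X ->
  rg (den (Find t i a) s) t = (if pick_last X is Some x then ix x else rg s 1).
Proof.
move=> [s10 s1] /uniq4[ti t10 t1 i10 i1] rX.
rewrite /Find den_seq den_set; set s0 := setr s t _; set B := PIf _ _ _.
have e1 : rg s0 1 = rg s 1 by rewrite /= /upd eq_sym (negPf t1).
have [|||s' [h _ ->]] := @den_for (fun k s' => rg s' t =
    (if ohead (rev [seq x <- take k vs | x \in X]) is Some x then ix x else rg s 1))
    i BN B s0 (rg s 1).
- exact: esym e1.
- by rewrite take0 /= /upd eqxx.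
- move=> k s' kN [f1 f2 f3] IH.
  have e10 : rg s' 10 = rg s 10.
    rewrite f1 /= /upd ?inE; first by rewrite eq_sym (negPf t10).
    by rewrite /= negb_or !(eq_sym 10) i10 t10.
  rewrite /= /upd eqxx (eq_sym 10) (negPf i10) e10 s10 f2 //=.
  case: (ltnP k #|T|) => kT; last first.
    rewrite mul0n /= /upd (negPf ti) IH !take_oversize ?size_vs //.
    exact: leq_trans kT _.
  have [x ex] := ix_onto kT; rewrite mul1n -ex.
  have -> : take (ix x).+1 vs = rcons (take (ix x) vs) x.
    by rewrite (take_nth x) ?index_mem // nth_index.
  rewrite filter_rcons lt0n rX; case: (boolP (x \in X)) => xX /=.
    by rewrite /upd !eqxx rev_rcons.
  by rewrite /upd (negPf ti) IH ex.
- rewrite /= /upd (negPf ti) h take_oversize //; by rewrite size_vs.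
Qed.

(** The list in array 12, with its length in register 30, serves as the initial queue of [Reach] and
    as the numbering of the kept vertices of a block. *)
Definition Rank a := PSeq (PSet 30 (Cst 0)) (PFor 34 BN
  (PIf (eAnd (Less (Var 34) (Var 10)) (eIn a (Var 34)))
    (PSeq (PArr 12 (Var 30) (Var 34)) (PSet 30 (Plus (Var 30) (Cst 1)))) PSkip)).

Definition rank (X : {set T}) := [seq x <- vs | x \in X].

Lemma rank_uniq X : uniq (rank X). Proof. exact: filter_uniq. Qed.

Lemma mem_rank X x : (x \in rank X) = (x \in X).
Proof. by rewrite mem_filter vsT andbT. Qed.

Lemma rank_list a s (X : {set T}) : small s -> rep s a X -> a != 12 ->
  rg (den (Rank a) s) 30 = size (rank X) /\
  forall i, i < size (rank X) -> ar (den (Rank a) s) 12 i = nth 0 (map ix (rank X)) i.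
Proof.
move=> [s10 s1] rX a12; rewrite /Rank den_seq den_set; set s0 := setr s 30 _; set B1 := PIf _ _ _.
have [|||s1' [h1 _ ->]] := @den_for (fun k s' => let q := [seq x <- take k vs | x \in X] in
    rg s' 30 = size q /\ forall i, i < size q -> ar s' 12 i = nth 0 (map ix q) i) 34 BN B1 s0 (rg s 1).
- by [].
- by split; rewrite take0.
- move=> k s' kN [f1 f2 _] [h30 h12].
  rewrite /B1 [den _ _]/=; rewrite /upd /= f1 // f2; last by rewrite /= inE.
  rewrite [rg s0 10]/= /upd /= s10.
  case: (ltnP k #|T|) => kT; last first.
    rewrite mul0n /= !take_oversize ?size_vs ?(leq_trans kT) // in h30 h12 *.
  have [x ex] := ix_onto kT; rewrite mul1n -ex lt0n rX.
  have -> : take (ix x).+1 vs = rcons (take (ix x) vs) x.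
    by rewrite (take_nth x) ?index_mem // nth_index.
  rewrite -ex in h30 h12; rewrite filter_rcons; case: (boolP (x \in X)) => xX //=.
  rewrite /upd /= h30 size_rcons addn1; split=> // i.
  rewrite ltnS map_rcons nth_rcons size_map.
  rewrite leq_eqVlt => /orP[/eqP->|ii]; first by rewrite eqxx ltnn.
  by rewrite (ltn_eqF ii) ii; apply: h12.
by rewrite /rank /= /upd /=; move: h1; rewrite take_oversize ?size_vs.
Qed.

(* Replaces the set in array 11 by its closure under the relation e on          *)
(* registers 32, 33.                                                            *)
Definition Reach e := PSeq (Rank 11)
  (PFor 31 BN (PIf (Less (Var 31) (Var 30))
    (PSeq (PSet 32 (Aget 12 (Var 31)))
          (PFor 33 BN (PIf (eAnd (Less (Var 33) (Var 10)) (eAnd (eNot (eIn 11 (Var 33))) e))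
            (PSeq (PArr 11 (Var 33) (Cst 1))
            (PSeq (PArr 12 (Var 30) (Var 33)) (PSet 30 (Plus (Var 30) (Cst 1)))))
            PSkip)))
    PSkip)).

(** Array 12 is the queue of a breadth-first search, in which each vertex is expanded once; this
    keeps the cost at O(N^2). The invariant: after k rounds all successors of the first k entries
    are in the queue. *)
Lemma reach_rep e s (r : rel T) (X : {set T}) : small s -> rep s 11 X ->
  [&& 30 \notin rr e, 31 \notin rr e, 34 \notin rr e, 11 \notin ra e & 12 \notin ra e] ->
  (forall x y, ev (setr (setr s 32 (ix x)) 33 (ix y)) e = r x y) ->
  rep (den (Reach e) s) 11 (cl r X).
Proof.
move=> sm rX /and5P[r30 r31 r34 a11 a12] he; have [s10 s1] := sm.
pose QI q s' := [/\ uniq q, rg s' 30 = size q,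
  forall i, i < size q -> ar s' 12 i = nth 0 (map ix q) i & rep s' 11 [set x in q]].
pose W := [:: 30; 31; 32; 33; 34]; pose A := [:: 11; 12].
have sub w a h s1' s2' : all (fun x => x \in W) w -> all (fun x => x \in A) a ->
    same_off w a h s1' s2' -> same_off W A h s1' s2'.
  move=> /allP hw /allP ha [f1 f2 f3]; split=> // x xn; [apply: f1 | apply: f2].
    by apply: contra xn; apply: hw.
  by apply: contra xn; apply: ha.
have trans h1 h2 s1' s2' s3' : same_off W A h1 s1' s2' -> ~~ h1 -> same_off W A h2 s2' s3' -> ~~ h2 ->
    same_off W A false s1' s3'.
  move=> [f1 f2 f3] n1 [g1 g2 g3] n2; split=> [x xn|a an|_].
  - by rewrite g1 // f1.
  - by rewrite g2 // f2.
  - by rewrite g3 // f3.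
rewrite /Reach den_seq; set s2 := den (Rank 11) s; set B2 := PIf _ _ _.
have so2 : same_off W A false s s2.
  exact: (sub (wr (Rank 11)) (wa (Rank 11)) false s s2 isT isT (den_same (Rank 11) s)).
have q0 : QI (rank X) s2.
  have [h30 h12] := rank_list sm rX isT; split=> //; first exact: rank_uniq.
  by move=> x; rewrite /s2 den_ar // inE mem_rank.
have evE s' x y : same_off W A false s s' -> rg s' 32 = ix x -> rg s' 33 = ix y -> ev s' e = r x y.
  move=> [f1 f2 f3] e32 e33; rewrite -he; apply: ev_ext => [z ze|b be|_].
  - rewrite /= /upd; case: eqP => [->//|/eqP n33]; case: eqP => [->//|/eqP n32].
    rewrite f1 // !inE !negb_or n33 n32 /=.
    by apply/and3P; split; [apply: contraNneq r30|apply: contraNneq r31|apply: contraNneq r34] => <-.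
  - move=> z /=; rewrite f2 // !inE negb_or.
    by apply/andP; split; [apply: contraNneq a11|apply: contraNneq a12] => <-.
  - by rewrite f3.
have [|||s3 [h3 so3 ->]] := @den_for (fun k s' => exists q, [/\ QI q s', {subset X <= q},
    {subset q <= cl r X} & forall x y, x \in take k q -> r x y -> y \in q]) 31 BN B2 s2 (rg s 1).
- by have [f1 _ _] := so2; exact: esym (f1 1 isT).
- exists (rank X); split=> //.
  + by move=> x; rewrite mem_rank.
  + by move=> x; rewrite mem_rank; apply: (subsetP (cl_sub _ _)).
  + by move=> x y; rewrite take0.
- move=> k s' kN so [q [Qq Xq qX hq]].
  have so' : same_off W A false s s'.
    exact: (trans false false s s2 s' so2 isT (sub (31 :: wr B2) (wa B2) false s2 s' isT isT so) isT).
  rewrite /B2 den_if den_seq den_set; set IF := PIf _ _ _.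
  have -> : (ev (setr s' 31 k) (Less (Var 31) (Var 30)) != 0) = (k < size q).
    by rewrite /= /upd /=; have [_ -> _ _] := Qq; rewrite eqb0 negbK.
  case: ltnP => kq; last first.
    exists q; split=> // x y; rewrite !take_oversize ?(leq_trans kq) // in hq *.
    exact: hq.
  have [x xq ex] : exists2 x, x \in q & [/\ nth 0 (map ix q) k = ix x & take k.+1 q = rcons (take k q) x].
    case: q kq {Qq Xq qX hq} => // x0 q kq; exists (nth x0 (x0 :: q) k); first exact: mem_nth.
    by split; [rewrite (nth_map x0) | rewrite (take_nth x0)].
  have e12 : ar s' 12 k = ix x by have [_ _ -> // _] := Qq; case: ex.
  have -> : ev (setr s' 31 k) (Aget 12 (Var 31)) = ix x by rewrite /= /upd.
  set s4 := setr _ 32 _.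
  have so4 : same_off W A false s s4.
    have [f1 f2 f3] := so'; split=> // z zn; rewrite /= /upd.
    case: eqP => [ez|_]; first by rewrite ez in zn.
    case: eqP => [ez|_]; first by rewrite ez in zn.
    exact: f1.
  have [|||s5 [[q' [Q' [q'' eq']] q'X hq'] so5 ->]] := @den_for (fun j s' => exists q',
     [/\ QI q' s', exists q'', q' = q ++ q'', {subset q' <= cl r X} &
      forall y, ix y < j -> r x y -> y \in q']) 33 BN IF s4 (rg s 1).
  + by have [f1 _ _] := so4; exact: esym (f1 1 isT).
  + exists q; split=> //; last by exists [::]; rewrite cats0.
  + move=> j s6 jN so6 [q' [Q' [q'' eq'] q'X hq']].
    have so6' : same_off W A false s s6.
      exact: (trans false false s s4 s6 so4 isT (sub (33 :: wr IF) (wa IF) false s4 s6 isT isT so6) isT).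
    have e32 : rg s6 32 = ix x by have [f1 _ _] := so6; rewrite f1 // /= /upd.
    rewrite /IF /=; have [f1 f2 f3] := so6'.
    rewrite {1 2}/upd /= f1 // s10.
    case: (ltnP j #|T|) => jT; last first.
      rewrite mul0n /=; exists q'; split=> //.
      * by exists q''.
      * by move=> y _; apply: hq'; apply: leq_trans (ix_lt y) jT.
    have [y ey] := ix_onto jT; rewrite mul1n /upd /= -ey.
    rewrite (evE _ x y); last 3 first.
    * by split=> // z zn; rewrite /= /upd; case: eqP => [ez|_]; [rewrite ez in zn | apply: f1].
    * by rewrite /= /upd.
    * by rewrite /= /upd.
    have [U h30 h12 h11] := Q'.
    have -> : ((0 < ar s6 11 (ix y)) == 0 :> nat) = (y \notin q').
      by rewrite lt0n h11 inE; case: (y \in q').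
    rewrite mulnb eqb0 negbK; case: ifP => [/andP[yq rxy]|yr].
      exists (rcons q' y); split=> /=.
      * split=> /=.
        - by rewrite rcons_uniq yq.
        - by rewrite /upd /= h30 size_rcons addn1.
        - move=> i; rewrite size_rcons ltnS map_rcons nth_rcons size_map /upd /= h30.
          rewrite leq_eqVlt => /orP[/eqP->|ii]; first by rewrite eqxx ltnn.
          by rewrite (ltn_eqF ii) ii; apply: h12.
        - move=> z /=; rewrite /upd /= ix_eq inE mem_rcons inE.
          by have := h11 z; rewrite inE => <-; case: (z == y).
      * by exists (rcons q'' y); rewrite eq' rcons_cat.
      * move=> z; rewrite mem_rcons inE => /orP[/eqP->|]; last exact: q'X.
        by apply: cl_closed rxy; apply: q'X; rewrite eq' mem_cat xq.
      * move=> z; rewrite ltnS leq_eqVlt mem_rcons inE => /orP[|zj rxz]; last by rewrite hq' ?orbT -?ey.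
        by rewrite ix_eq => ->.
    exists q'; split=> //.
    * by exists q''.
    * move=> z; rewrite ltnS leq_eqVlt => /orP[|zj rxz]; last by rewrite hq' -?ey.
      by rewrite ix_eq => /eqP-> rxy; move: yr; rewrite rxy andbT => /negbFE.
  exists q'; split=> //.
  + by move=> y /Xq yq; rewrite eq' mem_cat yq.
  + move=> z y; rewrite eq' takel_cat ?kq //; case: ex => _ ->.
    rewrite mem_rcons inE => /orP[/eqP->|zk].
      by rewrite -eq'; apply: hq'; apply: leq_trans (ix_lt y) s1.
    by move=> /(hq _ _ zk); rewrite mem_cat => ->.
have [q [[U h30 h12 h11] Xq qX hq]] := h3 => x /=.
rewrite h11 inE; apply/idP/idP; first exact: qX.
have sz : size q <= rg s 1 by rewrite -(card_uniqP U); apply: leq_trans (max_card _) s1.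
rewrite take_oversize // in hq.
have : cl r X \subset [set y in q].
  apply: cl_min => [|u v]; first by apply/subsetP=> y /Xq; rewrite inE.
  by rewrite !inE; apply: hq.
by move/subsetP=> h /h; rewrite inE.
Qed.
End Index.

Fact run_key : unit. Proof. by []. Qed.
(** A locked copy of [den], so that simplification does not unfold whole programs. *)
Definition run := locked_with run_key den.

Lemma runE : run = den. Proof. exact: unlock. Qed.

Lemma run_seq p q s : run (PSeq p q) s = run q (run p s). Proof. by rewrite runE. Qed.
Lemma run_cons p ps s : run (seqs (p :: ps)) s = run (seqs ps) (run p s).
Proof. by rewrite runE. Qed.
Lemma run_nil s : run (seqs [::]) s = s. Proof. by rewrite runE. Qed.
Lemma run_skip s : run PSkip s = s. Proof. by rewrite runE. Qed.
Lemma run_set x e s : run (PSet x e) s = setr s x (ev s e). Proof. by rewrite runE. Qed.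
Lemma run_arr a i e s : run (PArr a i e) s = seta s a (ev s i) (ev s e). Proof. by rewrite runE. Qed.
Lemma run_heap a e s :
  run (PHeap a e) s = if ev s a < rg s 3 then seth s (ev s a) (ev s e) else s.
Proof. by rewrite runE. Qed.
Lemma run_if e p q s : run (PIf e p q) s = if ev s e != 0 then run p s else run q s.
Proof. by rewrite runE. Qed.

Lemma run_rg p s x : x \notin wr p -> rg (run p s) x = rg s x.
Proof. by rewrite runE; apply: den_rg. Qed.
Lemma run_ar p s a : a \notin wa p -> ar (run p s) a = ar s a.
Proof. by rewrite runE; apply: den_ar. Qed.
Lemma run_hp p s : ~~ wh p -> hp (run p s) = hp s.
Proof. by rewrite runE; apply: den_hp. Qed.
Lemma run_same p s : same_off (wr p) (wa p) (wh p) s (run p s).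
Proof. by rewrite runE; apply: den_same. Qed.

Lemma run_for (P : nat -> mstate -> Prop) x b p s k :
  k = bval (rg s 1) (rg s 2) b -> P 0 s ->
  (forall i s', i < k -> same_off (x :: wr p) (wa p) (wh p) s s' -> P i s' ->
     P i.+1 (run p (setr s' x i))) ->
  exists2 s', P k s' /\ same_off (x :: wr p) (wa p) (wh p) s s' &
    run (PFor x b p) s = setr s' x k.
Proof. by rewrite runE; apply: den_for. Qed.

Lemma same_trans w a h s1 s2 s3 : same_off w a h s1 s2 -> same_off w a h s2 s3 ->
  same_off w a h s1 s3.
Proof.
move=> [f1 f2 f3] [g1 g2 g3]; split=> [x xn|b bn|hn]; first by rewrite g1 ?f1.
  by rewrite g2 ?f2.
by rewrite g3 ?f3.
Qed.

Lemma same_weak w a w' a' h s1 s2 : {subset w <= w'} -> {subset a <= a'} ->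
  same_off w a h s1 s2 -> same_off w' a' h s1 s2.
Proof.
move=> hw ha [f1 f2 f3]; split=> // x xn.
  by apply: f1; apply: contra xn; apply: hw.
by apply: f2; apply: contra xn; apply: ha.
Qed.

Lemma same_setr w a h s x v : x \in w -> same_off w a h s (setr s x v).
Proof.
by move=> xw; split=> // y yn; rewrite /= /upd; case: eqP => // e; rewrite e xw in yn.
Qed.

(** Two nested loops with one invariant for both counters; at the end of a row, (i, l) is turned
    into (i.+1, 0). *)
Lemma run_for2 (P : nat -> nat -> mstate -> Prop) x y b c p s k l :
  k = bval (rg s 1) (rg s 2) b -> l = bval (rg s 1) (rg s 2) c ->
  ~~ has (fun z => z \in x :: y :: wr p) [:: 1; 2] -> x \notin y :: wr p -> P 0 0 s ->
  (forall i j s' z v, z \in [:: x; y] -> P i j s' -> P i j (setr s' z v)) ->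
  (forall i s', i < k -> P i l s' -> P i.+1 0 s') ->
  (forall i j s', i < k -> j < l -> same_off (x :: y :: wr p) (wa p) (wh p) s s' ->
     rg s' x = i -> rg s' y = j -> P i j s' -> P i j.+1 (run p s')) ->
  P k 0 (run (PFor x b (PFor y c p)) s).
Proof.
rewrite /= orbF negb_or => ek el /andP[n1 n2] xw P0 Pset Pnext Pstep.
set W := x :: y :: wr p.
have [|||s' [h _ ->]] := @run_for (fun i s' => P i 0 s') x b (PFor y c p) s k => //; last first.
  by apply: Pset h; rewrite inE eqxx.
move=> i s' ik so h; have so' : same_off W (wa p) (wh p) s s' by [].
have [f1 _ _] := so'.
have [|||s2 [h2 _ ->]] := @run_for (fun j s' => P i j s' /\ rg s' x = i) y c p (setr s' x i) l.
- have e z : z \notin W -> rg (setr s' x i) z = rg s z.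
    move=> zW; rewrite /= /upd; case: eqP => [e|_]; last exact: f1.
    by move: zW; rewrite e inE eqxx.
  by rewrite !e.
- by split; [apply: Pset h; rewrite inE eqxx | rewrite /= /upd eqxx].
- move=> j s2 jl so2 [h2 e2].
  have yx : (x == y) = false by apply: contraNF xw => /eqP->; rewrite inE eqxx.
  have xp : x \notin wr p by move: xw; rewrite inE negb_or => /andP[].
  split; last by rewrite run_rg //= /upd yx.
  apply: Pstep => //; last 1 first.
  + by apply: Pset h2; rewrite !inE eqxx orbT.
  + apply: (same_trans so'); apply: same_trans (same_setr _ _ _ _ _); last by rewrite !inE eqxx orbT.
    apply: (same_trans (same_setr _ _ _ i (mem_head x _))).
    by apply: same_weak so2 => // z zp; rewrite inE zp orbT.
  + by rewrite /= /upd yx.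
  + by rewrite /= /upd eqxx.
- by apply: Pset; [rewrite !inE eqxx orbT | apply: Pnext => //; case: h2].
Qed.

Section Index.
Variables (T : finType) (vs : seq T).
Hypotheses (Uvs : uniq vs) (vsT : forall x, x \in vs).
Notation ix := (ix vs).
Notation rep := (rep vs).

Lemma run_fill_rep i a e s (X : {set T}) : small T s -> i != 10 -> i != 1 -> a \notin ra e ->
  (forall x, ev (setr s i (ix x)) e = (x \in X)) -> rep (run (Fill i a e) s) a X.
Proof. by rewrite runE; apply: fill_rep. Qed.

Lemma run_count t i e s (Q : pred T) : small T s -> uniq [:: t; i; 10; 1] -> t \notin rr e ->
  (forall x, ev (setr s i (ix x)) e = Q x) -> rg (run (Count t i e) s) t = #|Q|.
Proof. by rewrite runE; apply: count_set. Qed.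

Lemma run_find t i a s (X : {set T}) : small T s -> uniq [:: t; i; 10; 1] -> rep s a X ->
  rg (run (Find t i a) s) t = (if pick_last vs X is Some x then ix x else rg s 1).
Proof. by rewrite runE; apply: find_last. Qed.

Lemma run_rank a s (X : {set T}) : small T s -> rep s a X -> a != 12 ->
  rg (run (Rank a) s) 30 = size (rank vs X) /\
  forall i, i < size (rank vs X) -> ar (run (Rank a) s) 12 i = nth 0 (map ix (rank vs X)) i.
Proof. by rewrite runE; apply: rank_list. Qed.

Lemma run_reach e s (r : rel T) (X : {set T}) : small T s -> rep s 11 X ->
  [&& 30 \notin rr e, 31 \notin rr e, 34 \notin rr e, 11 \notin ra e & 12 \notin ra e] ->
  (forall x y, ev (setr (setr s 32 (ix x)) 33 (ix y)) e = r x y) ->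
  rep (run (Reach e) s) 11 (cl r X).
Proof. by rewrite runE; apply: reach_rep. Qed.
End Index.

(** * The search for a 2-join as a program *)

Section View.
Variables (G : sgraph) (vs : seq G).
Hypotheses (Uvs : uniq vs) (vsT : forall x, x \in vs).
Notation ix := (ix vs).
Notation rep := (rep vs).

(* While a graph is treated, register 10 is its number of vertices; arrays 0 to *)
(* 3 are its adjacency matrix, the matrix of M, the labels and the names; arrays*)
(* 4 and 5 contain the numbers of vertices and of edges, 6 and 7 the ends of    *)
(* the edges. Row x of a matrix starts at index x (N + 1), where N, in register *)
(* 1, is the number of vertices of the root. Registers 2 and 3 are the number   *)
(* of edges of the root and the end of the heap.                                *)
Definition view (s : mstate) :=
  small G s /\ forall x y, ar s 0 (ix x * (rg s 1 + 1) + ix y) = adj x y.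

Lemma view_run p s : ~~ has (fun x => x \in wr p) [:: 1; 10] -> 0 \notin wa p ->
  view s -> view (run p s).
Proof.
rewrite /= !negb_or => /and3P[n1 n10 _] n0 [[h10 h1] h].
by split; [split|move=> x y]; rewrite ?(run_rg _ n1) ?(run_rg _ n10) ?(run_ar _ n0).
Qed.

Lemma view_setr s x v : x \notin [:: 1; 10] -> view s -> view (setr s x v).
Proof.
rewrite !inE negb_or => /andP[x1 x10] [[h10 h1] h].
by split; [split|move=> u w]; rewrite /= /upd ?(eq_sym 1) ?(eq_sym 10) ?(negPf x1) ?(negPf x10).
Qed.

Lemma rep_run p s a X : a \notin wa p -> rep s a X -> rep (run p s) a X.
Proof. by move=> h r x; rewrite run_ar. Qed.

Lemma ev_in s a e X x : rep s a X -> ev s e = ix x -> ev s (eIn a e) = (x \in X).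
Proof. by move=> r /= ->; rewrite lt0n r. Qed.

Lemma ev_equ s e1 e2 x y : ev s e1 = ix x -> ev s e2 = ix y -> ev s (Equ e1 e2) = (x == y).
Proof. by move=> /= -> ->; rewrite ix_eq. Qed.

Lemma ev_adj s e1 e2 x y : view s -> ev s e1 = ix x -> ev s e2 = ix y ->
  ev s (eAdj e1 e2) = adj x y.
Proof. by move=> [_ h] /= -> ->. Qed.

Lemma ev_eqb s e1 e2 (b1 b2 : bool) : ev s e1 = b1 -> ev s e2 = b2 -> ev s (Equ e1 e2) = (b1 == b2).
Proof. by move=> /= -> ->; case: b1; case: b2. Qed.

Lemma ev_by s e (b b' : bool) : ev s e = b -> b = b' -> ev s e = b'.
Proof. by move=> -> ->. Qed.

Lemma small_view s : view s -> small G s. Proof. by case. Qed.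
End View.

Ltac regs := solve [rewrite /= /upd; first [reflexivity | eassumption] | rewrite /= /upd /=; first [reflexivity | eassumption]].
Ltac evb := repeat first
  [ apply: ev_and | apply: ev_or | apply: ev_not
  | (eapply ev_in; [solve [eassumption]|regs])
  | (eapply ev_adj; [solve [repeat (apply: view_setr; [by []|]); eassumption]|regs|regs])
  | (eapply ev_equ; [solve [eassumption]|regs|regs]) ].

Definition args := [:: 12; 13; 14; 15].

Lemma args_setr p y v s : p \in args -> y \notin args -> rg (setr s y v) p = rg s p.
Proof. by move=> pa ya; rewrite /= /upd; case: eqP => // e; rewrite -e pa in ya. Qed.

Lemma args_run p P s : p \in args -> ~~ has (mem args) (wr P) -> rg (run P s) p = rg s p.
Proof. by move=> pa /hasPn h; apply: run_rg; apply: contraTN pa => /h. Qed.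

Lemma hargs p : p \in args -> [\/ p = 12, p = 13, p = 14 | p = 15].
Proof. by rewrite !inE => /or4P[]/eqP->; [apply: Or41|apply: Or42|apply: Or43|apply: Or44]. Qed.

Lemma hsplit a : a \in [:: 8; 9] -> a = 8 \/ a = 9.
Proof. by rewrite !inE => /orP[] /eqP->; [left|right]. Qed.

Ltac reg := first [solve [regs] |
  match goal with |- ev _ (Var ?p) = _ => change (ev ?s (Var p)) with (rg s p) end;
  rewrite !args_setr //; eassumption].
Ltac evb ::= repeat first
  [ apply: ev_and | apply: ev_or | apply: ev_not
  | (eapply ev_in; [solve [eassumption]|reg])
  | (eapply ev_adj; [solve [repeat (apply: view_setr; [by []|]); eassumption]|reg|reg])
  | (eapply ev_equ; [solve [eassumption]|reg|reg]) ].

Definition Copy a b := Fill 20 b (eIn a (Var 20)).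

(* Entry x of array 15 counts the y for which e holds of registers 46, 20.      *)
Definition Degs e := PFor 46 BN (PSeq (Count 47 20 e) (PArr 15 (Var 46) (Var 47))).

Definition eForced p1 p2 q1 q2 := let u := Var 32 in let v := Var 33 in
  eOr (eNot (Equ (eAdj u v) (eOr (eAnd (eAdj (Var p2) u) (eAdj (Var p1) v))
                                 (eAnd (eAdj (Var q2) u) (eAdj (Var q1) v)))))
 (eOr (eAnd (Equ u (Var p1)) (eAnd (eAdj (Var p1) v) (eAdj (Var q1) v)))
      (eAnd (Equ v (Var p2)) (eAnd (eAdj (Var p2) u) (eAdj (Var q2) u)))).

Definition Good := let x := Var 20 in let X := eIn 13 x in
  seqs [:: Fill 20 11 (eAnd X (eAdj (Var 40) x));
    Reach (eAnd (eIn 13 (Var 32)) (eAnd (eIn 13 (Var 33)) (eAdj (Var 32) (Var 33))));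
    Count 43 20 (eAnd (eIn 11 x) (eAnd X (eAdj (Var 41) x)));
    Count 48 20 (eAnd X (eNot (eIn 11 x)));
    Count 44 20 (eAnd X (eAdj (Var 40) x));
    Count 45 20 (eAnd X (eAdj (Var 41) x));
    Degs (eAnd X (eAdj (Var 46) x));
    Count 49 20 (eAnd X (Less (Cst 2) (Aget 15 x)));
    Count 35 20 (eAnd X (Less (Aget 15 x) (Cst 2)));
    PSet 43 (Less (Cst 0) (Var 43));
    PSet 42 (Less (Cst 0) (eAnd (Var 43) (eNot (eAnd (Equ (Var 44) (Cst 1)) (eAnd (Equ (Var 45) (Cst 1))
      (eAnd (Equ (Var 48) (Cst 0)) (eAnd (Equ (Var 49) (Cst 0)) (Less (Cst 0) (Var 35)))))))))].

Definition Test t l a p q :=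
  seqs [:: Copy a 13; PSet 40 (Var p); PSet 41 (Var q); Good; PSet t (Var 42); PSet l (Var 43)].

Definition Piv p1 p2 q1 a := let x := Var 20 in let u := Var 32 in let v := Var 33 in
  seqs [:: Fill 20 11 (eAnd (eNot (eIn a x)) (eAdj (Var p1) x));
    Reach (eAnd (eAdj u v) (eAnd (eNot (eIn a v)) (eAnd (eNot (eAdj (Var p1) v)) (eNot (eAdj (Var q1) v)))));
    Degs (eAnd (eNot (eIn a x)) (eAnd (eAdj (Var q1) x) (eAnd (eAdj (Var 46) x)
      (eOr (eNot (eAdj (Var p1) (Var 46))) (eNot (eAdj (Var p2) x))))));
    Fill 20 14 (eAnd (eNot (eIn a x)) (eOr (eAnd (eAdj (Var q1) x) (eAdj (Var p2) x))
      (eAnd (eIn 11 x) (Less (Cst 0) (Aget 15 x)))))].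

Definition Grow a p1 p2 q1 q2 :=
  seqs [:: Fill 20 11 (eOr (eIn a (Var 20)) (Equ (Var 20) (Var 59)));
    Reach (eForced p1 p2 q1 q2); Copy 11 a].

Definition Tests := seqs
  [:: Test 50 51 8 13 15; Fill 20 27 (eNot (eIn 8 (Var 20))); Test 52 53 27 12 14;
      Test 54 55 9 12 14; Fill 20 27 (eNot (eIn 9 (Var 20))); Test 56 57 27 13 15;
      Count 58 20 (eAnd (eIn 8 (Var 20)) (eIn 9 (Var 20)))].

Definition Check := PIf (eAnd (eNot (Var 11)) (Equ (Var 58) (Cst 0)))
  (PIf (eAnd (Var 50) (Var 52)) (PSeq (Copy 8 10) (PSet 11 (Cst 1)))
  (PIf (eAnd (Var 54) (Var 56))
    (PSeq (Fill 20 10 (eNot (eIn 9 (Var 20)))) (PSet 11 (Cst 1))) PSkip)) PSkip.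

Definition Pivot := PSeq
  (PIf (eNot (Var 55)) (Piv 12 13 14 8)
  (PIf (eNot (Var 51)) (Piv 13 12 15 9)
    (Fill 20 14 (eNot (eOr (eIn 8 (Var 20)) (eIn 9 (Var 20)))))))
  (Find 59 20 14).

Definition Step c := PIf (Var c) (Grow 8 12 13 14 15) (Grow 9 13 12 15 14).

Section Search.
Variables (G : sgraph) (vs : seq G).
Hypotheses (Uvs : uniq vs) (vsT : forall x, x \in vs).
Notation ix := (ix vs).
Notation rep := (rep vs).
Notation view := (view vs).

Lemma copy_rep a b s X : view s -> a != b -> rep s a X -> rep (run (Copy a b) s) b X.
Proof.
move=> [sm _] ab r; apply: (run_fill_rep Uvs vsT) => //; first by rewrite [ra _]/= inE eq_sym.
by move=> x; evb.
Qed.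

Lemma degs_val e s (r : rel G) : view s -> 47 \notin rr e -> 15 \notin ra e ->
  (forall x y, ev (setr (setr s 46 (ix x)) 20 (ix y)) e = r x y) ->
  forall x, ar (run (Degs e) s) 15 (ix x) = #|r x|.
Proof.
move=> [sm _] e47 e15 he.
have [s10 s1] := sm.
rewrite /Degs; set B := PSeq _ _.
have [|||s' [h _ ->]] := @run_for (fun k s' => forall x, ix x < k -> ar s' 15 (ix x) = #|r x|)
  46 BN B s (rg s 1).
- by [].
- by [].
- move=> k s' kN [f1 f2 f3] IH x; rewrite ltnS.
  have g1 y : y \notin [:: 20; 46; 47] -> rg s' y = rg s y.
    by move=> yn; apply: f1; move: yn; rewrite !inE !negb_or => /and3P[-> -> ->].
  have e1 : rg (run (Count 47 20 e) (setr s' 46 k)) 46 = k by rewrite run_rg //= /upd.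
  have ea : ar (run (Count 47 20 e) (setr s' 46 k)) 15 = ar s' 15 by rewrite run_ar.
  rewrite /B run_seq run_arr /= e1 ea /upd leq_eqVlt.
  case: eqP => [ek _|_ /= xk]; last by apply: IH.
  rewrite (@run_count _ _ Uvs vsT 47 20 e _ (r x)) //=.
  + by split; rewrite /= /upd /= g1.
  + move=> y; rewrite -he; apply: ev_ext => [z ze|b be|_].
    * rewrite /= /upd; case: eqP => // /eqP z20; case: eqP => [_|/eqP z46]; first by rewrite ek.
      apply: g1; rewrite !inE !negb_or z20 z46 /=; apply: contraNneq e47 => <- //.
    * move=> z /=; rewrite f2 //= !inE; apply: contraNneq e15 => <- //.
    * by rewrite f3.
- by move=> x; rewrite /=; apply: h; apply: ix_small Uvs vsT _ _ sm.
Qed.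

Lemma ev_forced s p1 p2 q1 q2 a1 a2 b1 b2 u v : view s ->
  rg s p1 = ix a1 -> rg s p2 = ix a2 -> rg s q1 = ix b1 -> rg s q2 = ix b2 ->
  rg s 32 = ix u -> rg s 33 = ix v -> ev s (eForced p1 p2 q1 q2) = forced a1 a2 b1 b2 u v.
Proof.
move=> V h1 h2 h3 h4 hu hv.
apply: ev_or; last by evb.
apply: ev_not; apply: ev_eqb; [|apply: ev_or]; evb.
Qed.

Lemma linked_cl (a b : G) X : linked a b X =
  (0 < #|[pred y | [&& y \in cl (induced X) [set x in X | adj a x], y \in X & adj b y]]|).
Proof.
apply/idP/card_gt0P => [/linkedP[x [y [xX yX ax b_y xy]]]|[y]].
  by exists y; rewrite inE yX b_y andbT andbT; apply/clP; exists x; rewrite ?inE ?xX.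
rewrite inE => /and3P[/clP[x]]; rewrite inE => /andP[xX ax] xy yX b_y.
by apply/linkedP; exists x, y.
Qed.

(** When a has a single neighbour in X, connectivity of X amounts to all of X being reached from it,
    so the set computed for [linked] is used again. *)
Lemma pathlike_cl (a b : G) X : pathlike a b X =
  [&& #|[pred x | (x \in X) && adj a x]| == 1, #|[pred x | (x \in X) && adj b x]| == 1,
      #|[pred x | (x \in X) && (x \notin cl (induced X) [set x in X | adj a x])]| == 0,
      #|[pred x | (x \in X) && (2 < deg X x)]| == 0
    & 0 < #|[pred x | (x \in X) && (deg X x < 2)]|].
Proof.
rewrite /pathlike /pathb.
have e c : #|[set x in X | adj c x]| = #|[pred x | (x \in X) && adj c x]|.
  by apply: eq_card => x; rewrite !inE.
rewrite !e; case: eqP => //= c1; case: eqP => //= _.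
have /cards1P[a0 ea] : #|[set x in X | adj a x]| == 1 by rewrite e c1.
rewrite ea; have /setP/(_ a0) := ea; rewrite !inE eqxx => /andP[a0X _].
congr [&& _, _ & _].
- apply/forall_inP/eqP => [h|/card0_eq h x xX].
    apply/eqP/pred0P => x /=; apply: contraTF (a0X) => /andP[xX /negP[]].
    by apply/clP; exists a0; rewrite ?inE //; have /forall_inP := h _ a0X; apply.
  have r y : y \in X -> connect (induced X) a0 y.
    move=> yX; have := h y; rewrite !inE yX /= => /negbFE /exists_inP[z].
    by rewrite inE => /eqP->.
  apply/forall_inP=> y yX; apply: connect_trans (r y yX).
  by rewrite connect_induced_sym r.
- apply/forall_inP/eqP => [h|/card0_eq h x xX].
    by apply/eqP/pred0P => x /=; apply/negP => /andP[/h]; rewrite ltnNge => ->.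
  by have := h x; rewrite !inE xX /= ltnNge => /negbFE.
- apply/exists_inP/card_gt0P => [[x xX dx]|[x]]; first by exists x; rewrite inE xX.
  by rewrite inE => /andP[xX dx]; exists x.
Qed.

Ltac viewd := repeat first [assumption | apply: view_run; [vmt|vmt|]].
Ltac repd := repeat first [assumption | apply: rep_run; [vmt|]].
Ltac rgd := rewrite ?run_rg; [|vmt..].

Lemma good_val s X a b : view s -> rep s 13 X -> rg s 40 = ix a -> rg s 41 = ix b ->
  rg (run Good s) 43 = linked a b X /\ rg (run Good s) 42 = good a b X.
Proof.
move=> V0 X0 a0 b0; rewrite /Good !run_cons run_nil.
set RS := cl (induced X) [set x in X | adj a x].
set s1 := run (Fill _ _ _) s.
have V1 : view s1 by viewd. have X1 : rep s1 13 X by repd.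
have a1 : rg s1 40 = ix a by rgd. have b1 : rg s1 41 = ix b by rgd.
have R1 : rep s1 11 [set x in X | adj a x].
  apply: (run_fill_rep Uvs vsT) => //; first exact: small_view V0.
  by move=> x; eapply ev_by; [evb|rewrite inE].
set s2 := run (Reach _) s1.
have V2 : view s2 by viewd. have X2 : rep s2 13 X by repd.
have a2 : rg s2 40 = ix a by rgd. have b2 : rg s2 41 = ix b by rgd.
have R2 : rep s2 11 RS.
  apply: (run_reach Uvs vsT) => //; first exact: small_view V1.
  by move=> x y; evb.
set s3 := run (Count 43 _ _) s2.
have V3 : view s3 by viewd. have X3 : rep s3 13 X by repd.
have a3 : rg s3 40 = ix a by rgd. have b3 : rg s3 41 = ix b by rgd.
have R3 : rep s3 11 RS by repd.
have e43 : rg s3 43 = #|[pred y | [&& y \in RS, y \in X & adj b y]]|.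
  apply: (run_count Uvs vsT) => //; first exact: small_view V2.
  by move=> x; evb.
set s4 := run (Count 48 _ _) s3.
have V4 : view s4 by viewd. have X4 : rep s4 13 X by repd.
have a4 : rg s4 40 = ix a by rgd. have b4 : rg s4 41 = ix b by rgd.
have e48 : rg s4 48 = #|[pred x | (x \in X) && (x \notin RS)]|.
  apply: (run_count Uvs vsT) => //; first exact: small_view V3.
  by move=> x; evb.
set s5 := run (Count 44 _ _) s4.
have V5 : view s5 by viewd. have X5 : rep s5 13 X by repd.
have b5 : rg s5 41 = ix b by rgd.
have e44 : rg s5 44 = #|[pred x | (x \in X) && adj a x]|.
  apply: (run_count Uvs vsT) => //; first exact: small_view V4.
  by move=> x; evb.
set s6 := run (Count 45 _ _) s5.
have V6 : view s6 by viewd. have X6 : rep s6 13 X by repd.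
have e45 : rg s6 45 = #|[pred x | (x \in X) && adj b x]|.
  apply: (run_count Uvs vsT) => //; first exact: small_view V5.
  by move=> x; evb.
set s7 := run (Degs _) s6.
have V7 : view s7 by viewd. have X7 : rep s7 13 X by repd.
have D7 x : ar s7 15 (ix x) = deg X x.
  rewrite (@degs_val _ _ (fun x y => (y \in X) && adj x y) V6) //; first by apply: eq_card => y; rewrite !inE.
  by move=> {}x y; evb.
set s8 := run (Count 49 _ _) s7.
have V8 : view s8 by viewd. have X8 : rep s8 13 X by repd.
have D8 x : ar s8 15 (ix x) = deg X x by rewrite run_ar // D7.
have e49 : rg s8 49 = #|[pred x | (x \in X) && (2 < deg X x)]|.
  apply: (run_count Uvs vsT) => //; first exact: small_view V7.
  by move=> x; apply: ev_and; [evb|rewrite /= /upd /= D7].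
set s9 := run (Count 35 _ _) s8.
have e35 : rg s9 35 = #|[pred x | (x \in X) && (deg X x < 2)]|.
  apply: (run_count Uvs vsT) => //; first exact: small_view V8.
  by move=> x; apply: ev_and; [evb|rewrite /= /upd /= D8].
rewrite !run_set.
have f43 : rg s9 43 = rg s3 43 by do 6 (rewrite [LHS]run_rg; last by vmt).
have f48 : rg s9 48 = rg s4 48 by do 5 (rewrite [LHS]run_rg; last by vmt).
have f44 : rg s9 44 = rg s5 44 by do 4 (rewrite [LHS]run_rg; last by vmt).
have f45 : rg s9 45 = rg s6 45 by do 3 (rewrite [LHS]run_rg; last by vmt).
have f49 : rg s9 49 = rg s8 49 by do 1 (rewrite [LHS]run_rg; last by vmt).
have l43 : (0 < rg s9 43) = linked a b X by rewrite linked_cl -/RS f43 e43.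
split; first by rewrite /= /upd /= l43.
rewrite /good pathlike_cl -/RS -e35 -e49 -f49 -e48 -f48 -e44 -f44 -e45 -f45 -l43.
by rewrite /= /upd /= !mulnb lt0b; case: (_ && (_ && _)).
Qed.

Lemma test_val t l a p q s X x y : view s -> rep s a X -> rg s p = ix x -> rg s q = ix y ->
  p \in args -> q \in args -> [&& a != 13, t != l & t != 43] ->
  rg (run (Test t l a p q) s) t = good x y X /\ rg (run (Test t l a p q) s) l = linked x y X.
Proof.
move=> V r hx hy pa qa /and3P[a13 tl t43]; rewrite /Test 6!run_cons run_nil.
set s1 := run (Copy a 13) s; rewrite (run_set 40) (run_set 41) (run_set t) (run_set l).
have r1 : rep s1 13 X by apply: copy_rep V _ r.
have V1 : view s1 by viewd.
set s3 := setr (setr s1 40 _) 41 _.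
have [||||e43 e42] := @good_val s3 X x y.
- by do 2 (apply: view_setr; first by []).
- by [].
- by rewrite /= /upd /= args_run.
- by change (rg (setr s1 40 (rg s1 p)) q = ix y); rewrite args_setr // args_run.
by split; rewrite /= /upd ?eqxx ?(negPf tl) ?[43 == t]eq_sym ?(negPf t43).
Qed.

Lemma piv_rep s p1 p2 q1 a a1 a2 b1 b2 X : view s -> rep s a X ->
  rg s p1 = ix a1 -> rg s p2 = ix a2 -> rg s q1 = ix b1 ->
  [&& p1 \in args, p2 \in args & q1 \in args] -> a \in [:: 8; 9] ->
  rep (run (Piv p1 p2 q1 a) s) 14 (pivots a1 a2 b1 b2 X).
Proof.
move=> V0 r0 e1 e2 e3 /and3P[h1 h2 h3] h.
have [n11 n12 n15] : [/\ a != 11, a != 12 & a != 15] by move: h; rewrite !inE => /orP[] /eqP->.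
rewrite /Piv !run_cons run_nil.
set s1 := run (Fill _ _ _) s.
have V1 : view s1 by viewd.
have r1 : rep s1 a X by apply: rep_run r0; case: (hsplit h) => ->.
have f1 : rg s1 p1 = ix a1 by rewrite args_run.
have f2 : rg s1 p2 = ix a2 by rewrite args_run.
have f3 : rg s1 q1 = ix b1 by rewrite args_run.
have R1 : rep s1 11 [set v in ~: X | adj a1 v].
  apply: (run_fill_rep Uvs vsT) => //; first exact: small_view V0.
    by case: (hsplit h) => ->.
  by move=> x; eapply ev_by; [evb|rewrite !inE].
set s2 := run (Reach _) s1.
have V2 : view s2 by viewd.
have r2 : rep s2 a X by apply: rep_run r1; case: (hsplit h) => ->.
have g1 : rg s2 p1 = ix a1 by rewrite args_run.
have g2 : rg s2 p2 = ix a2 by rewrite args_run.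
have g3 : rg s2 q1 = ix b1 by rewrite args_run.
have R2 : rep s2 11 (from_a a1 b1 X).
  apply: (run_reach Uvs vsT) => //; first exact: small_view V1.
    by case: (hsplit h) => ->; case: (hargs h1) => ->; case: (hargs h3) => ->.
  by move=> x y; evb.
set s3 := run (Degs _) s2.
have V3 : view s3 by viewd.
have r3 : rep s3 a X by apply: rep_run r2; case: (hsplit h) => ->.
have k1 : rg s3 p1 = ix a1 by rewrite args_run.
have k2 : rg s3 p2 = ix a2 by rewrite args_run.
have k3 : rg s3 q1 = ix b1 by rewrite args_run.
have R3 : rep s3 11 (from_a a1 b1 X) by repd.
have D3 x : ar s3 15 (ix x) = #|[pred q | [&& q \notin X, adj b1 q, adj x q & ~~ adj a1 x || ~~ adj a2 q]]|.
  rewrite (@degs_val _ _ (fun x q => [&& q \notin X, adj b1 q, adj x q & ~~ adj a1 x || ~~ adj a2 q]) V2) //.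
  - by case: (hargs h1) => ->; case: (hargs h2) => ->; case: (hargs h3) => ->.
  - by case: (hsplit h) => ->.
  - by move=> {}x y; evb.
apply: (run_fill_rep Uvs vsT) => //; first exact: small_view V3.
  by case: (hsplit h) => ->.
move=> x; eapply ev_by.
  evb; instantiate (1 := [exists q, [&& q \notin X, adj b1 q, adj x q & ~~ adj a1 x || ~~ adj a2 q]]).
  rewrite /= /upd /= D3; congr nat_of_bool; apply/card_gt0P/existsP=> -[q]; by exists q.
by rewrite !inE.
Qed.

Lemma grow_rep s a p1 p2 q1 q2 a1 a2 b1 b2 X w : view s -> rep s a X ->
  rg s p1 = ix a1 -> rg s p2 = ix a2 -> rg s q1 = ix b1 -> rg s q2 = ix b2 ->
  [&& p1 \in args, p2 \in args, q1 \in args & q2 \in args] -> a \in [:: 8; 9] ->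
  rg s 59 = (if w is Some x then ix x else rg s 1) ->
  rep (run (Grow a p1 p2 q1 q2) s) a (cl (forced a1 a2 b1 b2) (addp X w)).
Proof.
move=> V0 r0 e1 e2 e3 e4 /and4P[h1 h2 h3 h4] h hw.
rewrite /Grow !run_cons run_nil.
have n11 : a != 11 by move: h; rewrite !inE => /orP[] /eqP->.
set s1 := run (Fill _ _ _) s.
have V1 : view s1 by viewd.
have R1 : rep s1 11 (addp X w).
  have sm := small_view V0; apply: (run_fill_rep Uvs vsT) => //.
    by case: (hsplit h) => ->.
  move=> x; eapply ev_by.
    apply: ev_or; first evb.
    by instantiate (1 := if w is Some y then x == y else false); rewrite /= /upd /= hw;
      case: w {hw} => [y|] /=; rewrite ?ix_eq // ltn_eqF // ix_small.
  by case: w {hw} => [y|] /=; rewrite ?orbF // orbC in_setU1.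
apply: copy_rep; first by viewd.
  by rewrite eq_sym.
apply: (run_reach Uvs vsT) => //; first exact: small_view V1.
  by case: (hargs h1) => ->; case: (hargs h2) => ->; case: (hargs h3) => ->;
    case: (hargs h4) => ->.
move=> x y; apply: ev_forced; first by do 2 (apply: view_setr; first by []).
all: first [by rewrite !args_setr // args_run | regs].
Qed.

Section Fixed.
Variables a1 a2 b1 b2 : G.

Definition ready (L R : {set G}) s := [/\ view s,
  [/\ rg s 12 = ix a1, rg s 13 = ix a2, rg s 14 = ix b1 & rg s 15 = ix b2],
  rep s 8 L & rep s 9 R].

Lemma ready_run L R p s : ~~ has (fun x => x \in wr p) [:: 1; 10; 12; 13; 14; 15] ->
  ~~ has (fun a => a \in wa p) [:: 0; 8; 9] -> ready L R s -> ready L R (run p s).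
Proof.
rewrite /= !negb_or !andbT => /and5P[n1 n10 n12 n13 /andP[n14 n15]] /and3P[m0 m8 m9].
move=> [V [e1 e2 e3 e4] r8 r9]; split.
- by apply: view_run V => //; rewrite /= (negPf n1) (negPf n10).
- by rewrite !run_rg.
- exact: rep_run r8.
- exact: rep_run r9.
Qed.

Lemma tests_val L R s : ready L R s -> let s' := run Tests s in
  [/\ ready L R s', rg s' 50 = good a2 b2 L /\ rg s' 51 = linked a2 b2 L,
      rg s' 52 = good a1 b1 (~: L), rg s' 54 = good a1 b1 R /\ rg s' 55 = linked a1 b1 R &
      rg s' 56 = good a2 b2 (~: R) /\ (rg s' 58 == 0) = [disjoint L & R]].
Proof.
move=> H s'; rewrite /s'; split; first by apply: ready_run H; vmt.
all: rewrite /Tests 7!run_cons run_nil.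
all: set s1 := run (Test 50 _ _ _ _) s; have H1 : ready L R s1 by apply: ready_run H; vmt.
all: set s2 := run (Fill _ _ _) s1; have H2 : ready L R s2 by apply: ready_run H1; vmt.
all: set s3 := run (Test 52 _ _ _ _) s2; have H3 : ready L R s3 by apply: ready_run H2; vmt.
all: set s4 := run (Test 54 _ _ _ _) s3; have H4 : ready L R s4 by apply: ready_run H3; vmt.
all: set s5 := run (Fill _ _ _) s4; have H5 : ready L R s5 by apply: ready_run H4; vmt.
all: set s6 := run (Test 56 _ _ _ _) s5; have H6 : ready L R s6 by apply: ready_run H5; vmt.
- have [V [h1 h2 h3 h4] r8 r9] := H.
  have [e50 e51] := @test_val 50 51 8 13 15 s _ _ _ V r8 h2 h4 isT isT isT.
  by split; do 6 (rewrite [LHS]run_rg; last by vmt).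
- have [V [h1 h2 h3 h4] r8 r9] := H2.
  have r27 : rep s2 27 (~: L).
    have [V1 _ r8' _] := H1; apply: (run_fill_rep Uvs vsT) => //; first exact: small_view V1.
    by move=> x; eapply ev_by; [evb|rewrite inE].
  have [e _] := @test_val 52 53 27 12 14 s2 _ _ _ V r27 h1 h3 isT isT isT.
  by do 4 (rewrite [LHS]run_rg; last by vmt).
- have [V [h1 h2 h3 h4] r8 r9] := H3.
  have [e e'] := @test_val 54 55 9 12 14 s3 _ _ _ V r9 h1 h3 isT isT isT.
  by split; do 3 (rewrite [LHS]run_rg; last by vmt).
have [V [h1 h2 h3 h4] r8 r9] := H5.
have r27 : rep s5 27 (~: R).
  have [V1 _ _ r9'] := H4; apply: (run_fill_rep Uvs vsT) => //; first exact: small_view V1.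
  by move=> x; eapply ev_by; [evb|rewrite inE].
have [e _] := @test_val 56 57 27 13 15 s5 _ _ _ V r27 h2 h4 isT isT isT.
split; first by rewrite [LHS]run_rg //; vmt.
have [V6 _ r86 r96] := H6.
rewrite (run_count (Q := [pred x | (x \in L) && (x \in R)]) Uvs vsT) //.
- exact: small_view V6.
- by move=> x; evb.
Qed.
End Fixed.

End Search.

Lemma reg_ge n x p : all (fun y => y < n) (wr p) -> n <= x -> x \notin wr p.
Proof. by move=> /allP h nx; apply: contraL nx => /h; rewrite -ltnNge. Qed.

(** The guesses are read from registers c, c + 1 and so on. Unlike [srch], the stages go on after a
    success, but then [Check] no longer changes the answer, since register 11 is set. *)
Fixpoint Stages c k := if k is k'.+1
  then seqs [:: Tests; Check; Pivot; Step c; Stages c.+1 k'] else seqs [:: Tests; Check].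

Lemma stages0 c : Stages c (size (@nil bool)) = seqs [:: Tests; Check]. Proof. by []. Qed.

Lemma stagesS c (b : bool) cs : Stages c (size (b :: cs)) =
  seqs [:: Tests; Check; Pivot; Step c; Stages c.+1 (size cs)].
Proof. by []. Qed.

Section Search.
Variables (G : sgraph) (vs : seq G).
Hypotheses (Uvs : uniq vs) (vsT : forall x, x \in vs).
Notation ix := (ix vs).
Notation rep := (rep vs).
Notation view := (view vs).
Notation pk := (pick_last vs).
Section Fixed.
Variables a1 a2 b1 b2 : G.
Notation ready := (ready vs a1 a2 b1 b2).

(* Register 11 tells whether array 10 holds a solution. *)
Definition outcome (r : option {set G}) (s s' : mstate) :=
  if rg s 11 == 0 then
    if r is Some X then rg s' 11 = 1 /\ rep s' 10 X else rg s' 11 = 0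
  else rg s' 11 = rg s 11 /\ ar s' 10 = ar s 10.

Lemma check_val L R s : ready L R s -> rg s 50 = good a2 b2 L -> rg s 52 = good a1 b1 (~: L) ->
  rg s 54 = good a1 b1 R -> rg s 56 = good a2 b2 (~: R) -> (rg s 58 == 0) = [disjoint L & R] ->
  outcome (check a1 a2 b1 b2 L R) s (run Check s).
Proof.
move=> [V _ r8 r9] e50 e52 e54 e56 e58; rewrite /outcome /Check run_if /= e58 mulnb eqb0 negbK.
case: eqP => [e11|e11] /=; last by rewrite run_skip.
rewrite /check; case: [disjoint _ & _]; last by rewrite run_skip.
rewrite run_if /= e50 e52 mulnb eqb0 negbK; case: (_ && _).
  rewrite run_seq run_set; split; first by [].
  by apply: copy_rep V _ r8.
rewrite run_if /= e54 e56 mulnb eqb0 negbK; case: (_ && _); last by rewrite run_skip.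
rewrite run_seq run_set; split; first by [].
have [sm _] := V; apply: (run_fill_rep Uvs vsT) => //.
by move=> x; eapply ev_by; [evb|rewrite inE].
Qed.

Lemma pivot_val L R s : ready L R s -> rg s 51 = linked a2 b2 L -> rg s 55 = linked a1 b1 R ->
  rg (run Pivot s) 59 = (if pivot pk a1 a2 b1 b2 L R is Some x then ix x else rg s 1).
Proof.
move=> H e51 e55; have [V [h1 h2 h3 h4] r8 r9] := H; have [sm _] := V.
rewrite /Pivot run_seq; set P := PIf _ _ _; set s1 := run P s.
have H1 : ready L R s1 by apply: ready_run H; vmt.
have [[sm1 _] _ _ _] := H1.
have <- : rg s1 1 = rg s 1 by rewrite run_rg //; vmt.
apply: (run_find Uvs vsT) => //; rewrite /s1 /P run_if /= e55 eqb0.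
case: (linked a1 b1 R) => /=; last by apply: piv_rep V r8 h1 h2 h3 isT isT.
rewrite run_if /= e51 eqb0.
case: (linked a2 b2 L) => /=; last by apply: piv_rep V r9 h2 h1 h4 isT isT.
apply: (run_fill_rep Uvs vsT) => // x.
by eapply ev_by; [evb|rewrite !inE].
Qed.

Lemma step_val L R c s : ready L R s ->
  rg s 59 = (if pivot pk a1 a2 b1 b2 L R is Some x then ix x else rg s 1) ->
  let s' := run (Step c) s in
  if rg s c != 0 then ready (growL pk a1 a2 b1 b2 L R) R s'
  else ready L (growR pk a1 a2 b1 b2 L R) s'.
Proof.
move=> [V [h1 h2 h3 h4] r8 r9] e59 s'; rewrite /s' /Step run_if [ev _ _]/=.
case: (rg s c != 0); split; try (by rewrite !run_rg); try (by apply: rep_run => //; vmt).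
- by apply: view_run V; vmt.
- by apply: grow_rep r8 h1 h2 h3 h4 isT isT e59.
- by apply: view_run V; vmt.
- by apply: grow_rep r9 h2 h1 h4 h3 isT isT e59.
Qed.

Lemma stages_val cs c L R s : ready L R s -> 60 <= c ->
  (forall j, j < size cs -> (rg s (c + j) != 0) = nth false cs j) ->
  outcome (srch pk a1 a2 b1 b2 cs L R) s (run (Stages c (size cs)) s).
Proof.

elim: cs c L R s => [|b cs IH] c L R s H c60 bits; rewrite ?stagesS ?stages0 2!run_cons.
all: set s1 := run Tests s; have [H1 [e50 e51] e52 [e54 e55] [e56 e58]] := tests_val Uvs vsT H.
all: have e11 : rg s1 11 = rg s 11 by rewrite run_rg //; vmt.
all: have e10 : ar s1 10 = ar s 10 by rewrite run_ar //; vmt.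
all: set s2 := run Check s1; have O2 : outcome (check a1 a2 b1 b2 L R) s s2
  by rewrite /outcome -e11 -e10; apply: check_val.
  by rewrite run_nil /=; case: (check _ _ _ _ _ _) O2.
rewrite 3!run_cons run_nil.
have H2 : ready L R s2 by apply: ready_run H1; vmt.
set s3 := run Pivot s2; have H3 : ready L R s3 by apply: ready_run H2; vmt.
have f50 x : x \in [:: 50; 51; 52; 54; 55; 56; 58] -> rg s2 x = rg s1 x.
  by move=> h; apply: run_rg; move: x h; apply/allP; vmt.
have e59 := @pivot_val L R s2 H2 (etrans (f50 51 isT) e51) (etrans (f50 55 isT) e55).
have e1 : rg s3 1 = rg s2 1 by rewrite run_rg //; vmt.
rewrite -e1 in e59; have /= H4 := @step_val L R c s3 H3 e59.
set s4 := run (Step c) s3 in H4 *.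
have low x : 60 <= x -> rg s4 x = rg s x.
  by move=> x60; rewrite !run_rg //; apply: reg_ge x60; vmt.
have e11' : rg s4 11 = rg s2 11 by do 2 (rewrite [LHS]run_rg; last by vmt).
have e10' : ar s4 10 = ar s2 10 by do 2 (rewrite [LHS]run_ar; last by vmt).
have bits' j : j < size cs -> (rg s4 (c.+1 + j) != 0) = nth false cs j.
  by move=> js; rewrite low; [rewrite addSnnS (bits j.+1) | lia].
have bc : (rg s3 c != 0) = b.
  have -> : rg s3 c = rg s c by rewrite !run_rg //; apply: reg_ge c60; vmt.
  by have := bits 0 isT; rewrite addn0.
have O5 : outcome (if b then srch pk a1 a2 b1 b2 cs (growL pk a1 a2 b1 b2 L R) R
    else srch pk a1 a2 b1 b2 cs L (growR pk a1 a2 b1 b2 L R)) s4 (run (Stages c.+1 (size cs)) s4).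
  by move: H4; rewrite bc; case: (b) => H4; apply: IH => //; lia.
move: O2 O5; rewrite /outcome [srch _ _ _ _ _ _ _ _]/= e11' e10'.
case: (eqVneq (rg s 11) 0) => [e0|e0]; last by move=> [-> ->]; rewrite (negPf e0).
case: (check _ _ _ _ _ _) => [X|] /=.
  by move=> [-> r] /= [-> e]; split=> // x; rewrite e; apply: r.
by move=> ->.
Qed.

Definition base s := view s /\
  [/\ rg s 12 = ix a1, rg s 13 = ix a2, rg s 14 = ix b1 & rg s 15 = ix b2].

Definition Body := seqs
  [:: Fill 20 11 (eOr (Equ (Var 20) (Var 12)) (Equ (Var 20) (Var 14)));
      Reach (eForced 12 13 14 15); Copy 11 8;
      Fill 20 11 (eOr (Equ (Var 20) (Var 13)) (Equ (Var 20) (Var 15)));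
      Reach (eForced 13 12 15 14); Copy 11 9; Stages 60 11].

Lemma base_run p s : ~~ has (fun x => x \in wr p) [:: 1; 10; 12; 13; 14; 15] ->
  0 \notin wa p -> base s -> base (run p s).
Proof.
rewrite /= !negb_or !andbT => /and5P[n1 n10 n12 n13 /andP[n14 n15]] m0.
move=> [V [e1 e2 e3 e4]]; split; last by rewrite !run_rg.
by apply: view_run V => //; rewrite /= (negPf n1) (negPf n10).
Qed.

Lemma start_rep s p1 p2 q1 q2 x1 x2 y1 y2 : view s ->
  rg s p1 = ix x1 -> rg s p2 = ix x2 -> rg s q1 = ix y1 -> rg s q2 = ix y2 ->
  [&& p1 \in args, p2 \in args, q1 \in args & q2 \in args] ->
  rep (run (Reach (eForced p1 p2 q1 q2))
    (run (Fill 20 11 (eOr (Equ (Var 20) (Var p1)) (Equ (Var 20) (Var q1)))) s)) 11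
    (cl (forced x1 x2 y1 y2) [set x1; y1]).
Proof.
move=> V e1 e2 e3 e4 /and4P[h1 h2 h3 h4]; set s1 := run (Fill _ _ _) s.
have V1 : view s1 by apply: view_run V; vmt.
have [sm _] := V; have [sm1 _] := V1.
apply: (run_reach Uvs vsT) => //.
- apply: (run_fill_rep Uvs vsT) => // x.
  eapply ev_by; last by rewrite in_set2.
  by evb.
- by case: (hargs h1) => ->; case: (hargs h2) => ->; case: (hargs h3) => ->; case: (hargs h4) => ->.
move=> x y; apply: (ev_forced vsT); first by do 2 (apply: view_setr; first by []).
all: first [by rewrite !args_setr // args_run | regs].
Qed.

Lemma body_val cs s : base s -> size cs = 11 ->
  (forall j, j < 11 -> (rg s (60 + j) != 0) = nth false cs j) ->
  outcome (search pk a1 a2 b1 b2 cs) s (run Body s).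
Proof.
move=> H sz bits; rewrite /Body 7!run_cons run_nil.
set s1 := run (Fill _ _ _) s; have H1 : base s1 by apply: base_run H; vmt.
set s2 := run (Reach _) s1; have H2 : base s2 by apply: base_run H1; vmt.
set s3 := run (Copy _ _) s2; have H3 : base s3 by apply: base_run H2; vmt.
set s4 := run (Fill _ _ _) s3; have H4 : base s4 by apply: base_run H3; vmt.
set s5 := run (Reach _) s4; have H5 : base s5 by apply: base_run H4; vmt.
set s6 := run (Copy _ _) s5; have H6 : base s6 by apply: base_run H5; vmt.
have r8 : rep s6 8 (cl (forced a1 a2 b1 b2) [set a1; b1]).
  do 3 (apply: rep_run; first by vmt).
  apply: copy_rep (proj1 H2) _ _ => //.
  by have [V [e1 e2 e3 e4]] := H; apply: start_rep.
have r9 : rep s6 9 (cl (forced a2 a1 b2 b1) [set a2; b2]).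
  apply: copy_rep (proj1 H5) _ _ => //.
  by have [V [e1 e2 e3 e4]] := H3; apply: start_rep.
have e11 : rg s6 11 = rg s 11 by do 6 (rewrite [LHS]run_rg; last by vmt).
have e10 : ar s6 10 = ar s 10 by do 6 (rewrite [LHS]run_ar; last by vmt).
have := @stages_val cs 60 _ _ s6 _ isT; rewrite /outcome e11 e10 sz; apply.
  by have [V e] := H6; split; last exact: r9.
move=> j /bits <-.
have lt : 60 <= 60 + j by apply: leq_addr.
by do 6 (rewrite [rg _ (60 + j)]run_rg; last by apply: reg_ge lt; vmt).
Qed.

(** Runs through all 2^11 sequences of guesses, a constant number, with the guesses in the loop
    registers from 60 on. *)
Fixpoint Nest c k := if k is k'.+1 then PFor c (BC 2) (Nest c.+1 k') else Body.

Lemma nest_wr c k x : x \in wr (Nest c k) -> x \in wr Body \/ c <= x.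
Proof.
elim: k c => [|k IH] c; first by left.
by rewrite [wr _]/= inE => /orP[/eqP->|/IH[|h]]; [right | left | right; apply: ltnW].
Qed.

Lemma nest_wa c k : wa (Nest c k) = wa Body.
Proof. by elim: k c => //= k IH c. Qed.

(** P is what has been established in case nothing was found; an answer found earlier is left
    untouched. *)
Definition report (P : Prop) (s s' : mstate) :=
  if rg s 11 == 0 then if rg s' 11 == 0 then P
    else exists2 X, target a1 a2 b1 b2 X & rep s' 10 X
  else rg s' 11 = rg s 11 /\ ar s' 10 = ar s 10.

Lemma report_trans P Q s s1 s2 : report P s s1 -> report Q s1 s2 -> report (P /\ Q) s s2.
Proof.
rewrite /report; case: eqP => e.
  case: eqP => e1; first by case: eqP.
  move=> [X tX r] [e2 e3]; rewrite e2; case: eqP => // _.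
  by exists X => // x; rewrite e3.
by move=> [-> ->]; case: eqP.
Qed.

Lemma report_imp P Q s s' : (P -> Q) -> report P s s' -> report Q s s'.
Proof. by rewrite /report => h; case: ifP => // _; case: ifP. Qed.

(** [pre] is the sequence of guesses fixed by the enclosing loops. *)
Lemma nest_val k pre s : base s -> size pre + k = 11 ->
  (forall j, j < size pre -> (rg s (60 + j) != 0) = nth false pre j) ->
  report (forall cs, size cs = k -> search pk a1 a2 b1 b2 (pre ++ cs) = None) s
    (run (Nest (60 + size pre) k) s).
Proof.
have pkP := pick_lastP vsT.
elim: k pre s => [|k IH] pre s H sz bits.
  rewrite addn0 in sz; rewrite sz in bits.
  have := body_val H sz bits; rewrite /outcome /report [Nest _ _]/=.
  case: ifP => // _; case e: (search _ _ _ _ _ _) => [X|].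
    by move=> [-> r]; exists X => //; apply: (search_sound e).
  by move=> -> cs /size0nil->; rewrite cats0.
rewrite [Nest _ _]/=; set c := 60 + size pre; set p := Nest c.+1 k.
have keep s' : same_off (c :: wr p) (wa p) (wh p) s s' ->
    base s' /\ forall j, j < size pre -> (rg s' (60 + j) != 0) = nth false pre j.
  move=> [f1 f2 _].
  have out x : x \notin wr Body -> x < 60 -> x \notin c :: wr p.
    move=> xB x60; rewrite inE negb_or; apply/andP; split; first by apply/eqP; rewrite /c; lia.
    by apply/negP => /nest_wr[xB'|]; [rewrite xB' in xB | rewrite /c; lia].
  have [[[s10 s1] V] [e1 e2 e3 e4]] := H.
  have b1' : 1 \notin c :: wr p by apply: out; [vmt|].
  have b10 : 10 \notin c :: wr p by apply: out; [vmt|].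
  split; first split.
  - split; first by split; rewrite f1.
    by move=> x y; rewrite f1 // f2 ?V // nest_wa; vmt.
  - by split; rewrite f1 //; apply: out => //; vmt.
  - move=> j jp; rewrite f1 ?bits // inE negb_or; apply/andP; split.
      by rewrite /c eqn_add2l neq_ltn jp.
    apply/negP => /nest_wr[h|]; last by rewrite /c; lia.
    have /allP/(_ _ h) : all (fun x => x < 60) (wr Body) by vmt.
    by rewrite /=; lia.
have [|||s' [h _ ->]] := @run_for (fun i s' => report (forall b cs, nat_of_bool b < i -> size cs = k ->
    search pk a1 a2 b1 b2 (pre ++ b :: cs) = None) s s') c (BC 2) p s 2.
- by [].
- by rewrite /report; case: ifP => // ->.
- move=> i s' i2 so R; apply: report_imp (report_trans R _); last first.
    have := IH (rcons pre (i != 0)) (setr s' c i); rewrite size_rcons addnS; apply=> //.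
    - have [[V [e1 e2 e3 e4]] _] := keep s' so.
      split; first by apply: view_setr V; rewrite /c !inE !negb_or; lia.
      by split; rewrite args_setr //; rewrite /c !inE; lia.
    - by rewrite addSnnS.
    - move=> j; have [_ b'] := keep s' so; rewrite ltnS nth_rcons leq_eqVlt => /orP[/eqP->|lt].
        by rewrite ltnn eqxx /= /upd eqxx.
      by rewrite lt /= /upd /c eqn_add2l (ltn_eqF lt) b'.
  move=> [h1 h2] b cs; rewrite ltnS leq_eqVlt => /orP[/eqP eb|]; last exact: h1.
  have -> : b = (i != 0) by rewrite -eb; case: (b).
  by rewrite -cat_rcons; apply: h2.
rewrite /report /= /upd.
have -> : (11 == c) = false by rewrite /c.
move: h; rewrite /report; case: ifP => // _; case: ifP => // _ h [|b cs] //= [sc].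
by apply: h => //; case: (b).
Qed.

Lemma search_val s : base s -> adj a1 a2 -> adj b1 b2 ->
  report (forall X, ~ target a1 a2 b1 b2 X) s (run (Nest 60 11) s).
Proof.
move=> H a12 b12; have h0 j : j < 0 -> (rg s (60 + j) != 0) = nth false [::] j by [].
apply: report_imp (@nest_val 11 [::] s H erefl h0) => h X tX.
have [cs sz] := search_complete (pick_lastP vsT) a12 b12 tX.
by rewrite (h cs sz).
Qed.

End Fixed.
End Search.

(** * The test of one edge against all edges, and the choice of the edge *)

Definition Try := PIf (eNot (Var 11)) (seqs
  [:: PIf (Var 81)
        (seqs [:: PSet 14 (Aget 6 (Var 80)); PSet 15 (Aget 7 (Var 80))])
        (seqs [:: PSet 14 (Aget 7 (Var 80)); PSet 15 (Aget 6 (Var 80))]);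
      Nest 60 11]) PSkip.

Definition Hunt := PSeq (PSet 11 (Cst 0))
  (PFor 80 BM (PIf (Less (Var 80) (Aget 5 (Cst 0))) (PFor 81 (BC 2) Try) PSkip)).

(* Sets registers 12 and 13 to a pair satisfying e, and 16 to v.                *)
Definition Pick v e := PFor 20 BN (PFor 21 BN
  (PIf (eAnd (Less (Var 20) (Var 10)) (eAnd (Less (Var 21) (Var 10)) e))
    (seqs [:: PSet 12 (Var 20); PSet 13 (Var 21); PSet 16 (Cst v)]) PSkip)).

Section Hunt.
Variables (G : sgraph) (vs : seq G) (es : seq (G * G)).
Hypotheses (Uvs : uniq vs) (vsT : forall x, x \in vs).
Notation ix := (ix vs).
Notation rep := (rep vs).
Notation view := (view vs).

Definition lists s := [/\ ar s 5 0 = size es, size es <= rg s 2,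
  forall k, k < size es -> ar s 6 k = nth 0 [seq ix e.1 | e <- es] k &
  forall k, k < size es -> ar s 7 k = nth 0 [seq ix e.2 | e <- es] k].

Lemma lists_run p s : 2 \notin wr p -> [&& 5 \notin wa p, 6 \notin wa p & 7 \notin wa p] ->
  lists s -> lists (run p s).
Proof. by move=> n2 /and3P[n5 n6 n7] [h1 h2 h3 h4]; split; rewrite ?run_rg ?run_ar. Qed.

Lemma lists_off w a h s s' : same_off w a h s s' -> 2 \notin w ->
  [&& 5 \notin a, 6 \notin a & 7 \notin a] -> lists s -> lists s'.
Proof. by move=> [f1 f2 _] n2 /and3P[n5 n6 n7] [h1 h2 h3 h4]; split; rewrite ?f1 ?f2. Qed.

Lemma view_off w a h s s' : same_off w a h s s' -> ~~ has (fun x => x \in w) [:: 1; 10] ->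
  0 \notin a -> view s -> view s'.
Proof.
rewrite /= !negb_or => -[f1 f2 _] /and3P[n1 n10 _] n0 [[h10 h1] hh].
by split; [split|move=> x y]; rewrite ?(f1 _ n1) ?(f1 _ n10) ?(f2 _ n0).
Qed.

Variables a1 a2 : G.
Hypothesis a12 : adj a1 a2.
Hypothesis esP : {in es, forall e, adj e.1 e.2}.
Hypothesis esA : forall u v, adj u v -> ((u, v) \in es) || ((v, u) \in es).

Definition found s := exists b1 b2 X, [/\ adj b1 b2, target a1 a2 b1 b2 X,
  rg s 14 = ix b1, rg s 15 = ix b2 & rep s 10 X].

Definition tried (P : Prop) s := if rg s 11 == 0 then P else found s.

Let env s := [/\ view s, lists s, rg s 12 = ix a1 & rg s 13 = ix a2].

Let env_off w a h s s' : same_off w a h s s' ->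
  ~~ has (fun x => x \in w) [:: 1; 2; 10; 12; 13] ->
  ~~ has (fun x => x \in a) [:: 0; 5; 6; 7] -> env s -> env s'.
Proof.
rewrite /= !negb_or !andbT => so /and5P[n1 n2 n10 n12 n13] /and4P[m0 m5 m6 m7] [V L h12 h13].
have [f1 _ _] := so; split; rewrite ?f1 //.
- by apply: view_off so _ m0 V; rewrite /= (negPf n1) (negPf n10).
- by apply: lists_off so n2 _ L; rewrite m5 m6.
Qed.

Lemma try_val s b1 b2 (P : Prop) o : env s -> tried P s -> adj b1 b2 -> rg s 81 = o ->
  ar s 6 (rg s 80) = (if o == 0 then ix b2 else ix b1) ->
  ar s 7 (rg s 80) = (if o == 0 then ix b1 else ix b2) ->
  tried (P /\ forall X, ~ target a1 a2 b1 b2 X) (run Try s).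
Proof.
move=> [V L h12 h13] T b12 e81 e6 e7; rewrite /Try run_if [ev _ _]/= eqb0 negbK.
move: T; rewrite /tried; case: (eqVneq (rg s 11) 0) => [e11|/negPf e11] T; last by rewrite run_skip e11.
rewrite 2!run_cons run_nil; set s1 := run (PIf _ _ _) s.
have [e14 e15] : rg s1 14 = ix b1 /\ rg s1 15 = ix b2.
  rewrite /s1 run_if [ev _ _]/= e81; case: (o == 0) e6 e7 => /= e6 e7;
    by rewrite 2!run_cons run_nil !run_set /= /upd /= ?e6 ?e7.
have V1 : view s1 by apply: view_run V; vmt.
have B1 : base vs a1 a2 b1 b2 s1 by split=> //; split=> //; rewrite run_rg //; vmt.
have e11' : rg s1 11 = 0 by rewrite run_rg //; vmt.
have := search_val Uvs vsT B1 a12 b12; rewrite /report e11' /=; case: ifP => // _ [X tX r].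
exists b1, b2, X; split=> //; rewrite run_rg //; vmt.
Qed.

(** Each edge is listed in one orientation, so both are tried for b1b2; a1a2 needs only one by
    [separates_target]. *)
Lemma hunt_val s : env s -> let s' := run Hunt s in env s' /\
  tried (forall b1 b2 X, adj b1 b2 -> ~ target a1 a2 b1 b2 X) s'.
Proof.
move=> E s'; split; first by apply: env_off (run_same Hunt s) _ _ E; vmt.
rewrite /s' /Hunt run_seq run_set; set s0 := setr s 11 0.
have E0 : env s0 by have := run_same (PSet 11 (Cst 0)) s; rewrite run_set => so; apply: env_off so _ _ E; vmt.
set B := PIf _ _ _.
have [|||s1 [T _ ->]] := @run_for (fun k s' => tried (forall e X, e \in take k es ->
    ~ target a1 a2 e.1 e.2 X /\ ~ target a1 a2 e.2 e.1 X) s') 80 BM B s0 (rg s0 2).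
- by [].
- by rewrite /tried /=; move=> e X; rewrite take0.
- move=> k s1 kM so T; have E1 : env s1 by apply: env_off so _ _ E0; vmt.
  rewrite /B run_if [ev _ _]/=; have [V1 [l1 l2 l3 l4] h12 h13] := E1.
  rewrite l1 {1}/upd eqxx eqb0 -leqNgt.
  case: (ltnP k (size es)) => kes; last first.
    by rewrite run_skip; move: T; rewrite !take_oversize // ltnW.
  have [e ees ek] : exists2 e, e \in es & take k.+1 es = rcons (take k es) e /\
      ix e.1 = nth 0 [seq ix e.1 | e <- es] k /\ ix e.2 = nth 0 [seq ix e.2 | e <- es] k.
    exists (nth (a1, a1) es k); first exact: mem_nth.
    by rewrite (take_nth (a1, a1)) // !(nth_map (a1, a1)).
  have [-> [ek1 ek2]] := ek.
  have E2 : env (setr s1 80 k).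
    by have := run_same (PSet 80 (Cst k)) s1; rewrite run_set => so2; apply: env_off so2 _ _ E1; vmt.
  have [|||s2 [T2 _ ->]] := @run_for (fun o s' => tried ((forall e X, e \in take k es ->
    ~ target a1 a2 e.1 e.2 X /\ ~ target a1 a2 e.2 e.1 X) /\ (0 < o -> forall X, ~ target a1 a2 e.2 e.1 X) /\
    (1 < o -> forall X, ~ target a1 a2 e.1 e.2 X)) s') 81 (BC 2) Try (setr s1 80 k) 2.
  + by [].
  + move: T; rewrite /tried /=; case: ifP => _ //.
  + move=> o s2 o2 so2 T2.
    have E3 : env (setr s2 81 o).
      have E3 : env s2 by apply: env_off so2 _ _ E2; vmt.
      by have := run_same (PSet 81 (Cst o)) s2; rewrite run_set => so3; apply: env_off so3 _ _ E3; vmt.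
    have e80 : rg s2 80 = k by have [f1 _ _] := so2; rewrite f1 //; vmt.
    have [_ [m1 m2 m3 m4] _ _] := E3.
    have := @try_val (setr s2 81 o) (if o == 0 then e.2 else e.1) (if o == 0 then e.1 else e.2) _ o E3 T2.
    have -> : rg (setr s2 81 o) 80 = k by [].
    rewrite m3 // m4 // -ek1 -ek2 /tried.
    have ea : adj (if o == 0 then e.2 else e.1) (if o == 0 then e.1 else e.2).
      by case: eqP => _; [rewrite adj_sym|]; apply: esP.
    case: o o2 ea {T2 E3 so2 m1 m2 m3 m4} => [|[|//]] _ /= ea h.
      have {}h := h ea erefl erefl erefl; move: h; case: ifP => // _ [[h1 h2] h3].
      by split.
    have {}h := h ea erefl erefl erefl; move: h; case: ifP => // _ [[h1 [h2 _]] h3].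
    by split.
  move: T2; rewrite /tried /=; case: ifP => // _ [h1 [h2 h3]] e' X.
  by rewrite mem_rcons inE => /orP[/eqP->|]; [split; [apply: h3|apply: h2] | apply: h1].
move: T; rewrite /tried /=; case: ifP => // _ h b1 b2 X b12 tX.
have [_ [_ le _ _] _ _] := E; rewrite take_oversize // in h.
by case/orP: (esA b12) => m; have [] := h _ X m.
Qed.

End Hunt.

Section Pick.
Variables (G : sgraph) (vs : seq G).
Hypotheses (Uvs : uniq vs) (vsT : forall x, x \in vs).
Notation ix := (ix vs).

Definition picked v (r : rel G) s := rg s 16 = v /\
  exists x y, [/\ r x y, rg s 12 = ix x & rg s 13 = ix y].

Lemma pick_val v e s (r : rel G) : small G s -> rg s 16 = 0 ->
  ~~ has (fun x => x \in rr e) [:: 12; 13; 16] ->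
  (forall x y, ev (setr (setr s 20 (ix x)) 21 (ix y)) e = r x y) ->
  let s' := run (Pick v e) s in
  (rg s' 16 = 0 /\ forall x y, ~~ r x y) \/ picked v r s'.
Proof.
rewrite /= !negb_or !andbT => -[s10 s1] e16 /and3P[r12 r13 r16] he.
pose Q (P : G -> G -> Prop) s' := (rg s' 16 = 0 /\ forall x y, P x y -> ~~ r x y) \/ picked v r s'.
pose R i j s' := Q (fun x y => ix x < i \/ ix x = i /\ ix y < j) s'.
have Rs i j s' z u : z \in [:: 20; 21] -> R i j s' -> R i j (setr s' z u).
  by rewrite !inE => /orP[]/eqP->.
have : R (rg s 1) 0 (run (Pick v e) s).
apply: (run_for2 (k := rg s 1) (l := rg s 1)) => //.
- by left; split=> // x y [|[]].
- move=> i s' iN [[h16 h]|h]; [left | by right]; split=> // x y [|[]//].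
  rewrite ltnS leq_eqVlt => /orP[/eqP ei|lt]; apply: h; [right | by left].
  by split=> //; apply: leq_trans (ix_lt Uvs vsT y) s1.
- move=> i j s' iN jN so e20 e21 h; rewrite run_if.
  have [f1 f2 f3] := so.
  have ee x y : i = ix x -> j = ix y -> ev s' e = r x y.
    move=> ei ej; rewrite -he; apply: ev_ext => [z ze|b _ z|_].
    - rewrite /= /upd; case: eqP => [->|/eqP z21]; first by rewrite e21.
      case: eqP => [->|/eqP z20]; first by rewrite e20.
      rewrite f1 // !inE !negb_or z20 z21 !andTb.
      by apply/and3P; split; [apply: contraNneq r12|apply: contraNneq r13|apply: contraNneq r16] => <-.
    - by rewrite /= f2.
    - by rewrite /= f3.
  have -> : (ev s' (eAnd (Less (Var 20) (Var 10)) (eAnd (Less (Var 21) (Var 10)) e)) != 0) =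
     [&& i < #|G|, j < #|G| & ev s' e != 0].
    by rewrite /= e20 e21 f1 // s10 !muln_eq0 !negb_or; case: (_ < _); case: (_ < _).
  case: ifP => [/and3P[iG jG]|no].
    have [x ex] := ix_onto Uvs vsT iG; have [y ey] := ix_onto Uvs vsT jG.
    rewrite (ee x y) // eqb0 negbK => rxy; right.
    rewrite 3!run_cons run_nil !run_set /picked /= /upd /= e20 e21; split=> //.
    by exists x, y.
  rewrite run_skip; case: h => [[h16 h]|h]; last by right.
  left; split=> // x y [lt|[ex]]; first by apply: h; left.
  rewrite ltnS leq_eqVlt => /orP[/eqP ey|lt]; last by apply: h; right.
  by move: no; rewrite -ex -ey !ix_lt //= (ee x y) // eqb0 negbK => /negbT.
move=> [[h16 h]|h]; [left | by right]; split=> // x y; apply: h; left.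
exact: leq_trans (ix_lt Uvs vsT x) s1.
Qed.

End Pick.

(** * Consistency *)

Section Consistency.
Variable G : sgraph.
Implicit Types (X A B : {set G}).

(** Each condition of consistency is turned into counts to be compared with constants; this one
    gives (2), and (3) with A and B exchanged. *)
Definition misses A B := [pred a | (a \in A) && (#|[pred b | (b \in B) && ~~ adj a b]| == 0)].

Definition around X A B := cl (fun u v => [&& adj u v, v \in X & v \notin A]) B.

Definition stuck X A B := [pred x | [&& x \in X, x \notin around X A B &
  #|[pred y | (y \in around X A B) && adj x y]| == 0]].

Lemma missesP A B : reflect {in A, forall a, exists2 b, b \in B & ~~ adj a b} (#|misses A B| == 0).
Proof.
apply: (iffP eqP) => [/card0_eq h a aA|h].
  have := h a; rewrite !inE aA /= => /negbT; rewrite -lt0n => /card_gt0P[b].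
  by rewrite inE => /andP[bB ab]; exists b.
apply/eqP/pred0P=> a /=; apply/negP=> /andP[/h[b bB ab] /eqP /card0_eq/(_ b)].
by rewrite !inE bB ab.
Qed.

(** The search runs backwards from B through vertices outside A. Whether v itself is in A does not
    matter for an end of the path, so v qualifies if it is reached or adjacent to a vertex that
    is. *)
Lemma aroundP X A B v : B \subset X -> [disjoint A & B] -> v \in X ->
  (exists p : seq G, [/\ path_in X v p, last v p \in B & {in internal v p, forall u, u \notin A}]) <->
  (v \in around X A B \/ exists2 w, w \in around X A B & adj v w).
Proof.
move=> BX AB vX; set R := around X A B; split.
  case=> -[|w q] [] /and3P[/= /andP[_ qX] pq _] lB intA.
    by left; apply: (subsetP (cl_sub _ _)).
  right; case/andP: pq => vw pq; exists w => //.
  have {}intA : {in belast w q, forall u, u \notin A} by move=> u uq; apply: intA.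
  elim: q w {vw} qX pq lB intA => [|w' q IH] w /= /andP[wX qX].
    by move=> _ lB _; apply: (subsetP (cl_sub _ _)).
  case/andP=> ww' pq lB intA.
  have w'R : w' \in R by apply: IH => // u uq; apply: intA; rewrite inE uq orbT.
  by apply: cl_closed w'R _; rewrite adj_sym ww' wX intA ?mem_head.
have sub : X :\: A \subset X by apply: subsetDl.
have toB w : w \in R -> exists p : seq G, path_in (X :\: A) w p /\ last w p \in B.
  case/clP=> b bB bw.
  have bXA : b \in X :\: A by rewrite inE (subsetP BX) // andbT (disjointFl AB bB).
  have [c wXA] : connect (induced (X :\: A)) b w /\ w \in X :\: A.
    apply: (connect_ind_r (P := fun w => connect (induced (X :\: A)) b w /\ w \in X :\: A)) bw => //.
    move=> u z [cu uXA] /and3P[uz zX zA]; have zXA : z \in X :\: A by rewrite inE zA.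
    by split=> //; apply: connect_trans cu _; apply: connect_adj.
  have [|_ h] := @path_in_connect G (X :\: A) [set w] B; first by rewrite sub1set.
  have [|a [p [+ pp lB]]] := h; last by rewrite inE => /eqP ea; exists p; rewrite -ea.
  by exists w, b; rewrite inE eqxx bB connect_induced_sym.
have wide w p : path_in (X :\: A) w p -> path_in X w p /\ {in w :: p, forall u, u \notin A}.
  case/and3P=> /allP al pp up; split; first apply/and3P; try split=> //.
    by apply/allP=> u /al /(subsetP sub).
  by move=> u /al; rewrite !inE => /andP[].
have inR : v \in R -> exists p : seq G,
    [/\ path_in X v p, last v p \in B & {in internal v p, forall u, u \notin A}].
  case/toB=> p [/wide[pX pA] lB]; exists p; split=> // u uint; apply: pA.
  by apply: mem_belast; rewrite /internal in uint; case: p uint {pX lB} => //= y p; rewrite inE => ->; rewrite orbT.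
case=> [|[w wR vw]]; first exact: inR.
case: (boolP (v \in A)) => vA; last first.
  by apply: inR; apply: cl_closed wR _; rewrite adj_sym vw vX.
have [p [/wide[/and3P[pX pp up] pA] lB]] := toB w wR.
exists (w :: p); split=> //.
  rewrite /path_in; apply/and3P; split; [by rewrite /= vX | by rewrite /= vw | ].
  by rewrite cons_uniq up andbT; apply: contraL vA => /pA.
by move=> u; rewrite /internal /= => /mem_belast /pA.
Qed.

Lemma stuckP X A B : B \subset X -> [disjoint A & B] ->
  reflect {in X, forall v, exists p : seq G, [/\ path_in X v p, last v p \in B &
             {in internal v p, forall u, u \notin A}]} (#|stuck X A B| == 0).
Proof.
move=> BX AB; apply: (iffP eqP) => [/card0_eq h v vX|h].
  apply/(aroundP BX AB vX); have := h v; rewrite [_ \in stuck _ _ _]inE vX /=; case: (boolP (v \in around X A B)) => [|_] /=; first by left.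
  move/negbT; rewrite -lt0n => /card_gt0P[w]; rewrite inE => /andP[wR vw].
  by right; exists w.
apply/eqP/pred0P=> v /=; apply/negP=> /and3P[vX vR /eqP /card0_eq no].
have /(aroundP BX AB vX)[vR'|[w wR vw]] := h v vX; first by rewrite vR' in vR.
by have := no w; rewrite inE wR vw.
Qed.

Definition sideb X A B a0 :=
  [&& #|[pred x | (x \in X) && (x \notin cl (induced X) [set a0])]| == 0,
      #|misses A B| == 0, #|misses B A| == 0, #|stuck X A B| == 0 & #|stuck X B A| == 0].

(** Connectivity is tested from the single vertex a0. It makes X its only component, which meets A
    and B as these are non-empty. *)
Lemma sideP X A B a0 : A \subset X -> B \subset X -> [disjoint A & B] -> A != set0 -> B != set0 ->
  a0 \in X -> reflect (consistent_side X A B) (sideb X A B a0).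
Proof.
move=> AX BX AB A0 B0 a0X; have BA : [disjoint B & A] by rewrite disjoint_sym.
have cE : (#|[pred x | (x \in X) && (x \notin cl (induced X) [set a0])]| == 0) = conn X.
  apply/eqP/connP => [/card0_eq h|h].
    have r y : y \in X -> connect (induced X) a0 y.
      move=> yX; have := h y; rewrite !inE yX /= => /negbFE /exists_inP[z].
      by rewrite inE => /eqP->.
    move=> x y xX yX; apply: connect_trans (r y yX).
    by rewrite connect_induced_sym r.
  apply/eqP/pred0P => x /=; apply/negP => /andP[xX /negP[]].
  by apply/clP; exists a0; rewrite ?inE //; apply: h.
rewrite /sideb cE; apply: (iffP and5P) => [[/connP c /missesP m1 /missesP m2 /stuckP s1 /stuckP s2]|].
  split=> //; last by split=> //; [apply: s1 | apply: s2].
  move=> C CC.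
  have eqv : {in X & &, equivalence_rel (connect (induced X))}.
    move=> x y z _ _ _; split=> // xy; apply/idP/idP; apply: connect_trans => //.
    by rewrite connect_induced_sym.
  have -> : C = X; last by rewrite !(setIidPr _).
  have /and3P[/eqP cov tr _] := equivalence_partitionP eqv.
  have CX : C \subset X by rewrite -cov; apply: (bigcup_max C).
  have /set0Pn[x xC] : C != set0.
    by have /and3P[_ _ n0] := equivalence_partitionP eqv; apply: contraNneq n0 => <-.
  have xX := subsetP CX x xC.
  apply/eqP; rewrite eqEsubset CX; apply/subsetP=> y yX.
  rewrite -(def_pblock tr CC xC) (pblock_equivalence_partition eqv) //; exact: c.
by case=> _ m1 m2 [/connP c s1 s2]; split=> //; [apply/missesP|apply/missesP|apply/stuckP|apply/stuckP].
Qed.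

Definition odd_ones A := [pred x | (x \in A) && (0 < #|[pred y | [&& y \in A, ~~ adj x y & x != y]]|)].

Lemma cliqueP A : reflect (clique A) (#|odd_ones A| == 0).
Proof.
apply: (iffP eqP) => [/card0_eq h u v uA vA uv|h].
  have := h u; rewrite !inE uA /= lt0n => /negbFE/eqP/card0_eq/(_ v).
  by rewrite !inE vA uv andbT /= => /negbFE.
apply/eqP/pred0P=> x /=; apply/negP=> /andP[xA /card_gt0P[y]].
by rewrite inE => /and3P[yA xy ne]; rewrite h in xy.
Qed.

(** A graph is a disjoint union of cliques if and only if it has no induced path on three vertices,
    that is, if adjacent vertices agree on every third vertex. Tested along the edges, this takes
    time O(nm). *)
Definition p3 A := [forall u in A, forall v in A, adj u v ==>
  (#|[pred w | [&& w \in A, w != u, w != v & adj u w != adj v w]]| == 0)].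

Lemma p3P A : reflect (disjoint_union_of_cliques A) (p3 A).
Proof.
apply: (iffP idP) => [/forall_inP h|[P [PA Pc Pd]]].
  have tri u v w : u \in A -> v \in A -> w \in A -> adj u v -> adj u w -> v != w -> adj v w.
    move=> uA vA wA uv uw vw; have /forall_inP/(_ v vA)/implyP/(_ uv) := h u uA.
    move=> /eqP/card0_eq/(_ w); rewrite !inE wA [w == v]eq_sym vw uw /=.
    have -> : w != u by apply: contraTneq uw => ->; rewrite adj_irr.
    by move/negbFE/eqP.
  pose R (x y : G) := (x == y) || adj x y.
  have eqv : {in A & &, equivalence_rel R}.
    move=> x y z xA yA zA; rewrite /R eqxx; split=> // /orP[/eqP->//|xy].
    have yx : adj y x by rewrite adj_sym.
    apply/idP/idP => /orP[/eqP e|a].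
    - by rewrite -e yx orbT.
    - by case: (eqVneq y z) => //= yz; apply: (tri x).
    - by rewrite -e xy orbT.
    - by case: (eqVneq x z) => //= xz; apply: (tri y).
  have part := equivalence_partitionP eqv; have /and3P[/eqP cov tr _] := part.
  have inA C u : C \in equivalence_partition R A -> u \in C -> u \in A.
    by move=> CP uC; rewrite -cov; apply/bigcupP; exists C.
  exists (equivalence_partition R A); split=> //.
    move=> C CP u v uC vC uv.
    have := pblock_equivalence_partition eqv (inA C u CP uC) (inA C v CP vC).
    by rewrite (def_pblock tr CP uC) vC /R (negPf uv) => /esym.
  move=> C D CP DP CD u v uC vD; apply: contra CD => uv.
  have := pblock_equivalence_partition eqv (inA C u CP uC) (inA D v DP vD).
  rewrite (def_pblock tr CP uC) /R uv orbT => vC.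
  by rewrite -(def_pblock tr CP vC) (def_pblock tr DP vD).
have /and3P[/eqP cov tr _] := PA.
have same u v : u \in A -> v \in A -> adj u v -> pblock P u = pblock P v.
  move=> uA vA; apply: contraTeq => ne; apply: (Pd (pblock P u) (pblock P v)) => //.
  - by rewrite pblock_mem // cov.
  - by rewrite pblock_mem // cov.
  - by rewrite mem_pblock cov.
  - by rewrite mem_pblock cov.
have step u v w : u \in A -> v \in A -> w \in A -> w != v -> adj u v -> adj u w -> adj v w.
  move=> uA vA wA wv uv uw; apply: (Pc (pblock P u)); rewrite ?pblock_mem ?cov //.
  - by rewrite (same u v) // mem_pblock cov.
  - by rewrite (same u w) // mem_pblock cov.
  - by rewrite eq_sym.
apply/forall_inP=> u uA; apply/forall_inP=> v vA; apply/implyP=> uv.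
apply/eqP/eqP/pred0P=> w /=; apply/negP=> /and4P[wA wu wv]; apply/negP; rewrite negbK.
have vu : adj v u by rewrite adj_sym.
apply/eqP; apply/idP/idP => h; [exact: (step u) | exact: (step v)].
Qed.

Definition condb (A : bool -> {set G}) :=
  [|| (#|odd_ones (A true)| == 0) && (#|odd_ones (A false)| == 0),
      (#|A true| == 1) && p3 (A false) | (#|A false| == 1) && p3 (A true)].

Lemma condP (A : bool -> {set G}) : reflect (clique_condition A) (condb A).
Proof.
apply: (iffP or3P) => [[/andP[/cliqueP c1 /cliqueP c2]|/andP[/eqP c /p3P d]|/andP[/eqP c /p3P d]]|].
- by left; case.
- by right; exists true.
- by right; exists false.
case=> [h|[[] [c d]]].
- by apply: Or31; apply/andP; split; apply/cliqueP.
- by apply: Or32; rewrite c; apply/p3P.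
- by apply: Or33; rewrite c; apply/p3P.
Qed.

Definition consb (J : split G) (a1 a2 : G) :=
  [&& sideb (sX J true) (sA J true) (sB J true) a1, sideb (sX J false) (sA J false) (sB J false) a2,
      condb (sA J) & condb (sB J)].

Lemma consP J a1 a2 : almost_2join J -> a1 \in sX J true -> a2 \in sX J false ->
  reflect (consistent J) (consb J a1 a2).
Proof.
move=> aJ h1 h2; have [_ _ h _ _] := aJ.
have [t1 t2 t3 t4 t5] := h true; have [f1 f2 f3 f4 f5] := h false.
apply: (iffP and4P) => [[/(sideP t1 t2 t3 t4 t5 h1) s1 /(sideP f1 f2 f3 f4 f5 h2) s2 /condP c1 /condP c2]|].
  by split=> //; case.
case=> s /condP c1 /condP c2; split=> //.
- exact/(sideP t1 t2 t3 t4 t5 h1)/(s true).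
- exact/(sideP f1 f2 f3 f4 f5 h2)/(s false).
Qed.
End Consistency.

Definition Miss a b t := seqs
  [:: Degs (eAnd (eIn b (Var 20)) (eNot (eAdj (Var 46) (Var 20))));
      Count t 20 (eAnd (eIn a (Var 20)) (eNot (Aget 15 (Var 20))))].

(* The set X is in array 24.                                                    *)
Definition Hops b a t := let x := Var 20 in seqs
  [:: Copy b 11; Reach (eAnd (eAdj (Var 32) (Var 33)) (eAnd (eIn 24 (Var 33)) (eNot (eIn a (Var 33)))));
      Degs (eAnd (eIn 11 x) (eAdj (Var 46) x));
      Count t 20 (eAnd (eIn 24 x) (eAnd (eNot (eIn 11 x)) (eNot (Aget 15 x))))].

Definition Cliq a t := seqs
  [:: Degs (eAnd (eIn a (Var 20)) (eAnd (eNot (eAdj (Var 46) (Var 20))) (eNot (Equ (Var 46) (Var 20)))));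
      Count t 20 (eAnd (eIn a (Var 20)) (Less (Cst 0) (Aget 15 (Var 20))))].

Definition P3 a t := let x := Var 20 in seqs
  [:: PSet t (Cst 0);
      PFor 80 BM (PIf (Less (Var 80) (Aget 5 (Cst 0)))
        (seqs [:: PSet 32 (Aget 6 (Var 80)); PSet 33 (Aget 7 (Var 80));
           PIf (eAnd (eIn a (Var 32)) (eIn a (Var 33)))
            (seqs [:: Count 55 20 (eAnd (eIn a x) (eAnd (eNot (Equ x (Var 32))) (eAnd (eNot (Equ x (Var 33)))
                        (eNot (Equ (eAdj (Var 32) x) (eAdj (Var 33) x))))));
                      PIf (Var 55) (PSet t (Cst 1)) PSkip]) PSkip]) PSkip)].

Definition Side := let x := Var 20 in seqs
  [:: Fill 20 11 (Equ x (Var 40));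
      Reach (eAnd (eIn 24 (Var 32)) (eAnd (eIn 24 (Var 33)) (eAdj (Var 32) (Var 33))));
      Count 43 20 (eAnd (eIn 24 x) (eNot (eIn 11 x)));
      Miss 25 26 44; Miss 26 25 45; Hops 26 25 48; Hops 25 26 49; Cliq 25 50; Cliq 26 51;
      Count 52 20 (eIn 25 x); Count 53 20 (eIn 26 x); P3 25 54; P3 26 56;
      PSet 57 (Less (Cst 0) (eAnd (eNot (Var 43)) (eAnd (eNot (Var 44)) (eAnd (eNot (Var 45))
        (eAnd (eNot (Var 48)) (eNot (Var 49)))))))].

Definition outs := [:: 43; 44; 45; 48; 49; 50; 51; 54; 56].

Section Side.
Variables (G : sgraph) (vs : seq G) (es : seq (G * G)).
Hypotheses (Uvs : uniq vs) (vsT : forall x, x \in vs).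
Notation ix := (ix vs).
Notation rep := (rep vs).
Notation view := (view vs).
Notation lists := (lists vs es).

Lemma outsP t : t \in outs -> [/\ uniq [:: t; 20; 10; 1], t != 46 & t != 32 /\ t != 33].
Proof.
move=> ht; have /allP/(_ t ht) : all (fun t => [&& uniq [:: t; 20; 10; 1], t != 46, t != 32 & t != 33]) outs by [].
by case/and4P.
Qed.

Ltac viewd := repeat first [assumption | apply: view_run; [vmt|vmt|]].
Ltac repd := repeat first [assumption | apply: rep_run; [vmt|]].

Lemma side2 a : a \in [:: 25; 26] -> a = 25 \/ a = 26.
Proof. by rewrite !inE => /orP[] /eqP->; [left|right]. Qed.

Lemma miss_val s a b t (A B : {set G}) : view s -> rep s a A -> rep s b B -> t \in outs ->
  a \in [:: 25; 26] -> b \in [:: 25; 26] -> rg (run (Miss a b t) s) t = #|misses A B|.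
Proof.
move=> V rA rB /outsP[U t46 _] ha hb; rewrite /Miss 2!run_cons run_nil.
have [b15 a15] : b != 15 /\ a != 15 by case: (side2 ha) (side2 hb) => -> [] ->.
set s1 := run (Degs _) s; have V1 : view s1 by viewd.
have rA1 : rep s1 a A by apply: rep_run rA; case: (side2 ha) => ->.
have D1 x : ar s1 15 (ix x) = #|[pred y | (y \in B) && ~~ adj x y]|.
  rewrite (@degs_val _ _ Uvs vsT _ _ (fun x y => (y \in B) && ~~ adj x y) V) //.
  - by rewrite /= !inE eq_sym orbF.
  - by move=> {}x y; evb.
have [t20 _ _ _ _] := uniq4 U.
apply: (run_count Uvs vsT) => //; first exact: small_view V1.
  by rewrite /= !inE orbb.
move=> x; apply: ev_and; first by evb.
by rewrite /= /upd /= D1.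
Qed.

Lemma hops_val s a b t (X A B : {set G}) : view s -> rep s 24 X -> rep s a A -> rep s b B ->
  t \in outs -> a \in [:: 25; 26] -> b \in [:: 25; 26] ->
  rg (run (Hops b a t) s) t = #|stuck X A B|.
Proof.
move=> V rX rA rB /outsP[U t46 _] ha hb; rewrite /Hops 4!run_cons run_nil.
set s1 := run (Copy _ _) s; have V1 : view s1 by viewd. have X1 : rep s1 24 X by repd.
have A1 : rep s1 a A by apply: rep_run rA; case: (side2 ha) => ->.
have R1 : rep s1 11 B by apply: copy_rep V _ rB => //; case: (side2 hb) => ->.
set s2 := run (Reach _) s1; have V2 : view s2 by viewd. have X2 : rep s2 24 X by repd.
have R2 : rep s2 11 (around X A B).
  apply: (run_reach Uvs vsT) => //; first exact: small_view V1.
    by case: (side2 ha) => ->.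
  by move=> x y; evb.
set s3 := run (Degs _) s2; have V3 : view s3 by viewd. have X3 : rep s3 24 X by repd.
have R3 : rep s3 11 (around X A B) by repd.
have D3 x : ar s3 15 (ix x) = #|[pred y | (y \in around X A B) && adj x y]|.
  rewrite (@degs_val _ _ Uvs vsT _ _ (fun x y => (y \in around X A B) && adj x y) V2) //.
  by move=> {}x y; evb.
have [t20 _ _ _ _] := uniq4 U.
apply: (run_count Uvs vsT) => //; first exact: small_view V3.
  by rewrite /= !inE !orbb.
move=> x; apply: ev_and; first by evb.
by apply: ev_and; [evb | rewrite /= /upd /= D3].
Qed.

Lemma cliq_val s a t (A : {set G}) : view s -> rep s a A -> t \in outs -> a \in [:: 25; 26] ->
  rg (run (Cliq a t) s) t = #|odd_ones A|.
Proof.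
move=> V rA /outsP[U t46 _] ha; rewrite /Cliq 2!run_cons run_nil.
set s1 := run (Degs _) s; have V1 : view s1 by viewd.
have rA1 : rep s1 a A by apply: rep_run rA; case: (side2 ha) => ->.
have D1 x : ar s1 15 (ix x) = #|[pred y | [&& y \in A, ~~ adj x y & x != y]]|.
  rewrite (@degs_val _ _ Uvs vsT _ _ (fun x y => [&& y \in A, ~~ adj x y & x != y]) V) //.
  - by case: (side2 ha) => ->.
  - by move=> {}x y; evb.
have [t20 _ _ _ _] := uniq4 U.
apply: (run_count Uvs vsT) => //; first exact: small_view V1.
  by rewrite /= !inE !orbb.
move=> x; apply: ev_and; first by evb.
by rewrite /= /upd /= D1.
Qed.

Hypothesis esP : {in es, forall e, adj e.1 e.2}.
Hypothesis esA : forall u v, adj u v -> ((u, v) \in es) || ((v, u) \in es).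

Let bad (A : {set G}) (e : G * G) := [pred w | [&& w \in A, w != e.1, w != e.2 & adj e.1 w != adj e.2 w]].

(** The condition is symmetric in u and v, so one orientation of each edge is enough. *)
Lemma p3_es A : p3 A = all (fun e => (e.1 \in A) && (e.2 \in A) ==> (#|bad A e| == 0)) es.
Proof.
apply/forall_inP/allP => [h e ees|h u uA].
  apply/implyP=> /andP[h1 h2]; have /forall_inP/(_ _ h2)/implyP := h _ h1.
  exact/(fun f => f (esP ees)).
apply/forall_inP=> v vA; apply/implyP=> /esA /orP[]/h/implyP /=; rewrite uA vA => /(_ isT) //.
rewrite (@eq_card _ _ (bad A (u, v))) // => w; rewrite !inE /= [adj v w == _]eq_sym.
by case: (w != v); case: (w != u); rewrite ?andbF.
Qed.

Lemma p3_val s a t (A : {set G}) : view s -> lists s -> rep s a A -> t \in outs -> a \in [:: 25; 26] ->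
  (rg (run (P3 a t) s) t == 0) = p3 A.
Proof.
move=> V L rA ht ha; have [U t46 [t32 t33]] := outsP ht; have [t20 _ _ _ _] := uniq4 U.
have oth : all (fun t => [&& t != 80, t != 55, t \notin [:: 1; 10] & t != 2]) outs by [].
have /and4P[/negPf t80 /negPf t55 t1 t2] := allP oth t ht.
rewrite /P3 2!run_cons run_nil run_set; set s0 := setr s t 0; set B := PIf _ _ _.
have V0 : view s0 by apply: view_setr V.
have L0 : lists s0 by have [l1 l2 l3 l4] := L; split; rewrite //= /upd eq_sym (negPf t2).
rewrite p3_es.
have [|||s1 [h _ ->]] := @run_for (fun k s' => (rg s' t == 0) =
    all (fun e => (e.1 \in A) && (e.2 \in A) ==> (#|bad A e| == 0)) (take k es)) 80 BM B s0 (rg s0 2).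
- by [].
- by rewrite take0 /= /upd eqxx.
- move=> k s1 kM so IH.
  have so' : same_off [:: 80; 32; 33; 55; 20; t] [::] false s0 s1.
    apply: same_weak so => // x; rewrite [x \in _]/= /B !inE.
    by do ?[case/orP]; move/eqP->; rewrite eqxx ?orbT.
  have V1 : view s1 by apply: view_off so' _ _ V0 => //=; move: t1; rewrite !inE !negb_or ![_ == t]eq_sym => /andP[/negPf-> /negPf->].
  have [l1 l2 l3 l4] : lists s1 by apply: lists_off so' _ _ L0 => //; rewrite !inE /= eq_sym.
  rewrite /B run_if [ev _ _]/= l1 {1}/upd eqxx eqb0 -leqNgt.
  case: (ltnP k (size es)) => kes; last by rewrite run_skip /= /upd t80 IH !take_oversize // ltnW.
  have [e ees [-> [e1 e2]]] : exists2 e, e \in es & take k.+1 es = rcons (take k es) e /\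
      ix e.1 = nth 0 [seq ix e.1 | e <- es] k /\ ix e.2 = nth 0 [seq ix e.2 | e <- es] k.
    have [e0 _] : exists e0 : G * G, true by case: (es) kes => // e0 l; exists e0.
    exists (nth e0 es k); first exact: mem_nth.
    by rewrite (take_nth e0) // !(nth_map e0).
  rewrite 3!run_cons run_nil !run_set all_rcons.
  have -> : ev (setr s1 80 k) (Aget 6 (Var 80)) = ix e.1 by rewrite /= /upd eqxx l3.
  have -> : ev (setr (setr s1 80 k) 32 (ix e.1)) (Aget 7 (Var 80)) = ix e.2 by rewrite /= /upd /= l4.
  set s2 := setr (setr _ 32 _) 33 _.
  have V2 : view s2 by do 3 (apply: view_setr; first by []).
  have A2 : rep s2 a A by have [_ f2 _] := so' => x; rewrite /= f2 //; apply: rA.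
  have t2' : rg s2 t = rg s1 t by rewrite /= /upd (negPf t33) (negPf t32) t80.
  have if1 S (x y : S) : (if ~~ false then x else y) = x by [].
  rewrite (if1 _ _ (run PSkip (setr s1 80 k))).
  rewrite run_if.
  have -> : ev s2 (eAnd (eIn a (Var 32)) (eIn a (Var 33))) = (e.1 \in A) && (e.2 \in A).
    by apply: ev_and; apply: (ev_in A2).
  rewrite eqb0 negbK; case: (_ && _); last by rewrite run_skip t2' IH.
  rewrite 2!run_cons run_nil; set s3 := run (Count _ _ _) s2.
  have e55 : rg s3 55 = #|bad A e|.
    apply: (run_count Uvs vsT) => //; first exact: small_view V2.
    move=> x; apply: ev_and; first by evb.
    apply: ev_and; first by evb.
    apply: ev_and; first by evb.
    by apply: ev_not; apply: ev_eqb; evb.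
  have e3 : rg s3 t = rg s1 t by rewrite run_rg // !inE t55 (negPf t20).
  rewrite run_if [ev _ _]/= e55 implyTb; case: (#|bad A e| == 0); first by rewrite run_skip e3 IH.
  by rewrite run_set /= /upd eqxx.
rewrite /= /upd t80 h take_oversize //; by case: L0.
Qed.

Lemma side_val s X A B a0 : view s -> lists s -> rep s 24 X -> rep s 25 A -> rep s 26 B ->
  rg s 40 = ix a0 -> let s' := run Side s in
  [/\ rg s' 57 = sideb X A B a0, rg s' 50 = #|odd_ones A| /\ rg s' 51 = #|odd_ones B|,
      rg s' 52 = #|A| /\ rg s' 53 = #|B| & (rg s' 54 == 0) = p3 A /\ (rg s' 56 == 0) = p3 B].
Proof.
move=> V0 L0 X0 A0 B0 e40 s'; rewrite /s' /Side 14!run_cons run_nil.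
have nxt p s1 : ~~ has (fun x => x \in wr p) [:: 1; 2; 10] ->
    ~~ has (fun a => a \in wa p) [:: 0; 5; 6; 7; 24; 25; 26] ->
    [/\ view s1, lists s1, rep s1 24 X, rep s1 25 A & rep s1 26 B] ->
    [/\ view (run p s1), lists (run p s1), rep (run p s1) 24 X, rep (run p s1) 25 A & rep (run p s1) 26 B].
  rewrite /= !negb_or !andbT => /and3P[n1 n2 n10] /and5P[m0 m5 m6 m7 /and3P[m24 m25 m26]] [V L X1 A1 B1].
  split; try exact: rep_run.
  - by apply: view_run V => //; rewrite /= (negPf n1) (negPf n10).
  - by apply: lists_run L => //; rewrite m5 m6.
have H0 := And5 V0 L0 X0 A0 B0.
set s1 := run (Fill _ _ _) s; have H1 : [/\ view s1, lists s1, rep s1 24 X, rep s1 25 A & rep s1 26 B] by apply: nxt H0; vmt.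
set s2 := run (Reach _) s1; have H2 : [/\ view s2, lists s2, rep s2 24 X, rep s2 25 A & rep s2 26 B] by apply: nxt H1; vmt.
set s3 := run (Count _ _ _) s2; have H3 : [/\ view s3, lists s3, rep s3 24 X, rep s3 25 A & rep s3 26 B] by apply: nxt H2; vmt.
set s4 := run (Miss _ _ _) s3; have H4 : [/\ view s4, lists s4, rep s4 24 X, rep s4 25 A & rep s4 26 B] by apply: nxt H3; vmt.
set s5 := run (Miss _ _ _) s4; have H5 : [/\ view s5, lists s5, rep s5 24 X, rep s5 25 A & rep s5 26 B] by apply: nxt H4; vmt.
set s6 := run (Hops _ _ _) s5; have H6 : [/\ view s6, lists s6, rep s6 24 X, rep s6 25 A & rep s6 26 B] by apply: nxt H5; vmt.
set s7 := run (Hops _ _ _) s6; have H7 : [/\ view s7, lists s7, rep s7 24 X, rep s7 25 A & rep s7 26 B] by apply: nxt H6; vmt.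
set s8 := run (Cliq _ _) s7; have H8 : [/\ view s8, lists s8, rep s8 24 X, rep s8 25 A & rep s8 26 B] by apply: nxt H7; vmt.
set s9 := run (Cliq _ _) s8; have H9 : [/\ view s9, lists s9, rep s9 24 X, rep s9 25 A & rep s9 26 B] by apply: nxt H8; vmt.
set s10 := run (Count _ _ _) s9; have H10 : [/\ view s10, lists s10, rep s10 24 X, rep s10 25 A & rep s10 26 B] by apply: nxt H9; vmt.
set s11 := run (Count _ _ _) s10; have H11 : [/\ view s11, lists s11, rep s11 24 X, rep s11 25 A & rep s11 26 B] by apply: nxt H10; vmt.
set s12 := run (P3 _ _) s11; have H12 : [/\ view s12, lists s12, rep s12 24 X, rep s12 25 A & rep s12 26 B] by apply: nxt H11; vmt.
set s13 := run (P3 _ _) s12.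
have R2 : rep s2 11 (cl (induced X) [set a0]).
  have [V1 _ X1 _ _] := H1.
  apply: (run_reach Uvs vsT) => //; first exact: small_view V1.
    apply: (run_fill_rep Uvs vsT) => //; first exact: small_view V0.
    by move=> x; eapply ev_by; [evb|rewrite inE].
  by move=> x y; evb.
have e43 : rg s13 43 = #|[pred x | (x \in X) && (x \notin cl (induced X) [set a0])]|.
  do 10 (rewrite [LHS]run_rg; last by vmt).
  have [V2 _ X2 _ _] := H2; apply: (run_count Uvs vsT) => //; first exact: small_view V2.
  by move=> x; evb.
have e44 : rg s13 44 = #|misses A B|.
  do 9 (rewrite [LHS]run_rg; last by vmt).
  by have [V3 _ _ A3 B3] := H3; apply: miss_val.
have e45 : rg s13 45 = #|misses B A|.
  do 8 (rewrite [LHS]run_rg; last by vmt).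
  by have [V3 _ _ A3 B3] := H4; apply: miss_val.
have e48 : rg s13 48 = #|stuck X A B|.
  do 7 (rewrite [LHS]run_rg; last by vmt).
  by have [V3 _ X3 A3 B3] := H5; apply: hops_val.
have e49 : rg s13 49 = #|stuck X B A|.
  do 6 (rewrite [LHS]run_rg; last by vmt).
  by have [V3 _ X3 A3 B3] := H6; apply: hops_val.
rewrite run_set; split; last 3 first.
- split.
    do 5 (rewrite [LHS]run_rg; last by vmt).
    by have [V3 _ X3 A3 B3] := H7; apply: cliq_val.
  do 4 (rewrite [LHS]run_rg; last by vmt).
  by have [V3 _ X3 A3 B3] := H8; apply: cliq_val.
- split.
    do 3 (rewrite [LHS]run_rg; last by vmt).
    have [V3 _ X3 A3 B3] := H9; apply: (run_count Uvs vsT) => //; first exact: small_view V3.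
    by move=> x; evb.
  do 2 (rewrite [LHS]run_rg; last by vmt).
  have [V3 _ X3 A3 B3] := H10; apply: (run_count Uvs vsT) => //; first exact: small_view V3.
  by move=> x; evb.
- split.
    have [V3 L3 X3 A3 B3] := H11; rewrite -(p3_val V3 L3 A3 (t := 54)) //.
    by congr (_ == _); rewrite [LHS]run_rg //; vmt.
  by have [V3 L3 X3 A3 B3] := H12; apply: p3_val.
rewrite /sideb -e43 -e44 -e45 -e48 -e49 /= /upd /=.
by rewrite !mulnb lt0b.
Qed.
End Side.

(** * The split that was found, and its consistency, as a program *)

Definition Sets := let x := Var 20 in seqs
  [:: Copy 10 16; Fill 20 17 (eAnd (eIn 10 x) (eAdj (Var 13) x)); Fill 20 18 (eAnd (eIn 10 x) (eAdj (Var 15) x));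
      Fill 20 19 (eNot (eIn 10 x)); Fill 20 20 (eAnd (eNot (eIn 10 x)) (eAdj (Var 12) x));
      Fill 20 21 (eAnd (eNot (eIn 10 x)) (eAdj (Var 14) x))].

Definition Focus X A B p := seqs [:: Copy X 24; Copy A 25; Copy B 26; PSet 40 (Var p)].

Definition eCond o1 o2 c1 q1 c2 q2 := eOr (eAnd (eNot (Var o1)) (eNot (Var o2)))
  (eOr (eAnd (Equ (Var c1) (Cst 1)) (eNot (Var q2))) (eAnd (Equ (Var c2) (Cst 1)) (eNot (Var q1)))).

(** [Side] is run once for each side, so its results for the first side have to be saved in
    registers 82 to 88. The final answer is in register 17, unrelated to array 17. *)
Definition Cons := seqs
  [:: Focus 16 17 18 12; Side;
      seqs [:: PSet 82 (Var 57); PSet 83 (Var 50); PSet 84 (Var 51); PSet 85 (Var 52); PSet 86 (Var 53);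
               PSet 87 (Var 54); PSet 88 (Var 56)];
      Focus 19 20 21 13; Side;
      PSet 17 (Less (Cst 0) (eAnd (Var 82) (eAnd (Var 57)
        (eAnd (eCond 83 50 85 87 52 54) (eCond 84 51 86 88 53 56)))))].

Section Split.
Variables (G : sgraph) (vs : seq G) (es : seq (G * G)).
Hypotheses (Uvs : uniq vs) (vsT : forall x, x \in vs).
Notation ix := (ix vs).
Notation rep := (rep vs).
Notation view := (view vs).
Notation lists := (lists vs es).
Hypothesis esP : {in es, forall e, adj e.1 e.2}.
Hypothesis esA : forall u v, adj u v -> ((u, v) \in es) || ((v, u) \in es).
Variables (a1 a2 b1 b2 : G) (S : {set G}).
Let J := mk_split a1 a2 b1 b2 S.

Definition sides s := forall i, [/\ rep s (if i then 16 else 19) (sX J i),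
  rep s (if i then 17 else 20) (sA J i) & rep s (if i then 18 else 21) (sB J i)].

Lemma sides_run p s : all (fun a => a \notin wa p) [:: 16; 17; 18; 19; 20; 21] ->
  sides s -> sides (run p s).
Proof.
rewrite /= andbT => /and5P[m1 m2 m3 m4 /andP[m5 m6]] h i; have [h1 h2 h3] := h i.
by case: i {h} h1 h2 h3 => h1 h2 h3; split; apply: rep_run.
Qed.

Ltac viewd := repeat first [assumption | apply: view_run; [vmt|vmt|]].
Ltac repd := repeat first [assumption | apply: rep_run; [vmt|]].

Lemma sets_val s : view s -> rg s 12 = ix a1 -> rg s 13 = ix a2 -> rg s 14 = ix b1 ->
  rg s 15 = ix b2 -> rep s 10 S -> sides (run Sets s).
Proof.
move=> V e12 e13 e14 e15 r; rewrite /Sets 6!run_cons run_nil.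
pose env s := [/\ view s, rg s 12 = ix a1 /\ rg s 13 = ix a2, rg s 14 = ix b1 /\ rg s 15 = ix b2 & rep s 10 S].
have nxt p t : ~~ has (fun x => x \in wr p) [:: 1; 10; 12; 13; 14; 15] ->
    (0 \notin wa p) && (10 \notin wa p) -> env t -> env (run p t).
  rewrite /= !negb_or !andbT => /and5P[n1 n10 n12 n13 /andP[n14 n15]] /andP[m0 m10] [V1 [h1 h2] [h3 h4] r1].
  split; rewrite ?run_rg //; last exact: rep_run.
  by apply: view_run V1 => //; rewrite /= (negPf n1) (negPf n10).
have fill a e t (X : {set G}) : env t -> a \notin ra e ->
    (forall x, env t -> ev (setr t 20 (ix x)) e = (x \in X)) -> rep (run (Fill 20 a e) t) a X.
  move=> E ae h; apply: (run_fill_rep Uvs vsT) => //; first by case: E => /small_view.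
  by move=> x; apply: h.
have E0 : env s by split.
set s1 := run (Copy _ _) s; have E1 : env s1 by apply: nxt E0; vmt.
set s2 := run (Fill _ _ _) s1; have E2 : env s2 by apply: nxt E1; vmt.
set s3 := run (Fill _ _ _) s2; have E3 : env s3 by apply: nxt E2; vmt.
set s4 := run (Fill _ _ _) s3; have E4 : env s4 by apply: nxt E3; vmt.
set s5 := run (Fill _ _ _) s4; have E5 : env s5 by apply: nxt E4; vmt.
case; split.
- do 5 (apply: rep_run; first vmt); exact: copy_rep V _ r.
- do 4 (apply: rep_run; first vmt); apply: fill => // x [V1 [h1 h2] [h3 h4] r1].
  by eapply ev_by; [evb|rewrite inE].
- do 3 (apply: rep_run; first vmt); apply: fill => // x [V1 [h1 h2] [h3 h4] r1].
  by eapply ev_by; [evb|rewrite inE].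
- do 2 (apply: rep_run; first vmt); apply: fill => // x [V1 [h1 h2] [h3 h4] r1].
  by eapply ev_by; [evb|rewrite inE].
- do 1 (apply: rep_run; first vmt); apply: fill => // x [V1 [h1 h2] [h3 h4] r1].
  by eapply ev_by; [evb|rewrite !inE].
- apply: fill => // x [V1 [h1 h2] [h3 h4] r1].
  by eapply ev_by; [evb|rewrite !inE].
Qed.

Lemma focus_val s X A B p (Xs As Bs : {set G}) x : view s -> rep s X Xs -> rep s A As -> rep s B Bs ->
  rg s p = ix x -> p \in args -> all (fun a => a \notin [:: 24; 25; 26]) [:: X; A; B] ->
  let s' := run (Focus X A B p) s in
  [/\ rep s' 24 Xs, rep s' 25 As, rep s' 26 Bs & rg s' 40 = ix x].
Proof.
move=> V rX rA rB hp pa /= /and4P[nX nA nB _]; rewrite /Focus 4!run_cons run_nil run_set.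
move: nX nA nB; rewrite !inE !negb_or => /and3P[nX _ _] /and3P[nA nA' _] /and3P[nB nB' nB''].
set s1 := run (Copy X 24) s; have V1 : view s1 by viewd.
set s2 := run (Copy A 25) s1; have V2 : view s2 by viewd.
set s3 := run (Copy B 26) s2.
split.
- do 2 (apply: rep_run; first vmt); exact: copy_rep V _ rX.
- apply: rep_run; first vmt.
  by apply: copy_rep V1 _ _ => //; apply: rep_run => //; rewrite !inE orbb.
- apply: copy_rep V2 _ _ => //; apply: rep_run; first by rewrite !inE orbb.
  by apply: rep_run => //; rewrite !inE orbb.
- by rewrite [RHS](_ : _ = rg s p) //= /upd /= !args_run.
Qed.

Lemma cons_val s : view s -> lists s -> rg s 12 = ix a1 -> rg s 13 = ix a2 -> sides s ->
  rg (run Cons s) 17 = consb J a1 a2.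
Proof.
move=> V L e12 e13 K; rewrite /Cons 6!run_cons run_nil.
pose env s := [/\ view s, lists s, rg s 12 = ix a1, rg s 13 = ix a2 & sides s].
have nxt p t : ~~ has (fun x => x \in wr p) [:: 1; 2; 10; 12; 13] ->
    ~~ has (fun a => a \in wa p) [:: 0; 5; 6; 7] ->
    all (fun a => a \notin wa p) [:: 16; 17; 18; 19; 20; 21] -> env t -> env (run p t).
  move=> nw nm ms [V1 L1 h12 h13 K1]; move: nw nm; rewrite /= !negb_or !andbT.
  move=> /and5P[n1 n2 n10 n12 n13] /and4P[m0 m5 m6 m7].
  split; rewrite ?run_rg //; last exact: sides_run.
  - by apply: view_run V1 => //; rewrite /= (negPf n1) (negPf n10).
  - by apply: lists_run L1 => //; rewrite m5 m6.
have E0 : env s by split.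
set s1 := run (Focus _ _ _ _) s; have E1 : env s1 by apply: nxt E0; vmt.
have [x1 x2 x3 x4] : [/\ rep s1 24 (sX J true), rep s1 25 (sA J true), rep s1 26 (sB J true) & rg s1 40 = ix a1].
  by have [k1 k2 k3] := K true; apply: focus_val.
set s2 := run Side s1; have E2 : env s2 by apply: nxt E1; vmt.
have [t57 [t50 t51] [t52 t53] [t54 t56]] : [/\ rg s2 57 = sideb (sX J true) (sA J true) (sB J true) a1,
    rg s2 50 = #|odd_ones (sA J true)| /\ rg s2 51 = #|odd_ones (sB J true)|,
    rg s2 52 = #|sA J true| /\ rg s2 53 = #|sB J true| & (rg s2 54 == 0) = p3 (sA J true) /\ (rg s2 56 == 0) = p3 (sB J true)].
  by have [V1 L1 _ _ _] := E1; exact: (side_val Uvs vsT esP esA V1 L1 x1 x2 x3 x4).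
set s3 := run (seqs _) s2; have E3 : env s3 by apply: nxt E2; vmt.
have [g1 g2 g3 g4] : [/\ rg s3 82 = rg s2 57, rg s3 83 = rg s2 50 /\ rg s3 84 = rg s2 51,
    rg s3 85 = rg s2 52 /\ rg s3 86 = rg s2 53 & rg s3 87 = rg s2 54 /\ rg s3 88 = rg s2 56].
  by rewrite /s3 7!run_cons run_nil !run_set /= /upd /=.
set s4 := run (Focus _ _ _ _) s3; have E4 : env s4 by apply: nxt E3; vmt.
have [y1 y2 y3 y4] : [/\ rep s4 24 (sX J false), rep s4 25 (sA J false), rep s4 26 (sB J false) & rg s4 40 = ix a2].
  by have [V3 _ _ h13 K3] := E3; have [k1 k2 k3] := K3 false; apply: focus_val.
set s5 := run Side s4.
have [f57 [f50 f51] [f52 f53] [f54 f56]] : [/\ rg s5 57 = sideb (sX J false) (sA J false) (sB J false) a2,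
    rg s5 50 = #|odd_ones (sA J false)| /\ rg s5 51 = #|odd_ones (sB J false)|,
    rg s5 52 = #|sA J false| /\ rg s5 53 = #|sB J false| & (rg s5 54 == 0) = p3 (sA J false) /\ (rg s5 56 == 0) = p3 (sB J false)].
  by have [V4 L4 _ _ _] := E4; exact: (side_val Uvs vsT esP esA V4 L4 y1 y2 y3 y4).
have keep x : x \in [:: 82; 83; 84; 85; 86; 87; 88] -> rg s5 x = rg s3 x.
  move=> hx; rewrite [LHS]run_rg; last by move: x hx; apply/allP; vmt.
  by rewrite [LHS]run_rg //; move: x hx; apply/allP; vmt.
move: g2 g3 g4 => [g2 g2'] [g3 g3'] [g4 g4'].
rewrite run_set /= {1}/upd /=.
have cond o1 o2 c1 q1 c2 q2 (A : bool -> {set G}) : rg s5 o1 = #|odd_ones (A true)| ->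
    rg s5 o2 = #|odd_ones (A false)| -> rg s5 c1 = #|A true| -> (rg s5 q1 == 0) = p3 (A true) ->
    rg s5 c2 = #|A false| -> (rg s5 q2 == 0) = p3 (A false) ->
    ev s5 (eCond o1 o2 c1 q1 c2 q2) = condb A.
  move=> h1 h2 h3 h4 h5 h6; rewrite /condb -h1 -h2 -h3 -h4 -h5 -h6 /=.
  by rewrite !mulnb; case: (_ && _); case: (_ && _) => //=; case: (_ && _).
have := cond 83 50 85 87 52 54 (sA J); rewrite !(keep 83, keep 85, keep 87) // g2 g3 g4.
move=> /(_ t50 f50 t52 t54 f52 f54) /= cA.
have := cond 84 51 86 88 53 56 (sB J); rewrite !(keep 84, keep 86, keep 88) // g2' g3' g4'.
move=> /(_ t51 f51 t53 t56 f53 f56) /= cB.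
move: cA cB; rewrite (keep 82) // g1 t57 f57 (keep 83) // (keep 85) // (keep 87) // (keep 84) // (keep 86) // (keep 88) //.
by rewrite g2 g3 g4 g2' g3' g4' => -> ->; rewrite /consb !mulnb lt0b.
Qed.
End Split.

(** * Building a block *)

Lemma mat_inj N i j i' j' : j < N -> j' < N ->
  (i * (N + 1) + j == i' * (N + 1) + j') = (i == i') && (j == j').
Proof.
move=> jN j'N; apply/eqP/andP => [e|[/eqP-> /eqP->] //].
have := f_equal (edivn^~ (N + 1)) e; rewrite !edivn_eq ?addn1 ?ltnS 1?ltnW //.
by case=> -> ->.
Qed.

Definition eCell := Plus (Times (Var 20) (Plus (Var 1) (Cst 1))) (Var 21).

Definition Mat b e := PFor 20 BN (PFor 21 BN (PArr b eCell e)).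

Lemma mat_val b e s i j : b \notin ra e -> i < rg s 1 -> j < rg s 1 ->
  ar (run (Mat b e) s) b (i * (rg s 1 + 1) + j) = ev (setr (setr s 20 i) 21 j) e.
Proof.
move=> be; set N := rg s 1 => iN jN.
pose Q i j s' := forall i' j', i' < N -> j' < N -> i' < i \/ i' = i /\ j' < j ->
    ar s' b (i' * (N + 1) + j') = ev (setr (setr s 20 i') 21 j') e.
have : Q N 0 (run (Mat b e) s).
  apply: (run_for2 (P := Q) (k := N) (l := N)) => //.
  - by move=> i' j' _ _ [|[]].
  - move=> k s' kN h i' j' iN' jN' [|[]//]; rewrite ltnS leq_eqVlt => /orP[/eqP ->|lt]; apply: h => //.
      by right.
    by left.
  - move=> k l s' kN lN so e20 e21 h i' j' iN' jN' lt; rewrite run_arr /= eqxx.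
    have [f1 f2 f3] := so.
    have -> : rg s' 1 = N by rewrite f1.
    rewrite e20 e21 /upd mat_inj //; case: andP => [[/eqP-> /eqP->]|ne].
      apply: ev_ext => [x _|a ae y|_].
      - rewrite /= /upd; case: eqP => [->|/eqP x21]; first by rewrite e21.
        case: eqP => [->|/eqP x20]; first by rewrite e20.
        by rewrite f1 // !inE negb_or x20 x21.
      - by rewrite /= f2 // !inE; apply: contraNneq be => <-.
      - by rewrite /= f3.
    apply: h => //; case: lt => [|[e1]]; first by left.
    rewrite ltnS leq_eqVlt => /orP[/eqP e2|]; last by right.
    by case: ne; rewrite e1 e2 !eqxx.
by move=> h; apply: h => //; left.
Qed.

Definition Edges := seqs [:: PSet 31 (Cst 0);
  PFor 20 BN (PFor 21 BN (PIf (eAnd (eAnd (Less (Var 20) (Aget 44 (Cst 0))) (Less (Var 21) (Aget 44 (Cst 0))))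
      (eAnd (Less (Var 20) (Var 21)) (Aget 40 eCell)))
    (seqs [:: PArr 46 (Var 31) (Var 20); PArr 47 (Var 31) (Var 21); PSet 31 (Plus (Var 31) (Cst 1))]) PSkip));
  PArr 45 (Cst 0) (Var 31)].

Section Shows.
Variables (G : sgraph) (vs : seq G).
Hypotheses (Uvs : uniq vs) (vsT : forall x, x \in vs).
Notation ix := (ix vs).

(** Orienting each edge by index makes a listing that can be recomputed from the adjacency
    matrix. *)
Definition clean (es : seq (G * G)) := [/\ uniq es,
  {in es, forall e, adj e.1 e.2 /\ ix e.1 < ix e.2} &
  forall u v, adj u v -> ix u < ix v -> (u, v) \in es].

Lemma clean_adj es : clean es -> {in es, forall e, adj e.1 e.2}.
Proof. by move=> [_ h _] e /h[]. Qed.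

Lemma clean_all es u v : clean es -> adj u v -> ((u, v) \in es) || ((v, u) \in es).
Proof.
move=> [_ _ h] uv; case: (ltngtP (ix u) (ix v)) => [lt|lt|/(ix_inj vsT) e].
- by rewrite h.
- by rewrite (h v u) ?orbT // adj_sym.
- by rewrite e adj_irr in uv.
Qed.

Lemma clean_xor es u v : clean es -> adj u v = ((u, v) \in es) (+) ((v, u) \in es).
Proof.
move=> c; have [_ h _] := c; apply/idP/idP => [uv|].
  have := clean_all c uv; case: (boolP ((u, v) \in es)) => [/h[_ /= lt] _|] //=.
  by apply/negP => /h[_ /=]; rewrite ltnNge ltnW.
case: (boolP ((u, v) \in es)) => [/h[] //|_ /= /h[/=]].
by rewrite adj_sym.
Qed.

Lemma clean_size es : clean es -> size es = #|edges G|.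
Proof.
move=> c; apply: listing_edges; [by case: c | exact: clean_adj | by move=> u v; apply: clean_xor].
Qed.

Definition lists_in (f : nat -> nat -> nat) (es : seq (G * G)) := [/\ f 5 0 = size es,
  forall k, k < size es -> f 6 k = nth 0 [seq ix e.1 | e <- es] k &
  forall k, k < size es -> f 7 k = nth 0 [seq ix e.2 | e <- es] k].

(* The data of a node are given by the function f of the index of an array and  *)
(* an index into that array.                                                    *)
Definition shows N (name : G -> nat) (M : rel G) (lab : G -> nat) es (f : nat -> nat -> nat) :=
  [/\ f 4 0 = #|G|, forall x y, f 0 (ix x * (N + 1) + ix y) = adj x y,
      forall x y, f 1 (ix x * (N + 1) + ix y) = M x y,
      forall x, f 2 (ix x) = lab x /\ f 3 (ix x) = name x & lists_in f es].

Definition newf (s : mstate) a k := ar s (40 + a) k.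

Lemma edges_val s : ar s 44 0 = #|G| -> #|G| <= rg s 1 ->
  (forall x y, ar s 40 (ix x * (rg s 1 + 1) + ix y) = adj x y) ->
  exists2 es, clean es & lists_in (newf (run Edges s)) es.
Proof.
move=> s44 s1 A; rewrite /Edges 3!run_cons run_nil run_set run_arr.
set s0 := setr s 31 0; set N := rg s 1; rewrite -/N in s1 A.
pose P i j (u v : G) := ix u < i \/ ix u = i /\ ix v < j.
pose Q i j s' := exists es, [/\ uniq es, {in es, forall e, adj e.1 e.2 /\ ix e.1 < ix e.2 /\ P i j e.1 e.2},
   (forall u v, adj u v -> ix u < ix v -> P i j u v -> (u, v) \in es), rg s' 31 = size es &
   (forall k, k < size es -> ar s' 46 k = nth 0 [seq ix e.1 | e <- es] k) /\
   (forall k, k < size es -> ar s' 47 k = nth 0 [seq ix e.2 | e <- es] k)].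
set p := PFor 20 _ _.
have : Q N 0 (run p s0).
  apply: (run_for2 (k := N) (l := N)) => //.
  - by exists [::]; split=> // u v _ _ [|[]].
  - by move=> i j s' z v; rewrite !inE => /orP[]/eqP->.
  - move=> i s' iN [es [U h1 h2 h3 h4]]; exists es; split=> //.
      move=> e /h1[a [lt [l|[l1 l2]]]]; do 2 split=> //; left; first exact: ltnW.
      by rewrite l1.
    move=> u v uv lt [|[] //]; rewrite ltnS leq_eqVlt => /orP[/eqP e|l]; apply: h2 => //; last by left.
    by right; split=> //; apply: leq_trans (ix_lt Uvs vsT v) s1.
  - move=> i j s' iN jN so e20 e21 [es [U h1 h2 h3 [h4 h5]]].
    have [f1 f2 f3] := so; have e1 : rg s' 1 = N by rewrite f1.
    have e44 : ar s' 44 0 = #|G| by rewrite f2.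
    rewrite run_if; set c := ev s' _.
    have ec : (c != 0) = [&& i < #|G|, j < #|G|, i < j & ar s 40 (i * (N + 1) + j) != 0].
      rewrite /c /= e20 e21 e44 e1 f2 // !muln_eq0 !negb_or; do 3 case: (_ < _) => //.
    rewrite ec; case: ifP => [/and4P[iG jG ij a]|no].
      have [x ex] := ix_onto Uvs vsT iG; have [y ey] := ix_onto Uvs vsT jG.
      have xy : adj x y by move: a; rewrite -ex -ey A eqb0 negbK.
      rewrite 3!run_cons run_nil !run_arr run_set.
      exists (rcons es (x, y)); split.
      + by rewrite rcons_uniq U andbT; apply/negP => /h1[_ [_ [|[] /=]]]; rewrite /= ?ex ?ey ltnn.
      + move=> e; rewrite mem_rcons inE => /orP[/eqP->/=|/h1[a1 [a2 a3]]].
          by split=> //; split; [rewrite ex ey | right; rewrite ex ey].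
        by do 2 split=> //; case: a3 => [|[l1 l2]]; [left|right; split=> //; apply: ltnW].
      + move=> u v uv lt [l|[l1 l2]]; rewrite mem_rcons inE; first by rewrite h2 ?orbT //; left.
        move: l2; rewrite ltnS leq_eqVlt => /orP[/eqP l2|l2]; last by rewrite h2 ?orbT //; right.
        have -> : u = x by apply: (ix_inj vsT); rewrite l1.
        have -> : v = y by apply: (ix_inj vsT); rewrite l2.
        by rewrite eqxx.
      + by rewrite /= /upd /= h3 size_rcons addn1.
      + split=> k; rewrite size_rcons ltnS map_rcons nth_rcons size_map /= /upd /= h3.
          rewrite leq_eqVlt => /orP[/eqP->|ii]; first by rewrite eqxx ltnn e20.
          by rewrite (ltn_eqF ii) ii; apply: h4.
        rewrite leq_eqVlt => /orP[/eqP->|ii]; first by rewrite eqxx ltnn e21.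
        by rewrite (ltn_eqF ii) ii; apply: h5.
    rewrite run_skip; exists es; split=> //.
    + by move=> e /h1[a1 [a2 [|[l1 l2]]]]; do 2 split=> //; [left|right; split=> //; apply: ltnW].
    + move=> u v uv lt [l|[l1]]; first by apply: h2 => //; left.
      rewrite ltnS leq_eqVlt => /orP[/eqP l2|l2]; last by apply: h2 => //; right.
      by move: no; rewrite -l1 -l2 !(ix_lt Uvs vsT) lt A uv.
case=> es [U h1 h2 h3 [h4 h5]]; exists es.
  split=> //; first by move=> e /h1[a1 [a2 _]].
  by move=> u v uv lt; apply: h2 => //; left; apply: leq_trans (ix_lt Uvs vsT u) s1.
by split; rewrite /newf /= /upd /= ?h3.
Qed.
End Shows.

Notation ix_in := ix (only parsing).
Notation rep_in := rep (only parsing).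

Definition Vec b c e := PFor 20 BN (PIf c (PArr b (Var 20) e) PSkip).

Lemma vec_val b c e s k : b \notin ra c -> b \notin ra e -> k < rg s 1 ->
  ar (run (Vec b c e) s) b k =
  if ev (setr s 20 k) c != 0 then ev (setr s 20 k) e else ar s b k.
Proof.
move=> bc be kN; set N := rg s 1 in kN.
have [|||s' [h _ ->]] := @run_for (fun i s' => forall k, (k < i ->
    ar s' b k = if ev (setr s 20 k) c != 0 then ev (setr s 20 k) e else ar s b k) /\
    (i <= k -> ar s' b k = ar s b k)) 20 BN (PIf c (PArr b (Var 20) e) PSkip) s N.
- by [].
- by move=> j; split.
- move=> i s' iN [f1 f2 f3] h j.
  have ee e' : b \notin ra e' -> ev (setr s' 20 i) e' = ev (setr s 20 i) e'.
    move=> be'; apply: ev_ext => [x _|a ae y|_].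
    - rewrite /= /upd; case: eqP => // /eqP x20; rewrite f1 // !inE (negPf x20).
      by [].
    - by rewrite /= f2 // !inE; apply: contraNneq be' => <-.
    - by rewrite /= f3.
  rewrite run_if ee //; case: ifP => ci.
    rewrite run_arr /= eqxx /upd eqxx ee //; have [h1 h2] := h j.
    split; first by rewrite ltnS leq_eqVlt => /orP[/eqP->|lt]; rewrite ?eqxx ?ci // (ltn_eqF lt) h1.
    by move=> ij; rewrite gtn_eqF // h2 // ltnW.
  rewrite run_skip /=; have [h1 h2] := h j; split=> [|ij]; last by rewrite h2 // ltnW.
  rewrite ltnS leq_eqVlt => /orP[/eqP->|lt]; last exact: h1.
  by rewrite ci; have [_ ->] := h i.
- by have [h1 _] := h k; apply: h1.
Qed.

Definition eAtt a b x q := eOr (eAnd (eIn a x) (Equ q (Var 30)))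
  (eAnd (eIn b x) (Equ q (Plus (Var 30) (Cst 2)))).

(* Entry (20, 21) of a matrix of the block being built, from matrix m of the    *)
(* current graph and the sets a, b of neighbours of the ends of the marker path.*)
Definition eGlue m a b :=
  let p := Var 20 in let q := Var 21 in let x := Aget 12 p in let y := Aget 12 q in
  let inp := Less p (Var 30) in let inq := Less q (Var 30) in
  eOr (eAnd inp (eAnd inq (eMat m x y))) (eOr (eAnd inp (eAtt a b x q))
  (eOr (eAnd inq (eAtt a b y p)) (eAnd (eNot inp) (eAnd (eNot inq)
    (eOr (Equ (Plus p (Cst 1)) q) (Equ (Plus q (Cst 1)) p)))))).

Definition Child := let x := Var 20 in let inp := Less (Var 20) (Var 30) in seqs
  [:: Degs (eAnd (eIn 28 x) (eMat 1 (Var 46) x)); Fill 20 13 (eAnd (eIn 25 x) (Less (Cst 0) (Aget 15 x)));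
      Degs (eAnd (eIn 29 x) (eMat 1 (Var 46) x)); Fill 20 14 (eAnd (eIn 26 x) (Less (Cst 0) (Aget 15 x)));
      Degs (eAnd (eNot (eIn 24 x)) (Equ (Aget 2 x) (Aget 2 (Var 46))));
      Rank 24; Mat 40 (eGlue 0 25 26); Mat 41 (eGlue 1 13 14);
      Vec 42 inp (Aget 2 (Aget 12 x)); Vec 42 (eAnd inp (Aget 15 (Aget 12 x))) (Var 7);
      Vec 43 inp (Aget 3 (Aget 12 x));
      seqs [:: PArr 42 (Var 30) (Var 7); PArr 42 (Plus (Var 30) (Cst 1)) (Var 7); PArr 42 (Plus (Var 30) (Cst 2)) (Var 7);
        PArr 43 (Var 30) (Var 7); PArr 43 (Plus (Var 30) (Cst 1)) (Plus (Var 7) (Cst 1));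
        PArr 43 (Plus (Var 30) (Cst 2)) (Plus (Var 7) (Cst 2)); PArr 44 (Cst 0) (Plus (Var 30) (Cst 3))];
      Edges].

Section Block.
Variables (G : sgraph) (vs : seq G) (J : split G) (i : bool).
Hypotheses (Uvs : uniq vs) (vsT : forall x, x \in vs).
Notation ix := (ix vs).
Notation rep := (rep vs).
Notation view := (view vs).
Notation X := (sX J i).
Notation r := (rank vs X).

(** The kept vertices retain their order; the markers a, c, b come last, so their indices are the
    size of the side plus 0, 1, 2. *)
Definition bvs : seq (block J i) :=
  [seq inl u | u <- pmap insub r] ++ [:: inr mk_a; inr mk_c; inr mk_b].
Notation bix := (ix_in bvs).

Lemma map_r : map val (pmap insub r : seq {x | x \in X}) = r.
Proof.
rewrite (pmap_filter (@insubK _ _ _)); apply/all_filterP/allP => x; rewrite mem_rank // => xX.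
by rewrite isSome_insub.
Qed.

Lemma inl_inj : injective (inl : {x | x \in X} -> block J i). Proof. by move=> u v []. Qed.

Lemma bvs_uniq : uniq bvs.
Proof.
rewrite cat_uniq map_inj_uniq; last exact: inl_inj.
rewrite (pmap_uniq (@insubK _ _ _)) ?rank_uniq //=.
by rewrite orbF !negb_or andbT; apply/and3P; split; apply/mapP=> -[].
Qed.

Lemma bix_inl u : bix (inl u) = index (val u) r.
Proof.
rewrite /ix_in index_cat mem_map; last exact: inl_inj.
have -> : u \in pmap insub r.
  by rewrite -(mem_map val_inj) map_r mem_rank //; apply: valP.
by rewrite index_map; [rewrite -(index_map val_inj) map_r | apply: inl_inj].
Qed.

Lemma size_r : size (pmap insub r : seq {x | x \in X}) = size r.
Proof. by rewrite -(size_map val) map_r. Qed.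

Lemma bix_inr (k : 'I_3) : bix (inr k) = size r + k.
Proof.
rewrite /ix_in index_cat ifF; last by apply/mapP=> -[].
by rewrite size_map size_r; congr addn; have [->|->|->] := mkP k.
Qed.

Lemma bvs_all h : h \in bvs.
Proof.
case: h => [u|k]; rewrite mem_cat.
  by rewrite mem_map; [rewrite -(mem_map val_inj) map_r mem_rank // (valP u) | apply: inl_inj].
by apply/orP; right; rewrite !inE; have [->|->|->] := mkP k.
Qed.

Lemma r_lt (u : {x | x \in X}) : index (val u) r < size r.
Proof. by rewrite index_mem mem_rank //; apply: valP. Qed.

Lemma size_rX : size r = #|X|.
Proof.
by rewrite -(card_uniqP (rank_uniq Uvs X)); apply: eq_card => x; rewrite mem_rank.
Qed.

(** The common shape of adjacency and of the marks in a block, so that one expression, [eGlue],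
    computes both matrices. *)
Definition glue (e : rel G) (P Q : {set G}) : rel (block J i) := fun x y =>
  let att (u : G) (k : 'I_3) := (k == 0 :> nat) && (u \in P) || (k == 2 :> nat) && (u \in Q) in
  match x, y with
  | inl u, inl v => e (val u) (val v)
  | inl u, inr k => att (val u) k
  | inr k, inl u => att (val u) k
  | inr k, inr l => (k.+1 == l) || (l.+1 == k)
  end.

Definition ranked s := rg s 30 = size r /\ forall k, k < size r -> ar s 12 k = nth 0 (map ix r) k.

Lemma ranked_ix s (u : {x | x \in X}) : ranked s -> ar s 12 (index (val u) r) = ix (val u).
Proof.
move=> [_ h]; rewrite h ?r_lt // (nth_map (val u)) ?r_lt // nth_index //.
by rewrite mem_rank //; apply: valP.
Qed.

Lemma glue_val s m a b (e : rel G) P Q h h' : ranked s ->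
  (forall x y, ar s m (ix x * (rg s 1 + 1) + ix y) = e x y) -> rep s a P -> rep s b Q ->
  ev (setr (setr s 20 (bix h)) 21 (bix h')) (eGlue m a b) = glue e P Q h h'.
Proof.
move=> R hm rP rQ; have [e30 _] := R; rewrite /eGlue.
set s' := setr _ 21 _.
have e1 : rg s' 30 = size r by [].
have e20 : rg s' 20 = bix h by rewrite /= /upd.
have e21 : rg s' 21 = bix h' by rewrite /= /upd.
have e12 : ar s' 12 = ar s 12 by [].
have eN : rg s' 1 = rg s 1 by [].
have em : ar s' m = ar s m by [].
have ea : ar s' a = ar s a by []. have eb : ar s' b = ar s b by [].
move: s' e1 e20 e21 e12 eN em ea eb => s' e1 e20 e21 e12 eN em ea eb.
rewrite /= e1 e20 e21 e12 eN em ea eb.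
have lt (w : {x | x \in X}) : (index (val w) r < size r) = true by rewrite r_lt.
have nl (k : 'I_3) : (size r + k < size r) = false by rewrite ltnNge leq_addr.
have n1 (w : {x | x \in X}) : (index (val w) r == size r) = false by rewrite ltn_eqF ?r_lt.
have n2 (w : {x | x \in X}) : (index (val w) r == size r + 2) = false.
  by rewrite ltn_eqF // ltn_addr ?r_lt.
have q1 (k : 'I_3) : (size r + k == size r) = (k == 0 :> nat) by rewrite -[X in _ == X]addn0 eqn_add2l.
have q2 (k : 'I_3) : (size r + k == size r + 2) = (k == 2 :> nat) by rewrite eqn_add2l.
have q3 (k l : 'I_3) : (size r + k + 1 == size r + l) = (k.+1 == l) by rewrite -addnA eqn_add2l addn1.
case: h {e20} => [u|k]; case: h' {e21} => [v|l]; rewrite ?bix_inl ?bix_inr //=;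
  rewrite ?lt ?nl ?n1 ?n2 ?q1 ?q2 ?q3 ?(ranked_ix _ R) ?hm ?lt0n ?rP ?rQ.
- by do !rewrite ?muln0 ?mul0n ?mul1n ?addn0 /=; case: (e _ _).
- by case: (val u \in P); case: (val u \in Q); case: (l == 0 :> nat); case: (l == 2 :> nat).
- by case: (val v \in P); case: (val v \in Q); case: (k == 0 :> nat); case: (k == 2 :> nat).
- rewrite -[nat_of_bool false]/0 !mul0n !add0n eqxx -[nat_of_bool true]/1 !mul1n.
  by case: (k.+1 == l); case: (l.+1 == k).
Qed.
End Block.

Section Child.
Variables (G : sgraph) (vs : seq G) (J : split G) (i : bool).
Hypotheses (Uvs : uniq vs) (vsT : forall x, x \in vs).
Notation ix := (ix vs).
Notation rep := (rep vs).
Notation view := (view vs).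
Notation X := (sX J i).
Notation r := (rank vs X).
Notation bvs := (bvs vs J i).
Notation bix := (ix_in bvs).
Variables (M : rel G) (lab name : G -> nat).

Ltac viewd := repeat first [assumption | apply: view_run; [vmt|vmt|]].
Ltac repd := repeat first [assumption | apply: rep_run; [vmt|]].

Definition wide s := [/\ view s, forall x y, ar s 1 (ix x * (rg s 1 + 1) + ix y) = M x y &
  forall x, ar s 2 (ix x) = lab x /\ ar s 3 (ix x) = name x].

Lemma wide_run p s : ~~ has (fun x => x \in wr p) [:: 1; 10] ->
  ~~ has (fun a => a \in wa p) [:: 0; 1; 2; 3] -> wide s -> wide (run p s).
Proof.
move=> nw; rewrite /= !negb_or !andbT => /and4P[m0 m1 m2 m3] [V h1 h2].
have n1 : 1 \notin wr p by move: nw; rewrite /= negb_or => /andP[].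
split; first exact: view_run V.
  by move=> x y; rewrite run_rg ?run_ar.
by move=> x; rewrite !run_ar.
Qed.

Definition focus s := [/\ rep s 24 X, rep s 25 (sA J i), rep s 26 (sB J i),
  rep s 28 (sA J (~~ i)) & rep s 29 (sB J (~~ i))].

Lemma focus_run p s : ~~ has (fun a => a \in wa p) [:: 24; 25; 26; 28; 29] ->
  focus s -> focus (run p s).
Proof.
rewrite /= !negb_or !andbT => /and5P[m1 m2 m3 m4 m5] [h1 h2 h3 h4 h5].
by split; apply: rep_run.
Qed.

Lemma child_val s : wide s -> focus s -> #|X| + 3 <= rg s 1 -> let s' := run Child s in
  exists2 es, clean bvs es & shows bvs (rg s 1) (block_name name (fun k : 'I_3 => rg s 7 + k))
    (@block_marks G J i M) (block_lab lab (rg s 7) (i := i)) es (newf s').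
Proof.
move=> W F le s'; rewrite /s' /Child 13!run_cons run_nil.
set N := rg s 1.
have nxt p t : ~~ has (fun x => x \in wr p) [:: 1; 10] ->
    ~~ has (fun a => a \in wa p) [:: 0; 1; 2; 3; 24; 25; 26; 28; 29] -> wide t /\ focus t ->
    wide (run p t) /\ focus (run p t).
  move=> nw /hasPn na [Wt Ft]; split; [apply: wide_run Wt => // | apply: focus_run Ft];
    by apply/hasPn => a ha; apply: na; move: a ha; apply/allP.
have H0 : wide s /\ focus s by split.
have [V0 _ _] := W.
set s1 := run (Degs _) s; have H1 : wide s1 /\ focus s1 by apply: nxt H0; vmt.
set s2 := run (Fill _ _ _) s1; have H2 : wide s2 /\ focus s2 by apply: nxt H1; vmt.
set s3 := run (Degs _) s2; have H3 : wide s3 /\ focus s3 by apply: nxt H2; vmt.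
set s4 := run (Fill _ _ _) s3; have H4 : wide s4 /\ focus s4 by apply: nxt H3; vmt.
set s5 := run (Degs _) s4; have H5 : wide s5 /\ focus s5 by apply: nxt H4; vmt.
set s6 := run (Rank _) s5; have H6 : wide s6 /\ focus s6 by apply: nxt H5; vmt.
set s7 := run (Mat 40 _) s6; have H7 : wide s7 /\ focus s7 by apply: nxt H6; vmt.
set s8 := run (Mat 41 _) s7; have H8 : wide s8 /\ focus s8 by apply: nxt H7; vmt.
set s9 := run (Vec 42 _ _) s8; have H9 : wide s9 /\ focus s9 by apply: nxt H8; vmt.
set s10 := run (Vec 42 _ _) s9; have H10 : wide s10 /\ focus s10 by apply: nxt H9; vmt.
set s11 := run (Vec 43 _ _) s10; have H11 : wide s11 /\ focus s11 by apply: nxt H10; vmt.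
set s12 := run (seqs _) s11.
have touch t a b d (P P' : {set G}) : wide t -> rep t a P' -> rep t b P -> a \in [:: 28; 29] ->
    b \in [:: 25; 26] -> d \in [:: 13; 14] ->
    rep (run (Fill 20 d (eAnd (eIn b (Var 20)) (Less (Cst 0) (Aget 15 (Var 20)))))
      (run (Degs (eAnd (eIn a (Var 20)) (eMat 1 (Var 46) (Var 20)))) t)) d
     [set u in P | [exists t in P', M u t]].
  move=> [V hM _] rP' rP ha hb hd; set t1 := run (Degs _) t.
  have V1 : view t1 by viewd.
  have rP1 : rep t1 b P by apply: rep_run rP; case: (side2 hb) => ->.
  have D x : ar t1 15 (ix x) = #|[pred y | (y \in P') && M x y]|.
    rewrite (@degs_val _ _ Uvs vsT _ _ (fun x y => (y \in P') && M x y) V) //.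
      by move: ha; rewrite !inE => /orP[]/eqP->.
    move=> {}x y; apply: ev_and; first by evb.
    by rewrite /= /upd /= hM.
  apply: (run_fill_rep Uvs vsT) => //; first exact: small_view V1.
    by move: hb hd; rewrite !inE => /orP[]/eqP-> /orP[]/eqP->.
  move=> x; eapply ev_by.
    apply: ev_and; first evb.
    by rewrite /= /upd /= D.
  rewrite inE; congr (_ && _); apply/card_gt0P/exists_inP => -[y].
    by rewrite inE => /andP[yP xy]; exists y.
  by move=> yP xy; exists y; rewrite inE yP.
have TA : rep s7 13 [set u in sA J i | [exists t in sA J (~~ i), M u t]].
  by do 5 (apply: rep_run; first vmt); have [W0 [_ ? _ ? _]] := H0; apply: touch.
have TB : rep s7 14 [set u in sB J i | [exists t in sB J (~~ i), M u t]].
  by do 3 (apply: rep_run; first vmt); have [W2 [_ _ ? _ ?]] := H2; apply: touch.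
have [[V5 _ _] [X5 _ _ _ _]] := H5.
have R6 : ranked vs J i s6.
  by apply: (run_rank Uvs vsT) => //; exact: small_view V5.
have lost x : ar s9 15 (ix x) = #|[pred t | (t \notin X) && (lab t == lab x)]|.
  do 4 (rewrite run_ar; last vmt); have [[V4 _ h4] [X4 _ _ _ _]] := H4.
  rewrite (@degs_val _ _ Uvs vsT _ _ (fun x t => (t \notin X) && (lab t == lab x)) V4) //.
  move=> {}x t; apply: ev_and; first by evb.
  by rewrite /= /upd /= !(proj1 (h4 _)).
have eN p t : 1 \notin wr p -> rg t 1 = N -> rg (run p t) 1 = N by move=> n1 e; rewrite run_rg.
have N6 : rg s6 1 = N by do 6 (rewrite [LHS]run_rg; last by vmt).
have N7 : rg s7 1 = N by apply: eN N6; vmt.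
have N8 : rg s8 1 = N by apply: eN N7; vmt.
have N9 : rg s9 1 = N by apply: eN N8; vmt.
have N10 : rg s10 1 = N by apply: eN N9; vmt.
have N11 : rg s11 1 = N by apply: eN N10; vmt.
have N12 : rg s12 1 = N by apply: eN N11; vmt.
have rk p t : 30 \notin wr p -> 12 \notin wa p -> ranked vs J i t -> ranked vs J i (run p t).
  by move=> n1 n2 [h1 h2]; split; rewrite ?run_rg ?run_ar.
have R7 : ranked vs J i s7 by apply: rk R6; vmt.
have R8 : ranked vs J i s8 by apply: rk R7; vmt.
have R9 : ranked vs J i s9 by apply: rk R8; vmt.
have R10 : ranked vs J i s10 by apply: rk R9; vmt.
have R11 : ranked vs J i s11 by apply: rk R10; vmt.
have F7 t p : rg (run p t) 7 = rg (run p t) 7 by [].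
have e7_9 : rg s9 7 = rg s 7 by do 9 (rewrite [LHS]run_rg; last by vmt).
have e7_11 : rg s11 7 = rg s 7 by do 11 (rewrite [LHS]run_rg; last by vmt).
have Ub := bvs_uniq J i Uvs. have Tb := @bvs_all _ vs J i vsT.
have cardb : #|block J i| = size r + 3 by rewrite (size_rX J i Uvs vsT); apply: card_block.
have leN : #|block J i| <= N by rewrite cardb (size_rX J i Uvs vsT).
have bN h : bix h < N by apply: leq_trans (ix_lt Ub Tb h) leN.
have rN k : k <= size r + 2 -> k < N by move: leN; rewrite cardb; lia.
have [e30 _] := R11.
have A12 : forall x y, ar s12 40 (bix x * (rg s12 1 + 1) + bix y) = adj x y.
  move=> x y; rewrite N12; do 5 (rewrite run_ar; last vmt).
  have [[V6 _ _] [_ A6 B6 _ _]] := H6.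
  rewrite -N6 mat_val ?N6 //.
  rewrite (@glue_val _ vs J i vsT s6 0 25 26 (@adj G) _ _ x y R6 _ A6 B6); first by case: x => ?; case: y => ?.
  by have [_ h] := V6.
have E12 : ar s12 44 0 = #|block J i|.
  by rewrite /s12 7!run_cons run_nil !run_arr /= /upd /= e30 cardb.
have [|es c L] := edges_val Ub Tb E12 _ A12; first by rewrite N12.
exists es => //; split=> //.
- by rewrite /newf run_ar //; vmt.
- by move=> x y; rewrite /newf run_ar; [rewrite -[N]N12; exact: A12 | vmt].
- move=> x y; rewrite /newf; do 5 (rewrite run_ar; last vmt).
  have [[V7 hM _] _] := H7.
  rewrite -N7 mat_val ?N7 //.
  rewrite (@glue_val _ vs J i vsT s7 1 13 14 M _ _ x y R7 _ TA TB) //.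
  by case: x => ?; case: y => ? //=; rewrite /touches !inE.
- have labv k : k < size r -> ar s11 42 k =
      if ar s9 15 (ar s9 12 k) != 0 then rg s9 7 else ar s8 2 (ar s8 12 k).
    move=> kr; have kN : k < N by apply: rN; lia.
    rewrite run_ar; last vmt.
    rewrite vec_val ?N9 //= /upd /= (proj1 R9) kr mul1n.
    case: ifP => // _; rewrite vec_val ?N8 //= /upd /= (proj1 R8) kr //.
  have namv k : k < size r -> ar s11 43 k = ar s10 3 (ar s10 12 k).
    move=> kr; have kN : k < N by apply: rN; lia.
    by rewrite vec_val ?N10 //= /upd /= (proj1 R10) kr.
  move=> x; rewrite /newf ![ar (run Edges _) _]run_ar; [|vmt..].
  rewrite /s12 7!run_cons run_nil !run_arr /= /upd /= e30 e7_11.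
  case: x => [u|k]; rewrite ?bix_inl ?bix_inr //=; last first.
    have p1 : (size r == size r + 1) = false by lia.
    have p2 : (size r == size r + 2) = false by lia.
    by have [->|->|->] := mkP k; rewrite /= ?addn0 ?p1 ?p2 ?eqxx ?eqn_add2l.
  have lt := @r_lt _ vs J i vsT u; set k := index _ _ in lt *.
  have -> : (k == size r) = false by lia.
  have -> : (k == size r + 1) = false by lia.
  have -> : (k == size r + 2) = false by lia.
  rewrite labv // namv // !(ranked_ix vsT) // lost e7_9.
  have [[_ _ h8] _] := H8; have [[_ _ h10] _] := H10.
  rewrite (proj1 (h8 _)) (proj2 (h10 _)); split=> //.
Qed.
End Child.

(** * Output and storage *)

Definition HLoop x b len adr e := PFor x b (PIf (Less (Var x) len) (PHeap adr e) PSkip).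

Lemma hloop_val x b len adr e s k L (p c : nat) (w : nat -> nat) :
  k = bval (rg s 1) (rg s 2) b -> L <= k -> 0 < c -> x \notin [:: 1; 2; 3] ->
  (forall s', same_off [:: x] [::] true s s' -> ev s' len = L) ->
  (forall s' i, i < L -> same_off [:: x] [::] true s s' -> rg s' x = i ->
     ev s' adr = p + i * c /\ ev s' e = w i) ->
  (forall i, i < L -> p + i * c < rg s 3) ->
  let s' := run (HLoop x b len adr e) s in
  (forall i, i < L -> hp s' (p + i * c) = w i) /\
  (forall a, (forall i, i < L -> a <> p + i * c) -> hp s' a = hp s a).
Proof.
move=> ek Lk c0; rewrite !inE !negb_or => /and3P[x1 x2 x3] hlen hw hp3 s'; rewrite /s' /HLoop.
set B := PIf _ _ _.
have [|||s1 [h _ ->]] := @run_for (fun j s' => (forall i, i < j -> i < L -> hp s' (p + i * c) = w i) /\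
  (forall a, (forall i, i < L -> a <> p + i * c) -> hp s' a = hp s a)) x b B s k => //.
- move=> i s1 ik so [h1 h2].
  have so1 : same_off [:: x] [::] true s (setr s1 x i).
    have [f1 f2 f3] := so; split=> // y; rewrite inE => yx; rewrite /= /upd (negPf yx) f1 //.
    by rewrite inE (negPf yx).
  have ex : rg (setr s1 x i) x = i by rewrite /= /upd eqxx.
  have -> : run B (setr s1 x i) = if i < L then run (PHeap adr e) (setr s1 x i) else setr s1 x i.
    by rewrite /B run_if run_skip [ev _ _]/= hlen // {1}/upd eqxx eqb0 -leqNgt; case: ltnP.
  case: (ltnP i L) => iL; last first.
    split=> // j; rewrite ltnS leq_eqVlt => /orP[/eqP->|lt]; last exact: h1.
    by rewrite ltnNge iL.
  have [ea ee] := hw _ _ iL so1 ex.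
  have e3 : rg (setr s1 x i) 3 = rg s 3 by have [f1 _ _] := so1; rewrite f1 // inE eq_sym.
  rewrite run_heap ea e3 hp3 // ee; split=> [j|a ha] /=; last first.
    by rewrite /upd; case: eqP => [e0|_]; [case: (ha i iL) | apply: h2].
  rewrite ltnS /upd eqn_add2l eqn_pmul2r // leq_eqVlt.
  by case: eqP => [->//|_ /= ji jL]; apply: h1.
by case: h => h1 h2; split=> // i iL; apply: h1 => //; apply: leq_trans iL Lk.
Qed.

Definition SetDump a := seqs [:: Rank a; PHeap (Var 35) (Var 30);
  HLoop 20 BN (Var 30) (Plus (Plus (Var 35) (Cst 1)) (Var 20)) (Aget 3 (Aget 12 (Var 20)))].

Definition eEdge := Plus (Plus (Plus (Var 36) (Cst 2)) (Aget 44 (Cst 0))) (Times (Var 80) (Cst 2)).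

Definition GraphDump := seqs [:: PHeap (Var 36) (Aget 44 (Cst 0)); PHeap (Plus (Var 36) (Cst 1)) (Aget 45 (Cst 0));
  HLoop 20 BN (Aget 44 (Cst 0)) (Plus (Plus (Var 36) (Cst 2)) (Var 20)) (Aget 43 (Var 20));
  HLoop 80 BM (Aget 45 (Cst 0)) eEdge (Aget 43 (Aget 46 (Var 80)));
  HLoop 80 BM (Aget 45 (Cst 0)) (Plus eEdge (Cst 1)) (Aget 43 (Aget 47 (Var 80)))].

Lemma flat_pairs (T : Type) (f g : T -> nat) es k : k < size es ->
  nth 0 (flatten [seq [:: f e; g e] | e <- es]) (k * 2) = nth 0 (map f es) k /\
  nth 0 (flatten [seq [:: f e; g e] | e <- es]) (k * 2 + 1) = nth 0 (map g es) k.
Proof.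
elim: es k => // e es IH [|k] //= /IH[h1 h2].
by split.
Qed.

Section Output.
Variables (G : sgraph) (vs : seq G).
Hypotheses (Uvs : uniq vs) (vsT : forall x, x \in vs).
Notation ix := (ix vs).
Notation rep := (rep vs).

Lemma setdump_val s a X (name : G -> nat) : small G s -> rep s a X -> a != 12 ->
  (forall x, ar s 3 (ix x) = name x) -> rg s 35 + 1 + #|X| <= rg s 3 ->
  let s' := run (SetDump a) s in
  set_at (hp s') (rg s 35) name X /\
  forall c, (c < rg s 35) || (rg s 35 + 1 + #|X| <= c) -> hp s' c = hp s c.
Proof.
move=> sm rX a12 hn le s'; rewrite /s' /SetDump 3!run_cons run_nil.
have [h30 h12] := run_rank Uvs vsT sm rX a12.
set s1 := run (Rank a) s in h30 h12 *.
have e35 : rg s1 35 = rg s 35 by rewrite run_rg.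
have e3 : rg s1 3 = rg s 3 by rewrite run_rg.
have sz : size (rank vs X) = #|X|.
  by rewrite -(card_uniqP (rank_uniq Uvs X)); apply: eq_card => x; rewrite mem_rank.
have hp1 : hp s1 = hp s by rewrite run_hp.
rewrite run_heap [ev _ _]/= e35 e3 [ev _ _]/= h30; case: ifP => [lt|]; last by move/negbT; lia.
set s2 := seth s1 _ _; set p := rg s 35 in le e35 lt s2 *.
have [_ s1N] := sm.
have [|||||||h1 h2] := @hloop_val 20 BN (Var 30) (Plus (Plus (Var 35) (Cst 1)) (Var 20)) (Aget 3 (Aget 12 (Var 20)))
  s2 (rg s 1) (size (rank vs X)) (p + 1) 1 (nth 0 (map name (rank vs X))).
- by rewrite /= run_rg.
- by rewrite sz; apply: leq_trans (max_card _) s1N.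
- by [].
- by [].
- by move=> s3 [f1 _ _]; rewrite /= f1.
- move=> s3 i iL [f1 f2 _] e20; rewrite /= f1 // e20 /= e35 muln1; split=> //.
  have a3 : ar s1 3 = ar s 3 by rewrite run_ar.
  have [x0 _] : exists x0 : G, true by case: (rank vs X) iL => // x0; exists x0.
  by rewrite !f2 //= h12 // a3 !(nth_map x0).
- by move=> i iL; rewrite /= e3 muln1; lia.
have out c : (c < p) || (p + 1 + #|X| <= c) -> hp (run (HLoop 20 BN (Var 30)
    (Plus (Plus (Var 35) (Cst 1)) (Var 20)) (Aget 3 (Aget 12 (Var 20)))) s2) c = hp s c.
  move=> hc; rewrite h2; last by move=> i iL; move: hc; rewrite -sz; lia.
  by rewrite /= /upd hp1; case: eqP => // e; move: hc; rewrite e; lia.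
split=> //; exists (rank vs X); split; [exact: rank_uniq | by move=> x; rewrite mem_rank | ].
case=> [_|i] /=.
  rewrite addn0 h2; first by rewrite /= /upd eqxx.
  by move=> i iL; lia.
by rewrite size_map => iL; rewrite -h1 // muln1; congr hp; lia.
Qed.

Lemma graphdump_val s (name : G -> nat) (es : seq (G * G)) : #|G| <= rg s 1 -> lists_in vs (newf s) es ->
  ar s 44 0 = #|G| -> (forall x, ar s 43 (ix x) = name x) -> size es <= rg s 2 ->
  rg s 36 + 2 + #|G| + 2 * size es <= rg s 3 ->
  let s' := run GraphDump s in
  stored (hp s') (rg s 36) (graph_code name vs es) /\
  forall c, (c < rg s 36) || (rg s 36 + 2 + #|G| + 2 * size es <= c) -> hp s' c = hp s c.
Proof.
move=> s1N [l5 l6 l7] e44 hn esM le s'; rewrite /s' /GraphDump 5!run_cons run_nil.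
set p := rg s 36 in le *.
rewrite (run_heap (Var 36)) [ev _ _]/= -/p [ev _ _]/= e44; case: ifP => [lt0|]; last by move/negbT; lia.
set s1 := seth s _ _.
rewrite (run_heap (Plus _ _)) [ev _ _]/= -/p [ev _ _]/=; case: ifP => [lt1|]; last by move/negbT; rewrite /=; lia.
have -> : ar s 45 0 = size es by exact: l5.
set s2 := seth s1 _ _.
have [|||||||h1 h2] := @hloop_val 20 BN (Aget 44 (Cst 0)) (Plus (Plus (Var 36) (Cst 2)) (Var 20)) (Aget 43 (Var 20))
  s2 (rg s 1) #|G| (p + 2) 1 (nth 0 (map name vs)).
- by [].
- by [].
- by [].
- by [].
- by move=> s3 [_ f2 _]; rewrite /= f2.
- move=> s3 i iL [f1 f2 _] e20; rewrite /= f1 // e20 /= muln1; split=> //.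
  have [x ex] := ix_onto Uvs vsT iL.
  by rewrite f2 //= -ex hn (nth_map x) ?index_mem // nth_index.
- by move=> i iL; rewrite /= muln1; lia.
set s3 := run (HLoop 20 _ _ _ _) s2 in h1 h2 *.
have keep t q r : same_off [:: 20; 80] [::] true s t -> all (fun x => x \in [:: 20; 80]) (wr q) ->
     wa q = [::] -> r = run q t -> same_off [:: 20; 80] [::] true s r.
  move=> so /allP hq ha ->; apply: same_trans so _; have [f1 f2 _] := run_same q t.
  by split=> // [x xn|a _]; [apply: f1; apply: contra xn => /hq | apply: f2; rewrite ha].
have so2 : same_off [:: 20; 80] [::] true s s2 by split.
have so3 : same_off [:: 20; 80] [::] true s s3 by apply: (keep s2 _ _ so2 _ _ erefl).
have vals t i : i < size es -> same_off [:: 20; 80] [::] true s t -> rg t 80 = i ->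
    [/\ ev t eEdge = p + 2 + #|G| + i * 2, ev t (Aget 43 (Aget 46 (Var 80))) = nth 0 [seq name e.1 | e <- es] i &
        ev t (Aget 43 (Aget 47 (Var 80))) = nth 0 [seq name e.2 | e <- es] i].
  move=> iL [f1 f2 _] e80; rewrite /= f1 // e80 !f2 // e44.
  have [e0 _] : exists e0 : G * G, true by case: (es) iL => // e0 l; exists e0.
  have -> : ar s 46 i = ix (nth e0 es i).1 by rewrite -[ar s 46 i]/(newf s 6 i) l6 // (nth_map e0).
  have -> : ar s 47 i = ix (nth e0 es i).2 by rewrite -[ar s 47 i]/(newf s 7 i) l7 // (nth_map e0).
  by rewrite !hn !(nth_map e0).
have one a t x : same_off [:: 20; 80] [::] true s t -> same_off [:: x] [::] true t a -> x \in [:: 20; 80] ->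
    same_off [:: 20; 80] [::] true s a.
  move=> so so' xi; apply: same_trans so _; apply: same_weak so' => // y; by rewrite inE => /eqP->.
have [f31 f32 _] := so3.
have [|||||||h3 h4] := @hloop_val 80 BM (Aget 45 (Cst 0)) eEdge (Aget 43 (Aget 46 (Var 80))) s3 (rg s3 2) (size es)
  (p + 2 + #|G|) 2 (nth 0 [seq name e.1 | e <- es]).
- by [].
- by rewrite f31.
- by [].
- by [].
- by move=> t [_ f2 _]; rewrite /= f2 // f32.
- move=> t i iL so e80; have [|? ? _] := vals t i iL _ e80; last by split.
  by apply: (one _ _ _ so3 so).
- by move=> i iL; rewrite f31 //; lia.
set s4 := run (HLoop 80 _ _ _ (Aget 43 (Aget 46 _))) s3 in h3 h4 *.
have so4 : same_off [:: 20; 80] [::] true s s4 by apply: (keep s3 _ _ so3 _ _ erefl).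
have [f41 f42 _] := so4.
have [|||||||h5 h6] := @hloop_val 80 BM (Aget 45 (Cst 0)) (Plus eEdge (Cst 1)) (Aget 43 (Aget 47 (Var 80))) s4 (rg s4 2) (size es)
  (p + 2 + #|G| + 1) 2 (nth 0 [seq name e.2 | e <- es]).
- by [].
- by rewrite f41.
- by [].
- by [].
- by move=> t [_ f2 _]; rewrite /= f2 // f42.
- move=> t i iL so e80; have [|e1 _ ->] := vals t i iL _ e80; last first.
    by split=> //; change (ev t eEdge + 1 = p + 2 + #|G| + 1 + i * 2); rewrite e1; lia.
  by apply: (one _ _ _ so4 so).
- by move=> i iL; rewrite f41 //; lia.
set s5 := run _ s4 in h5 h6 *.
split; last first.
  move=> c hc.
  have n1 i : i < #|G| -> c <> p + 2 + i * 1 by move=> iL e; move: hc; rewrite e; lia.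
  have n2 i : i < size es -> c <> p + 2 + #|G| + i * 2 by move=> iL e; move: hc; rewrite e; lia.
  have n3 i : i < size es -> c <> p + 2 + #|G| + 1 + i * 2 by move=> iL e; move: hc; rewrite e; lia.
  rewrite h6 // h4 // h2 //= /upd.
  by case: eqP hc => [->|_]; [lia|]; case: eqP => [->|]; [lia|].
have sz : size vs = #|G| by apply: size_vs.
have off c : c < p + 2 + #|G| -> hp s5 c = hp s3 c.
  by move=> hc; rewrite h6 ?h4 // => i iL; move: hc; lia.
case=> [_|[_|i]].
- rewrite addn0 off; last by lia.
  rewrite h2; last by move=> i iL; lia.
  have ne : (p == p + 1) = false by lia.
  by rewrite /= /upd ne eqxx sz.
- rewrite off; last by lia.
  rewrite h2; last by move=> i iL; lia.
  by rewrite /= /upd eqxx.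
rewrite /graph_code /= !ltnS size_cat size_map nth_cat size_map sz => hi.
case: ltnP => iG.
  have -> : p + i.+2 = p + 2 + i * 1 by clear; lia.
  by rewrite off ?h1 // muln1 ltn_add2l.
have := flat_pairs (fun e : G * G => name e.1) (fun e : G * G => name e.2).
have szf : size (flatten [seq [:: name e.1; name e.2] | e <- es]) = 2 * size es.
  by elim: (es) => //= e l ->; lia.
rewrite szf in hi.
have [k [b [ek b2]]] : exists k b, i - #|G| = k * 2 + b /\ b < 2.
  by exists ((i - #|G|) %/ 2), ((i - #|G|) %% 2); rewrite -divn_eq ltn_mod.
have kL : k < size es by move: hi iG ek b2; clear; lia.
move=> /(_ es _ kL)[n1 n2]; rewrite ek.
case: b b2 ek => [|[|//]] _ ek.
- rewrite addn0 n1 -h3 // h6; last by move=> j _; move: ek iG; clear; lia.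
  by congr hp; move: ek iG; clear; lia.
- by rewrite n2 -h5 //; congr hp; move: ek iG; clear; lia.
Qed.
End Output.

(* Arrays 40 to 47 are a block under construction, in the format of arrays 0 to *)
(* 7; the graph of node j of the tree is in arrays 50 to 57, from index         *)
(* j (N + 1) ^ 2 on.                                                            *)
Definition eN1 := Plus (Var 1) (Cst 1).
Definition eCell1 := Plus (Times (Var 20) eN1) (Var 21).
Definition eBig j := Plus (Times (Var j) (Times eN1 eN1)) eCell1.

(** With N + 1 rounds in each loop there is a cell to copy even when N = 0, as entry 0 of arrays 4
    and 5 requires; the cells also suffice for the list of edges. *)
Definition Copies b ai e := PFor 20 BN1 (PFor 21 BN1 (PArr b ai e)).

Definition Store b j := seqs [seq Copies (50 + a) (eBig j) (Aget (b + a) eCell1) | a <- iota 0 8].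
Definition Recall := seqs [seq Copies a eCell1 (Aget (50 + a) (eBig 5)) | a <- iota 0 8].

Definition cells N := (N + 1) * (N + 1).

Lemma cell_split N k : k < cells N -> exists i j, [/\ i < N.+1, j < N.+1 & k = i * (N + 1) + j].
Proof.
move=> h; exists (k %/ (N + 1)), (k %% (N + 1)).
rewrite ltn_divLR ?addn1 // ltn_mod; split=> //; last exact: divn_eq.
by rewrite /cells !addn1 in h.
Qed.

Lemma copies_val b ai e s (z : nat -> nat) : let N := rg s 1 in
  b \notin ra e -> injective z ->
  (forall s' i j, same_off [:: 20; 21] [:: b] false s s' -> rg s' 20 = i -> rg s' 21 = j ->
     ev s' ai = z (i * (N + 1) + j)) ->
  let s' := run (Copies b ai e) s in
  (forall i j, i < N.+1 -> j < N.+1 -> ar s' b (z (i * (N + 1) + j)) = ev (setr (setr s 20 i) 21 j) e) /\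
  (forall k, (forall l, l < cells N -> k <> z l) -> ar s' b k = ar s b k).
Proof.
move=> N be zi hz s'.
have inj1 i j i' j' : j < N.+1 -> j' < N.+1 ->
    (i * (N + 1) + j == i' * (N + 1) + j') = (i == i') && (j == j').
  move=> jN j'N; apply/eqP/andP => [e0|[/eqP-> /eqP->] //].
  have := f_equal (edivn^~ (N + 1)) e0; rewrite !edivn_eq ?addn1 //.
  by case=> -> ->.
pose Q i j s' := (forall i' j', i' < N.+1 -> j' < N.+1 -> i' < i \/ i' = i /\ j' < j ->
    ar s' b (z (i' * (N + 1) + j')) = ev (setr (setr s 20 i') 21 j') e) /\
  (forall k, (forall l, l < cells N -> k <> z l) -> ar s' b k = ar s b k).
have : Q N.+1 0 s'.
  apply: (run_for2 (P := Q) (k := N.+1) (l := N.+1)) => //.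
  - by split=> // i' j' _ _ [|[]].
  - move=> k s1 kN [h h']; split=> // i' j' iN' jN' [|[]//].
    rewrite ltnS leq_eqVlt => /orP[/eqP ->|lt]; apply: h => //; first by right.
    by left.
  - move=> k l s1 kN lN so e20 e21 [h h'].
    have so' : same_off [:: 20; 21] [:: b] false s s1 by [].
    have [f1 f2 f3] := so.
    rewrite run_arr (hz s1 k l so' e20 e21); split=> [i' j' iN' jN' lt|q hq] /=; rewrite eqxx /upd; last first.
      case: eqP => [eq|_]; last exact: h'.
      case: (hq (k * (N + 1) + l)) => //; rewrite /cells !addn1; nia.
    rewrite (inj_eq zi) inj1 //; case: andP => [[/eqP-> /eqP->]|ne].
      apply: ev_ext => [x _|a ae y|_].
      - rewrite /= /upd; case: eqP => [->|/eqP x21]; first by rewrite e21.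
        case: eqP => [->|/eqP x20]; first by rewrite e20.
        by rewrite f1 // !inE negb_or x20 x21.
      - by rewrite /= f2 // !inE; apply: contraNneq be => <-.
      - by rewrite /= f3.
    apply: h => //; case: lt => [|[e1]]; first by left.
    rewrite ltnS leq_eqVlt => /orP[/eqP e2|]; last by right.
    by case: ne; rewrite e1 e2 !eqxx.
by case=> h h'; split=> // i j iN jN; apply: h => //; left.
Qed.

Definition bigf (s : mstate) j a k := ar s (50 + a) (j * cells (rg s 1) + k).

Lemma store_val b j s : b + 8 <= 50 -> j \notin [:: 20; 21] -> let s' := run (Store b j) s in
  (forall a k, a < 8 -> k < cells (rg s 1) -> bigf s' (rg s j) a k = ar s (b + a) k) /\
  (forall j' a k, j' <> rg s j -> a < 8 -> k < cells (rg s 1) -> bigf s' j' a k = bigf s j' a k).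
Proof.
move=> b50 hj s'; rewrite /s' /Store /bigf.
pose Ps l := [seq Copies (50 + a) (eBig j) (Aget (b + a) eCell1) | a <- iota l (8 - l)].
suff H l t : l <= 8 -> rg t =1 rg t ->
    rg t 1 = rg s 1 -> rg t j = rg s j ->
    (forall a, a < 50 -> ar t a = ar s a) ->
    (forall a, l <= a < 8 -> ar t (50 + a) = ar s (50 + a)) ->
    (forall a k, a < l -> k < cells (rg s 1) -> ar t (50 + a) (rg s j * cells (rg s 1) + k) = ar s (b + a) k) ->
    (forall j' a k, j' <> rg s j -> a < 8 -> k < cells (rg s 1) ->
       ar t (50 + a) (j' * cells (rg s 1) + k) = ar s (50 + a) (j' * cells (rg s 1) + k)) ->
    let s' := run (seqs (Ps l)) t in
    (forall a k, a < 8 -> k < cells (rg s 1) -> ar s' (50 + a) (rg s j * cells (rg s 1) + k) = ar s (b + a) k) /\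
    (forall j' a k, j' <> rg s j -> a < 8 -> k < cells (rg s 1) ->
       ar s' (50 + a) (j' * cells (rg s 1) + k) = ar s (50 + a) (j' * cells (rg s 1) + k)).
  have := H 0 s isT (fun=> erefl) erefl erefl (fun _ _ => erefl) (fun _ _ => erefl) _ (fun _ _ _ _ _ _ => erefl).
  by rewrite /Ps subn0 run_rg; [apply | vmt].
elim: (8 - l) {-2}l t (erefl (8 - l)) => [|n IH] {}l t en l8 _ e1 ej h1 h2 h3 h4 s1.
  rewrite /s1 /Ps en /= run_nil; split=> // a k a8; apply: h3.
  by move: en a8; lia.
have l8' : l < 8 by lia.
rewrite /s1 /Ps en [iota _ _]/= [map _ _]/= run_cons.
have -> : n = 8 - l.+1 by lia.
rewrite -/(Ps l.+1); set p := Copies _ _ _; set t1 := run p t.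
have := @copies_val (50 + l) (eBig j) (Aget (b + l) eCell1) t (fun k => rg t j * cells (rg t 1) + k).
case.
- by rewrite [ra _]/= !inE; apply/eqP; lia.
- exact: addnI.
- move=> t' i' j' [f1 _ _] e20 e21; rewrite /= e20 e21 !f1 // /cells; lia.
rewrite -/p -/t1 => g1 g2.
have q : rg t1 =1 rg t1 by [].
have f x : x \notin [:: 20; 21] -> rg t1 x = rg t x by move=> hx; apply: run_rg.
apply: IH => //; try lia.
- by rewrite f.
- by rewrite f.
- by move=> a a50; rewrite run_ar ?h1 // inE; apply/eqP; lia.
- by move=> a /andP[la a8]; rewrite run_ar ?h2 ?inE //; [lia | apply/eqP; lia].
- move=> a k + kc; rewrite ltnS leq_eqVlt => /orP[/eqP->|lt]; last first.
    by rewrite run_ar ?h3 // inE; apply/eqP; lia.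
  have [i' [j' [iN jN ->]]] := cell_split kc.
  rewrite -ej -e1 in iN jN *; rewrite g1 // /= /upd /=.
  by rewrite h1 //; lia.
- move=> j' a k jj a8 kc; case: (eqVneq a l) => [->|al]; last first.
    by rewrite run_ar ?h4 // inE; apply/eqP; move/eqP: al; lia.
  rewrite g2 ?h4 // => l' l'c; rewrite e1 ej in l'c *; move=> e0.
  have := f_equal (edivn^~ (cells (rg s 1))) e0; rewrite !edivn_eq //.
  by case=> e0' _; apply: jj.
Qed.

Lemma load_val s : let s' := run Recall s in
  forall a k, a < 8 -> k < cells (rg s 1) -> ar s' a k = bigf s (rg s 5) a k.
Proof.
move=> s' a k a8 kc; rewrite /s' /Recall /bigf.
pose Ps l := [seq Copies a (eCell1) (Aget (50 + a) (eBig 5)) | a <- iota l (8 - l)].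
suff H l t : l <= 8 -> rg t 1 = rg s 1 -> rg t 5 = rg s 5 ->
    (forall a, 50 <= a -> ar t a = ar s a) ->
    (a < l -> ar t a k = ar s (50 + a) (rg s 5 * cells (rg s 1) + k)) ->
    ar (run (seqs (Ps l)) t) a k = ar s (50 + a) (rg s 5 * cells (rg s 1) + k).
  by have := H 0 s isT erefl erefl (fun _ _ => erefl) (fun h => match notF h with end).
elim: (8 - l) {-2}l t (erefl (8 - l)) => [|n IH] {}l t en l8 e1 e5 h1 h2.
  by rewrite /Ps en /= run_nil; apply: h2; move: en a8; lia.
rewrite /Ps en [iota _ _]/= [map _ _]/= run_cons.
have -> : n = 8 - l.+1 by lia.
rewrite -/(Ps l.+1); set p := Copies _ _ _; set t1 := run p t.
have := @copies_val l eCell1 (Aget (50 + l) (eBig 5)) t id.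
case.
- by rewrite [ra _]/= !inE; apply/eqP; lia.
- by [].
- by move=> t' i' j' [f1 _ _] e20 e21; rewrite /= e20 e21 !f1.
rewrite -/p -/t1 => g1 g2.
have f x : x \notin [:: 20; 21] -> rg t1 x = rg t x by move=> hx; apply: run_rg.
apply: IH => //; try lia.
- by rewrite f.
- by rewrite f.
- by move=> c c50; rewrite run_ar ?h1 // inE; apply/eqP; lia.
rewrite ltnS leq_eqVlt => /orP[/eqP->|lt]; last by rewrite run_ar ?h2 // inE; apply/eqP; lia.
have [i' [j' [iN jN ->]]] := cell_split kc.
by rewrite -e5 -e1 in iN jN *; rewrite g1 // /= /upd /= h1.
Qed.

Lemma shows_ext (G : sgraph) (vs : seq G) N name M lab es f f' : uniq vs -> (forall x, x \in vs) ->
  #|G| <= N -> clean vs es -> (forall a k, a < 8 -> k < cells N -> f' a k = f a k) ->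
  shows vs N name M lab es f -> shows vs N name M lab es f'.
Proof.
move=> U T GN c h [h1 h2 h3 h4 [h5 h6 h7]].
have c0 : 0 < cells N by rewrite /cells; lia.
have xN x : ix vs x < N by apply: leq_trans (ix_lt U T x) GN.
have cN x y : ix vs x * (N + 1) + ix vs y < cells N.
  rewrite /cells; move: (xN x) (xN y); nia.
have xc x : ix vs x < cells N by rewrite /cells; move: (xN x); nia.
have sz : size es <= cells N.
  have : size es <= #|[set: G * G]|.
    by have [Ue _ _] := c; rewrite -(card_uniqP Ue); apply/subset_leq_card/subsetP => e; rewrite inE.
  by rewrite cardsT card_prod /cells => le; apply: leq_trans le _; nia.
split.
- by rewrite h.
- by move=> x y; rewrite h.
- by move=> x y; rewrite h.
- by move=> x; rewrite !h.
- by split; [rewrite h | move=> k ks; rewrite h ?h6 //; apply: leq_trans ks sz | move=> k ks; rewrite h ?h7 //; apply: leq_trans ks sz].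
Qed.

(** * Treating one node of the tree *)

Definition Decide := seqs
  [:: PSet 10 (Aget 4 (Cst 0)); PSet 16 (Cst 0); PSet 11 (Cst 0);
      Pick 1 (eMat 1 (Var 20) (Var 21));
      PIf (eNot (Var 16)) (Pick 2 (eAnd (eAdj (Var 20) (Var 21))
         (eNot (Equ (Aget 2 (Var 20)) (Aget 2 (Var 21)))))) PSkip;
      PIf (Var 16) Hunt PSkip].

Definition Drop := seqs [:: PArr 1 (Plus (Times (Var 12) eN1) (Var 13)) (Cst 0);
  PArr 1 (Plus (Times (Var 13) eN1) (Var 12)) (Cst 0)].

Definition Merge := seqs [:: PSet 37 (Aget 2 (Var 12)); PSet 38 (Aget 2 (Var 13));
  Vec 15 (Cst 1) (Aget 2 (Var 20)); Vec 2 (Equ (Aget 15 (Var 20)) (Var 38)) (Var 37)].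

Section Turn.
Variables (G : sgraph) (vs : seq G).
Hypotheses (Uvs : uniq vs) (vsT : forall x, x \in vs).
Notation ix := (ix vs).
Notation rep := (rep vs).
Notation view := (view vs).
Variables (name : G -> nat) (es : seq (G * G)).
Hypothesis esC : clean vs es.

Definition loaded M lab s := [/\ rg s 10 = #|G|, #|G| <= rg s 1, size es <= rg s 2 &
  shows vs (rg s 1) name M lab es (ar s)].

Lemma loaded_view M lab s : loaded M lab s -> view s.
Proof. by move=> [h10 h1 _ [_ h _ _ _]]; split. Qed.

Lemma loaded_lists M lab s : loaded M lab s -> lists vs es s.
Proof. by move=> [_ _ h2 [_ _ _ _ [h5 h6 h7]]]; split. Qed.

Lemma loaded_wide M lab s : loaded M lab s -> wide vs M lab name s.
Proof. by move=> L; have [_ _ _ [_ _ h h' _]] := L; split=> //; apply: loaded_view L. Qed.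

Lemma loaded_run M lab p s : ~~ has (fun x => x \in wr p) [:: 1; 2; 10] ->
  ~~ has (fun a => a \in wa p) (iota 0 8) -> loaded M lab s -> loaded M lab (run p s).
Proof.
rewrite /= !negb_or !andbT => /and3P[n1 n2 n10] /and5P[m0 m1 m2 m3 /and4P[m4 m5 m6 m7]].
move=> [h10 h1 hs [s4 s0 s1 s2 [s5 s6 s7]]].
split; rewrite ?run_rg //; split; rewrite ?run_ar //.
by split; rewrite ?run_ar.
Qed.

Definition nothing s := rg s 16 = 0 /\ (forall J : split G, ~ two_join J).

Definition failed (M : rel G) (lab : G -> nat) s := [/\ rg s 16 != 0, rg s 11 = 0 & exists a1 a2,
  [/\ rg s 12 = ix a1 /\ rg s 13 = ix a2, forall J, two_join J -> ~~ separates J a1 a2 &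
   rg s 16 = 1 /\ M a1 a2 \/ rg s 16 = 2 /\ lab a1 != lab a2]].

Definition succeeded s := [/\ rg s 16 != 0, rg s 11 != 0 & exists a1 a2 b1 b2 X,
  [/\ adj a1 a2, adj b1 b2 & target a1 a2 b1 b2 X] /\
  [/\ rg s 12 = ix a1, rg s 13 = ix a2, rg s 14 = ix b1, rg s 15 = ix b2 & rep s 10 X]].

(** The outcomes: no pair is left to test, so there is no 2-join by [hitting_leaf]; the test of a
    pair fails, so no 2-join separates it; or a 2-join has been found. *)
Lemma decide_val M lab s : rg s 10 = rg s 10 -> loaded M lab (setr s 10 (ar s 4 0)) -> hitting M lab ->
  (forall u v, M u v -> adj u v) ->
  let s' := run Decide s in
  loaded M lab s' /\ [\/ nothing s', failed M lab s' | succeeded s'].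
Proof.
move=> _ L0 hit Madj s'.
have L' : loaded M lab s'.
  rewrite /s' /Decide run_cons run_set; by apply: loaded_run L0; vmt.
split=> //; rewrite /s' /Decide 6!run_cons run_nil !run_set.
set s0 := setr (setr (setr s 10 _) 16 _) 11 _.
have {}L0 : loaded M lab s0.
  by have := @loaded_run M lab (seqs [:: PSet 16 (Cst 0); PSet 11 (Cst 0)]) _ isT isT L0;
     rewrite 2!run_cons run_nil !run_set.
have V0 := loaded_view L0; have sm0 := small_view V0.
set s1 := run (Pick 1 _) s0; have L1 : loaded M lab s1 by apply: loaded_run L0; vmt.
have e11 : rg s1 11 = 0 by rewrite run_rg //; vmt.
have P1 : (rg s1 16 = 0 /\ forall x y, ~~ M x y) \/ picked vs 1 M s1.
  apply: (pick_val Uvs vsT) => // x y.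
  by have [_ _ _ [_ _ h _ _]] := L0; rewrite /= /upd /= h.
set s2 := run (PIf (eNot (Var 16)) _ _) s1.
have L2 : loaded M lab s2 by apply: loaded_run L1; vmt.
have e11' : rg s2 11 = 0 by rewrite run_rg //; vmt.
have P2 : [\/ rg s2 16 = 0 /\ ((forall x y, ~~ M x y) /\ forall x y, adj x y -> lab x = lab y),
   picked vs 1 M s2 | picked vs 2 (fun x y => adj x y && (lab x != lab y)) s2].
  rewrite /s2 run_if; case: P1 => [[e16 noM]|P1]; last first.
    have [e16 _] := P1; rewrite [ev _ _]/= e16 run_skip; exact: Or32.
  rewrite [ev _ _]/= e16 /=; have V1 := loaded_view L1.
  have [||[e16' h]|h] := @pick_val G vs Uvs vsT 2 (eAnd (eAdj (Var 20) (Var 21)) (eNot (Equ (Aget 2 (Var 20)) (Aget 2 (Var 21)))))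
     s1 (fun x y => adj x y && (lab x != lab y)) (small_view V1) e16.
  - by [].
  - move=> x y; apply: ev_and; first by evb.
    by have [_ _ _ [_ _ _ h _]] := L1; rewrite /= /upd /= (proj1 (h x)) (proj1 (h y)); case: (lab x == lab y).
  - apply: Or31; split=> //; split=> // x y xy.
    by have := h x y; rewrite xy /= negbK => /eqP.
  - exact: Or33.
set s3 := run (PIf _ Hunt _) s2.
case: P2 => [[e16 [noM sameL]]|P2|P2].
- apply: Or31; rewrite /s3 run_if [ev _ _]/= e16 /= run_skip; split=> //.
  exact: hitting_leaf hit noM sameL.
all: have [e16 [a1 [a2 [h12 e12 e13]]]] := P2.
all: have a12 : adj a1 a2 by [exact: Madj | case/andP: h12].
all: have s3E : s3 = run Hunt s2 by rewrite /s3 run_if [ev _ _]/= e16.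
all: have [|[V3 _ f12 f13]] := @hunt_val G vs es Uvs vsT a1 a2 a12 (clean_adj esC) (fun u v => clean_all vsT esC) s2;
  first by split=> //; [apply: loaded_view L2 | apply: loaded_lists L2].
all: have f16 : rg (run Hunt s2) 16 = rg s2 16 by rewrite run_rg //; vmt.
all: rewrite -s3E in V3 f12 f13 f16 *; rewrite /tried.
all: case: (eqVneq (rg s3 11) 0) => [z|nz] T.
1,3: apply: Or32; split=> //; first by rewrite f16 e16.
1,2: exists a1, a2; split=> //; last by rewrite f16 e16; first [by left | by right; split=> //; case/andP: h12].
1,2: move=> J tJ; apply/negP => sep; have [b1 [b2 [X [b12 tX]]]] := separates_target tJ sep a12; exact: (T b1 b2 X b12 tX).
all: apply: Or33; split=> //; first by rewrite f16 e16.
all: have [b1 [b2 [X [b12 tX f14 f15 r]]]] := T.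
all: by exists a1, a2, b1, b2, X.
Qed.

Lemma drop_val M lab s a1 a2 : loaded M lab s -> rg s 12 = ix a1 -> rg s 13 = ix a2 ->
  loaded (fun u v => M u v && ((u, v) != (a1, a2)) && ((v, u) != (a1, a2))) lab (run Drop s).
Proof.
move=> [h10 h1 h2 [s4 s0 s1 s2 s5]] e12 e13; rewrite /Drop 2!run_cons run_nil !run_arr.
split=> //; split=> // x y; rewrite /= /upd /= e12 e13.
have lt u : ix u < rg s 1 by apply: leq_trans (ix_lt Uvs vsT u) h1.
rewrite !mat_inj // !ix_eq // s1 !xpair_eqE.
case: (x == a1); case: (y == a2); case: (x == a2); case: (y == a1); rewrite ?andbF ?andbT //=.
Qed.

Lemma merge_val M lab s a1 a2 : loaded M lab s -> rg s 12 = ix a1 -> rg s 13 = ix a2 ->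
  loaded M (fun x => if lab x == lab a2 then lab a1 else lab x) (run Merge s).
Proof.
move=> L e12 e13; rewrite /Merge 4!run_cons run_nil !run_set.
have [h10 h1 h2 [s4 s0 s1 s2 s5]] := L.
set t := setr (setr s 37 _) 38 _.
have e37 : rg t 37 = lab a1 by rewrite /= /upd /= e12; case: (s2 a1).
have e38 : rg t 38 = lab a2 by rewrite /= /upd /= e13; case: (s2 a2).
set t1 := run (Vec 15 _ _) t; set t2 := run (Vec 2 _ _) t1.
have r x : x \notin [:: 20; 37; 38] -> rg t2 x = rg s x.
  move=> hx; have x20 : x != 20 by move: hx; rewrite !inE negb_or => /andP[].
  rewrite !run_rg; try by rewrite /= inE.
  by move: hx; rewrite !inE !negb_or /= /upd => /and3P[_ /negPf-> /negPf->].
have a b : b \notin [:: 2; 15] -> ar t2 b = ar s b.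
  by rewrite !inE negb_or => /andP[b2 b15]; rewrite !run_ar //= inE.
have lt u : ix u < rg s 1 by apply: leq_trans (ix_lt Uvs vsT u) h1.
split; rewrite ?r //; split.
- by rewrite a.
- by move=> x y; rewrite a.
- by move=> x y; rewrite a.
- move=> x; rewrite (a 3) // (proj2 (s2 x)); split=> //.
  have e1 : rg t1 1 = rg s 1 by rewrite run_rg.
  rewrite /t2 vec_val ?e1 //= /upd /= [ar t1 15 _]vec_val //= /upd /=.
  rewrite ![rg t1 _]run_rg // e37 e38 (proj1 (s2 x)) eqb0 negbK run_ar //= (proj1 (s2 x)).
  by [].
- by have [h5 h6 h7] := s5; split; rewrite ?a.
Qed.
End Turn.

(** A property that depends on the words in an interval only and so survives later writes
    elsewhere. *)
Definition within lo hi (P : (nat -> nat) -> Prop) (hp : nat -> nat) :=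
  forall hp', (forall a, lo <= a < hi -> hp' a = hp a) -> P hp'.

Lemma set_within (G : sgraph) (name : G -> nat) X p hp : set_at hp p name X ->
  within p (p + 1 + #|X|) (fun h => set_at h p name X) hp.
Proof.
move=> [t [Ut tX st]] hp' h; exists t; split=> // i /= hi; rewrite h ?st //.
have -> : #|X| = size t by rewrite -(card_uniqP Ut); apply: eq_card => x; rewrite tX.
by move: hi; rewrite size_map; lia.
Qed.

Lemma graph_within (G : sgraph) (name : G -> nat) vs es p hp : uniq vs -> (forall x, x \in vs) ->
  clean vs es -> injective name -> stored hp p (graph_code name vs es) ->
  within p (p + 2 + #|G| + 2 * size es) (fun hp => graph_at hp p name) hp.
Proof.
move=> U T c inj st hp' h; split=> //; exists vs, es; split.
  by split=> //; [case: c | move=> u v; apply: clean_xor].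
move=> i hi; rewrite h ?st //; move: hi; rewrite /graph_code /= size_cat size_map (size_vs U T).
have -> : size (flatten [seq [:: name e.1; name e.2] | e <- es]) = 2 * size es.
  by elim: (es) => //= e l ->; lia.
by rewrite leq_addr -!addnA ltn_add2l.
Qed.

(* Node j of the tree owns the [slot N] words of the heap from T0 + j * slot N  *)
(* on: 16 for its record, then X, A and B, with N + 1 words each, and the code  *)
(* of its graph. Registers 5 and 6 are the number of the current node and the   *)
(* number of nodes, 23 and 24 the addresses of their slots, and 7 is a bound on *)
(* the names and labels in use.                                                 *)
Definition eD := Plus (Cst 18) (Plus (Times (Cst 4) eN1) (Times (Cst 2) (Times eN1 eN1))).
Definition slot N := 18 + (4 * (N + 1) + 2 * ((N + 1) * (N + 1))).

Definition Fields off := let q k := Plus (Var 23) (Cst (off + k)) in seqs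
  [:: PHeap (q 0) (Plus (Var 24) (Cst 16)); PHeap (q 1) (Plus (Var 24) (Plus (Cst 16) eN1));
      PHeap (q 2) (Plus (Var 24) (Plus (Cst 16) (Plus eN1 eN1)));
      PHeap (q 3) (Var 7); PHeap (q 4) (Plus (Var 7) (Cst 1)); PHeap (q 5) (Plus (Var 7) (Cst 2));
      PHeap (q 6) (Var 24)].

Lemma fields_val off s : let q := rg s 23 + off in let p := rg s 24 in let n := rg s 1 + 1 in
  q + 7 <= rg s 3 -> let s' := run (Fields off) s in
  [/\ [/\ hp s' q = p + 16, hp s' (q + 1) = p + 16 + n & hp s' (q + 2) = p + 16 + 2 * n],
      forall k, k < 3 -> hp s' (q + 3 + k) = rg s 7 + k, hp s' (q + 6) = p &
      forall a, ~~ (q <= a < q + 7) -> hp s' a = hp s a].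
Proof.
move=> q p n le s'; rewrite /s' /Fields 7!run_cons run_nil.
have step k e t : k < 7 -> rg t =1 rg s ->
    run (PHeap (Plus (Var 23) (Cst (off + k))) e) t = seth t (q + k) (ev t e).
  move=> k7 et; rewrite run_heap [ev _ (Plus _ _)]/= !et addnA ifT //.
  by move: le; rewrite /q; lia.
do 7 (rewrite step //=).
have ne j k : (q + j == q + k) = (j == k) by rewrite eqn_add2l.
have n0 k : (q == q + k) = (0 == k) by rewrite -[X in X == _]addn0 eqn_add2l.
split.
- split; rewrite /= /upd ?n0 ?ne //=; first by rewrite /p /n addnA.
  by rewrite /p /n; lia.
- move=> k k3; rewrite -[q + 3 + k]addnA.
  by case: k k3 => [|[|[|//]]] _; rewrite /= /upd !ne //= addn0.
- by rewrite /= /upd !ne.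
- move=> a ha; rewrite /= /upd.
  have na k : k < 7 -> (a == q + k) = false by move=> k7; apply/eqP => e; move: ha; rewrite e; lia.
  by rewrite !na.
Qed.

(** Creates the child for one side. The sets of the split on this side, to which the record of the
    parent points, are placed in the slot of the child together with the code of the block. *)
Definition BuildSide xs as_ bs oa ob off := seqs
  [:: seqs [:: Copy xs 24; Copy as_ 25; Copy bs 26; Copy oa 28; Copy ob 29];
      PSet 35 (Plus (Var 24) (Cst 16)); SetDump 24;
      PSet 35 (Plus (Var 35) eN1); SetDump 25; PSet 35 (Plus (Var 35) eN1); SetDump 26;
      Fields off; Child;
      PSet 36 (Plus (Var 24) (Plus (Cst 16) (Times (Cst 3) eN1))); GraphDump;
      PHeap (Plus (Var 24) (Cst 1)) (Var 36); Store 40 6;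
      seqs [:: PSet 6 (Plus (Var 6) (Cst 1)); PSet 24 (Plus (Var 24) eD); PSet 7 (Plus (Var 7) (Cst 3))]].

Definition mark fr (k : 'I_3) := fr + k.

Lemma block_name_inj (G : sgraph) (J : split G) (name : G -> nat) i fr : injective name -> (forall x, name x < fr) ->
  injective (@block_name G J i name (mark fr)).
Proof.
move=> inj lt [u|k] [v|l] //= e.
- by congr inl; apply: val_inj; apply: inj.
- by have := lt (val u); rewrite e /mark; lia.
- by have := lt (val v); rewrite -e /mark; lia.
- by congr inr; apply: val_inj; move: e; rewrite /mark /=; lia.
Qed.

Section Side.
Variables (G : sgraph) (vs : seq G).
Hypotheses (Uvs : uniq vs) (vsT : forall x, x \in vs).
Notation rep := (rep vs).
Variables (name : G -> nat) (es : seq (G * G)).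
Hypothesis esC : clean vs es.
Variables (J : split G) (hJ : two_join J) (cJ : consistent J).
Notation loaded := (loaded vs name es).

Lemma focus_copy xs as_ bs oa ob (i : bool) M lab s : loaded M lab s ->
  all (fun a => a \notin [:: 24; 25; 26; 28; 29]) [:: as_; bs; oa; ob] -> xs != 24 ->
  rep s xs (sX J i) -> rep s as_ (sA J i) -> rep s bs (sB J i) -> rep s oa (sA J (~~ i)) ->
  rep s ob (sB J (~~ i)) -> focus vs J i (run (seqs [:: Copy xs 24; Copy as_ 25; Copy bs 26; Copy oa 28; Copy ob 29]) s).
Proof.
move=> L /allP na nx rx ra rb roa rob; rewrite 5!run_cons run_nil.
have V := loaded_view L.
have nn a b : a \in [:: as_; bs; oa; ob] -> b \in [:: 24; 25; 26; 28; 29] -> (a != b) /\ a \notin [:: b; b].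
  by move=> /na h hb; split; rewrite ?inE ?orbb; apply: contraNneq h => ->.
have m1 : as_ \in [:: as_; bs; oa; ob] by rewrite !inE eqxx.
have m2 : bs \in [:: as_; bs; oa; ob] by rewrite !inE eqxx orbT.
have m3 : oa \in [:: as_; bs; oa; ob] by rewrite !inE eqxx !orbT.
have m4 : ob \in [:: as_; bs; oa; ob] by rewrite !inE eqxx !orbT.
have vw a b t : view vs t -> b != 0 -> view vs (run (Copy a b) t).
  by move=> Vt b0; apply: view_run Vt => //; rewrite /= !inE orbb eq_sym.
have cp a b c t (Z : {set G}) : a \in [:: as_; bs; oa; ob] -> b \in [:: 24; 25; 26; 28; 29] -> rep t a Z ->
    rep (run (Copy c b) t) a Z.
  by move=> ha hb r; apply: rep_run r; have [] := nn a b ha hb.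
split.
- by do 4 (apply: rep_run; first vmt); apply: copy_rep V _ rx.
- do 3 (apply: rep_run; first vmt); apply: copy_rep; [exact: Uvs|exact: vsT| | |]; last exact: (cp).
  - exact: (vw).
  - by have [] := nn as_ 25 m1 isT.
- do 2 (apply: rep_run; first vmt); apply: copy_rep; [exact: Uvs|exact: vsT| | |]; last by do 2 (apply: (cp) => //).
  - by do 2 (apply: (vw); last by []).
  - by have [] := nn bs 26 m2 isT.
- do 1 (apply: rep_run; first vmt); apply: copy_rep; [exact: Uvs|exact: vsT| | |]; last by do 3 (apply: (cp) => //).
  - by do 3 (apply: (vw); last by []).
  - by have [] := nn oa 28 m3 isT.
- apply: copy_rep; [exact: Uvs|exact: vsT| | |]; last by do 4 (apply: (cp) => //).
  - by do 4 (apply: (vw); last by []).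
  - by have [] := nn ob 29 m4 isT.
Qed.

Section One.
Variables (xs as_ bs oa ob off : nat) (i : bool).
Hypotheses (na : all (fun a => a \notin [:: 24; 25; 26; 28; 29]) [:: as_; bs; oa; ob]) (nx : xs != 24).

Lemma build_val M lab s : loaded M lab s ->
  rep s xs (sX J i) -> rep s as_ (sA J i) -> rep s bs (sB J i) -> rep s oa (sA J (~~ i)) ->
  rep s ob (sB J (~~ i)) -> let N := rg s 1 in let p := rg s 24 in let q := rg s 23 + off in
  p + slot N <= rg s 3 -> q + 7 <= p -> #|edges G| <= rg s 2 ->
  injective name -> (forall x, name x < rg s 7) ->
  let s' := run (BuildSide xs as_ bs oa ob off) s in
  let cname := @block_name G J i name (mark (rg s 7)) in
  [/\ [/\ rg s' 6 = rg s 6 + 1, rg s' 24 = p + slot N & rg s' 7 = rg s 7 + 3],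
      [/\ forall k, k < 3 -> hp s' (q + 3 + k) = rg s 7 + k, hp s' (q + 6) = p,
          hp s' (p + 1) = p + 16 + 3 * (N + 1) &
          forall a, ~~ (p <= a < p + slot N) -> ~~ (q <= a < q + 7) -> hp s' a = hp s a],
      [/\ within (p + 16) (p + slot N) (fun h => set_at h (hp s' q) name (sX J i)) (hp s'),
          within (p + 16) (p + slot N) (fun h => set_at h (hp s' (q + 1)) name (sA J i)) (hp s'),
          within (p + 16) (p + slot N) (fun h => set_at h (hp s' (q + 2)) name (sB J i)) (hp s') &
          within (p + 16) (p + slot N) (fun h => graph_at h (p + 16 + 3 * (N + 1)) cname) (hp s')] &
      (exists2 es', clean (bvs vs J i) es' & shows (bvs vs J i) N cname (@block_marks G J i M)
        (block_lab lab (rg s 7) (i := i)) es' (bigf s' (rg s 6))) /\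
      (forall j a k, j <> rg s 6 -> a < 8 -> k < cells N -> bigf s' j a k = bigf s j a k)].
Proof.
move=> L rx ra rb roa rob N p q leH qp leM inj lt s' cname.
rewrite /s' /BuildSide 14!run_cons run_nil.
set t1 := run (seqs [:: Copy _ _; _; _; _; _]) s.
have F1 : focus vs J i t1 by apply: (focus_copy L na nx rx ra rb roa rob).
have L1 : loaded M lab t1 by apply: loaded_run L; vmt.
set t2 := run (PSet 35 _) t1. set t3 := run (SetDump 24) t2.
set t4 := run (PSet 35 _) t3. set t5 := run (SetDump 25) t4.
set t6 := run (PSet 35 _) t5. set t7 := run (SetDump 26) t6.
set t8 := run (Fields off) t7. set t9 := run Child t8.
set t10 := run (PSet 36 _) t9. set t11 := run GraphDump t10.
set t12 := run (PHeap _ _) t11. set t13 := run (Store 40 6) t12.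
set t14 := run (seqs _) t13.
have keep x : x \in [:: 0; 1; 2; 3; 5; 6; 7; 23; 24] ->
    [/\ rg t1 x = rg s x, rg t3 x = rg s x & rg t5 x = rg s x] /\
    [/\ rg t7 x = rg s x, rg t8 x = rg s x, rg t9 x = rg s x & rg t11 x = rg s x].
  move=> hx.
  have st t r P : t = run P r -> ~~ has (fun y => y \in wr P) [:: 0; 1; 2; 3; 5; 6; 7; 23; 24] -> rg r x = rg s x -> rg t x = rg s x.
    by move=> -> /hasPn h e; rewrite run_rg // h.
  have e1 : rg t1 x = rg s x by apply: (st _ s _ erefl) => //; vmt.
  have e2 : rg t2 x = rg s x by apply: (st _ t1 _ erefl) => //; vmt.
  have e3 : rg t3 x = rg s x by apply: (st _ t2 _ erefl) => //; vmt.
  have e4 : rg t4 x = rg s x by apply: (st _ t3 _ erefl) => //; vmt.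
  have e5 : rg t5 x = rg s x by apply: (st _ t4 _ erefl) => //; vmt.
  have e6 : rg t6 x = rg s x by apply: (st _ t5 _ erefl) => //; vmt.
  have e7 : rg t7 x = rg s x by apply: (st _ t6 _ erefl) => //; vmt.
  have e8 : rg t8 x = rg s x by apply: (st _ t7 _ erefl) => //; vmt.
  have e9 : rg t9 x = rg s x by apply: (st _ t8 _ erefl) => //; vmt.
  have e10 : rg t10 x = rg s x by apply: (st _ t9 _ erefl) => //; vmt.
  have e11 : rg t11 x = rg s x by apply: (st _ t10 _ erefl) => //; vmt.
  by [].
have L2 : loaded M lab t2 by apply: loaded_run L1; vmt.
have L3 : loaded M lab t3 by apply: loaded_run L2; vmt.
have L4 : loaded M lab t4 by apply: loaded_run L3; vmt.
have L5 : loaded M lab t5 by apply: loaded_run L4; vmt.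
have L6 : loaded M lab t6 by apply: loaded_run L5; vmt.
have L7 : loaded M lab t7 by apply: loaded_run L6; vmt.
have L8 : loaded M lab t8 by apply: loaded_run L7; vmt.
have L9 : loaded M lab t9 by apply: loaded_run L8; vmt.
have L10 : loaded M lab t10 by apply: loaded_run L9; vmt.
have fc P t : ~~ has (fun a => a \in wa P) [:: 24; 25; 26; 28; 29] -> focus vs J i t -> focus vs J i (run P t).
  exact: focus_run.
have F2 : focus vs J i t2 by apply: fc F1; vmt.
have F3 : focus vs J i t3 by apply: fc F2; vmt.
have F4 : focus vs J i t4 by apply: fc F3; vmt.
have F5 : focus vs J i t5 by apply: fc F4; vmt.
have F6 : focus vs J i t6 by apply: fc F5; vmt.
have F7 : focus vs J i t7 by apply: fc F6; vmt.
have F8 : focus vs J i t8 by apply: fc F7; vmt.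
have aJ := hJ.1.
have GN : #|G| <= N by have [_ ? _ _] := L.
have XG : #|sX J i| + 4 <= #|G|.
  have := card_sides hJ; have := consistent_card hJ cJ true; have := consistent_card hJ cJ false.
  by case: (i); lia.
have AX : #|sA J i| <= #|sX J i|.
  by apply/subset_leq_card/subsetP => x; apply: (join_AX aJ).
have BX : #|sB J i| <= #|sX J i|.
  by apply/subset_leq_card/subsetP => x; apply: (join_BX aJ).
have slotE : slot N = 18 + (4 * (N + 1) + 2 * cells N) by [].
have nm t x : loaded M lab t -> ar t 3 (ix vs x) = name x.
  by move=> [_ _ _ [_ _ _ h _]]; case: (h x).
have sm t : loaded M lab t -> small G t by move=> /loaded_view/small_view.
have [[k1_1 k3_1 k5_1] [k7_1 k8_1 k9_1 k11_1]] := keep 1 isT.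
have [[k1_3 k3_3 k5_3] [k7_3 k8_3 k9_3 k11_3]] := keep 3 isT.
have [[k1_24 k3_24 k5_24] [k7_24 k8_24 k9_24 k11_24]] := keep 24 isT.
have [[k1_23 k3_23 k5_23] [k7_23 k8_23 k9_23 k11_23]] := keep 23 isT.
have [[k1_7 k3_7 k5_7] [k7_7 k8_7 k9_7 k11_7]] := keep 7 isT.
have [[k1_2 k3_2 k5_2] [k7_2 k8_2 k9_2 k11_2]] := keep 2 isT.
have [[k1_6 k3_6 k5_6] [k7_6 k8_6 k9_6 k11_6]] := keep 6 isT.
have h1 : hp t1 = hp s by rewrite run_hp //; vmt.
have E2 : t2 = setr t1 35 (p + 16) by rewrite /t2 run_set [ev _ _]/= k1_24.
have [S1 H1] : set_at (hp t3) (p + 16) name (sX J i) /\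
    forall c, (c < p + 16) || (p + 16 + 1 + #|sX J i| <= c) -> hp t3 c = hp s c.
  have e35 : rg t2 35 = p + 16 by rewrite E2.
  have e3 : rg t2 3 = rg s 3 by rewrite E2.
  have [|S1 H1] := @setdump_val G vs Uvs vsT t2 24 (sX J i) name (sm _ L2) (let: And5 r _ _ _ _ := F2 in r) isT (fun x => nm _ x L2).
    by rewrite e35 e3; move: leH; rewrite slotE /cells; lia.
  by rewrite e35 in S1 H1; split=> // c hc; have := H1 c hc; rewrite -/t3 => ->; rewrite E2 /= h1.
have e35_3 : rg t3 35 = p + 16 by rewrite /t3 run_rg; [rewrite E2 | vmt].
have E4 : t4 = setr t3 35 (p + 16 + (N + 1)) by rewrite /t4 run_set [ev _ _]/= e35_3 k3_1.
have [S2 H2] : set_at (hp t5) (p + 16 + (N + 1)) name (sA J i) /\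
    forall c, (c < p + 16 + (N + 1)) || (p + 16 + (N + 1) + 1 + #|sA J i| <= c) -> hp t5 c = hp t3 c.
  have e35 : rg t4 35 = p + 16 + (N + 1) by rewrite E4.
  have e3 : rg t4 3 = rg s 3 by rewrite E4.
  have [|S2 H2] := @setdump_val G vs Uvs vsT t4 25 (sA J i) name (sm _ L4) (let: And5 _ r _ _ _ := F4 in r) isT (fun x => nm _ x L4).
    by rewrite e35 e3; move: leH; rewrite slotE /cells; lia.
  by rewrite e35 in S2 H2; split=> // c hc; have := H2 c hc; rewrite -/t5 => ->; rewrite E4.
have e35_5 : rg t5 35 = p + 16 + (N + 1) by rewrite /t5 run_rg; [rewrite E4 | vmt].
have E6 : t6 = setr t5 35 (p + 16 + (N + 1) + (N + 1)) by rewrite /t6 run_set [ev _ _]/= e35_5 k5_1.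
have [S3 H3] : set_at (hp t7) (p + 16 + (N + 1) + (N + 1)) name (sB J i) /\
    forall c, (c < p + 16 + (N + 1) + (N + 1)) || (p + 16 + (N + 1) + (N + 1) + 1 + #|sB J i| <= c) -> hp t7 c = hp t5 c.
  have e35 : rg t6 35 = p + 16 + (N + 1) + (N + 1) by rewrite E6.
  have e3 : rg t6 3 = rg s 3 by rewrite E6.
  have [|S3 H3] := @setdump_val G vs Uvs vsT t6 26 (sB J i) name (sm _ L6) (let: And5 _ _ r _ _ := F6 in r) isT (fun x => nm _ x L6).
    by rewrite e35 e3; move: leH; rewrite slotE /cells; lia.
  by rewrite e35 in S3 H3; split=> // c hc; have := H3 c hc; rewrite -/t7 => ->; rewrite E6.
have [|[f0 f1 f2] f3 f6 H4] := @fields_val off t7.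
  by rewrite k7_23 k7_3 -/q; move: leH; rewrite slotE; lia.
rewrite -/t8 k7_23 k7_24 k7_1 k7_7 -/q -/p -/N in f0 f1 f2 f3 f6 H4.
have [|es' c' S'] := @child_val G vs J i Uvs vsT M lab name t8 (loaded_wide L8) F8; first by rewrite k8_1 -/N; lia.
rewrite -/t9 k8_1 k8_7 -/N -/cname in S'.
have h9 : hp t9 = hp t8 by rewrite run_hp //; vmt.
have E10 : t10 = setr t9 36 (p + 16 + 3 * (N + 1)).
  by rewrite /t10 run_set [ev _ _]/= k9_24 k9_1 -/p -/N; congr setr; lia.
have Ub := bvs_uniq J i Uvs; have Tb := @bvs_all _ vs J i vsT.
have cb : #|block J i| <= N by rewrite card_block; lia.
have esz : size es' <= rg s 2 by rewrite (clean_size Tb c'); apply: leq_trans (edges_block hJ cJ i) leM.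
have eN : size es' <= cells N.
  have [Ue _ _] := c'; rewrite -(card_uniqP Ue); apply: leq_trans (max_card _) _.
  by rewrite card_prod /cells; apply: leq_mul; rewrite (leq_trans cb) // leq_addr.
have newf10 : newf t10 = newf t9 by rewrite E10.
have [g4 gA gM gL gE] := S'.
have k10 x : x != 36 -> rg t10 x = rg t9 x by move=> hx; rewrite E10 /= /upd (negPf hx).
have e36 : rg t10 36 = p + 16 + 3 * (N + 1) by rewrite E10.
have bX : #|block J i| = #|sX J i| + 3 by rewrite card_block.
have [||||||st H5] := @graphdump_val (block J i) (bvs vs J i) Ub Tb t10 cname es'.
- by rewrite k10 // k9_1.
- by rewrite newf10.
- by rewrite E10; exact: g4.
- by move=> x; rewrite E10; exact: (proj2 (gL x)).
- by rewrite k10 // k9_2.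
- by rewrite (k10 3) // k9_3 e36 bX; move: leH eN XG GN; rewrite slotE -/N; lia.
rewrite -/t11 in st H5.
rewrite e36 in st H5.
have E12 : t12 = seth t11 (p + 1) (p + 16 + 3 * (N + 1)).
  rewrite /t12 run_heap [ev _ _]/= k11_24 -/p k11_3 ifT; last by move: leH; rewrite slotE; lia.
  by congr seth; rewrite /= run_rg; [exact: e36 | vmt].
have h10 : hp t10 = hp t9 by rewrite E10.
have e13 : hp t14 = hp t12.
  by rewrite /t14 run_hp; [rewrite /t13 run_hp //; vmt | vmt].
have r13 x : x \notin [:: 20; 21] -> rg t13 x = rg t11 x.
  have /allP hw : all (fun y => y \in [:: 20; 21]) (wr (Store 40 6)) by vmt.
  by move=> hx; rewrite /t13 run_rg ?E12 //; apply: contra hx => /hw.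
have r13_6 : rg t13 6 = rg s 6 by rewrite r13.
have r13_7 : rg t13 7 = rg s 7 by rewrite r13.
have r13_24 : rg t13 24 = p by rewrite r13.
have r13_1 : rg t13 1 = N by rewrite r13.
have E14 : t14 = setr (setr (setr t13 6 (rg s 6 + 1)) 24 (p + slot N)) 7 (rg s 7 + 3).
  by rewrite /t14 3!run_cons run_nil !run_set /= /upd /= r13_6 r13_24 r13_1 r13_7.
have big j a k : bigf t14 j a k = bigf t13 j a k by rewrite E14.
have [b1 b2] := @store_val 40 6 t12 isT isT.
rewrite -/t13 E12 /= k11_6 k11_1 -/N in b1 b2.
set g := p + 16 + 3 * (N + 1) in st H5 E12 *.
have hD c : c != p + 1 -> hp t14 c = hp t11 c by move=> hc; rewrite e13 E12 /= /upd (negPf hc).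
have low c : c < g -> c != p + 1 -> hp t14 c = hp t8 c.
  by move=> cg c1; rewrite hD // H5 ?cg // h10 h9.
have mid c : p <= c < g -> c != p + 1 -> hp t14 c = hp t7 c.
  by move=> /andP[pc cg] c1; rewrite low // H4 //; move: pc qp; lia.
have reg c : q <= c < q + 7 -> hp t14 c = hp t8 c.
  by move=> hc; apply: low; move: hc qp; rewrite /g; lia.
split.
- by rewrite E14.
- split.
  + by move=> k k3; rewrite reg ?f3 //; lia.
  + by rewrite reg ?f6 //; lia.
  + by rewrite e13 E12 /= /upd eqxx.
  + move=> a ha hq; rewrite hD; last by move: ha; rewrite slotE; lia.
    rewrite H5 ?h10 ?h9 ?H4 ?H3 ?H2 ?H1 //; move: ha hq; rewrite slotE ?bX; move: XG AX BX GN eN; rewrite -/N /g; lia.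
- rewrite (reg q) ?(reg (q + 1)) ?(reg (q + 2)) ?f0 ?f1 ?f2; try by lia.
  have -> : p + 16 + 2 * (N + 1) = p + 16 + (N + 1) + (N + 1) by lia.
  split.
  + have w := set_within S1 => h hh.
    apply: w => c hc; rewrite hh; last by move: hc XG GN; rewrite slotE -/N; lia.
    rewrite mid; last 2 first.
    * by move: hc XG GN; rewrite -/N /g; lia.
    * by move: hc; lia.
    by rewrite H3 ?H2 //; move: hc XG GN; rewrite -/N; lia.
  + have w := set_within S2 => h hh.
    apply: w => c hc; rewrite hh; last by move: hc XG AX GN; rewrite slotE -/N; lia.
    rewrite mid; last 2 first.
    * by move: hc XG AX GN; rewrite -/N /g; lia.
    * by move: hc; lia.
    by rewrite H3 //; move: hc XG AX GN; rewrite -/N; lia.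
  + have w := set_within S3 => h hh.
    apply: w => c hc; rewrite hh; last by move: hc XG BX GN; rewrite slotE -/N; lia.
    rewrite mid //.
    * by move: hc XG BX GN; rewrite -/N /g; lia.
    * by move: hc; lia.
  + have w := graph_within Ub Tb c' (block_name_inj inj lt) st => h hh.
    apply: w => c hc; rewrite hh; last by move: hc XG GN eN; rewrite slotE bX -/N /g; lia.
    by rewrite hD //; move: hc; rewrite /g; lia.
- split.
  + exists es' => //; apply: (shows_ext Ub Tb cb c' _ S') => a k a8 kc.
    rewrite big b1 // /newf run_ar; [by rewrite E10 | vmt].
  + move=> j a k jj a8 kc; rewrite big b2 // /bigf /=.
    have ea t r P : t = run P r -> all (fun c => c < 50) (wa P) -> ar r (50 + a) = ar s (50 + a) -> ar t (50 + a) = ar s (50 + a).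
      move=> -> /allP h e; rewrite run_ar //; apply/negP => /h; clear; lia.
    have a1 := ea t1 s _ erefl isT erefl. have a2 := ea t2 t1 _ erefl isT a1.
    have a3 := ea t3 t2 _ erefl isT a2. have a4 := ea t4 t3 _ erefl isT a3.
    have a5 := ea t5 t4 _ erefl isT a4. have a6 := ea t6 t5 _ erefl isT a5.
    have a7 := ea t7 t6 _ erefl isT a6. have a8' := ea t8 t7 _ erefl isT a7.
    have a9 := ea t9 t8 _ erefl isT a8'. have a10 := ea t10 t9 _ erefl isT a9.
    have er := ea t11 t10 _ erefl isT a10.
    by rewrite er.
Qed.
End One.
End Side.

Definition Advance k := seqs [:: PHeap (Var 23) (Cst k); PSet 5 (Plus (Var 5) (Cst 1)); PSet 23 (Plus (Var 23) eD)].

Definition Retry := PSeq (PIf (Equ (Var 16) (Cst 1)) Drop Merge) (Store 0 5).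

Definition Divide := seqs [:: BuildSide 16 17 18 20 21 2; BuildSide 19 20 21 17 18 9; Advance 2].

Definition Turn := PIf (Less (Var 5) (Var 6)) (seqs [:: Recall; Decide;
  PIf (eNot (Var 16)) (Advance 0) (PIf (eNot (Var 11)) Retry
    (seqs [:: Sets; Cons; PIf (Var 17) Divide (Advance 1)]))]) PSkip.

(** * The invariant of the main loop *)

Record gnode := GNode { gG : sgraph; gname : gG -> nat }.

(** Like [within], for an arbitrary set F of addresses. *)
Definition held (F : nat -> Prop) (P : (nat -> nat) -> Prop) hp :=
  forall hp', (forall a, F a -> hp' a = hp a) -> P hp'.

Lemma held_agree (F F' : nat -> Prop) P h h' : held F P h -> (forall a, F a -> h' a = h a) ->
  (forall a, F a -> F' a) -> held F' P h'.
Proof. by move=> H e s g eg; apply: H => a Fa; rewrite eg ?e //; apply: s. Qed.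

(** The weight is 16 = 12 + 2 + 1 + 1: a split may add 12 to [nrel], 2 labels and the constant 1 of
    one more graph, and must still lower the sum by 1. Blocks have at least 7 vertices by
    [consistent_card], so that no subtraction is truncated in a split and the sum of the terms |H| -
    7 drops by 1. *)
Definition potential (G : sgraph) (M : rel G) (lab : G -> nat) := nrel M + nlab lab + 16 * (#|G| - 7) + 1.

Section Inv.
Variables T0 N Mx H P : nat.
Definition pos j := T0 + slot N * j.
Hypothesis space : pos (2 * P + 1) <= H.
Variable root : gnode.

Lemma slot_ge : 18 <= slot N. Proof. exact: leq_addr. Qed.

Lemma posS j : pos j.+1 = pos j + slot N.
Proof. by rewrite /pos mulnS [slot N + _]addnC addnA. Qed.

Lemma pos_le i j : i <= j -> pos i <= pos j.
Proof. by move=> ij; rewrite leq_add2l leq_mul2l ij orbT. Qed.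

(** The addresses that are written no more: the slots of treated nodes and, for waiting nodes, the
    pointer to the graph and everything after the record. *)
Definition frozen cur cnt a := a < pos cur \/
  exists2 j, cur <= j < cnt & (a = pos j + 1) \/ (pos j + 16 <= a < pos j.+1).

Lemma frozen_le cur cnt cur' cnt' a : cur <= cur' -> cnt <= cnt' -> frozen cur cnt a -> frozen cur' cnt' a.
Proof.
move=> h1 h2 [lt|[j /andP[cj jc] hj]].
  by left; apply: leq_trans lt (pos_le h1).
case: (ltnP j cur') => jc'; last by right; exists j => //; rewrite jc' (leq_trans jc).
left; apply: leq_trans (pos_le jc'); case: hj => [->|/andP[]//].
by rewrite posS ltn_add2l; apply: leq_trans slot_ge.
Qed.

Lemma frozen_gap cur cnt a : frozen cur cnt a ->
  a < pos cur \/ (a = pos cur + 1 \/ pos cur + 16 <= a).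
Proof.
case=> [lt|[j /andP[cj _] hj]]; [by left | right].
by have := pos_le cj; case: hj => [->|/andP[h _] le]; [case: (ltngtP j cur) cj => // [lt|->] _ le; [right|left]|right]; try lia;
  have := pos_le lt; rewrite posS; have := slot_ge; lia.
Qed.

Lemma frozen_lt cur cnt a : cur <= cnt -> frozen cur cnt a -> a < pos cnt.
Proof.
move=> cc /(@frozen_le _ _ cnt cnt _ cc (leqnn _)) [//|[j /andP[h1 h2] _]].
by move: h2; rewrite ltnNge h1.
Qed.

(** Children are described by their position c only, as they may not have been treated yet; trees
    are built from this at the very end. *)
Definition finished (h : nat -> nat) (ns : nat -> gnode) cnt j :=
  let p := pos j in let name := @gname (ns j) in
  graph_at h (h (p + 1)) name /\
  [\/ h p = 0 /\ forall S : split (gG (ns j)), ~ two_join S,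
      h p = 1 /\ exists S : split (gG (ns j)), two_join S /\ ~ consistent S |
      exists J : split (gG (ns j)), [/\ two_join J, consistent J, h p = 2 & forall i : bool,
        let q := p + (if i then 2 else 9) in
        [/\ set_at h (h q) name (sX J i), set_at h (h (q + 1)) name (sA J i),
            set_at h (h (q + 2)) name (sB J i) &
            exists c fr, [/\ j < c < cnt, h (q + 6) = pos c,
              ns c = GNode (@block_name _ J i name (mark fr)) &
              forall k, k < 3 -> h (q + 3 + k) = fr + k]]]].

Lemma finished_ext h ns ns' cnt cnt' j : j < cnt -> cnt <= cnt' -> (forall j, j < cnt -> ns' j = ns j) ->
  finished h ns cnt j -> finished h ns' cnt' j.
Proof.
move=> jc cc e; rewrite /finished e // => -[g h3]; split=> //.
case: h3 => [h3|h3|[J [tJ cJ h2 hi]]]; [exact: Or31|exact: Or32|apply: Or33].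
exists J; split=> // i; have [x1 x2 x3 [c [fr [/andP[j1 j2] y2 y3 y4]]]] := hi i.
by split=> //; exists c, fr; split=> //; rewrite ?j1 ?(leq_trans j2) // e.
Qed.

Definition legal (G : sgraph) (vs : seq G) (name : G -> nat) es fr (M : rel G) (lab : G -> nat) :=
  [/\ [/\ uniq vs, forall x, x \in vs & clean vs es],
      [/\ symmetric M, forall u v, M u v -> adj u v, thin M & hitting M lab],
      [/\ injective name, forall x, name x < fr & forall x, lab x < fr],
      #|G| <= N & #|edges G| <= Mx].

Definition pending big fr b (x : gnode) := exists vs M lab es,
  [/\ legal vs (@gname x) es fr M lab, shows vs N (@gname x) M lab es big & potential M lab <= b].

Lemma pending_ext big big' fr fr' b x : fr <= fr' ->
  (forall a k, a < 8 -> k < cells N -> big' a k = big a k) ->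
  pending big fr b x -> pending big' fr' b x.
Proof.
move=> ff eb [vs [M [lab [es [[[U T c] h [inj nf lf] GN GM] S p]]]]]; exists vs, M, lab, es; split=> //.
  by split=> //; split=> // y; [apply: leq_trans (nf y) ff | apply: leq_trans (lf y) ff].
exact: (shows_ext U T GN c eb).
Qed.

Definition frame s := [/\ rg s 1 = N, rg s 2 = Mx, rg s 3 = H, rg s 23 = pos (rg s 5) & rg s 24 = pos (rg s 6)].

(** Here c counts the turns and [ph] bounds the potentials of waiting nodes. While nodes wait, these
    bounds and c add up to at most P. A turn creates at most two nodes, hence 2 * c + 1. *)
Definition data s ns ph c := let cur := rg s 5 in let cnt := rg s 6 in
  [/\ frame s /\ ns 0 = root, cur <= cnt <= 2 * c + 1 /\ 0 < cnt,
      cur = cnt \/ \sum_(cur <= j < cnt) ph j + c <= P,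
      forall j, j < cur -> held (frozen cur cnt) (fun h => finished h ns cnt j) (hp s) &
      forall j, cur <= j < cnt -> pending (bigf s j) (rg s 7) (ph j) (ns j) /\
        held (frozen cur cnt) (fun h => graph_at h (h (pos j + 1)) (@gname (ns j))) (hp s)].

Definition inv c s := exists ns ph, data s ns ph c.

(** What all kinds of turn have in common: only the current node and the newly created ones remain
    to be examined. *)
Lemma data_step s s' ns ns' ph ph' c : let cur := rg s 5 in let cnt := rg s 6 in
  data s ns ph c -> cur < cnt -> frame s' ->
  cur <= rg s' 5 <= cur.+1 -> cnt <= rg s' 6 <= cnt.+2 -> rg s 7 <= rg s' 7 ->
  (forall a, frozen cur cnt a -> hp s' a = hp s a) ->
  (forall j, j < cnt -> ns' j = ns j) -> (forall j, cur < j < cnt -> ph' j = ph j) ->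
  (forall j a k, cur < j < cnt -> a < 8 -> k < cells N -> bigf s' j a k = bigf s j a k) ->
  \sum_(rg s' 5 <= j < rg s' 6) ph' j + 1 <= \sum_(cur <= j < cnt) ph j ->
  (cur < rg s' 5 -> held (frozen cur.+1 (rg s' 6)) (fun h => finished h ns' (rg s' 6) cur) (hp s')) ->
  (forall j, rg s' 5 <= j < rg s' 6 -> (j == cur) || (cnt <= j) -> pending (bigf s' j) (rg s' 7) (ph' j) (ns' j) /\
    held (frozen (rg s' 5) (rg s' 6)) (fun h => graph_at h (h (pos j + 1)) (@gname (ns' j))) (hp s')) ->
  inv c.+1 s'.
Proof.
move=> cur cnt [[F e0] /= [/andP[h1 h2] h0] h3 h4 h5] cc F' /andP[c1 c2] /andP[n1 n2] ff eh en ep eb es fin pen.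
have fz a : frozen cur cnt a -> frozen (rg s' 5) (rg s' 6) a by apply: frozen_le.
exists ns', ph'; split.
- by split=> //; rewrite en.
- by split; [apply/andP; split; rewrite -?/cnt in h2 *; lia | rewrite (leq_trans h0)].
- by right; case: h3 => h3; [move: cc; rewrite /cur h3 ltnn | move: h3; rewrite -/cur -/cnt; lia].
- move=> j jc; case: (ltnP j cur) => jj.
    apply: held_agree eh fz => g eg.
    by apply: (@finished_ext _ ns _ cnt) => //; [apply: leq_trans jj (ltnW cc) | apply: h4].
  have ej : j = cur by lia.
  have e5 : rg s' 5 = cur.+1 by lia.
  by rewrite ej e5; apply: fin; lia.
- move=> j jj; case: (boolP ((j == cur) || (cnt <= j))) => [hj|]; first exact: pen.
  rewrite negb_or -ltnNge => /andP[/eqP jcur jcnt].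
  have jj' : cur < j < cnt by lia.
  have [|p g] := h5 j; first by rewrite -/cur -/cnt; lia.
  rewrite en // ep //; split; last exact: held_agree g eh fz.
  by apply: pending_ext p => // a k; apply: eb.
Qed.
(** A waiting node has positive potential, so c < P, and there is still room for two slots. *)
Lemma data_room s ns ph c : data s ns ph c -> rg s 5 < rg s 6 ->
  [/\ c < P, pos (rg s 6).+2 <= H & 0 < ph (rg s 5)].
Proof.
move=> [_ /= [/andP[h1 h2] _] h3 h4 h5] cc; have := h5 (rg s 5); rewrite leqnn cc => /(_ isT)[[vs [M [lab [es [_ _ p]]]]] _].
have p0 : 0 < ph (rg s 5) by apply: leq_trans p; rewrite /potential addn1.
case: h3 => [h3|]; first by move: cc; rewrite h3 ltnn.
rewrite big_ltn // => h3; have cP : c < P by lia.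
by split=> //; apply: leq_trans (pos_le _) space; lia.
Qed.

Definition idle s t := [/\ forall x, x \in [:: 1; 2; 3; 5; 6; 7; 23; 24] -> rg t x = rg s x,
  hp t = hp s & forall a, 50 <= a -> ar t a = ar s a].

Lemma idle_run p s t : ~~ has (fun x => x \in wr p) [:: 1; 2; 3; 5; 6; 7; 23; 24] -> ~~ wh p ->
  all (fun a => a < 50) (wa p) -> idle s t -> idle s (run p t).
Proof.
move=> /hasPn n w /allP a50 [f1 f2 f3]; split; rewrite ?run_hp // => x hx.
- by rewrite run_rg ?f1 ?n.
- by rewrite run_ar ?f3 //; apply/negP => /a50; rewrite ltnNge hx.
Qed.

Lemma idle_bigf s t j a k : idle s t -> bigf t j a k = bigf s j a k.
Proof. by move=> [f1 _ f3]; rewrite /bigf f1 // f3 // leq_addr. Qed.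

Lemma advance_val k t : rg t 23 < rg t 3 -> run (Advance k) t =
  setr (setr (seth t (rg t 23) k) 5 (rg t 5 + 1)) 23 (rg t 23 + slot (rg t 1)).
Proof. by move=> lt; rewrite /Advance 3!run_cons run_nil run_heap [ev _ _]/= lt !run_set. Qed.

Lemma advance_inv s ns ph c t k : data s ns ph c -> rg s 5 < rg s 6 -> idle s t ->
  k = 0 /\ (forall S : split (gG (ns (rg s 5))), ~ two_join S) \/
  k = 1 /\ (exists S : split (gG (ns (rg s 5))), two_join S /\ ~ consistent S) ->
  inv c.+1 (run (Advance k) t).
Proof.
move=> D cc [f1 f2 f3] hk; have [cP sp p0] := data_room D cc.
have [[[F1 F2 F3 F23 F24] e0] [/andP[h1 h2] h0] h3 h4 h5] := D.
have pp : pos (rg s 5) < pos (rg s 6).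
  by apply: leq_trans (pos_le cc); rewrite posS; have := slot_ge; lia.
have pH : pos (rg s 6) <= H by apply: leq_trans (pos_le _) sp; lia.
rewrite advance_val; last by rewrite !f1 // F3 F23; lia.
rewrite !f1 // F23 F1; set s' := setr _ _ _.
have eh a : frozen (rg s 5) (rg s 6) a -> hp s' a = hp s a.
  move=> fr; rewrite /= /upd f2; case: eqP => // ea; case: fr => [|[j /andP[j1 j2]]].
    by rewrite ea ltnn.
  have := pos_le j1; rewrite ea; have := slot_ge; rewrite posS; lia.
apply: (data_step (ns' := ns) (ph' := ph) (s' := s') D cc) => //=; rewrite /upd /= ?f1 ?addn1 //.
- by split; rewrite /= /upd /= ?f1 // ?addn1 ?posS.
- by rewrite leqnn leqnSn.
- by rewrite leqnn ltnW.
- by move=> j a k0 _ _ _; rewrite f3 ?leq_addr.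
- by rewrite [X in _ <= X]big_ltn //; lia.
- move=> _ g eg; have [|_ hg] := h5 (rg s 5); first by rewrite leqnn.
  have fz a : frozen (rg s 5) (rg s 6) a -> frozen (rg s 5).+1 (rg s 6) a by apply: frozen_le.
  split; first by apply: hg => a fa; rewrite eg; [exact: eh | exact: fz].
  have -> : g (pos (rg s 5)) = k.
    by rewrite eg /= /upd ?eqxx //; left; rewrite posS; have := slot_ge; lia.
  by case: hk => h; [apply: Or31|apply: Or32].
- by move=> j jj hj; exfalso; move: jj hj; clear; lia.
Qed.

Lemma retry_inv s ns ph c t vs es M lab : data s ns ph c -> rg s 5 < rg s 6 -> idle s t ->
  let x := ns (rg s 5) in legal vs (@gname x) es (rg s 7) M lab -> loaded vs (@gname x) es M lab t ->
  potential M lab < ph (rg s 5) -> inv c.+1 (run (Store 0 5) t).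
Proof.
move=> D cc I x L K lt; have [f1 f2 f3] := I.
have [[[F1 F2 F3 F23 F24] e0] [/andP[h1 h2] h0] h3 h4 h5] := D.
set s' := run _ t; have [b1 b2] := @store_val 0 5 t isT isT.
rewrite -/s' !f1 // F1 in b1 b2.
have r y : y \in [:: 1; 2; 3; 5; 6; 7; 23; 24] -> rg s' y = rg s y.
  have /allP hw : all (fun y => y \in [:: 20; 21]) (wr (Store 0 5)) by vmt.
  move=> hy; rewrite run_rg ?f1 //; apply/negP => /hw; move: hy; rewrite !inE.
  by do 7 (case/orP => [/eqP->//|]); move/eqP->.
have hs : hp s' = hp s by rewrite run_hp ?f2 //; vmt.
apply: (data_step (ns' := ns) (ph' := fun j => if j == rg s 5 then (ph (rg s 5)).-1 else ph j) (s' := s') D cc) => //; rewrite ?r ?leqnn //.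
- by split; rewrite ?r.
- by rewrite leqnSn.
- by rewrite /= ltnW.
- by move=> a _; rewrite hs.
- by move=> j jj; case: eqP => // e; move: jj; rewrite e ltnn.
- move=> j a k jj a8 kc; rewrite b2 // ?(idle_bigf _ _ _ I) // => e; move: jj; rewrite e ltnn //.
- rewrite [X in X + 1]big_ltn // [X in _ <= X]big_ltn // eqxx; have [_ _ p0] := data_room D cc.
  rewrite [in X in X + 1](eq_big_nat _ _ (F2 := ph)); first by lia.
  by move=> j jj; case: eqP => // e; move: jj; rewrite e ltnn.
- by rewrite ltnn.
move=> j jj /orP[/eqP->|]; last by move: jj => /andP[_ lt']; rewrite leqNgt lt'.
have [|_ hg] := h5 (rg s 5); first by rewrite leqnn.
split; last by rewrite hs.
have [_ g1 _ K5] := K; rewrite f1 // F1 in g1 K5.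
have [[U T C] _ _ _ _] := L.
rewrite eqxx; exists vs, M, lab, es; split=> //; last by lia.
by apply: (shows_ext U T g1 C _ K5) => a k a8 kc; rewrite b1.
Qed.

Lemma within_agree lo hi Q h h' : within lo hi Q h -> (forall a, lo <= a < hi -> h' a = h a) ->
  within lo hi Q h'.
Proof. by move=> w e g eg; apply: w => a ha; rewrite eg ?e. Qed.

Lemma potential_blocks (G : sgraph) (J : split G) (M : rel G) lab fr fr' : two_join J -> consistent J ->
  symmetric M -> (forall u v, M u v -> adj u v) -> thin M ->
  potential (@block_marks G J true M) (block_lab lab fr (i := true)) +
  potential (@block_marks G J false M) (block_lab lab fr' (i := false)) + 1 <= potential M lab.
Proof.
move=> tJ cJ sM MA th.
have h1 := nrel_blocks tJ cJ MA sM th.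
have h2 : nlab (@block_lab G J true lab fr) + nlab (@block_lab G J false lab fr') <= nlab lab + 2.
  exact: (nlab_block tJ).
have := consistent_card tJ cJ true; have := consistent_card tJ cJ false; have := card_sides tJ.
have := card_block J true; have := card_block J false; move: h1 h2.
rewrite /potential; lia.
Qed.

Section Divide.
Variables (s t : mstate) (ns : nat -> gnode) (ph : nat -> nat) (c : nat).
Hypotheses (D : data s ns ph c) (cc : rg s 5 < rg s 6) (I : idle s t).
Let G := gG (ns (rg s 5)).
Let name : G -> nat := @gname (ns (rg s 5)).
Variables (vs : seq G) (es : seq (G * G)) (M : rel G) (lab : G -> nat) (J : split G).
Hypotheses (L : legal vs name es (rg s 7) M lab) (K : loaded vs name es M lab t).
Hypotheses (tJ : two_join J) (cJ : consistent J) 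
  (sJ : forall i : bool, [/\ rep_in vs t (if i then 16 else 19) (sX J i),
    rep_in vs t (if i then 17 else 20) (sA J i) & rep_in vs t (if i then 18 else 21) (sB J i)]).

Let fr (i : bool) := rg s 7 + (if i then 0 else 3).
Let kid (i : bool) := rg s 6 + (if i then 0 else 1).
Let fld (i : bool) := pos (rg s 5) + (if i then 2 else 9).
Let s' := run Divide t.

Lemma divide_val :
  [/\ frame s', rg s' 5 = (rg s 5).+1, rg s' 6 = (rg s 6).+2, rg s' 7 = rg s 7 + 6 & hp s' (pos (rg s 5)) = 2] /\
  [/\ forall a, frozen (rg s 5) (rg s 6) a -> hp s' a = hp s a,
      forall j a k, j < rg s 6 -> a < 8 -> k < cells N -> bigf s' j a k = bigf s j a k &
      forall i, let p := pos (kid i) in let q := fld i in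
        let cname := @block_name G J i name (mark (fr i)) in
      [/\ [/\ forall k, k < 3 -> hp s' (q + 3 + k) = fr i + k, hp s' (q + 6) = p &
             hp s' (p + 1) = p + 16 + 3 * (N + 1)],
        [/\ within (p + 16) (p + slot N) (fun h => set_at h (hp s' q) name (sX J i)) (hp s'),
          within (p + 16) (p + slot N) (fun h => set_at h (hp s' (q + 1)) name (sA J i)) (hp s'),
          within (p + 16) (p + slot N) (fun h => set_at h (hp s' (q + 2)) name (sB J i)) (hp s') &
          within (p + 16) (p + slot N) (fun h => graph_at h (p + 16 + 3 * (N + 1)) cname) (hp s')] &
        exists2 es', clean (bvs vs J i) es' & shows (bvs vs J i) N cname (@block_marks G J i M)
        (block_lab lab (fr i) (i := i)) es' (bigf s' (kid i))]].
Proof.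
have [f1 f2 f3] := I; have [[[F1 F2 F3 F23 F24] e0] [/andP[h1 h2] h0] h3 h4 h5] := D.
have [cP sp p0] := data_room D cc.
have [[U T C] [sM MA th hit] [inj nf lf] GN GM] := L.
set t1 := run (BuildSide 16 17 18 20 21 2) t; set t2 := run (BuildSide 19 20 21 17 18 9) t1.
have keep t0 P0 r : t0 = run P0 r -> ~~ has (fun x => x \in wr P0) [:: 1; 2; 3; 5; 23] ->
    (forall x, x \in [:: 1; 2; 3; 5; 23] -> rg r x = rg s x) ->
    forall x, x \in [:: 1; 2; 3; 5; 23] -> rg t0 x = rg s x.
  by move=> -> /hasPn h e x hx; rewrite run_rg ?e // h.
have k0 x : x \in [:: 1; 2; 3; 5; 23] -> rg t x = rg s x.
  by rewrite !inE => hx; apply: f1; rewrite !inE; move: hx; do 4 (case/orP => [->|]; rewrite ?orbT //); move=> ->; rewrite !orbT.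
have k1 : forall x, x \in [:: 1; 2; 3; 5; 23] -> rg t1 x = rg s x by apply: (keep _ _ _ erefl) k0; vmt.
have k2 : forall x, x \in [:: 1; 2; 3; 5; 23] -> rg t2 x = rg s x by apply: (keep _ _ _ erefl) k1; vmt.
have P1 : pos (rg s 6) + slot N = pos (rg s 6).+1 by rewrite -posS.
have P2 : pos (rg s 6).+1 + slot N = pos (rg s 6).+2 by rewrite -posS.
have P0 : pos (rg s 5) + slot N <= pos (rg s 6) by rewrite -posS; apply: pos_le.
have D18 := slot_ge.
have [x1 a1 b1] := sJ true; have [x2 a2 b2] := sJ false.
have [|||||[A6 A24 A7] [B1 B2 B3 B4] [C1 C2 C3 C4] [E1 E2]] :=
  @build_val G vs U T name es J tJ cJ 16 17 18 20 21 2 true isT isT M lab t K x1 a1 b1 a2 b2.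
- by rewrite !f1 // F24 F1 F3 P1; lia.
- by rewrite !f1 // F23 F24; lia.
- by rewrite f1 // F2.
- exact: inj.
- by rewrite f1.
rewrite -/t1 !f1 // F24 F23 F1 in A6 A24 A7 B1 B2 B3 B4 C1 C2 C3 C4 E1 E2.
have K1 : loaded vs name es M lab t1 by apply: loaded_run K; vmt.
have rp a X : a \notin wa (BuildSide 16 17 18 20 21 2) -> rep_in vs t a X -> rep_in vs t1 a X.
  exact: rep_run.
have {}x1 := rp 16 _ isT x1; have {}a1 := rp 17 _ isT a1; have {}b1 := rp 18 _ isT b1.
have {}x2 := rp 19 _ isT x2; have {}a2 := rp 20 _ isT a2; have {}b2 := rp 21 _ isT b2.
have [|||||[A6' A24' A7'] [B1' B2' B3' B4'] [C1' C2' C3' C4'] [E1' E2']] :=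
  @build_val G vs U T name es J tJ cJ 19 20 21 17 18 9 false isT isT M lab t1 K1 x2 a2 b2 a1 b1.
- by rewrite (k1 1) // (k1 3) // A24 F1 F3 P1 P2; lia.
- by rewrite (k1 23) // A24 F23 P1; lia.
- by rewrite k1 // F2.
- exact: inj.
- by move=> x; rewrite A7; apply: leq_trans (nf x) _; lia.
rewrite -/t2 (k1 1) // (k1 23) // A24 A6 A7 F23 F1 P1 P2 in A6' A24' A7' B1' B2' B3' B4' C1' C2' C3' C4' E1' E2'.
have es' : s' = setr (setr (seth t2 (pos (rg s 5)) 2) 5 (rg s 5 + 1)) 23 (pos (rg s 5) + slot N).
  rewrite /s' /Divide 3!run_cons run_nil -/t1 -/t2 advance_val ?k2 //; first by rewrite F23 F1.
  by rewrite F23 F3; lia.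
have hs a : a != pos (rg s 5) -> hp s' a = hp t2 a by move=> ha; rewrite es' /= /upd (negPf ha).
have hs1 a : a != pos (rg s 5) -> ~~ (pos (rg s 6).+1 <= a < pos (rg s 6).+2) ->
    ~~ (pos (rg s 5) + 9 <= a < pos (rg s 5) + 16) -> hp s' a = hp t1 a.
  by move=> h g1 g2; rewrite hs // B4' //; move: g2; lia.
have bg j : bigf s' j = bigf t2 j by rewrite es'.
split; first (split; rewrite ?es' /= /upd /= ?eqxx ?A6' ?A7' ?addn1 //; last by rewrite -addnA).
  split; rewrite /= /upd /=.
  - by rewrite k2.
  - by rewrite k2.
  - by rewrite k2.
  - by rewrite posS.
  - by rewrite A24' A6' !addn1.
split.
- move=> a fa; have ha : a < pos (rg s 6) by apply: frozen_lt fa; apply: ltnW.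
  rewrite hs1 ?B4 ?f2 //; case: (frozen_gap fa) => [|[]]; lia.
- move=> j a k jc a8 kc; rewrite bg E2' ?E2 ?(idle_bigf _ _ _ I) //; lia.
- case; rewrite /kid /fld /fr ?addn0.
  + have hq a : pos (rg s 5) + 2 <= a < pos (rg s 5) + 9 -> hp s' a = hp t1 a by move=> ha; apply: hs1; lia.
    have hk a : pos (rg s 6) <= a < pos (rg s 6).+1 -> hp s' a = hp t1 a by move=> ha; apply: hs1; lia.
    have hk' a : pos (rg s 6) + 16 <= a < pos (rg s 6) + slot N -> hp s' a = hp t1 a by move=> ha; apply: hk; lia.
    split.
    * split; [move=> k k3; rewrite hq ?B1 //; lia | rewrite hq ?B2 //; lia | rewrite hk ?B3 //; lia].
    * rewrite !(hq (_ + 2)) ?(hq (_ + 2 + _)); try lia.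
      by split; [apply: within_agree C1 _|apply: within_agree C2 _|apply: within_agree C3 _|apply: within_agree C4 _].
    * have [e' ce se] := E1; exists e' => //.
      have cb : #|block J true| <= N.
        have := card_sides tJ; have := card_block J true; have := consistent_card tJ cJ false; lia.
      apply: (shows_ext (bvs_uniq J true U) (@bvs_all _ vs J true T) cb ce _ se) => a k a8 kc.
      by rewrite bg E2' //; lia.
  + rewrite [rg s 6 + 1]addn1.
    have hq a : pos (rg s 5) + 9 <= a < pos (rg s 5) + 16 -> hp s' a = hp t2 a by move=> ha; apply: hs; lia.
    have hk' a : pos (rg s 6).+1 + 16 <= a < pos (rg s 6).+2 -> hp s' a = hp t2 a by move=> ha; apply: hs; lia.
    rewrite P2; split.
    * split; [move=> k k3; rewrite hq ?B1' //; lia | rewrite hq ?B2' //; lia | rewrite hs ?B3' //; lia].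
    * rewrite !(hq (_ + 9)) ?(hq (_ + 9 + _)); try lia.
      by split; [apply: within_agree C1' _|apply: within_agree C2' _|apply: within_agree C3' _|apply: within_agree C4' _].
    * by move: E1'; rewrite [rg s 6 + 1]addn1 bg.
Qed.

Lemma divide_inv : potential M lab <= ph (rg s 5) -> inv c.+1 (run Divide t).
Proof.
move=> pM; have [[F' e5 e6 e7 ek] [eh eb ei]] := divide_val; rewrite -/s' in F' e5 e6 e7 ek eh eb ei *.
have [[F0 e0] [/andP[h1 h2] h0] h3 h4 h5] := D.
have [[U T C] [sM MA th hit] [inj nf lf] GN GM] := L.
pose bn i := @block_name G J i name (mark (fr i)).
pose bM i := @block_marks G J i M; pose bl i := @block_lab G J i lab (fr i).
pose ns' j := if j == rg s 6 then GNode (bn true) else if j == (rg s 6).+1 then GNode (bn false) else ns j.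
pose ph' j := if j == rg s 6 then potential (bM true) (bl true)
  else if j == (rg s 6).+1 then potential (bM false) (bl false) else ph j.
have nsk i : ns' (kid i) = GNode (bn i).
  by rewrite /ns' /kid; case: i; rewrite ?addn0 ?addn1 ?eqxx // gtn_eqF.
have phk i : ph' (kid i) = potential (bM i) (bl i).
  by rewrite /ph' /kid; case: i; rewrite ?addn0 ?addn1 ?eqxx // gtn_eqF.
have small j : j < rg s 6 -> ns' j = ns j /\ ph' j = ph j.
  by move=> jc; rewrite /ns' /ph' !ltn_eqF // ltnW.
have kk i : rg s 5 < kid i < rg s' 6 by rewrite e6 /kid; case: (i); lia.
have fz i a : pos (kid i) + 16 <= a < pos (kid i) + slot N -> frozen (rg s 5).+1 (rg s' 6) a.
  by move=> ha; right; exists (kid i); [exact: kk | right; rewrite posS].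
have fl i k : k < 7 -> frozen (rg s 5).+1 (rg s' 6) (fld i + k).
  move=> k7; left; rewrite posS /fld; have := slot_ge; case: (i); lia.
apply: (data_step (ns' := ns') (ph' := ph') D cc F').
- by rewrite e5 leqnn leqnSn.
- by rewrite e6 leqnn !leqW.
- by rewrite e7 leq_addr.
- exact: eh.
- by move=> j jc; have [] := small j jc.
- by move=> j /andP[_ jc]; have [] := small j jc.
- by move=> j a k /andP[_ jc]; apply: eb.
- rewrite e5 e6 big_nat_recr; last by lia.
  rewrite big_nat_recr //= [X in _ <= X]big_ltn //.
  rewrite [X in X + _ + _ + 1](eq_big_nat _ _ (F2 := ph)); last by move=> j /andP[_ jc]; have [] := small j jc.
  have -> : ph' (rg s 6) = potential (bM true) (bl true) by rewrite -phk /kid addn0.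
  have -> : ph' (rg s 6).+1 = potential (bM false) (bl false) by rewrite -phk /kid addn1.
  have := @potential_blocks G J M lab (fr true) (fr false) tJ cJ sM MA th.
  rewrite -/(bM true) -/(bM false) -/(bl true) -/(bl false); lia.
- move=> _ g eg; have [|_ hg] := h5 (rg s 5); first by rewrite leqnn.
  have [en _] := small _ cc; rewrite /finished en; split.
    apply: hg => a fa; rewrite eg ?eh //; apply: frozen_le fa => //; by rewrite e6 !leqW.
  apply: Or33; exists J; split=> //.
    by rewrite eg //; left; rewrite posS; have := slot_ge; lia.
  move=> i; rewrite -!/(fld i); have [[y1 y2 y3] [w1 w2 w3 w4] _] := ei i.
  have eq k : k < 7 -> g (fld i + k) = hp s' (fld i + k) by move=> k7; apply: eg; apply: fl.
  have eg' a : pos (kid i) + 16 <= a < pos (kid i) + slot N -> g a = hp s' a by move=> /fz; apply: eg.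
  have eq0 := eq 0 isT; rewrite addn0 in eq0.
  rewrite eq0 (eq 1) // (eq 2) //; split; [exact: w1|exact: w2|exact: w3|].
  exists (kid i), (fr i); split; [exact: kk | by rewrite eq | exact: nsk |].
  by move=> k k3; rewrite -addnA eq ?addnA ?y1 //; lia.
move=> j /andP[j1 j2] jo.
have [i ->] : exists i, j = kid i.
  rewrite e5 in j1; rewrite e6 in j2; case/orP: jo => [/eqP e|jc]; first by rewrite e ltnn in j1.
  by case: (eqVneq j (rg s 6)) => [e|ne]; [exists true|exists false]; rewrite /kid; lia.
have [[y1 y2 y3] [w1 w2 w3 w4] [es' ce se]] := ei i.
rewrite nsk phk; split; last first.
  move=> g eg; rewrite /= eg.
    rewrite y3; apply: w4 => a ha; apply: eg; rewrite e5; exact: fz ha.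
  by right; exists (kid i); [rewrite e5; exact: kk | left].
have fi : fr i + 3 <= rg s' 7 by rewrite e7 /fr; case: (i); lia.
have f7 : rg s 7 <= rg s' 7 by rewrite e7 leq_addr.
exists (bvs vs J i), (bM i), (bl i), es'; split=> //; split.
- by split=> //; [apply: bvs_uniq | apply: bvs_all].
- split; [exact: block_marks_sym | exact: block_marks_adj | exact: thin_block | ].
  by apply: block_hitting => // x; apply: leq_trans (lf x) _; apply: leq_addr.
- split.
  + by apply: block_name_inj => // x; apply: leq_trans (nf x) _; apply: leq_addr.
  + case=> [u|k] /=; first by apply: leq_trans (nf (val u)) _; lia.
    by have := ltn_ord k; rewrite /mark; lia.
  + case=> [u|k]; last by rewrite /bl /=; lia.
    by rewrite /bl /=; case: ifP => _; [lia | apply: leq_trans (lf (val u)) _; lia].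
- have -> : #|gG (GNode (bn i))| = #|sX J i| + 3 by exact: card_block.
  have e : #|sX J i| + #|sX J (~~ i)| = #|G| by rewrite -(card_sides tJ); case: (i) => //; apply: addnC.
  by have := consistent_card tJ cJ (~~ i); lia.
- by apply: leq_trans (edges_block tJ cJ i) GM.
Qed.
End Divide.

(** The sum of the bounds drops in each case: a leaf removes its own, a failed test removes pairs of
    M or a label, and a split is covered by [potential_blocks]. *)
Lemma turn_inv s c : inv c s -> inv c.+1 (run Turn s).
Proof.
move=> [ns [ph D]]; rewrite /Turn run_if [ev _ _]/= eqb0 negbK.
have [[[F1 F2 F3 F23 F24] e0] [/andP[h1 h2] h0] h3 h4 h5] := D.
case: ltnP => cc; last first.
  have ec : rg s 5 = rg s 6 by apply/eqP; rewrite eqn_leq h1.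
  rewrite run_skip; exists ns, ph; split=> //; last by left.
  by split=> //; apply/andP; split; [|lia].
have [|[vs [M [lab [es [L S pM]]]]] _] := h5 (rg s 5); first by rewrite leqnn.
have [[U T C] [sM MA th hit] [inj nf lf] GN GM] := L.
rewrite run_cons; set t1 := run Recall s.
have I1 : idle s t1 by apply: idle_run; [vmt|vmt|vmt|split].
have S1 : shows vs N (@gname (ns (rg s 5))) M lab es (ar t1).
  by apply: (shows_ext U T GN C _ S) => a k a8 kc; rewrite load_val // F1.
have L1 : loaded vs (@gname (ns (rg s 5))) es M lab (setr t1 10 (ar t1 4 0)).
  have [r1 _ _] := I1; have [s4 _ _ _ _] := S1.
  by split; rewrite /= /upd /= ?r1 // ?F1 ?F2 // (clean_size T C).
rewrite run_cons; set t2 := run Decide t1.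
have [L2 out] := decide_val U T C erefl L1 hit MA.
rewrite -/t2 in L2 out.
have I2 : idle s t2 by apply: idle_run I1; vmt.
rewrite run_cons run_nil run_if.
case: out => [[e16 no]|[e16 e11 [a1 [a2 [[e12 e13] nsep hM]]]]|[e16 e11 [a1 [a2 [b1 [b2 [X [[a12 b12 tX] [e12 e13 e14 e15 rX]]]]]]]]].
- by rewrite [ev _ _]/= e16 /=; apply: advance_inv D cc I2 _; left.
- rewrite [ev _ _]/= (negPf e16) /= run_if [ev _ _]/= e11 /= /Retry run_seq run_if.
  case: hM => [[k16 Ma]|[k16 lab12]]; rewrite [ev _ _]/= k16 /=.
  + set M' := fun u v => M u v && ((u, v) != (a1, a2)) && ((v, u) != (a1, a2)).
    have M'M u v : M' u v -> M u v by case/andP=> /andP[].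
    apply: (@retry_inv _ _ _ _ _ vs es M' lab D cc).
    * by apply: idle_run I2; vmt.
    * split=> //; split.
      - by move=> u v; rewrite /M' sM -!andbA; congr andb; rewrite andbC.
      - by move=> u v /M'M; apply: MA.
      - by move=> u v /M'M; apply: th.
      - move=> J tJ; case: (hitting_drop hit sM nsep tJ) => [[u [v [h sep]]]|]; last by right.
        left; exists u, v; split=> //; move: h; rewrite /M' !xpair_eqE => /andP[-> h] /=.
        by rewrite andbC.
    * exact: drop_val.
    * apply: leq_trans pM; rewrite /potential ltn_add2r !ltn_add2r; apply: proper_card.
      apply/properP; split; first by apply/subsetP => -[u v]; rewrite !inE; apply: M'M.
      by exists (a1, a2); rewrite !inE //= /M' eqxx andbF.
  + apply: (@retry_inv _ _ _ _ _ vs es M (fun x => if lab x == lab a2 then lab a1 else lab x) D cc).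
    * by apply: idle_run I2; vmt.
    * split=> //; split=> //; first exact: hitting_merge.
      by move=> x; case: ifP.
    * exact: merge_val.
    * by apply: leq_trans pM; rewrite /potential !ltn_add2r ltn_add2l; apply: nlab_merge.
- rewrite [ev _ _]/= (negPf e16) /= run_if [ev _ _]/= (negPf e11) /= run_cons.
  set J := mk_split a1 a2 b1 b2 X.
  have tJ : two_join J by apply: target_two_join.
  have V2 := loaded_view L2.
  have S3 := sets_val U T V2 e12 e13 e14 e15 rX.
  set t3 := run Sets t2 in S3 *.
  have I3 : idle s t3 by apply: idle_run I2; vmt.
  have L3 : loaded vs (@gname (ns (rg s 5))) es M lab t3 by apply: loaded_run L2; vmt.
  have f12 : rg t3 12 = ix vs a1 by rewrite run_rg //; vmt.
  have f13 : rg t3 13 = ix vs a2 by rewrite run_rg //; vmt.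
  rewrite 2!run_cons run_nil.
  have e17 := cons_val U T (clean_adj C) (fun u v => clean_all T C) (loaded_view L3) (loaded_lists L3) f12 f13 S3.
  set t4 := run Cons t3 in e17 *.
  have I4 : idle s t4 by apply: idle_run I3; vmt.
  have L4 : loaded vs (@gname (ns (rg s 5))) es M lab t4 by apply: loaded_run L3; vmt.
  have S4 : sides vs a1 a2 b1 b2 X t4 by apply: sides_run S3; vmt.
  rewrite run_if [ev _ _]/= e17; have [[a1X _ a2X _ _] _ _] := tX.
  have cP : reflect (consistent J) (consb J a1 a2) by apply: consP; [exact: tJ.1| |rewrite /= inE].
  case: cP => cJ /=; first exact: (divide_inv D cc I4 L L4 tJ cJ S4 pM).
  by apply: advance_inv D cc I4 _; right; split=> //; exists J.
Qed.
End Inv.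

(** * Reading the input *)

Definition eK := Plus (Times (Var 20) (Var 1)) (Var 21).
Definition eEnd j := Aget 27 (Hget (Plus (Plus (Plus (Cst 2) (Var 1)) (Times eK (Cst 2))) (Cst j))).

Definition Index := PFor 20 BN (PArr 27 (Hget (Plus (Cst 2) (Var 20))) (Var 20)).
Definition Arcs := PFor 20 BN (PFor 21 BN (PIf (Less eK (Hget (Cst 1)))
  (PArr 13 (Plus (Times (eEnd 0) eN1) (eEnd 1)) (Cst 1)) PSkip)).

(** Each edge is listed in one orientation only, so adjacency means that the two entries of the
    matrix of arcs differ. The edges are then listed anew, which gives their number and a clean
    listing. *)
Definition Start := seqs [:: Index; Arcs;
  Mat 40 (eNot (Equ (eMat 13 (Var 20) (Var 21)) (eMat 13 (Var 21) (Var 20))));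
  Vec 42 (Cst 1) (Var 20); Vec 43 (Cst 1) (Hget (Plus (Cst 2) (Var 20)));
  PArr 44 (Cst 0) (Var 1); Edges; Store 40 5;
  seqs [:: PSet 4 (Aget 45 (Cst 0)); PSet 6 (Cst 1); PSet 7 (Var 1); PSet 23 (Var 0); PSet 24 (Plus (Var 0) eD)]].

Section Start.
Variables (G : sgraph) (name : G -> nat) (vs : seq G) (es : seq (G * G)).
Hypotheses (inj : injective name) (GL : graph_listing vs es).
Notation ix := (ix vs).
Let Uvs : uniq vs. Proof. by case: GL. Qed.
Let vsT x : x \in vs. Proof. by case: GL => _ ->. Qed.
Let N := #|G|.

(** A bound for the length of the input that depends on n alone; the slots of the nodes begin
    here. *)
Definition room := 2 + N + 2 * (N * N).

Lemma size_es : size es <= N * N.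
Proof.
case: GL => _ _ Ue _; rewrite -(card_uniqP Ue); apply: leq_trans (max_card _) _.
by rewrite card_prod.
Qed.

Lemma size_code : size (graph_code name vs es) = 2 + N + 2 * size es.
Proof.
rewrite /graph_code /= size_cat size_map (size_vs Uvs vsT).
have -> : size (flatten [seq [:: name e.1; name e.2] | e <- es]) = 2 * size es.
  by elim: (es) => //= e l ->; lia.
by rewrite !addSn.
Qed.

Variable s : mstate.
Hypotheses (s1 : rg s 1 = N) (s5 : rg s 5 = 0) (s3 : room <= rg s 3).
Hypotheses (in0 : stored (hp s) 0 (graph_code name vs es)) (z : forall a i, ar s a i = 0).

Lemma hp_size : hp s 1 = size es.
Proof. by rewrite -[1]add0n in0. Qed.

Lemma hp_name x : hp s (2 + ix x) = name x.
Proof.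
have lt := ix_lt Uvs vsT x.
rewrite -[2 + _]add0n in0; last by rewrite size_code; lia.
rewrite /= nth_cat size_map (size_vs Uvs vsT) lt (nth_map x) ?index_mem //.
by rewrite nth_index.
Qed.

Lemma hp_edge k e0 : k < size es -> let e := nth e0 es k in
  hp s (2 + N + k * 2) = name e.1 /\ hp s (2 + N + k * 2 + 1) = name e.2.
Proof.
move=> ks e; have [f1 f2] := flat_pairs (fun e => name e.1) (fun e => name e.2) ks.
rewrite (nth_map e0) // in f1; rewrite (nth_map e0) // in f2.
have h j : j < 2 -> hp s (2 + N + k * 2 + j) = nth 0 (flatten [seq [:: name e.1; name e.2] | e <- es]) (k * 2 + j).
  move=> j2; rewrite -[2 + N + _ + _]add0n in0; last by rewrite size_code; lia.
  rewrite -!addnA [nth _ _ _]/= nth_cat size_map (size_vs Uvs vsT) ltnNge leq_addr /=.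
  by rewrite add0n -/N addKn.
by have := h 0 isT; have := h 1 isT; rewrite !addn0 f1 f2.
Qed.

Lemma index_val x : ar (run Index s) 27 (name x) = ix x.
Proof.
rewrite /Index.
have [|||s' [h _ ->]] := @run_for (fun i s' => forall x, ix x < i -> ar s' 27 (name x) = ix x)
  20 BN (PArr 27 (Hget (Plus (Cst 2) (Var 20))) (Var 20)) s N => //; last first.
- by rewrite /= h // ix_lt.
- move=> i s' iN [f1 f2 f3] h y; have [u eu] := ix_onto Uvs vsT iN.
  have e : ev (setr s' 20 i) (Hget (Plus (Cst 2) (Var 20))) = name u.
    by rewrite /= /upd /= f1 // f3 // ifT ?eu -?eu ?hp_name //; move: s3 iN; rewrite /room -/N eu; lia.
  rewrite run_arr e /= /upd /= (inj_eq inj) ltnS leq_eqVlt -eu ix_eq //.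
  by case: eqP => [->|_ /= lt] //; apply: h; rewrite -eu.
Qed.

Lemma arcs_val x y : ar (run Arcs (run Index s)) 13 (ix x * (N + 1) + ix y) = ((x, y) \in es).
Proof.
set t := run Index s.
have tr w : w != 20 -> rg t w = rg s w by move=> hw; rewrite run_rg // inE.
have th : hp t = hp s by rewrite run_hp.
pose Q i j s' := forall x y, ar s' 13 (ix x * (N + 1) + ix y) = ((x, y) \in take (i * N + j) es).
suff : Q N 0 (run Arcs t) by move=> ->; rewrite addn0 take_oversize // size_es.
apply: (run_for2 (k := N) (l := N)) => //.
- by rewrite tr.
- by rewrite tr.
- by move=> u v; rewrite take0 run_ar // z.
- by move=> i s' iN h u v; rewrite h mulSn addn0 addnC.
move=> i j s' iN jN [f1 f2 f3] e20 e21 h u v.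
have kN : i * N + j < N * N by nia.
have ek : ev s' eK = i * N + j by rewrite /= e20 e21 f1 // tr // s1.
have e1 : ev s' (Less eK (Hget (Cst 1))) = (i * N + j < size es).
  rewrite -[LHS]/(nat_of_bool (ev s' eK < hp s' (if 1 < rg s' 3 then 1 else 0))) ek.
  by rewrite f1 // tr // f3 // th ifT ?hp_size //; move: s3; rewrite /room; lia.
rewrite run_if e1 [_ + j.+1]addnS; case: ltnP => ks /=; last first.
  by rewrite run_skip h !take_oversize // ltnW.
have [e0 _] : exists e0 : G * G, true by case: (es) ks => // e0 l; exists e0.
have [n1 n2] := hp_edge e0 ks.
have en b : b < 2 -> ev s' (eEnd b) = ar t 27 (hp s (2 + N + (i * N + j) * 2 + b)).
  move=> b2; pose ad := Plus (Plus (Cst 2) (Var 1)) (Times eK (Cst 2)).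
  have ea : ev s' ad = 2 + N + (i * N + j) * 2 by rewrite -ek /ad /= f1 // tr // s1.
  rewrite -[LHS]/(ar s' 27 (hp s' (if ev s' ad + b < rg s' 3 then ev s' ad + b else 0))).
  by rewrite ea f1 // tr // f3 // th f2 // ifT //; move: s3; rewrite /room; lia.
have ei : ev s' (Plus (Times (eEnd 0) eN1) (eEnd 1)) = ev s' (eEnd 0) * (rg s' 1 + 1) + ev s' (eEnd 1) by [].
rewrite run_arr ei !en // addn0 n1 n2 !index_val /= /upd.
rewrite f1 // tr // s1 (take_nth e0) // mem_rcons inE mat_inj ?ix_lt // !ix_eq //.
by rewrite h -xpair_eqE -surjective_pairing; case: eqP.
Qed.

Lemma start_val : let s' := run Start s in
  [/\ forall x, x \in [:: 0; 1; 2; 3; 5] -> rg s' x = rg s x, hp s' = hp s,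
      [/\ rg s' 6 = 1, rg s' 7 = N, rg s' 23 = rg s 0 & rg s' 24 = rg s 0 + slot N] &
      exists es', [/\ clean vs es', rg s' 4 = size es' &
        shows vs N name (fun _ _ => false) ix es' (bigf s' 0)]].
Proof.
move=> s'; rewrite /s' /Start 9!run_cons run_nil.
set t2 := run Arcs _; set t3 := run (Mat _ _) t2; set t4 := run (Vec 42 _ _) t3; set t5 := run (Vec 43 _ _) t4.
set t6 := run (PArr 44 _ _) t5; set t7 := run Edges t6; set t8 := run (Store 40 5) t7.
pose ok t := (forall x, x \in [:: 0; 1; 2; 3; 5] -> rg t x = rg s x) /\ hp t = hp s.
have nxt p t : ~~ has (fun x => x \in wr p) [:: 0; 1; 2; 3; 5] -> ~~ wh p -> ok t -> ok (run p t).
  by move=> /hasPn n w [h1 h2]; split=> [x hx|]; [rewrite run_rg ?h1 // n | rewrite run_hp].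
have o2 : ok t2 by do 2 (apply: (nxt); [vmt|vmt|]).
have o3 : ok t3 by apply: nxt o2; vmt.
have o4 : ok t4 by apply: nxt o3; vmt.
have o5 : ok t5 by apply: nxt o4; vmt.
have o6 : ok t6 by apply: nxt o5; vmt.
have o7 : ok t7 by apply: nxt o6; vmt.
have o8 : ok t8 by apply: nxt o7; vmt.
have n1 t : ok t -> rg t 1 = N by case=> ->.
have lt x := ix_lt Uvs vsT x.
have e40 x y : ar t3 40 (ix x * (N + 1) + ix y) = adj x y.
  have := @mat_val 40 (eNot (Equ (eMat 13 (Var 20) (Var 21)) (eMat 13 (Var 21) (Var 20)))) t2 (ix x) (ix y) isT.
  rewrite -/t3 n1 // => -> //; rewrite /= /upd /= n1 // !arcs_val.
  by case: GL => _ _ _ ->; case: ((x, y) \in es); case: ((y, x) \in es).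
have e42 x : ar t4 42 (ix x) = ix x.
  by rewrite /t4 vec_val ?n1.
have e43 x : ar t5 43 (ix x) = name x.
  rewrite /t5 vec_val ?n1 //= /upd /=; have [h1 h2] := o4.
  by rewrite h1 // h2 ifT ?hp_name //; have := lt x; move: s3; rewrite /room -/N; lia.
have a4 a : a != 42 -> ar t4 a = ar t3 a by move=> ha; rewrite /t4 run_ar // inE.
have a5 a : a != 43 -> ar t5 a = ar t4 a by move=> ha; rewrite /t5 run_ar // inE.
have a6 a : a != 44 -> ar t6 a = ar t5 a by move=> ha; rewrite /t6 run_ar // inE.
have a7 a : a < 45 -> ar t7 a = ar t6 a.
  by move=> ha; rewrite /t7 run_ar // !inE; apply/negP; move: ha; clear; lia.
have e41 i : ar t3 41 i = 0 by rewrite /t3 run_ar // /t2 run_ar // run_ar // z.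
have [|||es' ce le] := @edges_val G vs Uvs vsT t6; rewrite ?n1 //.
- by rewrite /t6 run_arr /= /upd /= n1.
- by move=> x y; rewrite a6 // a5 // a4.
rewrite -/t7 in le.
have S7 : shows vs N name (fun _ _ => false) ix es' (newf t7).
  split=> //; rewrite /newf.
  - by rewrite a7 // /t6 run_arr /= /upd /= n1.
  - by move=> x y; rewrite a7 // a6 // a5 // a4.
  - by move=> x y; rewrite a7 // a6 // a5 // a4 // e41.
  - by move=> x; split; [rewrite a7 // a6 // a5 | rewrite a7 // a6].
have [b1 _] := @store_val 40 5 t7 isT isT.
have e75 : rg t7 5 = 0 by case: o7 => ->.
rewrite -/t8 e75 n1 // in b1.
have e4 : ar t8 45 0 = size es'.
  rewrite /t8 run_ar; last by vmt.
  by case: le.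
rewrite 5!run_cons run_nil !run_set; have [k8 h8] := o8.
split=> //.
- by move=> x hx; rewrite /= /upd -k8 //; move: hx; rewrite !inE; do 4 (case/orP => [/eqP->//|]); move/eqP->.
- by split; rewrite /= /upd /= ?k8 // n1.
exists es'; split=> //.
by apply: (shows_ext Uvs vsT (leqnn _) ce _ S7) => a k a8 kc; rewrite /newf -b1 // /bigf /= /upd /= n1.
Qed.
End Start.

(** * Resource bounds *)

(** As m is at most n^2, a bound in n and m is a power of n + 2; the base is at least 2 even for n =
    0. *)
Definition poly (f : nat -> nat -> nat) := exists k, forall n m, m <= n * n -> f n m < (n + 2) ^ k.

Lemma poly_le f g : (forall n m, f n m <= g n m) -> poly g -> poly f.
Proof. by move=> fg [k hk]; exists k => n m nm; apply: leq_ltn_trans (fg n m) (hk n m nm). Qed.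

Lemma poly_cst c : poly (fun _ _ => c).
Proof.
exists c => n m _; apply: (@leq_trans (2 ^ c)); first exact: ltn_expl.
by case: c => // c; rewrite leq_exp2r // leq_addl.
Qed.

Lemma poly_n : poly (fun n _ => n).
Proof. by exists 1 => n m _; rewrite expn1; lia. Qed.

Lemma poly_m : poly (fun _ m => m).
Proof. by exists 2 => n m nm; apply: leq_ltn_trans nm _; rewrite -mulnn; nia. Qed.

Lemma poly_add f g : poly f -> poly g -> poly (fun n m => f n m + g n m).
Proof.
move=> [k hk] [l hl]; exists (k + l + 1) => n m nm.
move: (hk n m nm) (hl n m nm); rewrite !expnD expn1.
have : 0 < (n + 2) ^ k by rewrite expn_gt0 addnS.
have : 0 < (n + 2) ^ l by rewrite expn_gt0 addnS.
move: (_ ^ k) (_ ^ l) (f n m) (g n m); nia.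
Qed.

Lemma poly_mul f g : poly f -> poly g -> poly (fun n m => f n m * g n m).
Proof.
move=> [k hk] [l hl]; exists (k + l) => n m nm.
by rewrite expnD; apply: ltn_mul; [exact: hk | exact: hl].
Qed.

Lemma poly_exp f k : poly f -> poly (fun n m => f n m ^ k).
Proof.
move=> pf; elim: k => [|k IH]; first exact: poly_cst 1.
by apply: poly_le (poly_mul pf IH) => n m; rewrite expnS.
Qed.

Lemma poly_bval b : poly (fun n m => bval n m b).
Proof.
case: b => [c|||] /=; [exact: poly_cst | exact: poly_n | | exact: poly_m].
by apply: poly_le (poly_add poly_n (poly_cst 1)) => n m; rewrite addn1.
Qed.

Section Growth.
Variable h : nat -> nat -> nat.
Hypothesis ph : poly h.

Lemma poly_cval e : poly (fun n m => cval n m (h n m) e).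
Proof.
elim: e => /= [c|x|e _|a e _|e1 h1 e2 h2|e1 _ e2 _|e1 h1 e2 h2|e1 _ e2 _|e1 _ e2 _];
  try exact: poly_cst; [|exact: poly_add|exact: poly_mul].
by case: (x == 1); [exact: poly_n | case: (x == 2); [exact: poly_m | ]].
Qed.

Lemma poly_gx e : poly (fun n m => gx n m (h n m) e).
Proof.
elim: e => /= [c|x|e _|a e _|e1 h1 e2 _|e1 h1 e2 _|e1 h1 e2 h2|e1 _ e2 _|e1 _ e2 _] //;
  try exact: poly_cst.
exact: poly_add h1 (poly_cval e2).
Qed.

Lemma poly_gr p : poly (fun n m => gr n m (h n m) p).
Proof.
elim: p => /= [|x e|a e|a i e|p1 IH1 p2 IH2|e p1 IH1 p2 IH2|x b p IH];
  try exact: poly_gx; try exact: poly_add; first exact: poly_cst.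
by apply: poly_add; [apply: poly_mul IH; exact: poly_bval | exact: poly_bval].
Qed.
End Growth.

(** The nesting depth of loops of length about n, and below, of loops of length m; their maxima are
    taken independently. *)
Fixpoint dgn (p : pg) : nat :=
  match p with
  | PSeq p1 p2 | PIf _ p1 p2 => maxn (dgn p1) (dgn p2)
  | PFor _ b p => (if b is (BN | BN1) then 1 else 0) + dgn p
  | _ => 0
  end.

Fixpoint dgm (p : pg) : nat :=
  match p with
  | PSeq p1 p2 | PIf _ p1 p2 => maxn (dgm p1) (dgm p2)
  | PFor _ b p => (if b is BM then 1 else 0) + dgm p
  | _ => 0
  end.

Lemma loop_le u w v X Y K : u <= w * v -> 0 < v -> 0 < X -> Y <= K * X ->
  u * (Y + 10) + 8 <= (w * (K + 10) + 8) * (v * X).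
Proof.
move=> uwv v0 X0 YX; have h1 : u * (Y + 10) <= w * v * (K * X + 10 * X).
  by apply: leq_mul => //; apply: leq_add => //; rewrite leq_pmulr.
have h2 : 8 <= 8 * (v * X) by rewrite leq_pmulr // muln_gt0 v0.
apply: leq_trans (leq_add h1 h2) _.
by rewrite [X in _ <= X]mulnDl -mulnDl leq_add2r -!mulnA leq_mul2l [v * (_ * _)]mulnCA leqnn orbT.
Qed.

Lemma cst_le NA p : exists K, forall n m, cst NA n m p <= K * ((n + 1) ^ dgn p * (m + 1) ^ dgm p).
Proof.
have pos n m a b : 0 < (n + 1) ^ a * (m + 1) ^ b by rewrite muln_gt0 !expn_gt0 !addn1.
have base c a b : exists K, forall n m, c <= K * ((n + 1) ^ a * (m + 1) ^ b).
  by exists c => n m; rewrite leq_pmulr // pos.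
have mono n m a b a' b' : a <= a' -> b <= b' ->
    (n + 1) ^ a * (m + 1) ^ b <= (n + 1) ^ a' * (m + 1) ^ b'.
  by move=> aa bb; apply: leq_mul; apply: leq_pexp2l => //; rewrite addn1.
elim: p => [|x e|a e|a i e|p1 [K1 h1] p2 [K2 h2]|e p1 [K1 h1] p2 [K2 h2]|x b p [K hK]]; try exact: base.
- exists (K1 + K2) => n m; rewrite [cst _ _ _ _]/= mulnDl; apply: leq_add.
    by apply: leq_trans (h1 n m) _; rewrite leq_mul2l mono ?orbT //= leq_maxl.
  by apply: leq_trans (h2 n m) _; rewrite leq_mul2l mono ?orbT //= leq_maxr.
- exists ((ecost (ce NA e)).+1 + K1 + K2) => n m; rewrite [cst _ _ _ _]/= !mulnDl.
  apply: leq_add; first apply: leq_add; first by rewrite leq_pmulr // pos.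
    by apply: leq_trans (h1 n m) _; rewrite leq_mul2l mono ?orbT //= leq_maxl.
  by apply: leq_trans (h2 n m) _; rewrite leq_mul2l mono ?orbT //= leq_maxr.
exists ((if b is BC c then c else 1) * (K + 10) + 8) => n m; rewrite [cst _ _ _ _]/=.
have -> : (n + 1) ^ dgn (PFor x b p) * (m + 1) ^ dgm (PFor x b p) =
    (match b with BC c => 1 | BM => m + 1 | _ => n + 1 end) * ((n + 1) ^ dgn p * (m + 1) ^ dgm p).
  case: b => [c|||] /=; rewrite ?add0n ?mul1n // expnD expn1 ?mulnA //.
  by congr (_ * _); rewrite mulnC.
apply: loop_le; last exact: hK; last exact: pos; last by case: (b) => *; rewrite ?addn1.
by case: (b) => [c|||] /=; rewrite ?muln1 ?mul1n ?addn1.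
Qed.

Lemma poly_word (p1 p2 : pg) NA (h : nat -> nat) : poly (fun n _ => h n) -> exists k, forall n m, m <= n * n ->
  let vf := h n + gr n 0 (h n) p1 + gr n m (h n) p2 in
  [/\ vf < (n + 2) ^ k, h n + (vf.+2 ^ asz p1 * NA + NA) < (n + 2) ^ k &
      h n + (vf.+2 ^ asz p2 * NA + NA) < (n + 2) ^ k].
Proof.
move=> ph; pose vf n m := h n + gr n 0 (h n) p1 + gr n m (h n) p2.
have p0 : poly (fun n _ => gr n 0 (h n) p1).
  by have [k hk] := poly_gr ph p1; exists k => n m _; apply: hk.
have pv : poly vf by apply: poly_add (poly_gr ph p2); apply: poly_add ph p0.
have pw q : poly (fun n m => h n + ((vf n m).+2 ^ asz q * NA + NA)).
  apply: poly_add ph _; apply: poly_add; last exact: poly_cst.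
  apply: poly_mul; last exact: poly_cst.
  by apply: poly_exp; apply: poly_le (poly_add pv (poly_cst 2)) => n m; rewrite addn2.
have [k hk] := poly_add pv (poly_add (pw p1) (pw p2)); exists k => n m nm vf'.
have := hk n m nm; rewrite -[vf n m]/vf'.
move: (_ ^ k) (vf'.+2 ^ _) (vf'.+2 ^ _) => W x y.
by split; lia.
Qed.

(** * The complete program *)

Definition Loop := PFor 90 (BC 17) (PFor 91 BN1 Turn).

Section Main.
Variables T0 N Mx H P : nat.
Hypothesis space : pos T0 N (2 * P + 1) <= H.
Variable root : gnode.
Notation inv := (inv T0 N Mx H P root).
Notation pos := (pos T0 N).

Lemma inv_setr c s x v : x \notin [:: 1; 2; 3; 5; 6; 7; 23; 24] -> inv c s -> inv c (setr s x v).
Proof.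
move=> hx [ns [ph D]]; exists ns, ph.
have e y : y \in [:: 1; 2; 3; 5; 6; 7; 23; 24] -> rg (setr s x v) y = rg s y.
  by move=> hy; rewrite /= /upd; case: eqP => // ey; rewrite -ey hy in hx.
have eb j : bigf (setr s x v) j = bigf s j by rewrite /bigf e.
have [[[F1 F2 F3 F23 F24] e0] h0 h3 h4 h5] := D.
split; rewrite ?(e 5) ?(e 6) ?(e 7) //; first by split=> //; split; rewrite !e.
by move=> j jj; rewrite eb; apply: h5.
Qed.

(** The initial potential is at most N for the labels plus 16 * N + 1, so 17 * (N + 1) turns are
    enough. *)
Lemma loop_inv s : rg s 1 = N -> inv 0 s -> inv (17 * (N + 1)) (run Loop s).
Proof.
move=> s1 I0; rewrite /Loop.
have i1 c t : inv c t -> rg t 1 = N by move=> [ns [ph [[[]]]]].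
have [|||s' [h _ ->]] := @run_for (fun i s' => inv (i * (N + 1)) s') 90 (BC 17) (PFor 91 BN1 Turn) s 17 => //.
move=> i s' _ _ h; have h' := @inv_setr _ _ 90 i isT h.
have [|||s2 [h2 _ ->]] := @run_for (fun j s' => inv (i * (N + 1) + j) s') 91 BN1 Turn (setr s' 90 i) N.+1.
- by rewrite /= -(i1 _ _ h').
- by rewrite addn0.
- by move=> j s2 _ _ h2; rewrite addnS; apply: turn_inv => //; apply: inv_setr.
have -> : i.+1 * (N + 1) = i * (N + 1) + N.+1 by rewrite mulSn; lia.
exact: inv_setr h2.
Qed.

(** Children have larger positions than their parent, so the trees are built from the last node
    backwards. *)
Lemma finished_tree m ns cnt : (forall j, j < cnt -> finished T0 N m ns cnt j) ->
  forall j, j < cnt -> exists T : dtree (gG (ns j)), dtree_at m (pos j) (@gname (ns j)) T.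
Proof.
move=> F j; elim: {j}(cnt - j) {-2}j (leqnn (cnt - j)) => [|d IH] j dj jc; first by lia.
have [g] := F j jc; case=> [[m0 no]|[m1 ex]|[J [tJ cJ m2 hi]]].
- by exists (LeafNo2Join no).
- by exists (LeafNonConsistent ex).
have ch i : exists T : dtree (block J i), dtree_at m (m (pos j + (if i then 2 else 9) + 6))
    (@block_name _ J i (@gname (ns j)) (fun k => m (pos j + (if i then 2 else 9) + 3 + k))) T.
  have [_ _ _ [c [fr [/andP[jc' cc] -> ec em]]]] := hi i.
  have [|//|] := IH c; first by lia.
  rewrite ec /= => T hT; exists T.
  (* The names of the markers in memory agree with [mark fr] at each marker, and the tree is stated
     for the function read from memory. *)
  have -> : (fun k : 'I_3 => m (pos j + (if i then 2 else 9) + 3 + k)) = mark fr => //.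
  by apply: functional_extensionality => k; rewrite em.
have [T1 h1] := ch true; have [T2 h2] := ch false.
exists (Node tJ cJ (fun i => if i is true then T1 else T2)); split=> //; split=> // i.
by have [x1 x2 x3 _] := hi i; split=> //; case: (i).
Qed.

Lemma inv_tree s m : inv P s -> (forall a, a < H -> m a = hp s a) ->
  exists T : dtree (gG root), dtree_at m T0 (@gname root) T.
Proof.
move=> [ns [ph D]] em; have [[F e0] [/andP[h1 h2] h0] h3 h4 h5] := D.
have ec : rg s 5 = rg s 6.
  apply/eqP; rewrite eqn_leq h1 leqNgt; apply/negP => cc.
  by have [lt _ _] := data_room space D cc; rewrite ltnn in lt.
have mH : pos (rg s 6) <= H by apply: leq_trans (pos_le _ _ h2) space.
have [|T hT] := @finished_tree m ns (rg s 6) _ 0 h0; last first.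
  by move: T hT; rewrite e0 => T hT; exists T; move: hT; rewrite /pos muln0 addn0.
move=> j jc; apply: h4; first by rewrite ec.
by move=> a fa; apply: em; apply: leq_trans (frozen_lt h1 fa) mH.
Qed.
End Main.

(** At the start all labels differ and M is empty, so [hitting] is immediate. Names and labels are
    below n, which serves as the first fresh integer. *)
Lemma start_inv (G : sgraph) (name : G -> nat) vs es s H P Mx : injective name -> (forall u, name u < #|G|) ->
  graph_listing vs es -> rg s 1 = #|G| -> rg s 5 = 0 -> rg s 0 = room G -> rg s 3 = H ->
  room G <= H -> 17 * #|G| + 1 <= P ->
  stored (hp s) 0 (graph_code name vs es) -> (forall a, size (graph_code name vs es) <= a -> hp s a = 0) ->
  (forall a i, ar s a i = 0) -> let s' := run Start s in Mx = rg s' 4 ->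
  [/\ inv (room G) #|G| Mx H P (GNode name) 0 (setr s' 2 Mx), Mx = #|edges G|, rg s' 1 = #|G|,
      rg s' 3 = H & rg s' 0 = room G].
Proof.
move=> inj nlt GL s1 s5 s0 s3 rH PN in0 z0 z s' e4.
have rs : room G <= rg s 3 by rewrite s3.
have [k h [k6 k7 k23 k24] [es' [ce k4 S]]] := start_val inj GL s1 s5 rs in0 z.
rewrite -/s' in k h k6 k7 k23 k24 k4 S.
have [Uvs vsE _ _] := GL; have vsT x : x \in vs by rewrite vsE.
have eM : Mx = #|edges G| by rewrite e4 k4 (clean_size vsT ce).
split=> //; rewrite ?k //.
set N := #|G|; exists (fun=> GNode name), (fun=> 17 * N + 1).
have r x : x != 2 -> rg (setr s' 2 Mx) x = rg s' x by move=> hx; rewrite /= /upd (negPf hx).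
have fz : forall a, a < room G -> frozen (room G) N 0 1 a by move=> a ha; left; rewrite /pos muln0 addn0.
have r5 : rg (setr s' 2 Mx) 5 = 0 by rewrite r // k.
have r6 : rg (setr s' 2 Mx) 6 = 1 by rewrite r.
split; rewrite ?r5 ?r6 //.
- split=> //; split; rewrite ?r5 ?r6 //.
  + by rewrite r // k.
  + by rewrite r // k.
  + by rewrite r // k23 s0 /pos muln0 addn0.
  + by rewrite r // k24 s0 /pos muln1.
- by right; rewrite big_nat1 addn0.
case=> // _; split; last first.
  (* The pointer from the record of the root to its graph has never been written; its value 0 is the
     address of the input itself. *)
  move=> g eg; have e0 : g (pos (room G) N 0 + 1) = 0.
    rewrite eg /=; first by rewrite h z0 // /pos muln0 addn0 (size_code name GL) /room; have := size_es GL; lia.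
    by right; exists 0 => //; left.
  rewrite e0; split=> //; exists vs, es; split=> // i hi.
  rewrite eg /=; first by rewrite h in0.
  by apply: fz; move: hi; rewrite (size_code name GL) /room; have := size_es GL; lia.
exists vs, (fun _ _ => false), (index^~ vs), es'; split.
- have eML : #|edges G| <= Mx by rewrite eM.
  split=> //; last first.
  + by split=> // x; rewrite r // k7; [apply: nlt | apply: (ix_lt Uvs vsT)].
  + split=> // J tJ; right => u v e; have -> : u = v by apply: (ix_inj vsT).
    by rewrite /separates eqxx.
- exact: S.
- rewrite /potential; have -> : nrel (fun _ _ : G => false) = 0.
    by rewrite /nrel (eq_card0 (A := _)) // => e; rewrite inE.
  by have := nlab_le (index^~ vs); rewrite /= -/N; lia.
Qed.

Definition eRoom := Plus (Plus (Cst 2) (Var 1)) (Times (Cst 2) (Times (Var 1) (Var 1))).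
(** Room for 2 * P + 1 slots with P = 17 * (n + 1) turns. *)
Definition eTop := Plus (Var 0) (Times eD (Plus (Times (Cst 34) eN1) (Cst 1))).
Definition roomf n := 2 + n + 2 * (n * n).
Definition topf n := roomf n + slot n * (34 * (n + 1) + 1).

Definition prologue := Defs.Seq (Assign 1 (Fetch (Lit 0)))
  (Defs.Seq (Assign 0 (ce 64 eRoom)) (Assign 3 (ce 64 eTop))).
(** Register 2, the bound of the loops over edges, is constant within a compiled program. It is 0
    during the first phase, which computes m in register 4, and receives m before the second one. *)
Definition phases p1 p2 := Defs.Seq prologue
  (Defs.Seq (comp 64 p1) (Defs.Seq (Assign 2 (Reg 4)) (comp 64 p2))).

Lemma exec_phases p1 p2 W n m h c0 t t0 s0 : exec W prologue t c0 t0 -> sim 64 s0 t0 -> wf 64 p1 -> wf 64 p2 ->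
  rg s0 1 = n -> rg s0 2 = 0 -> rg s0 3 = h -> 0 < h -> bounded h s0 -> rg (run p1 s0) 4 = m ->
  (let vf := h + gr n 0 h p1 + gr n m h p2 in
   [/\ vf < W, h + (vf.+2 ^ asz p1 * 64 + 64) < W & h + (vf.+2 ^ asz p2 * 64 + 64) < W]) ->
  exists t' time, [/\ exec W (phases p1 p2) t time t', sim 64 (run p2 (setr (run p1 s0) 2 m)) t' &
    time <= c0 + (cst 64 n 0 p1 + (2 + cst 64 n m p2))].
Proof.
move=> x0 sim0 w1 w2 e1 e2 e3 h0 b0 e4 [vW hW1 hW2]; set vf := h + _ + _ in vW hW1 hW2.
have [|t1 [c1 [x1 l1 sim1 b1]]] := @comp_exec 64 W vf n 0 h vW p1 s0 t0 h w1 sim0 e1 e2 e3 h0 b0 _ hW1.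
  exact: leq_addr.
rewrite -runE in sim1 b1; set s1 := run p1 s0 in sim1 b1 e4 *.
have kc x : x \in [:: 1; 2; 3] -> rg s1 x = rg s0 x by rewrite /s1 runE; apply: wf_const w1.
have [sr sh sa] := sim1; have [br bh ba] := b1.
have mle : m <= h + gr n 0 h p1 by rewrite -e4.
have sim2 : sim 64 (setr s1 2 m) (State (upd (regs t1) 2 m) (memory t1)).
  by split=> [y|a|a i] //=; [rewrite /upd sr | apply: sh | apply: sa].
have b2 : bounded (h + gr n 0 h p1) (setr s1 2 m) by apply: bounded_setr.
have [||||t2 [c2 [x2 l2 sim3 _]]] := @comp_exec 64 W vf n m h vW p2 _ _ _ w2 sim2 _ _ _ h0 b2 _ hW2.
- by rewrite /= /upd /= kc.
- by [].
- by rewrite /= /upd /= kc.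
- exact: leqnn.
rewrite -runE in sim3; exists t2, (c0 + (c1 + (2 + c2))); split=> //.
- apply: exec_seq x0 _; apply: exec_seq x1 _; apply: exec_seq x2.
  have -> : m = eval t1 (Reg 4) by rewrite /= sr.
  by apply: exec_assign; rewrite /= sr e4; apply: leq_ltn_trans vW; apply: leq_trans mle (leq_addr _ _).
- by rewrite !leq_add.
Qed.

Lemma poly_top : poly (fun n _ => topf n).
Proof.
have p1 := poly_n; have pc := poly_cst.
have pN1 : poly (fun n _ => n + 1) by apply: poly_add.
have pr : poly (fun n _ => roomf n).
  by apply: poly_add; [apply: poly_add | apply: poly_mul => //; apply: poly_mul].
have ps : poly (fun n _ => slot n).
  by apply: poly_add => //; apply: poly_add; apply: poly_mul => //; apply: poly_mul.
by apply: poly_add => //; apply: poly_mul => //; apply: poly_add => //; apply: poly_mul.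
Qed.

Lemma wf_start : wf 64 Start. Proof. by vm_compute. Qed.
Lemma loop_reg0 : 0 \notin wr Loop. Proof. by vm_compute. Qed.
Lemma wf_loop : wf 64 Loop. Proof. by vm_compute. Qed.
Lemma degrees_start : dgn Start = 2 /\ dgm Start = 0. Proof. by vm_compute. Qed.
Lemma degrees_loop : dgn Loop = 3 /\ dgm Loop = 1. Proof. by vm_compute. Qed.

Lemma code_le (G : sgraph) (name : G -> nat) vs es b : graph_listing vs es -> #|G| <= b -> size es <= b ->
  (forall u, name u < #|G|) -> {in graph_code name vs es, forall x, x <= b}.
Proof.
move=> [Uvs vsE _ _] Gb eb nlt x; rewrite /graph_code !inE mem_cat.
have nb u : name u <= b by apply: leq_trans (ltnW (nlt u)) Gb.
have sz : size vs = #|G| by apply: size_vs => // u; rewrite vsE.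
case/or4P=> [/eqP->|/eqP->|/mapP[u _ ->]|/flatten_mapP[e _]] //; first by rewrite sz.
by rewrite !inE => /orP[]/eqP->.
Qed.

Definition prologue_cost := (ecost (Fetch (Lit 0))).+1 +
  ((ecost (ce 64 eRoom)).+1 + (ecost (ce 64 eTop)).+1).

Lemma prologue_exec W input n : nth 0 input 0 = n -> topf n < W ->
  exec W prologue (init input) prologue_cost
    (State (upd (upd (upd (fun=> 0) 1 n) 0 (roomf n)) 3 (topf n)) (nth 0 input)).
Proof.
move=> en tW; have rW : roomf n < W by apply: leq_ltn_trans tW; apply: leq_addr.
have nW : n < W by apply: leq_ltn_trans rW; rewrite /roomf; lia.
set t1 := State (upd (fun=> 0) 1 n) (nth 0 input).
set t2 := State (upd (upd (fun=> 0) 1 n) 0 (roomf n)) (nth 0 input).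
have r1 : eval t1 (ce 64 eRoom) = roomf n by [].
have r2 : eval t2 (ce 64 eTop) = topf n by [].
apply: (@exec_seq _ _ _ _ t1).
  by rewrite /t1 -en; apply: exec_assign; rewrite /= en.
apply: (@exec_seq _ _ _ _ t2).
  by rewrite /t2 -r1; apply: exec_assign; rewrite r1.
by rewrite -r2; apply: exec_assign; rewrite r2.
Qed.

(* The word size is O(log n) bits. The bound on the running time excludes   *)
(* only m = 0, where it would be 0, and that on the number of nodes only    *)
(* the empty graph.                                                         *)
Theorem theorem7p3 :
  exists (prog : cmd) (C D k : nat),
  forall (G : sgraph) (name : G -> nat) (vs : seq G) (es : seq (G * G)),
    injective name ->
    (forall u : G, name u < #|G|) ->
    graph_listing vs es ->
    exists (T : dtree G) (time : nat) (s : state),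
      [/\ exec ((#|G| + 2) ^ k) prog (init (graph_code name vs es)) time s,
          dtree_at (memory s) (regs s 0) name T,
          0 < #|G| -> dtree_nodes T <= D * #|G| &
          0 < #|edges G| -> time <= C * (#|G| ^ 3 * #|edges G|)].
Proof.
move: (@start_inv) (@loop_inv) loop_reg0 wf_start wf_loop (poly_word Start Loop 64 poly_top)
  (cst_le 64 Start) (cst_le 64 Loop) degrees_start degrees_loop.
(* From here on the two programs are variables, so that nothing can unfold them. *)
move: Start Loop => p1 p2 SI LI r0 w1 w2 [k hk] [K1 h1] [K2 h2] [d1 d2] [d3 d4].
rewrite d1 d2 in h1; rewrite d3 d4 in h2.
(* The factor 16 comes from (n + 1)^3 (m + 1) <= 16 n^3 m for positive n and m; [prologue_cost + 2]
   covers the prologue and the assignment between the phases. *)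
exists (phases p1 p2), (prologue_cost + 2 + 16 * K1 + 16 * K2), 2, k => G name vs es inj nlt GL.
set N := #|G|; set M := #|edges G|; set W := (N + 2) ^ k.
pose input := graph_code name vs es.
have [Uvs vsE _ _] := GL; have vsT x : x \in vs by rewrite vsE.
have esN := size_es GL.
have rE : room G = roomf N by [].
have rH : roomf N <= topf N by apply: leq_addr.
have tr : 17 * (N + 1) = 17 * N + 17 by rewrite mulnDr.
pose s0 := MState (upd (upd (upd (fun=> 0) 1 N) 0 (roomf N)) 3 (topf N)) (nth 0 input)
  (fun a i => nth 0 input (topf N + (i * 64 + a))).
have szH : size input <= roomf N by rewrite (size_code name GL) /roomf; lia.
(* The arrays lie above the heap, hence above the input, where the memory is 0. *)
have z a i : ar s0 a i = 0.
  by apply: nth_default; apply: leq_trans szH (leq_trans rH (leq_addr _ _)).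
have [|||I0 eM s11 s13 s10] := SI G name vs es s0 (topf N) (17 * (N + 1)) (rg (run p1 s0) 4)
  inj nlt GL erefl erefl erefl erefl rH _ _ _ z erefl.
- by rewrite tr; lia.
- by move=> i hi; rewrite add0n.
- by move=> a; apply: nth_default.
rewrite -/M in eM; rewrite eM in I0.
have MN : M <= N * N.
  apply: (@leq_trans (nrel (@adj G))); first by rewrite card_arcs leq_pmull.
  by rewrite /N -card_prod; apply: max_card.
have Wh := hk N M MN.
have en : nth 0 input 0 = N by apply: size_vs.
have x0 := prologue_exec en (leq_ltn_trans (leq_trans (leq_addr _ _) (leq_addr _ _)) (let: And3 h _ _ := Wh in h)).
have b0 : bounded (topf N) s0.
  have rN : N <= topf N by apply: leq_trans rH; rewrite /roomf; lia.
  have bi a : nth 0 input a <= topf N.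
    case: (ltnP a (size input)) => ha; last by rewrite nth_default.
    apply: (code_le GL) => //; last exact: mem_nth.
    by apply: leq_trans esN (leq_trans _ rH); rewrite /roomf -/N; lia.
  split=> [x|a|a i]; [|exact: bi|exact: bi]; rewrite /= /upd.
  by case: (x == 3) => //; case: (x == 0) => //; case: (x == 1).
have [||t [time [x ss tm]]] := @exec_phases p1 p2 W N M (topf N) prologue_cost _ _ s0 x0 _ w1 w2
  erefl erefl erefl _ b0 eM Wh.
- by split.
- by apply: leq_trans rH; rewrite /roomf; lia.
have sp : pos (roomf N) N (2 * (17 * (N + 1)) + 1) <= topf N.
  by rewrite /pos /topf leq_add2l leq_mul2l mulnA leqnn orbT.
have I1 := LI _ _ _ _ _ sp _ (setr (run p1 s0) 2 M) s11 I0.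
set s1 := run p2 _ in ss I1; have [sr sh _] := ss.
have [ns [ph [[[_ _ e3 _ _] _] _ _ _ _]]] := I1; rewrite e3 in sh.
have [T hT] : exists T : dtree G, dtree_at (memory t) (roomf N) name T := inv_tree sp I1 sh.
exists T, time, t; split=> //.
- by have -> : regs t 0 = roomf N by [rewrite sr /s1 run_rg].
- by move=> N0; have := dtree_nodes_le T; rewrite -/N; move: (dtree_nodes T) => d; lia.
- move=> M0; apply: leq_trans tm _.
  have N0 : 0 < N by move: MN; case: (N) => //; rewrite leqNgt M0.
  have Q0 : 0 < N ^ 3 * M by rewrite muln_gt0 expn_gt0 N0.
  have Q2 : (N + 1) ^ 3 * (M + 1) <= 16 * (N ^ 3 * M).
    have -> : 16 * (N ^ 3 * M) = (2 * N) ^ 3 * (2 * M) by rewrite expnMn mulnACA.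
    by apply: leq_mul; [rewrite leq_exp2r //; lia | lia].
  have Q1 : (N + 1) ^ 2 <= (N + 1) ^ 3 * (M + 1).
    by rewrite -[X in X <= _]muln1; apply: leq_mul; [apply: leq_pexp2l; rewrite ?addn1 | rewrite addn1].
  have := h1 N 0; have := h2 N M; rewrite expn1 expn0 muln1 => t2 t1.
  have t1' : cst 64 N 0 p1 <= K1 * (16 * (N ^ 3 * M)).
    by apply: leq_trans t1 _; rewrite leq_mul2l (leq_trans Q1 Q2) orbT.
  have t2' : cst 64 N M p2 <= K2 * (16 * (N ^ 3 * M)).
    by apply: leq_trans t2 _; rewrite leq_mul2l Q2 orbT.
  have t3 : prologue_cost + 2 <= (prologue_cost + 2) * (N ^ 3 * M) by rewrite leq_pmulr.
  move: t1' t2' t3; rewrite -/M -/N; move: (N ^ 3 * M) (cst _ _ _ p1) (cst _ _ _ p2) => Q u v.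
  by rewrite (mulnC 16 K1) (mulnC 16 K2) 2!mulnDl -!mulnA; lia.
Qed.
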